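(* Let $d\ge1$, let $m\colon(0,\infty)\to(0,\infty)$ be smooth, and let $(p,\kappa,s,q)$ be admissible parameters. For all $j,n\in\mathbb{N}$ there exist constants $C_{j,n},L_{j,n}\in(0,\infty)$ such that $$\|A^{(j)}[u]\|_{\mathscr{L}(X_1,X_0)}\le C_{j,n}\bigl(1+\|u\|_{X^{\mathrm{Tr}}_{\kappa,p}}\bigr),$$ $$\|A^{(j)}[u]-A^{(j)}[v]\|_{\mathscr{L}(X_1,X_0)}\le L_{j,n}\|u-v\|_{X^{\mathrm{Tr}}_{\kappa,p}}$$ for all $u,v\in X^{\mathrm{Tr}}_{\kappa,p}$ with $\|u\|_{X^{\mathrm{Tr}}_{\kappa,p}},\|v\|_{X^{\mathrm{Tr}}_{\kappa,p}}\le n$, where $A^{(j)}[u](f)=\operatorname{div}(m_j(u)\nabla\Delta f)$.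
   Context: $\mathbb{T}^d=\mathbb{R}^d/\mathbb{Z}^d$; $H^{s,q}$ and $B^s_{q,p}$ are the Bessel potential and Besov spaces. $X_0=H^{s-2,q}(\mathbb{T}^d)$, $X_1=H^{s+2,q}(\mathbb{T}^d)$, $X^{\mathrm{Tr}}_{\kappa,p}=B^{s+2-4\frac{1+\kappa}{p}}_{q,p}(\mathbb{T}^d)$. Admissible parameters: $s\in(-\tfrac12,\infty)$, $p,q\in[2,\infty)$, $\kappa\in[0,\infty)$ with: (a) either $p\in(2,\infty)$ and $\kappa\in[0,\tfrac p2-1)$, or $q=p=2$ and $\kappa=0$; (b) $s+2-4\tfrac{1+\kappa}{p}-\tfrac dq>0$; (c) $s+2-4\tfrac{1+\kappa}{p}>1-s$. Regularized coefficient: fix a smooth increasing $\eta\colon\mathbb{R}\to\mathbb{R}$ with $\eta(r)=1$ for $r\ge2$ and $\eta(r)=0$ for $r\le1$, and set $\eta_j(r)=\eta(jr)$ and $m_j(r)=\eta_j(r)m(r)+(1-\eta_j(r))$ for $r\in\mathbb{R}$ (with $\eta_jm:=0$ where $\eta_j=0$); $m_j\colon\mathbb{R}\to\mathbb{R}$ is smooth. If $s<1$, the product $m_j(u)\nabla\Delta f$ is understood in the sense of Sobolev pointwise multipliers. *)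

(* Defs.v *)
From HB Require Import structures.
From mathcomp Require Import all_boot all_order all_algebra.
From mathcomp Require Import complex.
From mathcomp Require Import all_classical all_reals all_analysis.

Set Implicit Arguments.
Unset Strict Implicit.
Unset Printing Implicit Defensive.

Import Order.TTheory GRing.Theory Num.Theory.
Import numFieldNormedType.Exports.

Local Open Scope classical_set_scope.
Local Open Scope ring_scope.

(* A function on the torus T^d = R^d / Z^d is given by its values on a
   fundamental cell, up to equality almost everywhere for the measure
   [torus R d] below.  All function spaces are spaces of real-valued
   functions and real distributions. *)

Definition cons_pair (R : realType) (d : nat)
  (z : measurableTypeR R * d.-tuple R) : d.+1.-tuple R :=
  [tuple of (z.1 : R) :: z.2].

Lemma measurable_cons_pair (R : realType) (d : nat) :
  measurable_fun [set: measurableTypeR R * d.-tuple R] (@cons_pair R d).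
Proof. by apply: measurable_cons; [exact: measurable_fst | exact: measurable_snd]. Qed.

HB.instance Definition _ (R : realType) (d : nat) :=
  isMeasurableFun.Build _ _ _ _ (@cons_pair R d) (@measurable_cons_pair R d).

(* Lebesgue measure on [0, 1]^d, i.e. the normalized Haar measure of T^d. *)
Fixpoint torus (R : realType) (d : nat) : probability (d.-tuple R) R :=
  match d with
  | 0%N => \d_([tuple] : 0.-tuple R)
  | d'.+1 =>
      distribution (uniform_prob (@ltr01 R) \x torus R d')%E
        (@cons_pair R d' : {mfun _ >-> _})
  end.

Definition freq (d : nat) := 'I_d -> int.

(* A periodic distribution is represented by its Fourier coefficients.  No
   growth condition is imposed: it is automatic for the elements of the Bessel
   potential and Besov spaces, whose norms are +oo elsewhere. *)
Definition distr (R : realType) (d : nat) := freq d -> R[i].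

Definition dot (R : realType) (d : nat) (k : freq d) (x : d.-tuple R) : R :=
  \sum_(i < d) (k i)%:~R * tnth x i.

Definition absfreq (R : realType) (d : nat) (k : freq d) : R :=
  Num.sqrt (\sum_(i < d) (k i)%:~R ^+ 2).

(* f^(k) = \int f(x) exp(- 2 pi i k.x) dx *)
Definition fourier (R : realType) (d : nat) (f : d.-tuple R -> R) : distr R d :=
  fun k =>
    ((\int[torus R d]_x (f x * cos (2 * pi * dot k x)))
     -i* (\int[torus R d]_x (f x * sin (2 * pi * dot k x))))%C.

Definition scaleD (R : realType) (d : nat) (c : R) (f : distr R d) : distr R d :=
  fun k => (c%:C)%C * f k.

Definition partial (R : realType) (d : nat) (i : 'I_d) (f : distr R d) :
  distr R d := fun k => (0 +i* (2 * pi * (k i)%:~R))%C * f k.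

Definition laplacian (R : realType) (d : nat) (f : distr R d) : distr R d :=
  fun k => \sum_(i < d) partial i (partial i f) k.

Definition grad (R : realType) (d : nat) (f : distr R d) : 'I_d -> distr R d :=
  fun i => partial i f.

Definition divergence (R : realType) (d : nat) (F : 'I_d -> distr R d) :
  distr R d := fun k => \sum_(i < d) partial i (F i) k.

(* The L^q norm of a distribution: the norm of the (a.e. unique) function in
   L^q having these Fourier coefficients, +oo if there is none. *)
Definition Lq_norm (R : realType) (d : nat) (q : R) (f : distr R d) : \bar R :=
  ereal_inf [set ('N[torus R d]_(q%:E)[EFin \o g])%E | g in
    [set g : d.-tuple R -> R | g \in Lfun (torus R d) q%:E /\ fourier g = f]].

(* (1 - Laplacian)^(s/2) *)
Definition bessel_potential (R : realType) (d : nat) (s : R) (f : distr R d) :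
  distr R d :=
  fun k => (((1 + (2 * pi * absfreq R k) ^+ 2) `^ (s / 2))%:C)%C * f k.

Definition bessel_norm (R : realType) (d : nat) (s q : R) (f : distr R d) :
  \bar R := Lq_norm q (bessel_potential s f).

Definition smooth_on (R : realType) (D : set R) (f : R -> R) : Prop :=
  forall (n : nat) (x : R), D x -> derivable (derive1n n f) x 1.

(* chi generates the smooth dyadic partition of unity
   phi_0 = chi(|.|), phi_l = chi(2^-l |.|) - chi(2^-(l-1) |.|)  (l >= 1). *)
Definition dyadic_cutoff (R : realType) (chi : R -> R) : Prop :=
  [/\ smooth_on setT chi,
      forall r, 0 <= chi r <= 1,
      forall r, r <= 1 -> chi r = 1 &
      forall r, 2 <= r -> chi r = 0].

Definition dyadic (R : realType) (chi : R -> R) (l : nat) (r : R) : R :=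
  if l is l'.+1 then chi (r / 2 ^+ l) - chi (r / 2 ^+ l') else chi r.

Definition dyadic_block (R : realType) (d : nat) (chi : R -> R) (l : nat)
  (f : distr R d) : distr R d :=
  fun k => ((dyadic chi l (absfreq R k))%:C)%C * f k.

(* B^s_{q,p} *)
Definition besov_norm (R : realType) (d : nat) (chi : R -> R) (s q p : R)
  (f : distr R d) : \bar R :=
  ((\sum_(0 <= l <oo)
      ((2 `^ (l%:R * s))%R%:E * Lq_norm q (dyadic_block chi l f)) `^ p)
   `^ p^-1)%E.

(* For f integrable this is membership of f in B^s_{q,p}; if s > 0 every
   element of B^s_{q,p} is such a function. *)
Definition in_besov (R : realType) (d : nat) (chi : R -> R) (s q p : R)
  (f : d.-tuple R -> R) : Prop :=
  (torus R d).-integrable setT (EFin \o f) /\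
  (besov_norm chi s q p (fourier f) < +oo)%E.

(* Operators between the spaces normed by N1 and N0 (norms being +oo outside
   the space); [opnorm N1 N0 T] is +oo if T does not map N1 into N0. *)
Definition opnorm (R : realType) (d : nat) (N1 N0 : distr R d -> \bar R)
  (T : distr R d -> distr R d) : \bar R :=
  ereal_sup [set N0 (T f) | f in [set f | (N1 f <= 1)%E]].

Definition bounded_linear (R : realType) (d : nat)
  (N1 N0 : distr R d -> \bar R) (T : distr R d -> distr R d) : Prop :=
  (forall (c : R) (f g : distr R d), (N1 f < +oo)%E -> (N1 g < +oo)%E ->
     T (scaleD c f \+ g) = scaleD c (T f) \+ T g) /\
  (opnorm N1 N0 T < +oo)%E.

(* M is the operator of multiplication by the function a on H^{r,q}: bounded
   on H^{r,q} and equal to the pointwise product of functions on the elements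
   of L^q lying in H^{r,q}.  For r >= 0 these are all of H^{r,q}; for r < 0
   they form the dense subspace L^q, so M is the unique bounded extension of
   the pointwise product. *)
Definition is_multiplication (R : realType) (d : nat) (r q : R)
  (a : d.-tuple R -> R) (M : distr R d -> distr R d) : Prop :=
  bounded_linear (bessel_norm r q) (bessel_norm r q) M /\
  forall g : d.-tuple R -> R, g \in Lfun (torus R d) q%:E ->
    (bessel_norm r q (fourier g) < +oo)%E ->
    M (fourier g) = fourier (a \* g).

Definition is_multiplier (R : realType) (d : nat) (r q : R)
  (a : d.-tuple R -> R) : Prop :=
  exists M, is_multiplication r q a M.

(* The default value is only used if a is not a multiplier of H^{r,q}. *)
Definition multiplication (R : realType) (d : nat) (r q : R)
  (a : d.-tuple R -> R) : distr R d -> distr R d :=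
  xget (fun _ _ => 0) [set M | is_multiplication r q a M].

(* m matters only on (0, +oo): eta (j r) = 0 for r <= 0. *)
Definition regularized (R : realType) (m eta : R -> R) (j : nat) (r : R) : R :=
  eta (j%:R * r) * m r + (1 - eta (j%:R * r)).

(* A^(j)[u](f) = div (m_j(u) grad (Laplacian f)), with the product taken in
   H^{s-1,q}. *)
Definition operatorA (R : realType) (d : nat) (s q : R) (m eta : R -> R)
  (j : nat) (u : d.-tuple R -> R) (f : distr R d) : distr R d :=
  divergence (fun i =>
    multiplication (s - 1) q (regularized m eta j \o u)
      (grad (laplacian f) i)).

Definition X0_norm (R : realType) (d : nat) (s q : R) : distr R d -> \bar R :=
  bessel_norm (s - 2) q.

Definition X1_norm (R : realType) (d : nat) (s q : R) : distr R d -> \bar R :=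
  bessel_norm (s + 2) q.

Definition trace_exponent (R : realType) (p kappa s : R) : R :=
  s + 2 - 4 * ((1 + kappa) / p).

Definition in_XTr (R : realType) (d : nat) (chi : R -> R) (p kappa s q : R)
  (u : d.-tuple R -> R) : Prop :=
  in_besov chi (trace_exponent p kappa s) q p u.

Definition XTr_norm (R : realType) (d : nat) (chi : R -> R) (p kappa s q : R)
  (u : d.-tuple R -> R) : \bar R :=
  besov_norm chi (trace_exponent p kappa s) q p (fourier u).

Definition admissible (R : realType) (d : nat) (p kappa s q : R) : Prop :=
  [/\ - 2^-1 < s, 2 <= p, 2 <= q & 0 <= kappa] /\
  [/\ (2 < p /\ kappa < p / 2 - 1) \/ [/\ q = 2, p = 2 & kappa = 0],
      0 < trace_exponent p kappa s - d%:R / q &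
      1 - s < trace_exponent p kappa s].

(* Main.v *)
(** Write F = m_j. Since grad Delta and div cost Riesz transforms, which are bounded on L^q, everything
    reduces to bounding multiplication by F(u) - F(v) on H^{r,q}, r = s - 1, by C |u - v|_{B^sigma};
    the growth bound is the case v = 0.

    Two facts are combined. First, a trigonometric polynomial a of degree 2^k acts on H^{r,q} with norm at
    most C (k + 1)^2 2^{k theta} |a|_q, theta = max(d/q, |r|): against low frequencies this follows
    from Bernstein's inequalities, and high frequencies almost commute with a. Secondly, let u = sum_l u_l
    be the Littlewood-Paley decomposition, S_n u its partial sums, and P_i polynomials of degree about 4^i
    that converge to F in C^1 faster than any prescribed power of 2^-i (Bernstein polynomials and
    repeated integration). The increments w_i of P_i(S_{bi} u) - P_i(S_{bi} v) are trigonometric polynomials of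
    degree 2^{(b+2)i+c} with |w_i|_q <= C 2^{-b i sigma} |u - v|. As sigma > theta, the series of the
    multiplication operators by the w_i converges for b large.

    The Riesz transforms are treated with a Bellman function, evaluated along the discrete harmonic
    extensions of a function and of a test function. *)

Require Import Defs.
From HB Require Import structures.
From mathcomp Require Import all_boot all_order all_algebra.
From mathcomp Require Import complex.
From mathcomp Require Import all_classical all_reals all_analysis.
From mathcomp Require Import ring lra zify.
From mathcomp Require Import measurable_realfun.
Import Order.TTheory GRing.Theory Num.Theory.
Import numFieldNormedType.Exports.

Set Implicit Arguments.
Unset Strict Implicit.
Unset Printing Implicit Defensive.

Local Open Scope classical_set_scope.
Local Open Scope ring_scope.

(** * Bounded functions and characters on the torus *)

(** The exponents: conditions (b) and (c) give sigma > d/q and sigma > 1 - s, while (a) gives (1 +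
    kappa)/p <= 1/2, hence sigma >= s > s - 1; so sigma > theta for r = s - 1. The obstacle is that
    r may have either sign and that a nonlinear function of u has no localized spectrum. With
    polynomials in place of F every object is a trigonometric polynomial, and multiplication by it
    is a finite convolution of coefficients, meaningful for any distribution. The degree of P_i
    costs 2^{2 i theta}, which b absorbs because (b + 2) theta < b sigma for large b. All
    multipliers except the Riesz transforms live on one dyadic annulus or have negative order. Their
    kernels are bounded in L^1 with a single difference per coordinate, so piecewise linear cutoffs
    suffice. The Riesz transforms have order 0: dyadic bounds do not sum, and cancellation has to be
    used. Norms are carried as real upper bounds ([Lb], [LQ], [Hq]). Since the norms of
    distributions are infima, returning to these bounds costs an arbitrarily small excess, which is
    the origin of several factors 2. *)

Section BoundedMeasurable.
Context d0 (T : measurableType d0) (R : realType) (P : probability T R).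
Implicit Types f g : T -> R.

(** Bounded measurable functions form an algebra on which the integral is always defined. All
    computations with trigonometric polynomials and kernels stay inside it, so integrability is
    settled once. *)
Definition bmf f := measurable_fun setT f /\ exists M : R, forall x, `|f x| <= M.

Lemma bmf_integrable f : bmf f -> P.-integrable setT (EFin \o f).
Proof.
move=> [mf [M Mf]]; apply: measurable_bounded_integrable => //.
  by rewrite -ge0_fin_numE// fin_num_measure.
by exists M; split; [exact: num_real|move=> r Mr x _; exact: (le_trans (Mf x) (ltW Mr))].
Qed.

Lemma bmf_cst (c : R) : bmf (fun=> c).
Proof. by split; [exact: measurable_cst|exists `|c|]. Qed.

Lemma bmfD f g : bmf f -> bmf g -> bmf (fun x => f x + g x).
Proof.
move=> [mf [M Mf]] [mg [N Ng]]; split; first exact: measurable_funD.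
by exists (M + N) => x; rewrite (le_trans (ler_normD _ _))// lerD.
Qed.

Lemma bmfN f : bmf f -> bmf (fun x => - f x).
Proof.
move=> [mf [M Mf]]; split; first exact: measurableT_comp.
by exists M => x; rewrite normrN.
Qed.

Lemma bmfB f g : bmf f -> bmf g -> bmf (fun x => f x - g x).
Proof. by move=> hf hg; apply: bmfD => //; exact: bmfN. Qed.

Lemma bmfM f g : bmf f -> bmf g -> bmf (fun x => f x * g x).
Proof.
move=> [mf [M Mf]] [mg [N Ng]]; split; first exact: measurable_funM.
by exists (M * N) => x; rewrite normrM ler_pM.
Qed.

Lemma bmf_sum (I : Type) (s : seq I) (F : I -> T -> R) :
  (forall i, bmf (F i)) -> bmf (fun x => \sum_(i <- s) F i x).
Proof.
move=> hF; elim: s => [|i s ih].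
  by under eq_fun do rewrite big_nil; exact: bmf_cst.
by under eq_fun do rewrite big_cons; exact: bmfD.
Qed.

Lemma bmf_norm f : bmf f -> bmf (fun x => `|f x|).
Proof.
move=> [mf [M Mf]]; split; first exact: measurableT_comp.
by exists M => x; rewrite normr_id.
Qed.

Lemma IntD f g : bmf f -> bmf g ->
  \int[P]_x (f x + g x) = \int[P]_x f x + \int[P]_x g x.
Proof. by move=> hf hg; rewrite RintegralD//; exact: bmf_integrable. Qed.

Lemma IntB f g : bmf f -> bmf g ->
  \int[P]_x (f x - g x) = \int[P]_x f x - \int[P]_x g x.
Proof. by move=> hf hg; rewrite RintegralB//; exact: bmf_integrable. Qed.

Lemma IntZ (c : R) f : bmf f -> \int[P]_x (c * f x) = c * \int[P]_x f x.
Proof. by move=> hf; rewrite RintegralZl//; exact: bmf_integrable. Qed.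

Lemma IntC (c : R) : \int[P]_x c = c.
Proof.
have PT : P setT = 1%E by exact: probability_setT.
by rewrite Rintegral_cst// -[RHS]mulr1; congr (_ * _); exact: (congr1 fine PT).
Qed.

Lemma Int_sum (I : Type) (s : seq I) (F : I -> T -> R) :
  (forall i, bmf (F i)) ->
  \int[P]_x (\sum_(i <- s) F i x) = \sum_(i <- s) \int[P]_x F i x.
Proof.
move=> hF; elim: s => [|i s ih].
  by rewrite big_nil; under eq_Rintegral do rewrite big_nil; rewrite IntC.
under eq_Rintegral do rewrite big_cons.
by rewrite big_cons IntD ?ih//; exact: bmf_sum.
Qed.

Lemma le_Int f g : bmf f -> bmf g -> (forall x, f x <= g x) ->
  \int[P]_x f x <= \int[P]_x g x.
Proof. by move=> hf hg fg; apply: le_Rintegral => //; exact: bmf_integrable. Qed.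

Lemma Int_norm_le f (c : R) : bmf f -> (forall x, `|f x| <= c) ->
  `|\int[P]_x f x| <= c.
Proof.
move=> hf fc; apply: le_trans (le_normr_Rintegral _ (bmf_integrable hf)) _ => //.
rewrite -(IntC c); apply: le_Int fc => //; [exact: bmf_norm|exact: bmf_cst].
Qed.

Lemma Int_EFin f : bmf f ->
  ((\int[P]_x f x)%:E = \int[P]_x (f x)%:E)%E.
Proof.
move=> hf; rewrite /Rintegral fineK//; apply: integrable_fin_num => //.
exact: bmf_integrable.
Qed.

Definition cint (F : T -> R[i]) : R[i] :=
  ((\int[P]_x complex.Re (F x)) +i* (\int[P]_x complex.Im (F x)))%C.

Definition cbmf (F : T -> R[i]) :=
  bmf (fun x => complex.Re (F x)) /\ bmf (fun x => complex.Im (F x)).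

Lemma cbmf_cst c : cbmf (fun=> c).
Proof. by split; exact: bmf_cst. Qed.

Lemma cbmfD F G : cbmf F -> cbmf G -> cbmf (fun x => F x + G x).
Proof. by move=> [a b] [c e]; split; under eq_fun do rewrite raddfD; exact: bmfD. Qed.

Lemma cReM (a b : R[i]) : complex.Re (a * b) =
  complex.Re a * complex.Re b - complex.Im a * complex.Im b.
Proof. by case: a b => [a1 a2] [b1 b2]. Qed.

Lemma cImM (a b : R[i]) : complex.Im (a * b) =
  complex.Re a * complex.Im b + complex.Im a * complex.Re b.
Proof. by case: a b => [a1 a2] [b1 b2]. Qed.

Lemma cbmfM F G : cbmf F -> cbmf G -> cbmf (fun x => F x * G x).
Proof.
move=> [a b] [c e]; split.
  under eq_fun do rewrite cReM; apply: bmfB; exact: bmfM.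
by under eq_fun do rewrite cImM; apply: bmfD; exact: bmfM.
Qed.

Lemma cbmf_sum (I : Type) (s : seq I) (F : I -> T -> R[i]) :
  (forall i, cbmf (F i)) -> cbmf (fun x => \sum_(i <- s) F i x).
Proof.
move=> hF; elim: s => [|i s ih].
  by under eq_fun do rewrite big_nil; exact: cbmf_cst.
by under eq_fun do rewrite big_cons; exact: cbmfD.
Qed.

Lemma cintD F G : cbmf F -> cbmf G -> cint (fun x => F x + G x) = cint F + cint G.
Proof.
move=> [a b] [c e]; rewrite /cint.
under eq_Rintegral do rewrite raddfD.
under [X in (_ +i* X)%C]eq_Rintegral do rewrite raddfD.
by rewrite /= !IntD.
Qed.

Lemma cintZ c F : cbmf F -> cint (fun x => c * F x) = c * cint F.
Proof.
move=> [a b]; rewrite /cint.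
under eq_Rintegral do rewrite cReM.
under [X in (_ +i* X)%C]eq_Rintegral do rewrite cImM.
have bM (k : R) f : bmf f -> bmf (fun x => k * f x).
  by move=> ?; apply: bmfM => //; exact: bmf_cst.
rewrite IntB ?IntD ?IntZ//; try exact: bM.
by case: c => c1 c2.
Qed.

Lemma cintC c : cint (fun=> c) = c.
Proof. by rewrite /cint !IntC; case: c. Qed.

Lemma cint_sum (I : Type) (s : seq I) (F : I -> T -> R[i]) :
  (forall i, cbmf (F i)) ->
  cint (fun x => \sum_(i <- s) F i x) = \sum_(i <- s) cint (F i).
Proof.
move=> hF; elim: s => [|i s ih].
  rewrite big_nil -[RHS](cintC 0); congr cint; apply/funext => x; exact: big_nil.
rewrite big_cons -ih -cintD//; last exact: cbmf_sum.
by congr cint; apply/funext => x; exact: big_cons.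
Qed.

Lemma cint_real f : cint (fun x => (f x)%:C%C) = (\int[P]_x f x)%:C%C.
Proof. by rewrite /cint /= IntC. Qed.

Lemma cbmf_real f : bmf f -> cbmf (fun x => (f x)%:C%C).
Proof. by move=> hf; split => //; exact: bmf_cst. Qed.

End BoundedMeasurable.
Arguments bmf {d0 T R} f.
Arguments cbmf {d0 T R} F.

Section CharacterDef.
Context (R : realType).

Definition cis (t : R) : R[i] := (cos t +i* sin t)%C.

Lemma cisD s t : cis (s + t) = cis s * cis t.
Proof.
rewrite /cis cosD sinD; apply/eqP; rewrite eq_complex /=; apply/andP; split => //.
by rewrite addrC [sin s * _]mulrC [cos s * _]mulrC addrC mulrC [sin t * _]mulrC.
Qed.

Lemma cis0 : cis 0 = 1.
Proof. by rewrite /cis cos0 sin0. Qed.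

Lemma cisN t : cis (- t) = ((cis t)^*)%C.
Proof. by rewrite /cis cosN sinN. Qed.

Lemma cis_periodic (n : int) t : cis (t + 2 * pi * n%:~R) = cis t.
Proof.
have h (k : nat) u : cis (u + 2 * pi * k%:R) = cis u.
  elim: k u => [|k ih] u; first by rewrite mulr0 addr0.
  have -> : u + 2 * pi * k.+1%:R = (u + 2 * pi * k%:R) + pi *+ 2.
    by rewrite -[k.+1]addn1 natrD -mulr_natl; ring.
  by rewrite -[RHS]ih /cis cosD2pi sinD2pi.
case: n => k; first exact: h.
by rewrite -(h k.+1) NegzE rmorphN /= mulrN -addrA addNr addr0.
Qed.

End CharacterDef.

Section Fubini.
Context d1 d2 (T1 : measurableType d1) (T2 : measurableType d2) (R : realType).
Variables (P : probability T1 R) (Q : probability T2 R).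

Lemma bmf_section1 (f : T1 * T2 -> R) x : bmf f -> bmf (fun y => f (x, y)).
Proof.
move=> [mf [M Mf]]; split; last by exists M.
exact: measurableT_comp.
Qed.

Lemma bmf_section2 (f : T1 * T2 -> R) y : bmf f -> bmf (fun x => f (x, y)).
Proof.
move=> [mf [M Mf]]; split; last by exists M.
exact: measurableT_comp.
Qed.

Lemma bmf_integrable_prod (f : T1 * T2 -> R) : bmf f ->
  (P \x Q)%E.-integrable setT (EFin \o f).
Proof. by move=> hf; apply: bmf_integrable. Qed.

Lemma bmf_Int1 (f : T1 * T2 -> R) : bmf f -> bmf (fun x => \int[Q]_y f (x, y)).
Proof.
move=> hf; split; last first.
  case: (hf) => _ [M Mf]; exists M => x.
  by apply: Int_norm_le => //; exact: bmf_section1.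
apply: measurableT_comp => //.
exact: (measurable_fubini_F (bmf_integrable_prod hf)).
Qed.

Lemma Int_Fubini1 (f : T1 * T2 -> R) : bmf f ->
  \int[(P \x Q)%E]_z f z = \int[P]_x \int[Q]_y f (x, y).
Proof.
move=> hf; rewrite /Rintegral -(integral12_prod_meas1 (bmf_integrable_prod hf)).
congr fine; apply: eq_integral => x _; rewrite /fubini_F /=.
by rewrite -Int_EFin//; exact: bmf_section1.
Qed.

Lemma Int_Fubini2 (f : T1 * T2 -> R) : bmf f ->
  \int[(P \x Q)%E]_z f z = \int[Q]_y \int[P]_x f (x, y).
Proof.
move=> hf; rewrite /Rintegral -(integral21_prod_meas1 (bmf_integrable_prod hf)).
congr fine; apply: eq_integral => x _; rewrite /fubini_G /=.
by rewrite -Int_EFin//; exact: bmf_section2.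
Qed.

Lemma Int_swap (f : T1 -> T2 -> R) : bmf (fun z => f z.1 z.2) ->
  \int[P]_x \int[Q]_y f x y = \int[Q]_y \int[P]_x f x y.
Proof. by move=> hf; rewrite -(Int_Fubini1 hf) (Int_Fubini2 hf). Qed.

Lemma Int_prod (g : T1 -> R) (h : T2 -> R) : bmf g -> bmf h ->
  \int[(P \x Q)%E]_z (g z.1 * h z.2) = \int[P]_x g x * \int[Q]_y h y.
Proof.
move=> hg hh; rewrite Int_Fubini1/=; last first.
  case: hg hh => [mg [M Mg]] [mh [N Nh]]; split.
    by apply: measurable_funM; apply: measurableT_comp.
  by exists (M * N) => z; rewrite normrM ler_pM.
under eq_Rintegral do rewrite IntZ//.
by rewrite RintegralZr//; exact: bmf_integrable.
Qed.

Lemma cint_prod (g : T1 -> R[i]) (h : T2 -> R[i]) : cbmf g -> cbmf h ->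
  cint (P \x Q)%E (fun z => g z.1 * h z.2) = cint P g * cint Q h.
Proof.
move=> [g1 g2] [h1 h2].
have bf (a : T1 -> R) (b : T2 -> R) : bmf a -> bmf b -> bmf (fun z => a z.1 * b z.2).
  move=> [ma [M Ma]] [mb [N Nb]]; split.
    by apply: measurable_funM; apply: measurableT_comp.
  by exists (M * N) => z; rewrite normrM ler_pM.
rewrite {1}/cint.
under eq_Rintegral do rewrite cReM.
under [X in (_ +i* X)%C]eq_Rintegral do rewrite cImM.
have [b1 b2] := (bf _ _ g1 h1, bf _ _ g2 h2).
have [b3 b4] := (bf _ _ g1 h2, bf _ _ g2 h1).
rewrite (IntB _ b1 b2) (IntD _ b3 b4).
rewrite (Int_prod g1 h1) (Int_prod g2 h2) (Int_prod g1 h2) (Int_prod g2 h1).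
by [].
Qed.

End Fubini.

Section Torus.
Context (R : realType).

Local Notation U := (uniform_prob (@ltr01 R)).

Lemma bmf_cons_pair d (f : d.+1.-tuple R -> R) :
  bmf f -> bmf (fun z : measurableTypeR R * d.-tuple R => f (cons_pair z)).
Proof.
move=> [mf [M Mf]]; split; last by exists M.
by apply: measurableT_comp => //; exact: measurable_cons_pair.
Qed.

Lemma Int_torusS d (f : d.+1.-tuple R -> R) : bmf f ->
  \int[torus R d.+1]_x f x =
  \int[(U \x torus R d)%E]_z f (cons_pair z).
Proof.
move=> hf; rewrite /Rintegral /=; congr fine.
rewrite integral_distribution//.
  by apply/measurable_EFinP; case: hf.
by apply: bmf_integrable; exact: bmf_cons_pair.
Qed.

Lemma Int_uniform (f : R -> R) : bmf (f : measurableTypeR R -> R) ->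
  ((\int[U]_x f x)%:E = \int[lebesgue_measure]_(x in `[0%R, 1%R]) (f x)%:E)%E.
Proof.
move=> hf; case: (hf) => mf [M Mf].
(* [integral_uniform] is applied to a nonnegative integrand: the bound [M] makes [f + M] nonnegative
   and is cancelled at the end. *)
have bM : bmf (fun x : measurableTypeR R => f x + M) by apply: bmfD => //; exact: bmf_cst.
have M1 : lebesgue_measure `[0%R, 1%R]%classic = 1%E :> \bar R.
  by rewrite lebesgue_measure_itv/= lte_fin ltr01 -EFinB subr0.
have e : (\int[U]_x (f x + M)%:E =
   \int[lebesgue_measure]_(x in `[0%R, 1%R]) (f x + M)%:E)%E.
  rewrite integral_uniform//.
  - by rewrite subr0 invr1 mul1e.
  - by apply/measurable_EFinP; case: bM.
  - by move=> x; rewrite lee_fin -lerBlDr sub0r lerNl (le_trans (ler_norm _))// normrN.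
have ib (g : R -> R) : bmf (g : measurableTypeR R -> R) ->
    lebesgue_measure.-integrable `[0%R, 1%R] (EFin \o g).
  move=> [mg [K Kg]]; apply: measurable_bounded_integrable => //=.
  - by rewrite M1 ltry.
  - exact: measurable_funTS.
  - by exists K; split; [exact: num_real|move=> r Kr x _; exact: (le_trans (Kg x) (ltW Kr))].
move: e; rewrite -Int_EFin// IntD//; last exact: bmf_cst.
rewrite IntC.
have -> : (\int[lebesgue_measure]_(x in `[0%R, 1%R]) (f x + M)%:E =
  \int[lebesgue_measure]_(x in `[0%R, 1%R]) (f x)%:E + M%:E)%E.
  under eq_integral do rewrite EFinD.
  rewrite integralD//=; [|exact: ib|exact/ib/bmf_cst].
  by rewrite integral_cst//= M1 mule1.
have /fineK <- : (\int[lebesgue_measure]_(x in `[0%R, 1%R]) (f x)%:E)%E \is a fin_num.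
  by apply: integrable_fin_num => //; exact: ib.
by rewrite -EFinD => -[] /addIr ->.
Qed.

Lemma bmf_cos (c : R) : bmf (fun x : measurableTypeR R => cos (c * x)).
Proof.
split; last by exists 1 => x; rewrite ler_norml cos_geN1 cos_le1.
apply: continuous_measurable_fun => x.
by apply: continuous_comp; [exact: mulrl_continuous|exact: continuous_cos].
Qed.

Lemma bmf_sin (c : R) : bmf (fun x : measurableTypeR R => sin (c * x)).
Proof.
split; last by exists 1 => x; rewrite ler_norml sin_geN1 sin_le1.
apply: continuous_measurable_fun => x.
by apply: continuous_comp; [exact: mulrl_continuous|exact: continuous_sin].
Qed.

Lemma Int_FTC (f F : R -> R) : bmf (f : measurableTypeR R -> R) -> continuous f ->
  (forall x : R, is_derive x 1 F (f x)) ->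
  \int[U]_x f x = F 1 - F 0.
Proof.
move=> hf cf dF; apply: EFin_inj; rewrite Int_uniform// EFinB.
have cF x : {for x, continuous F}.
  by apply/differentiable_continuous/derivable1_diffP; have [] := dF x.
rewrite (@continuous_FTC2 _ f F)//.
- exact: continuous_subspaceT.
- split.
  + by move=> x _; have [] := dF x.
  + exact/cvg_at_right_filter/cF.
  + exact/cvg_at_left_filter/cF.
- by move=> x _; rewrite derive1E; apply: derive_val.
Qed.

Lemma cint_cis (k : int) :
  cint U (fun x => cis (2 * pi * (k%:~R * x))) = (k == 0)%:R.
Proof.
have [->|k0] := eqVneq k 0.
  rewrite -[RHS](cintC U); congr cint; apply/funext => x.
  by rewrite mul0r mulr0 cis0.
pose c : R := 2 * pi * k%:~R.
have c0 : c != 0.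
  by apply: mulf_neq0; [apply: mulf_neq0; rewrite ?pnatr_eq0// gt_eqF ?pi_gt0|rewrite intr_eq0].
have e0 : cis c = 1.
  by have := @cis_periodic R k 0; rewrite add0r cis0.
have [e1 e2] : cos c = 1 /\ sin c = 0 by case: e0.
have E : (fun x : R => cis (2 * pi * (k%:~R * x))) = (fun x => cis (c * x)).
  by apply/funext => x; rewrite mulrA.
have D1 (x : R) : is_derive x 1 (fun y : R => sin (c * y) / c) (cos (c * x)).
  by apply: is_derive_eq; rewrite /GRing.scale /=; field.
have D2 (x : R) : is_derive x 1 (fun y : R => - cos (c * y) / c) (sin (c * x)).
  by apply: is_derive_eq; rewrite /GRing.scale /=; field.
have c1 : continuous (fun x : R => cos (c * x)).
  by move=> x; apply: continuous_comp; [exact: mulrl_continuous|exact: continuous_cos].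
have c2 : continuous (fun x : R => sin (c * x)).
  by move=> x; apply: continuous_comp; [exact: mulrl_continuous|exact: continuous_sin].
rewrite E /cint (Int_FTC (bmf_cos c) c1 D1) (Int_FTC (bmf_sin c) c2 D2).
by rewrite !mulr1 !mulr0 cos0 sin0 e1 e2 !subrr.
Qed.

End Torus.

Section CModulus.
Context (R : realType).
Implicit Types z w : R[i].

Definition nsq z : R := complex.Re z ^+ 2 + complex.Im z ^+ 2.
Definition cmod z : R := Num.sqrt (nsq z).

Lemma nsq_ge0 z : 0 <= nsq z.
Proof. by rewrite addr_ge0 ?sqr_ge0. Qed.

Lemma cmod_ge0 z : 0 <= cmod z.
Proof. exact: sqrtr_ge0. Qed.

Lemma nsqM z w : nsq (z * w) = nsq z * nsq w.
Proof. by rewrite /nsq cReM cImM; ring. Qed.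

Lemma cmodM z w : cmod (z * w) = cmod z * cmod w.
Proof. by rewrite /cmod nsqM sqrtrM// nsq_ge0. Qed.

Lemma cmodE z : `|z| = (cmod z)%:C%C.
Proof. by rewrite normc_def. Qed.

Lemma cmodD z w : cmod (z + w) <= cmod z + cmod w.
Proof. by have := ler_normD z w; rewrite !cmodE -rmorphD /= lecR. Qed.

Lemma cmod_sum (I : Type) (s : seq I) (F : I -> R[i]) :
  cmod (\sum_(i <- s) F i) <= \sum_(i <- s) cmod (F i).
Proof.
elim/big_ind2 : _ => //; first by rewrite /cmod /nsq /= expr0n /= addr0 sqrtr0.
by move=> x1 x2 y1 y2 h1 h2; rewrite (le_trans (cmodD _ _))// lerD.
Qed.

Lemma cmod_sqr z : cmod z ^+ 2 = nsq z.
Proof. by rewrite sqr_sqrtr// nsq_ge0. Qed.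

Lemma nsqE z : (nsq z)%:C%C = z * (z^*)%C.
Proof.
case: z => a b; apply/eqP; rewrite eq_complex /nsq /=; apply/andP; split; apply/eqP; ring.
Qed.

Lemma cmodN z : cmod (- z) = cmod z.
Proof. by rewrite /cmod /nsq !raddfN !sqrrN. Qed.

Lemma nsq_conj z : nsq (z^*)%C = nsq z.
Proof. by case: z => a b; rewrite /nsq /= sqrrN. Qed.

Lemma cmod_real (a : R) : cmod (a%:C%C) = `|a|.
Proof. by rewrite /cmod /nsq /= expr0n /= addr0 sqrtr_sqr. Qed.

Lemma normRe_cmod z : `|complex.Re z| <= cmod z.
Proof. by rewrite -[X in X <= _]sqrtr_sqr ler_wsqrtr// lerDl sqr_ge0. Qed.

Lemma nsq_cis (t : R) : nsq (cis t) = 1.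
Proof. by rewrite /nsq /= cos2Dsin2. Qed.

Lemma cmod_cis (t : R) : cmod (cis t) = 1.
Proof. by rewrite /cmod nsq_cis sqrtr1. Qed.

Lemma cmod1 : cmod (1 : R[i]) = 1.
Proof. by have := cmod_real 1; rewrite normr1. Qed.

Lemma cmod0 : cmod (0 : R[i]) = 0.
Proof. by have := cmod_real 0; rewrite normr0. Qed.

(** Telescoping over the powers of [cis t]. This is how a frequency becomes a Lipschitz constant for
    the metric [tdist]. *)
Lemma cmod_cis_sub1_nat (n : nat) (t : R) :
  cmod (cis (n%:R * t) - 1) <= n%:R * cmod (cis t - 1).
Proof.
elim: n => [|n ih]; first by rewrite !mul0r cis0 subrr cmod0.
have -> : cis (n.+1%:R * t) - 1 = cis t * (cis (n%:R * t) - 1) + (cis t - 1).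
  by rewrite -[n.+1]addn1 natrD mulrDl mul1r cisD; ring.
rewrite (le_trans (cmodD _ _))// cmodM cmod_cis mul1r -[n.+1]addn1 natrD mulrDl mul1r.
by rewrite lerD2r.
Qed.

Lemma cmod_cis_sub1 (n : int) (t : R) :
  cmod (cis (n%:~R * t) - 1) <= `|n|%:~R * cmod (cis t - 1).
Proof.
case: n => n; first exact: cmod_cis_sub1_nat.
rewrite NegzE rmorphN /= mulNr cisN -[X in X <= _]/(Num.sqrt _).
have -> : nsq ((cis (n.+1%:R * t))^*%C - 1) = nsq (cis (n.+1%:R * t) - 1).
  by rewrite /nsq /= !subr0 sqrrN.
by rewrite normrN; exact: cmod_cis_sub1_nat.
Qed.

Lemma cmod_cis_sub (s t : R) : cmod (cis s - cis t) = cmod (cis (s - t) - 1).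
Proof.
have -> : cis s - cis t = cis t * (cis (s - t) - 1).
  by rewrite mulrBr mulr1 -cisD [t + _]addrC subrK.
by rewrite cmodM cmod_cis mul1r.
Qed.

End CModulus.

Section Characters.
Context (R : realType) (d : nat).
Implicit Types (k l n : freq d) (x y : d.-tuple R).

Definition ek k x : R[i] := cis (2 * pi * dot k x).

Definition tsub x y : d.-tuple R := [tuple tnth x i - tnth y i | i < d].

Lemma dotD k l x : dot (k + l) x = dot k x + dot l x.
Proof.
rewrite /dot -big_split /=; apply: eq_bigr => i _.
by rewrite -mulrDl -rmorphD.
Qed.

Lemma dotN k x : dot (- k) x = - dot k x.
Proof.
rewrite /dot -sumrN; apply: eq_bigr => i _.
by rewrite -mulNr -rmorphN.
Qed.

Lemma dot0 x : dot (0 : freq d) x = 0.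
Proof. by rewrite /dot big1// => i _; rewrite mul0r. Qed.

Lemma dot_tsub k x y : dot k (tsub x y) = dot k x - dot k y.
Proof.
rewrite /dot -sumrN -big_split /=; apply: eq_bigr => i _.
by rewrite tnth_mktuple mulrBr.
Qed.

Lemma ekD k l x : ek (k + l) x = ek k x * ek l x.
Proof. by rewrite /ek dotD mulrDr cisD. Qed.

Lemma ek0 x : ek 0 x = 1.
Proof. by rewrite /ek dot0 mulr0 cis0. Qed.

Lemma ekN k x : ek (- k) x = ((ek k x)^*)%C.
Proof. by rewrite /ek dotN mulrN cisN. Qed.

Lemma ek_tsub k x y : ek k (tsub x y) = ek k x * ek (- k) y.
Proof. by rewrite /ek dot_tsub mulrBr cisD -mulrN -dotN. Qed.

Lemma cmod_ek k x : cmod (ek k x) = 1.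
Proof. exact: cmod_cis. Qed.

Lemma measurable_dot k : measurable_fun setT (fun x => dot k x).
Proof.
apply: measurable_sum => i.
by apply: measurable_funM => //; exact: measurable_tnth.
Qed.

Lemma cbmf_ek k : cbmf (fun x => ek k x).
Proof.
split; split.
- apply: (@measurableT_comp _ _ _ _ _ _ (@cos R)).
    exact: (continuous_measurable_fun (@continuous_cos R)).
  by apply: measurable_funM => //; exact: measurable_dot.
- by exists 1 => x; rewrite ler_norml cos_geN1 cos_le1.
- apply: (@measurableT_comp _ _ _ _ _ _ (@sin R)).
    exact: (continuous_measurable_fun (@continuous_sin R)).
  by apply: measurable_funM => //; exact: measurable_dot.
- by exists 1 => x; rewrite ler_norml sin_geN1 sin_le1.
Qed.

End Characters.

(** Orthogonality of the characters, by induction on the dimension: the first coordinate splits off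
    as a factor, following the recursion in [torus], and [cint_cis] evaluates it. *)
Lemma cint_ek (R : realType) (d : nat) (k : freq d) :
  cint (torus R d) (ek k) = (k == 0)%:R.
Proof.
elim: d k => [|d ih] k.
  have -> : k = 0 by apply/funext => -[].
  rewrite eqxx -[RHS](cintC (torus R 0)); congr cint; apply/funext => x; exact: ek0.
pose k' : freq d := fun i => k (lift ord0 i).
have kE (z : R * d.-tuple R) :
    ek k (cons_pair z) = cis (2 * pi * ((k ord0)%:~R * z.1)) * ek k' z.2.
  rewrite /ek -cisD -mulrDr; congr (cis (_ * _)).
  rewrite /dot big_ord_recl; congr (_ + _); apply: eq_bigr => i _.
  by rewrite /= tnthS.
have [c1 c2] := cbmf_ek R k.
have -> : cint (torus R d.+1) (ek k) = cint (uniform_prob (@ltr01 R) \x torus R d)%E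
   (fun z => cis (2 * pi * ((k ord0)%:~R * z.1)) * ek k' z.2).
  by rewrite /cint !Int_torusS//; congr (_ +i* _)%C; apply: eq_Rintegral => z _; rewrite -kE.
have h1 : cbmf (fun z : measurableTypeR R => cis (2 * pi * ((k ord0)%:~R * z)) : R[i]).
  by split; under eq_fun do rewrite mulrA; [exact: bmf_cos|exact: bmf_sin].
rewrite (cint_prod (uniform_prob (@ltr01 R)) (torus R d) h1 (cbmf_ek R k')).
have -> : (k == 0) = (k ord0 == 0) && (k' == 0).
  apply/eqP/andP => [k0|[/eqP k0 /eqP k1]]. 
    by split; apply/eqP; [rewrite k0|apply/funext => i; rewrite /k' k0].
  apply/funext => i; have [j ->|->] := unliftP ord0 i; last by rewrite k0.
  by have := congr1 (fun f => f j) k1.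
by rewrite cint_cis ih -natrM mulnb.
Qed.

(** * Frequency cubes and trigonometric polynomials *)

Section Box.
Context (d : nat).
Implicit Types (k l n : freq d).

(** A cube rather than a ball: sums of products over it factor into one-dimensional sums
    ([box_prod]), and sums of frequencies stay in a cube ([boxD]). *)
Definition box (N : nat) : seq (freq d) :=
  [seq (fun i => (g i : nat)%:Z - N%:Z) | g : {ffun 'I_d -> 'I_(N.*2.+1)}].

Lemma mem_box N k : (k \in box N) = [forall i, `|k i| <= N%:Z].
Proof.
apply/mapP/forallP => [[g _ ->] i|kN].
  by have := ltn_ord (g i); move: (nat_of_ord (g i)) => a; rewrite ltnS -addnn; lia.
have h i : (absz (k i + N%:Z)%R < N.*2.+1)%N by have := kN i; rewrite ltnS -addnn; lia.
exists [ffun i => Ordinal (h i)]; first by rewrite mem_enum.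
by apply/funext => i; rewrite ffunE /=; have := kN i; lia.
Qed.

Lemma boxP N k : reflect (forall i, `|k i| <= N%:Z) (k \in box N).
Proof. by rewrite mem_box; exact: forallP. Qed.

Lemma box_uniq N : uniq (box N).
Proof.
rewrite map_inj_uniq ?enum_uniq// => g h gh; apply/ffunP => i; apply/val_inj.
by have := congr1 (fun f => f i) gh; move=> /= ?; lia.
Qed.

Lemma size_box N : size (box N) = (N.*2.+1 ^ d)%N.
Proof. by rewrite size_map -cardE card_ffun !card_ord. Qed.

Lemma sub_box M N k : (M <= N)%N -> k \in box M -> k \in box N.
Proof. by move=> MN /boxP h; apply/boxP => i; have := h i; lia. Qed.

Lemma boxN N k : (- k \in box N) = (k \in box N).
Proof. by apply/boxP/boxP => h i; have := h i; rewrite ?[(- k) i]/(- k i) normrN. Qed.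

Lemma box0 N : (0 : freq d) \in box N.
Proof. by apply/boxP => i; rewrite normr0. Qed.

Lemma boxD M N k l : k \in box M -> l \in box N -> k + l \in box (M + N).
Proof.
move=> /boxP h /boxP h'; apply/boxP => i; have := h i; have := h' i.
rewrite [(k + l) i]/(k i + l i); move: (k i) (l i) => a b ha hb.
by apply: le_trans (ler_normD _ _) _; rewrite PoszD lerD.
Qed.

Lemma big_box_sub (V : nmodType) M N (F : freq d -> V) : (M <= N)%N ->
  (forall k, k \in box N -> k \notin box M -> F k = 0) ->
  \sum_(k <- box N) F k = \sum_(k <- box M) F k.
Proof.
move=> MN h; rewrite (bigID (fun k => k \in box M)) /= [X in _ + X]big1_seq ?addr0; last first.
  by move=> k /andP[k1 k2]; exact: h.
rewrite -big_filter; apply: perm_big; apply: uniq_perm.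
- by rewrite filter_uniq// box_uniq.
- exact: box_uniq.
- move=> k; rewrite mem_filter andb_idr//; exact: sub_box.
Qed.

Lemma big_box_opp (V : nmodType) N (F : freq d -> V) :
  \sum_(k <- box N) F k = \sum_(k <- box N) F (- k).
Proof.
rewrite -(big_map (@GRing.opp (freq d)) xpredT F); apply: perm_big; apply: uniq_perm.
- exact: box_uniq.
- by rewrite map_inj_uniq ?box_uniq//; exact: oppr_inj.
- move=> k; rewrite -[k in RHS]opprK mem_map; last exact: oppr_inj.
  by rewrite boxN.
Qed.

Lemma big_box1 (V : nmodType) N k (F : freq d -> V) : k \in box N ->
  (forall l, l \in box N -> l != k -> F l = 0) -> \sum_(l <- box N) F l = F k.
Proof.
move=> kN h; rewrite (bigD1_seq k)//= ?box_uniq// big1_seq ?addr0//.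
by move=> l /andP[lk lN]; exact: h.
Qed.

End Box.

Section TrigPoly.
Context (R : realType) (d : nat).
Local Notation mu := (torus R d).
Implicit Types (k l n : freq d) (x y : d.-tuple R) (f g : d.-tuple R -> R).

Definition syn (N : nat) (c : freq d -> R[i]) x : R[i] :=
  \sum_(k <- box d N) c k * ek k x.

Lemma cbmf_syn N c : cbmf (syn N c).
Proof. by apply: cbmf_sum => k; apply: cbmfM; [exact: cbmf_cst|exact: cbmf_ek]. Qed.

Lemma integrable_mulr_bmf f g : mu.-integrable setT (EFin \o f) -> bmf g ->
  mu.-integrable setT (EFin \o (fun x => f x * g x)).
Proof.
move=> intf [mg [M Mg]].
apply: (@integrableMl _ _ _ mu setT measurableT (EFin \o f) g) => //.
by exists M; split; [exact: num_real|move=> r Mr x _; exact: (le_trans (Mg x) (ltW Mr))].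
Qed.

Definition cintegrable (F : d.-tuple R -> R[i]) :=
  mu.-integrable setT (EFin \o (fun x => complex.Re (F x))) /\
  mu.-integrable setT (EFin \o (fun x => complex.Im (F x))).

Lemma cintegrable_mul g (E : d.-tuple R -> R[i]) :
  mu.-integrable setT (EFin \o g) -> cbmf E ->
  cintegrable (fun x => (g x)%:C%C * E x).
Proof.
move=> intg [h1 h2]; split.
  by under eq_fun do rewrite cReM /= mul0r subr0; exact: integrable_mulr_bmf.
by under eq_fun do rewrite cImM /= mul0r addr0; exact: integrable_mulr_bmf.
Qed.

Lemma integrableZ_real (a : R) g : mu.-integrable setT (EFin \o g) ->
  mu.-integrable setT (EFin \o (fun x => a * g x)).
Proof. by move=> ig; apply: (integrableZl measurableT a ig). Qed.

Lemma integrableD_real f g : mu.-integrable setT (EFin \o f) ->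
  mu.-integrable setT (EFin \o g) -> mu.-integrable setT (EFin \o (fun x => f x + g x)).
Proof. by move=> h1 h2; apply: (integrableD measurableT h1 h2). Qed.

Lemma integrableB_real f g : mu.-integrable setT (EFin \o f) ->
  mu.-integrable setT (EFin \o g) -> mu.-integrable setT (EFin \o (fun x => f x - g x)).
Proof. by move=> h1 h2; apply: (integrableB measurableT h1 h2). Qed.

Lemma cintegrableZ c F : cintegrable F -> cintegrable (fun x => c * F x).
Proof.
move=> [h1 h2]; split.
  by under eq_fun do rewrite cReM; apply: integrableB_real; exact: integrableZ_real.
by under eq_fun do rewrite cImM; apply: integrableD_real; exact: integrableZ_real.
Qed.

Lemma cintegrableD F G : cintegrable F -> cintegrable G ->
  cintegrable (fun x => F x + G x).
Proof.
by move=> [a b] [c e]; split; under eq_fun do rewrite raddfD; exact: integrableD_real.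
Qed.

Lemma cintegrable_intZ c F : cintegrable F -> cint mu (fun x => c * F x) = c * cint mu F.
Proof.
move=> [a b]; rewrite /cint.
under eq_Rintegral do rewrite cReM.
under [X in (_ +i* X)%C]eq_Rintegral do rewrite cImM.
rewrite RintegralB ?RintegralD ?RintegralZl//; try exact: integrableZ_real.
by case: c => c1 c2.
Qed.

Lemma cintegrable_sum (I : Type) (s : seq I) (F : I -> d.-tuple R -> R[i]) :
  (forall i, cintegrable (F i)) ->
  cint mu (fun x => \sum_(i <- s) F i x) = \sum_(i <- s) cint mu (F i).
Proof.
move=> hF; elim: s => [|i s ih].
  rewrite big_nil -[RHS](cintC mu 0); congr cint; apply/funext => x; exact: big_nil.
have hs : cintegrable (fun x => \sum_(j <- s) F j x).
  elim: {ih} s => [|j s ih].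
    under eq_fun do rewrite big_nil; split; apply: bmf_integrable; exact: bmf_cst.
  by under eq_fun do rewrite big_cons; exact: cintegrableD.
rewrite big_cons -ih /cint.
under eq_Rintegral do rewrite big_cons raddfD.
under [X in (_ +i* X)%C]eq_Rintegral do rewrite big_cons raddfD.
by have [[a b] [c e]] := (hF i, hs); rewrite /= !RintegralD.
Qed.

Lemma fourierE f k : mu.-integrable setT (EFin \o f) ->
  fourier f k = cint mu (fun x => (f x)%:C%C * ek (- k) x).
Proof.
move=> intf; rewrite /fourier /cint.
have [h1 h2] := cbmf_ek R k.
apply/eqP; rewrite eq_complex /=; apply/andP; split; apply/eqP.
  apply: eq_Rintegral => x _.
  by rewrite /= mul0r subr0 dotN mulrN cosN.
rewrite -mulN1r -RintegralZl//; last exact: integrable_mulr_bmf h2.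
apply: eq_Rintegral => x _.
by rewrite /= mul0r addr0 dotN mulrN sinN mulN1r mulrN.
Qed.

Lemma fourier_eq_ae f g : mu.-integrable setT (EFin \o f) ->
  mu.-integrable setT (EFin \o g) ->
  {ae mu, forall x, f x = g x} -> fourier f = fourier g.
Proof.
move=> intf intg fg; apply/funext => k; rewrite /fourier.
have h (a : d.-tuple R -> R) : bmf a ->
    \int[mu]_x (f x * a x) = \int[mu]_x (g x * a x).
  move=> ba; rewrite /Rintegral; congr fine; apply: ae_eq_integral => //.
  - by apply: (measurable_int mu); exact: integrable_mulr_bmf.
  - by apply: (measurable_int mu); exact: integrable_mulr_bmf.
  - by apply: filterS fg => x fgx _; rewrite fgx.
by have [h1 h2] := cbmf_ek R k; rewrite (h _ h1) (h _ h2).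
Qed.

Lemma fourierD f g : mu.-integrable setT (EFin \o f) ->
  mu.-integrable setT (EFin \o g) ->
  fourier (f \+ g) = fourier f \+ fourier g.
Proof.
move=> intf intg; apply/funext => k; rewrite /fourier /=.
have h (a : d.-tuple R -> R) : bmf a ->
    \int[mu]_x ((f x + g x) * a x) = \int[mu]_x (f x * a x) + \int[mu]_x (g x * a x).
  move=> ba; rewrite -RintegralD//; try exact: integrable_mulr_bmf.
  by apply: eq_Rintegral => x _; rewrite mulrDl.
have [h1 h2] := cbmf_ek R k.
rewrite (h _ h1) (h _ h2).
by apply/eqP; rewrite eq_complex /= opprD !eqxx.
Qed.

Lemma fourierZ (a : R) f : mu.-integrable setT (EFin \o f) ->
  fourier (fun x => a * f x) = scaleD a (fourier f).
Proof.
move=> intf; apply/funext => k; rewrite /fourier /scaleD.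
have h (b : d.-tuple R -> R) : bmf b ->
    \int[mu]_x ((a * f x) * b x) = a * \int[mu]_x (f x * b x).
  move=> ba; rewrite -RintegralZl//; try exact: integrable_mulr_bmf.
  by apply: eq_Rintegral => x _; rewrite mulrA.
have [h1 h2] := cbmf_ek R k.
rewrite (h _ h1) (h _ h2).
by apply/eqP; rewrite eq_complex /= !mul0r subr0 addr0 mulrN !eqxx.
Qed.

Lemma fourierB f g : mu.-integrable setT (EFin \o f) ->
  mu.-integrable setT (EFin \o g) ->
  fourier (f \- g) = fourier f \- fourier g.
Proof.
move=> intf intg.
have -> : f \- g = f \+ (fun x => -1 * g x) by apply/funext => x /=; rewrite mulN1r.
have intg' : mu.-integrable setT (EFin \o (fun x => -1 * g x)).
  by apply: (integrableZl measurableT (-1) intg).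
rewrite fourierD// fourierZ//; apply/funext => k /=.
by rewrite /scaleD rmorphN /= mulN1r.
Qed.

Lemma fourier_conj f k : mu.-integrable setT (EFin \o f) ->
  fourier f (- k) = ((fourier f k)^*)%C.
Proof.
move=> intf; rewrite /fourier; have [_ h2] := cbmf_ek R k.
apply/eqP; rewrite eq_complex /= opprK; apply/andP; split; apply/eqP.
  by apply: eq_Rintegral => x _; rewrite dotN mulrN cosN.
have i2 : mu.-integrable setT (EFin \o (fun x => f x * sin (2 * pi * dot (- k) x))).
  by apply: integrable_mulr_bmf => //; have [] := cbmf_ek R (- k).
rewrite -mulN1r -RintegralZl//.
by apply: eq_Rintegral => x _; rewrite dotN mulrN sinN mulN1r mulrN opprK.
Qed.

Lemma cint_synM N c n : cint mu (fun x => syn N c x * ek (- n) x) =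
  if n \in box d N then c n else 0.
Proof.
have -> : (fun x => syn N c x * ek (- n) x) =
   (fun x => \sum_(k <- box d N) (c k * ek (k - n) x)).
  by apply/funext => x; rewrite mulr_suml; apply: eq_bigr => k _; rewrite ekD mulrA.
rewrite cint_sum; last first.
  by move=> k; apply: cbmfM; [exact: cbmf_cst|exact: cbmf_ek].
have ez k : cint mu (fun x => c k * ek (k - n) x) = c k * (k - n == 0)%:R.
  by rewrite cintZ ?cint_ek//; exact: cbmf_ek.
under eq_bigr do rewrite ez.
have [nN|nN] := boolP (n \in _).
  rewrite (big_box1 nN) ?subrr ?eqxx ?mulr1// => l _ ln.
  by rewrite subr_eq0 (negbTE ln) mulr0.
rewrite big1_seq// => k /andP[_ kN].
by rewrite subr_eq0; case: eqP => [kn|]; rewrite ?mulr0//; move: nN; rewrite -kn kN.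
Qed.

Lemma parseval N c : \int[mu]_x nsq (syn N c x) = \sum_(k <- box d N) nsq (c k).
Proof.
suff h : (\int[mu]_x nsq (syn N c x))%:C%C = (\sum_(k <- box d N) nsq (c k))%:C%C.
  by case: h.
rewrite -cint_real.
have -> : (fun x => (nsq (syn N c x))%:C%C) =
   (fun x => \sum_(n <- box d N) (c n)^*%C * (syn N c x * ek (- n) x)).
  apply/funext => x; rewrite nsqE {2}/syn rmorph_sum mulr_sumr; apply: eq_bigr => n _.
  by rewrite ekN rmorphM mulrCA mulrA.
rewrite cint_sum; last first.
  move=> k; apply: cbmfM; first exact: cbmf_cst.
  by apply: cbmfM; [exact: cbmf_syn|exact: cbmf_ek].
rewrite rmorph_sum /= big_seq [RHS]big_seq; apply: eq_bigr => n nN.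
rewrite cintZ; last by apply: cbmfM; [exact: cbmf_syn|exact: cbmf_ek].
by rewrite cint_synM nN nsqE mulrC.
Qed.

(** The identity holds everywhere and not only almost everywhere, so equality of Fourier
    coefficients gives equality of functions ([trig_inj]). Bounds for trigonometric polynomials thus
    never carry exceptional sets. *)
Definition trig (N : nat) f := exists c, forall x, (f x)%:C%C = syn N c x.

Lemma trig_bmf N f : trig N f -> bmf f.
Proof.
move=> [c fc]; have [h _] := cbmf_syn N c.
by have -> : f = (fun x => complex.Re (syn N c x)) by apply/funext => x; rewrite -fc.
Qed.

Lemma trig_integrable N f : trig N f -> mu.-integrable setT (EFin \o f).
Proof. by move=> /trig_bmf; exact: bmf_integrable. Qed.

Lemma fourier_syn N f c : (forall x, (f x)%:C%C = syn N c x) ->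
  forall k, fourier f k = if k \in box d N then c k else 0.
Proof.
move=> fc k; rewrite fourierE; last by apply: (@trig_integrable N); exists c.
by rewrite -cint_synM; congr cint; apply/funext => x; rewrite fc.
Qed.

Lemma trig_rep N f : trig N f -> forall x, (f x)%:C%C = syn N (fourier f) x.
Proof.
move=> [c fc] x; rewrite fc /syn big_seq [RHS]big_seq; apply: eq_bigr => k kN.
by rewrite (fourier_syn fc) kN.
Qed.

Lemma trig_fourier0 N f k : trig N f -> k \notin box d N -> fourier f k = 0.
Proof. by move=> [c fc] kN; rewrite (fourier_syn fc) (negbTE kN). Qed.

Lemma trig_inj N f g : trig N f -> trig N g -> fourier f = fourier g -> f = g.
Proof.
move=> /trig_rep hf /trig_rep hg fg; apply/funext => x.
by have := hf x; rewrite fg -hg => -[].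
Qed.

(** Collects equal frequencies. Products and squared moduli arise as sums over pairs of frequencies,
    in which the same character occurs many times. *)
Lemma trig_list N f (s : seq (R[i] * freq d)) : (forall z, z \in s -> z.2 \in box d N) ->
  (forall x, (f x)%:C%C = \sum_(z <- s) z.1 * ek z.2 x) -> trig N f.
Proof.
move=> sN fs; exists (fun k => \sum_(z <- s | z.2 == k) z.1) => x.
rewrite fs /syn; under [RHS]eq_bigr do rewrite big_mkcond mulr_suml.
rewrite exchange_big /= big_seq [RHS]big_seq; apply: eq_bigr => z zs.
rewrite (big_box1 (sN _ zs)) ?eqxx// => l _ lz.
by rewrite eq_sym (negbTE lz) mul0r.
Qed.

Lemma trig_mono M N f : (M <= N)%N -> trig M f -> trig N f.
Proof.
move=> MN /trig_rep fM; exists (fun k => if k \in box d M then fourier f k else 0) => x.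
rewrite fM /syn (big_box_sub MN); last by move=> k _ /negbTE->; rewrite mul0r.
by rewrite big_seq [RHS]big_seq; apply: eq_bigr => k ->.
Qed.

Lemma trig_cst N (a : R) : trig N (fun=> a).
Proof.
apply: (@trig_list _ _ [:: (a%:C%C, 0)]) => [z|x].
  by rewrite inE => /eqP -> /=; exact: box0.
by rewrite big_seq1 ek0 mulr1.
Qed.

Lemma trigD N f g : trig N f -> trig N g -> trig N (fun x => f x + g x).
Proof.
move=> [c fc] [c' gc]; exists (fun k => c k + c' k) => x.
by rewrite rmorphD /= fc gc -big_split; apply: eq_bigr => k _; rewrite mulrDl.
Qed.

Lemma trigZ N a f : trig N f -> trig N (fun x => a * f x).
Proof.
move=> [c fc]; exists (fun k => a%:C%C * c k) => x.
by rewrite rmorphM /= fc mulr_sumr; apply: eq_bigr => k _; rewrite mulrA.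
Qed.

Lemma trigN N f : trig N f -> trig N (fun x => - f x).
Proof. by move=> /(trigZ (-1)); under eq_fun do rewrite mulN1r. Qed.

Lemma trigB N f g : trig N f -> trig N g -> trig N (fun x => f x - g x).
Proof. by move=> hf hg; apply: trigD => //; exact: trigN. Qed.

Lemma trig_sum N (I : Type) (s : seq I) (F : I -> d.-tuple R -> R) :
  (forall i, trig N (F i)) -> trig N (fun x => \sum_(i <- s) F i x).
Proof.
move=> hF; elim: s => [|i s ih].
  by under eq_fun do rewrite big_nil; exact: trig_cst.
by under eq_fun do rewrite big_cons; exact: trigD.
Qed.

Lemma trigM M N f g : trig M f -> trig N g -> trig (M + N) (fun x => f x * g x).
Proof.
move=> [c fc] [c' gc].
apply: (@trig_list _ _ [seq (c k * c' l, k + l) | k <- box d M, l <- box d N]).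
  by move=> z /allpairsP[[k l] /= [kM lN ->]]; exact: boxD.
move=> x; rewrite rmorphM /= fc gc big_allpairs_dep /= /syn big_distrl /=.
apply: eq_bigr => k _; rewrite big_distrr /=; apply: eq_bigr => l _.
by rewrite ekD; ring.
Qed.

Lemma trigX M f (n : nat) : trig M f -> trig (n * M) (fun x => f x ^+ n).
Proof.
move=> hf; elim: n => [|n ih].
  by under eq_fun do rewrite expr0; exact: trig_cst.
by under eq_fun do rewrite exprS; rewrite mulSn; exact: trigM.
Qed.

Lemma trig_horner M f (p : {poly R}) : trig M f ->
  trig ((size p).-1 * M) (fun x => p.[f x]).
Proof.
move=> hf; under eq_fun do rewrite horner_coef.
have e (x : d.-tuple R) : \sum_(i < size p) p`_i * f x ^+ i =
   \sum_(i <- index_enum 'I_(size p)) p`_i * f x ^+ i by [].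
apply: trig_sum => i; apply: trigZ; apply: trig_mono (trigX i hf).
by rewrite leq_mul2r; apply/orP; right; have := ltn_ord i; lia.
Qed.

(** A product with a polynomial is a finite convolution of coefficients. [convw] later takes the
    right-hand side as the definition of the product with an arbitrary distribution. *)
Lemma fourierM N f g n : trig N f -> mu.-integrable setT (EFin \o g) ->
  fourier (f \* g) n = \sum_(k <- box d N) fourier f k * fourier g (n - k).
Proof.
move=> hf intg.
have intfg : mu.-integrable setT (EFin \o (f \* g)).
  have := integrable_mulr_bmf intg (trig_bmf hf).
  by have -> : (fun x => g x * f x) = f \* g by apply/funext => x; rewrite mulrC.
rewrite fourierE//.
have e : (fun x => ((f \* g) x)%:C%C * ek (- n) x) = fun x =>
   \sum_(k <- box d N) fourier f k * ((g x)%:C%C * ek (- (n - k)) x).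
  apply/funext => x; rewrite /= rmorphM /= (trig_rep hf) !mulr_suml; apply: eq_bigr => k _.
  by rewrite opprB ekD; ring.
rewrite e cintegrable_sum; last first.
  by move=> k; apply: cintegrableZ; apply: cintegrable_mul => //; exact: cbmf_ek.
apply: eq_bigr => k _; rewrite cintegrable_intZ -?fourierE//.
by apply: cintegrable_mul => //; exact: cbmf_ek.
Qed.

Definition hermitian (c : freq d -> R[i]) := forall k, c (- k) = ((c k)^*)%C.

(** Synthesis of a real function: for [hermitian] coefficients the real part loses nothing
    ([reS_syn]), so multipliers with even real symbols return real functions. *)
Definition reS N c x : R := complex.Re (syn N c x).

Lemma reS_syn N c x : hermitian c -> (reS N c x)%:C%C = syn N c x.
Proof.
move=> hc.
have e : ((syn N c x)^*)%C = syn N c x.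
  rewrite {2}/syn big_box_opp /syn rmorph_sum; apply: eq_bigr => k _.
  by rewrite rmorphM /= hc ekN.
rewrite /reS; case: (syn N c x) e => a b [] /eqP.
by rewrite eq_sym -subr_eq0 opprK -mulr2n mulrn_eq0 /= => /eqP ->.
Qed.

Lemma trig_reS N c : hermitian c -> trig N (reS N c).
Proof. by move=> hc; exists c => x; rewrite reS_syn. Qed.

Lemma fourier_reS N c k : hermitian c ->
  fourier (reS N c) k = if k \in box d N then c k else 0.
Proof. by move=> hc; apply: fourier_syn => x; rewrite reS_syn. Qed.

Lemma reS_fourier N f : trig N f -> reS N (fourier f) = f.
Proof. by move=> hf; apply/funext => x; rewrite /reS -trig_rep. Qed.

Lemma hermitianM c c' : hermitian c -> hermitian c' -> hermitian (fun k => c k * c' k).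
Proof. by move=> h h' k; rewrite h h' rmorphM. Qed.

Lemma hermitian_fourier f : mu.-integrable setT (EFin \o f) -> hermitian (fourier f).
Proof. by move=> intf k; exact: fourier_conj. Qed.

Lemma hermitian_even (m : freq d -> R) : (forall k, m (- k) = m k) ->
  hermitian (fun k => (m k)%:C%C).
Proof. by move=> h k; rewrite h conjc_real. Qed.

End TrigPoly.
Arguments hermitian {R d} c.

(** * Periodic Lipschitz functions and convolution *)

Section PeriodicLipschitz.
Context (R : realType) (d : nat).
Implicit Types (k l n : freq d) (x y : d.-tuple R) (f g G : d.-tuple R -> R).

(** Chordal distance of the [i]-th coordinates on the circle R/Z. *)
Definition tdist1 (i : 'I_d) x y : R := cmod (cis (2 * pi * (tnth x i - tnth y i)) - 1).
Definition tdist x y : R := \sum_(i < d) tdist1 i x y.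

Lemma tdist1_ge0 i x y : 0 <= tdist1 i x y.
Proof. exact: cmod_ge0. Qed.

Lemma tdist1_le2 i x y : tdist1 i x y <= 2.
Proof. by rewrite (le_trans (cmodD _ _))// cmod_cis cmodN cmod1. Qed.

Lemma tdist_le x y : tdist x y <= 2 * d%:R.
Proof.
rewrite mulr_natr -[X in _ <= _ *+ X]card_ord -sumr_const.
by apply: ler_sum => i _; exact: tdist1_le2.
Qed.

Lemma cmod_cis_sum (I : Type) (s : seq I) (t : I -> R) :
  cmod (cis (\sum_(i <- s) t i) - 1) <= \sum_(i <- s) cmod (cis (t i) - 1).
Proof.
elim: s => [|i s ih]; first by rewrite !big_nil cis0 subrr cmod0.
rewrite !big_cons.
have -> : cis (t i + \sum_(j <- s) t j) - 1 =
    cis (t i) * (cis (\sum_(j <- s) t j) - 1) + (cis (t i) - 1) by rewrite cisD; ring.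
by rewrite (le_trans (cmodD _ _))// cmodM cmod_cis mul1r addrC lerD2l.
Qed.

Lemma ek_dist k x y :
  cmod (ek k x - ek k y) <= \sum_(i < d) `|k i|%:~R * tdist1 i x y.
Proof.
rewrite /ek cmod_cis_sub -mulrBr -dot_tsub /dot mulr_sumr.
apply: le_trans (cmod_cis_sum _ _) _; apply: ler_sum => i _.
by rewrite tnth_mktuple mulrCA; exact: cmod_cis_sub1.
Qed.

(* Lipschitz for a metric of the torus: such functions are periodic although they live on a cell of R^d. *)
Definition PL G := measurable_fun setT G /\
  exists2 C : R, 0 <= C & forall x y, `|G x - G y| <= C * tdist x y.

Lemma PL_bmf G : PL G -> bmf G.
Proof.
move=> [mG [C C0 GC]]; split => //.
pose x0 : d.-tuple R := [tuple 0 | i < d].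
exists (`|G x0| + C * (2 * d%:R)) => x.
have -> : G x = G x0 + (G x - G x0) by rewrite addrC subrK.
rewrite (le_trans (ler_normD _ _))// lerD2l (le_trans (GC _ _))//.
by rewrite ler_wpM2l// tdist_le.
Qed.

Lemma PL_cst (c : R) : PL (fun=> c).
Proof.
split; first exact: measurable_cst.
by exists 0 => // x y; rewrite subrr normr0 mul0r.
Qed.

(** Local Lipschitz continuity of [B] is enough because [PL] functions are bounded. *)
Lemma PL_comp2 (B : R -> R -> R) f g :
  (forall M : R, exists2 C : R, 0 <= C & forall a b a' b', `|a| <= M -> `|b| <= M ->
     `|a'| <= M -> `|b'| <= M -> `|B a b - B a' b'| <= C * (`|a - a'| + `|b - b'|)) ->
  measurable_fun setT (fun x => B (f x) (g x)) ->
  PL f -> PL g -> PL (fun x => B (f x) (g x)).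
Proof.
move=> lB mB hf hg; split => //.
have [_ [M Mf]] := PL_bmf hf; have [_ [M' Mg]] := PL_bmf hg.
have [C C0 BC] := lB (Num.max M M').
case: hf hg => _ [Cf Cf0 fC] [_ [Cg Cg0 gC]].
exists (C * (Cf + Cg)); first by rewrite mulr_ge0 ?addr_ge0.
move=> x y; apply: le_trans (BC _ _ _ _ _ _ _ _) _.
- by rewrite le_max Mf.
- by rewrite le_max Mg orbT.
- by rewrite le_max Mf.
- by rewrite le_max Mg orbT.
by rewrite -mulrA mulrDl ler_wpM2l// lerD.
Qed.

Lemma PL_D f g : PL f -> PL g -> PL (fun x => f x + g x).
Proof.
move=> hf hg; apply: (@PL_comp2 (fun a b => a + b)) => //.
  move=> M; exists 1 => // a b a' b' _ _ _ _.
  by rewrite mul1r opprD addrACA ler_normD.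
by case: hf hg => mf _ [mg _]; exact: measurable_funD.
Qed.

Lemma PL_M f g : PL f -> PL g -> PL (fun x => f x * g x).
Proof.
move=> hf hg; apply: (@PL_comp2 (fun a b => a * b)) => //.
  move=> M; exists `|M| => // a b a' b' ha hb ha' hb'.
  have -> : a * b - a' * b' = a * (b - b') + (a - a') * b' by ring.
  rewrite (le_trans (ler_normD _ _))// !normrM mulrDr addrC lerD//.
    by rewrite mulrC ler_wpM2r// (le_trans hb')// ler_norm.
  by rewrite ler_wpM2r// (le_trans ha)// ler_norm.
by case: hf hg => mf _ [mg _]; exact: measurable_funM.
Qed.

Lemma PL_comp (b : R -> R) f :
  (forall M : R, exists2 C : R, 0 <= C & forall a a', `|a| <= M -> `|a'| <= M ->
     `|b a - b a'| <= C * `|a - a'|) ->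
  measurable_fun setT b -> PL f -> PL (fun x => b (f x)).
Proof.
move=> lb mb hf; apply: (@PL_comp2 (fun a _ => b a) f (fun=> 0)) => //.
- move=> M; have [C C0 bC] := lb M; exists C => // a c a' c' ha _ ha' _.
  by rewrite (le_trans (bC _ _ _ _))// ler_wpM2l// lerDl.
- by apply: measurableT_comp => //; case: hf.
- exact: PL_cst.
Qed.

Lemma PL_norm f : PL f -> PL (fun x => `|f x|).
Proof.
move=> hf; apply: (@PL_comp (fun a => `|a|)) => //.
by move=> M; exists 1 => // a a' _ _; rewrite mul1r ler_dist_dist.
Qed.

Lemma PL_ek k : PL (fun x => complex.Re (ek k x)) /\ PL (fun x => complex.Im (ek k x)).
Proof.
have [[h1 _] [h2 _]] := cbmf_ek R k.
pose C : R := \sum_(i < d) `|k i|%:~R.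
have C0 : 0 <= C by apply: sumr_ge0 => i _; rewrite ler0z.
have hC x y : cmod (ek k x - ek k y) <= C * tdist x y.
  apply: le_trans (ek_dist _ _ _) _; rewrite /tdist mulr_sumr; apply: ler_sum => i _.
  rewrite ler_wpM2r ?tdist1_ge0// /C (bigD1 i)//= lerDl.
  by apply: sumr_ge0 => j _; rewrite ler0z.
split; split => //; exists C => // x y.
  by rewrite -raddfB (le_trans _ (hC x y))// normRe_cmod.
rewrite -raddfB (le_trans _ (hC x y))//.
by rewrite -[X in X <= _]sqrtr_sqr ler_wsqrtr// lerDr sqr_ge0.
Qed.

Lemma PL_sum (I : Type) (s : seq I) (F : I -> d.-tuple R -> R) :
  (forall i, PL (F i)) -> PL (fun x => \sum_(i <- s) F i x).
Proof.
move=> hF; elim: s => [|i s ih].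
  by under eq_fun do rewrite big_nil; exact: PL_cst.
by under eq_fun do rewrite big_cons; exact: PL_D.
Qed.

Lemma PL_reS N c : PL (reS N c).
Proof.
have -> : reS N c = fun x => \sum_(k <- box d N)
   (complex.Re (c k) * complex.Re (ek k x) + (- complex.Im (c k)) * complex.Im (ek k x)).
  apply/funext => x; rewrite /reS raddf_sum; apply: eq_bigr => k _.
  by rewrite -[LHS]/(complex.Re (c k * ek k x)) cReM mulNr.
apply: PL_sum => k; have [h1 h2] := PL_ek k.
by apply: PL_D; apply: PL_M => //; exact: PL_cst.
Qed.

Lemma PL_trig N f : trig N f -> PL f.
Proof. by move=> /reS_fourier <-; exact: PL_reS. Qed.

Lemma PL_bnd f g : PL f -> PL g -> PL (fun x => Num.min (f x) (g x)).
Proof.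
move=> hf hg; apply: (@PL_comp2 Num.min) => //.
  move=> M; exists 1 => // a b a' b' _ _ _ _; rewrite mul1r.
  have [h1|h1] := leP a b; have [h2|h2] := leP a' b'; rewrite ?lerDl ?lerDr//;
  have := ler_norm (a - a'); have := ler_norm (b - b');
  have := ler_norm (a' - a); have := ler_norm (b' - b);
  rewrite (distrC a' a) (distrC b' b) => ? ? ? ?; rewrite ler_norml; apply/andP; split; lra.
by case: hf hg => mf _ [mg _]; exact: measurable_minr.
Qed.

End PeriodicLipschitz.

Section Convolution.
Context (R : realType) (d : nat).
Local Notation mu := (torus R d).
Implicit Types (k l n : freq d) (x y : d.-tuple R) (f g K : d.-tuple R -> R).

(** [tsub x y] leaves the fundamental cell, so this is the convolution of the torus only for kernels
    that are given by a periodic formula, such as trigonometric polynomials. *)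
Definition conv K g x : R := \int[mu]_y (K (tsub x y) * g y).

Lemma measurable_tsubr x : measurable_fun setT (fun y => tsub x y).
Proof.
apply/measurable_fun_tnthP => i.
rewrite (_ : _ \o _ = fun y => tnth x i - tnth y i); last first.
  by apply/funext => y; rewrite /= tnth_mktuple.
by apply: measurable_funB => //; exact: measurable_tnth.
Qed.

Lemma measurable_tsubl y : measurable_fun setT (fun x => tsub x y).
Proof.
apply/measurable_fun_tnthP => i.
rewrite (_ : _ \o _ = fun x => tnth x i - tnth y i); last first.
  by apply/funext => x; rewrite /= tnth_mktuple.
by apply: measurable_funB => //; exact: measurable_tnth.
Qed.

Lemma measurable_tsub : measurable_fun setT
  (fun z : d.-tuple R * d.-tuple R => tsub z.1 z.2).
Proof.
apply/measurable_fun_tnthP => i.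
rewrite (_ : _ \o _ = fun z => tnth z.1 i - tnth z.2 i); last first.
  by apply/funext => x; rewrite /= tnth_mktuple.
by apply: measurable_funB; apply: (measurableT_comp (measurable_tnth i)).
Qed.

Lemma bmf_tsubr f x : bmf f -> bmf (fun y => f (tsub x y)).
Proof.
move=> [mf [M Mf]]; split; last by exists M.
by apply: measurableT_comp => //; exact: measurable_tsubr.
Qed.

Lemma bmf_tsubl f y : bmf f -> bmf (fun x => f (tsub x y)).
Proof.
move=> [mf [M Mf]]; split; last by exists M.
by apply: measurableT_comp => //; exact: measurable_tsubl.
Qed.

Lemma conv_syn N K g x : trig N K -> mu.-integrable setT (EFin \o g) ->
  (conv K g x)%:C%C = syn N (fun k => fourier K k * fourier g k) x.
Proof.
move=> hK intg; rewrite /conv -cint_real.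
have -> : (fun y => (K (tsub x y) * g y)%:C%C) = fun y =>
   \sum_(k <- box d N) (fourier K k * ek k x) * ((g y)%:C%C * ek (- k) y).
  apply/funext => y; rewrite rmorphM /= (trig_rep hK) mulr_suml; apply: eq_bigr => k _.
  by rewrite ek_tsub; ring.
rewrite cintegrable_sum; last first.
  by move=> k; apply: cintegrableZ; apply: cintegrable_mul => //; exact: cbmf_ek.
apply: eq_bigr => k _; rewrite cintegrable_intZ -?fourierE//; first by ring.
by apply: cintegrable_mul => //; exact: cbmf_ek.
Qed.

Lemma conv_trig N K g : trig N K -> mu.-integrable setT (EFin \o g) ->
  trig N (conv K g).
Proof. by move=> hK ig; exists (fun k => fourier K k * fourier g k) => x; exact: conv_syn. Qed.

Lemma fourier_conv N K g k : trig N K -> mu.-integrable setT (EFin \o g) ->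
  fourier (conv K g) k = fourier K k * fourier g k.
Proof.
move=> hK ig; rewrite (fourier_syn (fun x => conv_syn x hK ig)).
by case: ifPn => // kN; rewrite (trig_fourier0 hK kN) mul0r.
Qed.

Lemma Int_fourier0 N f : trig N f -> (\int[mu]_x f x)%:C%C = fourier f 0.
Proof.
move=> hf; rewrite fourierE; last exact: trig_integrable hf.
by rewrite -cint_real; congr cint; apply/funext => x; rewrite oppr0 ek0 mulr1.
Qed.

(** Invariance of the measure under reflections and translations can hold only for functions that
    are periodic on all of R^d. Here it follows from orthogonality; [Int_PL_tsubr] extends it to
    [PL] functions by approximation. *)
Lemma Int_trig_tsubr N f x : trig N f -> \int[mu]_y f (tsub x y) = \int[mu]_y f y.
Proof.
move=> hf; suff h : (\int[mu]_y f (tsub x y))%:C%C = (\int[mu]_y f y)%:C%C :> R[i] by case: h.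
rewrite (Int_fourier0 hf) -cint_real.
have -> : (fun y => (f (tsub x y))%:C%C) = fun y =>
   \sum_(k <- box d N) (fourier f k * ek k x) * ek (- k) y.
  by apply/funext => y; rewrite (trig_rep hf); apply: eq_bigr => k _; rewrite ek_tsub mulrA.
rewrite cint_sum; last by move=> k; apply: cbmfM; [exact: cbmf_cst|exact: cbmf_ek].
have e k : cint mu (fun y => fourier f k * ek k x * ek (- k) y) =
    fourier f k * ek k x * (k == 0)%:R.
  by rewrite cintZ ?cint_ek ?oppr_eq0//; exact: cbmf_ek.
under eq_bigr do rewrite e.
rewrite (big_box1 (box0 d N)) ?eqxx ?mulr1 ?ek0 ?mulr1// => l _ l0.
by rewrite (negbTE l0) mulr0.
Qed.

Lemma Int_trig_tsubl N f y : trig N f -> \int[mu]_x f (tsub x y) = \int[mu]_x f x.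
Proof.
move=> hf; suff h : (\int[mu]_x f (tsub x y))%:C%C = (\int[mu]_x f x)%:C%C :> R[i] by case: h.
rewrite (Int_fourier0 hf) -cint_real.
have -> : (fun x => (f (tsub x y))%:C%C) = fun x =>
   \sum_(k <- box d N) (fourier f k * ek (- k) y) * ek k x.
  by apply/funext => x; rewrite (trig_rep hf); apply: eq_bigr => k _; rewrite ek_tsub; ring.
rewrite cint_sum; last by move=> k; apply: cbmfM; [exact: cbmf_cst|exact: cbmf_ek].
have e k : cint mu (fun x => fourier f k * ek (- k) y * ek k x) =
    fourier f k * ek (- k) y * (k == 0)%:R.
  by rewrite cintZ ?cint_ek//; exact: cbmf_ek.
under eq_bigr do rewrite e.
rewrite (big_box1 (box0 d N)) ?eqxx ?mulr1 ?oppr0 ?ek0 ?mulr1// => l _ l0.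
by rewrite (negbTE l0) mulr0.
Qed.

End Convolution.

(** * Fejer kernels and density of trigonometric polynomials *)

Section Fejer.
Context (R : realType) (d : nat).
Local Notation mu := (torus R d).
Implicit Types (k l n : freq d) (x y : d.-tuple R) (f g G : d.-tuple R -> R).

Lemma box_prod (V : comPzRingType) N (a : 'I_d -> int -> V) :
  \sum_(k <- box d N) \prod_(i < d) a i (k i) =
  \prod_(i < d) \sum_(m < N.*2.+1) a i ((m : nat)%:Z - N%:Z).
Proof. by rewrite bigA_distr_bigA big_map /=; apply: big_enum. Qed.

Definition chi01 (N : nat) (m : int) : R := ((0 <= m) && (m < N%:Z))%:R.

Definition fejc (N : nat) k : R := \prod_(i < d) chi01 N (k i).

Lemma chi01_in N m : 0 <= m -> m < N%:Z -> chi01 N m = 1.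
Proof. by rewrite /chi01 => -> ->. Qed.

Lemma chi01_lt0 N m : m < 0 -> chi01 N m = 0.
Proof. by rewrite /chi01 leNgt => ->. Qed.

Lemma chi01_ge N m : N%:Z <= m -> chi01 N m = 0.
Proof. by rewrite /chi01 [m < _]ltNge => ->; rewrite andbF. Qed.

Lemma chi01_sqr N m : chi01 N m ^+ 2 = chi01 N m.
Proof. by rewrite /chi01; case: (_ && _); rewrite ?expr1n ?expr0n. Qed.

Lemma sum_chi01 N : \sum_(m < N.*2.+1) chi01 N ((m : nat)%:Z - N%:Z) = N%:R.
Proof.
rewrite -(big_mkord xpredT (fun m => chi01 N (m%:Z - N%:Z))).
rewrite (big_cat_nat (n := N))//=; last by rewrite -addnn; lia.
rewrite big_nat_cond big1 ?add0r; last first.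
  by move=> m /andP[/andP[_ mN] _]; rewrite chi01_lt0//; lia.
rewrite big_nat_recr/=; last by rewrite -addnn; lia.
rewrite [X in _ + X](_ : _ = 0) ?addr0; last first.
  by rewrite chi01_ge// -addnn; lia.
rewrite big_nat_cond (eq_bigr (fun=> 1)); last first.
  by move=> m /andP[/andP[mN mN2] _]; rewrite chi01_in//; move: mN2; rewrite -addnn; lia.
by rewrite -big_nat_cond sumr_const_nat -addnn addnK.
Qed.

Lemma sum_chi01_diff N : (0 < N)%N ->
  \sum_(m < N.*2.+1) (chi01 N (((m : nat)%:Z - N%:Z) - 1) - chi01 N ((m : nat)%:Z - N%:Z)) ^+ 2 = 2.
Proof.
move=> N0.
rewrite -(big_mkord xpredT (fun m => (chi01 N ((m%:Z - N%:Z) - 1) - chi01 N (m%:Z - N%:Z)) ^+ 2)).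
rewrite big_nat_recr/=; last by rewrite -addnn; lia.
have -> : chi01 N (N.*2%:Z - N%:Z - 1) = 1.
  by rewrite chi01_in// -addnn; lia.
have -> : chi01 N (N.*2%:Z - N%:Z) = 0.
  by rewrite chi01_ge// -addnn; lia.
rewrite (big_cat_nat (n := N))//=; last by rewrite -addnn; lia.
rewrite big_nat_cond big1 ?add0r; last first.
  move=> m /andP[/andP[_ mN] _].
  by rewrite [chi01 N (_ - 1)]chi01_lt0 ?chi01_lt0 ?subrr ?expr0n//; lia.
rewrite big_ltn; last by rewrite -addnn; lia.
rewrite subrr big_nat_cond big1.
  rewrite addr0 [chi01 N (0 - 1)]chi01_lt0// chi01_in//.
  by rewrite sub0r sqrrN subr0 !expr1n.
move=> m /andP[/andP[mN mN2] _].
have [h1 h2] : (m%:Z - N%:Z - 1 < N%:Z) /\ (m%:Z - N%:Z < N%:Z).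
  by move: mN2; rewrite -addnn; lia.
by rewrite [chi01 N (_ - 1)]chi01_in ?chi01_in ?subrr ?expr0n//; lia.
Qed.

Definition DN (N : nat) x : R[i] := syn N (fun k => (fejc N k)%:C%C) x.

(** The Fejer kernel as a normalized squared modulus of the sum of the characters in the cube 0 <=
    k_i < N. Positivity is then evident, and Parseval's identity computes both its integral and its
    second moment for [tdist1]. *)
Definition fejer (N : nat) x : R := (N%:R ^+ d)^-1 * nsq (DN N x).

Lemma fejer_ge0 N x : 0 <= fejer N x.
Proof. by rewrite mulr_ge0 ?invr_ge0 ?exprn_ge0 ?nsq_ge0. Qed.

Lemma cconjM (a b : R[i]) : ((a * b)^*)%C = (a^*)%C * (b^*)%C.
Proof. exact: rmorphM. Qed.

Lemma cconj_sum (I : Type) (s : seq I) (F : I -> R[i]) :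
  ((\sum_(i <- s) F i)^*)%C = \sum_(i <- s) ((F i)^*)%C.
Proof. exact: rmorph_sum. Qed.

Lemma fejer_trig N : trig (N + N) (fejer N).
Proof.
apply: trigZ; apply: (@trig_list _ _ _ _
  [seq ((fejc N k)%:C%C * (fejc N l)%:C%C, k - l) | k <- box d N, l <- box d N]).
  by move=> z /allpairsP[[k l] /= [kM lN ->]]; apply: boxD => //; rewrite boxN.
move=> x; rewrite nsqE big_allpairs_dep /DN {2}/syn cconj_sum mulr_suml.
apply: eq_bigr => k _; rewrite mulr_sumr; apply: eq_bigr => l _.
cbn [fst snd]; rewrite ekD ekN cconjM conjc_real; ring.
Qed.

Lemma syn_conj_tsub N c x y :
  ((syn N c (tsub x y))^*)%C = syn N (fun k => ((c k)^*)%C * ek (- k) x) y.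
Proof.
rewrite {1}/syn cconj_sum; apply: eq_bigr => k _.
by rewrite cconjM -ekN ek_tsub opprK mulrA.
Qed.

Lemma parseval_tsub N c x :
  \int[mu]_y nsq (syn N c (tsub x y)) = \sum_(k <- box d N) nsq (c k).
Proof.
under eq_Rintegral do rewrite -nsq_conj syn_conj_tsub.
rewrite parseval; apply: eq_bigr => k _.
by rewrite nsqM nsq_conj [X in _ * X](_ : _ = 1) ?mulr1//; exact: nsq_cis.
Qed.

Lemma nsq_real (a : R) : nsq (a%:C%C) = a ^+ 2.
Proof. by rewrite /nsq /= expr0n addr0. Qed.

Lemma bmf_nsq_syn N c : bmf (fun x => nsq (syn N c x)).
Proof.
have [h1 h2] := cbmf_syn N c.
by apply: bmfD; under eq_fun do rewrite expr2; exact: bmfM.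
Qed.

Lemma Int_fejer N x : (0 < N)%N -> \int[mu]_y fejer N (tsub x y) = 1.
Proof.
move=> N0; rewrite IntZ; last first.
  exact: (bmf_tsubr x (bmf_nsq_syn N _)).
rewrite parseval_tsub.
have -> : \sum_(k <- box d N) nsq ((fejc N k)%:C)%C =
   \sum_(k <- box d N) \prod_(i < d) chi01 N (k i).
  apply: eq_bigr => k _; rewrite nsq_real -prodrXl.
  by apply: eq_bigr => i _; rewrite chi01_sqr.
rewrite (box_prod N (fun=> chi01 N)).
under eq_bigr do rewrite sum_chi01.
by rewrite prodr_const card_ord mulVf// expf_neq0// pnatr_eq0 -lt0n.
Qed.

Definition basis (i : 'I_d) : freq d := fun j => (i == j)%:Z.

Lemma dot_basis i x : dot (basis i) x = tnth x i.
Proof.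
rewrite /dot (bigD1 i)//= /basis eqxx mul1r big1 ?addr0// => j ji.
by rewrite eq_sym (negbTE ji) mul0r.
Qed.

Lemma basisB_ne i j k : j != i -> (k - basis i) j = k j.
Proof.
move=> h; rewrite [LHS]/(k j - basis i j) /basis eq_sym (negbTE h).
exact: subr0.
Qed.

Lemma big_box_shift (V : nmodType) N i (F : freq d -> V) :
  (forall k, k \notin box d N -> F k = 0) ->
  (forall k, k \notin box d N -> F (k - basis i) = 0) ->
  \sum_(k <- box d N) F k = \sum_(k <- box d N) F (k - basis i).
Proof.
move=> h1 h2.
have bi : basis i \in box d 1.
  by apply/boxP => j; rewrite /basis; case: (_ == _).
have e1 : \sum_(k <- box d (N + 2)) F k = \sum_(k <- box d N) F k.
  by apply: big_box_sub => [|k _ /h1//]; rewrite leq_addr.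
have e2 : \sum_(k <- box d (N + 2)) F (k - basis i) = \sum_(k <- box d N) F (k - basis i).
  by apply: big_box_sub => [|k _ /h2//]; rewrite leq_addr.
rewrite -e1 -e2 -(big_map (fun k => k - basis i) xpredT F).
rewrite (bigID (fun k => k \in box d N)) [RHS](bigID (fun k => k \in box d N)) /=.
rewrite [X in _ + X]big1 ?addr0; last by move=> k /h1.
rewrite [in RHS]addrC [X in X + _]big1 ?add0r; last by move=> k /h1.
rewrite -big_filter -[RHS]big_filter; apply: perm_big; apply: uniq_perm.
- by rewrite filter_uniq ?box_uniq.
- by rewrite filter_uniq// map_inj_uniq ?box_uniq// => ? ? /addIr.
- move=> k; rewrite !mem_filter; have [kN|//] := boolP (k \in box d N).
  rewrite (sub_box _ kN) ?leq_addr//=; apply/esym/mapP.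
  exists (k + basis i); last by rewrite addrK.
  by apply: (@sub_box _ (N + 1)); [lia|exact: boxD].
Qed.

Lemma syn_diff N i c x : (forall k, k \notin box d N -> c k = 0) ->
  (forall k, k \notin box d N -> c (k - basis i) = 0) ->
  syn N c x * (ek (basis i) x - 1) = syn N (fun k => c (k - basis i) - c k) x.
Proof.
move=> h1 h2; rewrite mulrBr mulr1 {3}/syn.
under [RHS]eq_bigr do rewrite mulrBl.
rewrite sumrB; congr (_ - _).
rewrite mulr_suml.
transitivity (\sum_(k <- box d N) (fun k => c k * ek (k + basis i) x) k).
  by apply: eq_bigr => k _; rewrite ekD mulrA.
rewrite (big_box_shift (i := i)).
- by apply: eq_bigr => k _; rewrite subrK.
- by move=> k /h1 ->; rewrite mul0r.
- by move=> k /h2 ->; rewrite mul0r.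
Qed.

(** Multiplying [DN] by a character minus 1 differences the coefficients. Those of an indicator of
    an interval change only at its two ends, which makes the second moment in [Int_fejer_dist] equal
    to 2 / N. *)
Lemma fejer_dist N i x y : (0 < N)%N ->
  fejer N (tsub x y) * tdist1 i x y ^+ 2 = (N%:R ^+ d)^-1 *
    nsq (syn N (fun k => (fejc N (k - basis i) - fejc N k)%:C%C) (tsub x y)).
Proof.
move=> N0; rewrite /fejer -mulrA; congr (_ * _).
rewrite cmod_sqr -nsqM; congr nsq.
have -> : cis (2 * pi * (tnth x i - tnth y i)) = ek (basis i) (tsub x y).
  by rewrite /ek dot_tsub !dot_basis.
rewrite /DN syn_diff.
- by apply: eq_bigr => k _; rewrite rmorphB.
- move=> k kN; rewrite /fejc.
  have [j hj] : exists j, ~~ (`|k j| <= N%:Z).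
    by apply/existsP; rewrite -negb_forall; rewrite mem_box in kN.
  rewrite (bigD1 j)//= (_ : chi01 _ _ = 0) ?mul0r ?mul0r//.
  move: (k j) hj => a; have [a0|a0] := leP 0 a => ha; last exact: chi01_lt0.
  by apply: chi01_ge; lia.
- move=> k kN; rewrite /fejc.
  have [j hj] : exists j, ~~ (`|k j| <= N%:Z).
    by apply/existsP; rewrite -negb_forall; rewrite mem_box in kN.
  rewrite (bigD1 j)//= (_ : chi01 _ _ = 0) ?mul0r ?mul0r//.
  rewrite [(k - basis i) j]/(k j - basis i j) /basis.
  move: (k j) hj => a; have [a0|a0] := leP 0 a => ha.
    by apply: chi01_ge; case: (i == j) => /=; lia.
  by apply: chi01_lt0; case: (i == j) => /=; lia.
Qed.

Lemma Int_fejer_dist N i x : (0 < N)%N ->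
  \int[mu]_y (fejer N (tsub x y) * tdist1 i x y ^+ 2) = 2 / N%:R.
Proof.
move=> N0; under eq_Rintegral do rewrite fejer_dist//.
rewrite IntZ; last exact: (bmf_tsubr x (bmf_nsq_syn N _)).
rewrite parseval_tsub.
pose a (j : 'I_d) (m : int) : R :=
  if j == i then (chi01 N (m - 1) - chi01 N m) ^+ 2 else chi01 N m.
have -> : \sum_(k <- box d N) nsq ((fejc N (k - basis i) - fejc N k)%:C)%C =
   \sum_(k <- box d N) \prod_(j < d) a j (k j).
  apply: eq_bigr => k _; rewrite nsq_real /fejc.
  rewrite (bigD1 i)//= [X in _ - X](bigD1 i)//= [RHS](bigD1 i)//=.
  rewrite [(k - basis i) i]/(k i - basis i i) /basis eqxx.
  set A := \prod_(_ | _) _; set B := \prod_(_ | _) _; set C := \prod_(_ | _) _.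
  have -> : A = B.
    apply: eq_bigr => j ji.
    by rewrite basisB_ne.
  have -> : C = B ^+ 2.
    rewrite -prodrXl; apply: eq_bigr => j ji.
    by rewrite /a (negbTE ji) chi01_sqr.
  by rewrite /a eqxx; ring.
rewrite (box_prod N a) (bigD1 i)//= {1}/a eqxx sum_chi01_diff//.
rewrite (eq_bigr (fun=> N%:R)); last first.
  by move=> j ji; rewrite /a (negbTE ji) sum_chi01.
rewrite prodr_const (_ : #|_| = d.-1); last by rewrite cardC1 card_ord.
have d0 : (0 < d)%N by case: (d) i {a} => [[]|].
have N0' : N%:R != 0 :> R by rewrite pnatr_eq0 -lt0n.
have -> : N%:R ^+ d = N%:R * N%:R ^+ d.-1 :> R by rewrite -exprS prednK.
have : N%:R ^+ d.-1 != 0 :> R by rewrite expf_neq0.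
by move: (N%:R ^+ d.-1) => b b0; field; rewrite b0 N0'.
Qed.

Lemma PL_approx G : PL G -> forall e : R, 0 < e ->
  exists N P, trig N P /\ forall x, `|P x - G x| <= e.
Proof.
move=> hG e e0; case: (hG) => mG [C C0 GC].
have bG := PL_bmf hG.
pose D : R := C * d%:R + 1.
have D0 : 0 < D by rewrite ltr_pwDr// mulr_ge0.
(* With t <= dl / 2 + t^2 / (2 dl) for the distance t in each coordinate, the Fejer mean of |G y - G
   x| is at most C d (dl / 2 + 1 / (dl N)). The choice 2 / N <= dl^2 turns this into C d dl <= D dl
   = e. *)
pose dl : R := e / D.
have dl0 : 0 < dl by rewrite divr_gt0.
pose N := (Num.truncn (2 / dl ^+ 2)).+1.
have N0 : (0 < N%:R :> R) by rewrite ltr0n.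
have hN : 2 / N%:R <= dl ^+ 2.
  rewrite ler_pdivrMr// mulrC -ler_pdivrMr ?exprn_gt0//.
  by rewrite ltW// truncnS_gt.
exists (N + N)%N, (conv (fejer N) G); split.
  by apply: conv_trig; [exact: fejer_trig|exact: bmf_integrable].
move=> x.
have bF := bmf_tsubr x (trig_bmf (@fejer_trig N)).
have bT i : bmf (fun y => tdist1 i x y).
  have mT : measurable_fun setT (fun y => tdist1 i x y).
    have [[h1 _] [h2 _]] := cbmf_ek R (basis i).
    have -> : (fun y => tdist1 i x y) = fun y => Num.sqrt
       ((complex.Re (ek (basis i) (tsub x y)) - 1) ^+ 2 + (complex.Im (ek (basis i) (tsub x y))) ^+ 2).
      by apply/funext => y; rewrite /tdist1 /cmod /nsq /ek dot_tsub !dot_basis /= subr0.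
    apply: (measurableT_comp (continuous_measurable_fun (@sqrt_continuous R))).
    apply: measurable_funD; apply: measurable_funX.
      by apply: measurable_funB => //; apply: (measurableT_comp h1); exact: measurable_tsubr.
    by apply: (measurableT_comp h2); exact: measurable_tsubr.
  by split => //; exists 2 => y; rewrite ger0_norm ?tdist1_ge0 ?tdist1_le2.
have e1 : conv (fejer N) G x - G x = \int[mu]_y (fejer N (tsub x y) * (G y - G x)).
  under eq_Rintegral do rewrite mulrBr.
  rewrite IntB; [|exact: bmfM|by apply: bmfM => //; exact: bmf_cst].
  by rewrite RintegralZr ?Int_fejer ?mul1r//; exact: bmf_integrable.
rewrite e1.
apply: le_trans (le_normr_Rintegral _ _) _ => //.
  by apply: bmf_integrable; apply: bmfM => //; apply: bmfB => //; exact: bmf_cst.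
have b1 i : bmf (fun y => fejer N (tsub x y) * tdist1 i x y ^+ 2).
  apply: bmfM => //.
  have -> : (fun y => tdist1 i x y ^+ 2) = (fun y => tdist1 i x y * tdist1 i x y).
    by apply/funext => y; rewrite expr2.
  exact: bmfM.
have bound y : `|fejer N (tsub x y) * (G y - G x)| <=
    \sum_(i < d) (C * (dl / 2) * fejer N (tsub x y) +
       C * (2 * dl)^-1 * (fejer N (tsub x y) * tdist1 i x y ^+ 2)).
  rewrite normrM ger0_norm ?fejer_ge0// distrC.
  apply: le_trans (ler_wpM2l (fejer_ge0 _ _) (GC x y)) _.
  rewrite /tdist mulr_sumr mulr_sumr; apply: ler_sum => i _.
  have -> : C * (dl / 2) * fejer N (tsub x y) +
    C * (2 * dl)^-1 * (fejer N (tsub x y) * tdist1 i x y ^+ 2) =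
    fejer N (tsub x y) * (C * (dl / 2 + (2 * dl)^-1 * tdist1 i x y ^+ 2)) by ring.
  rewrite ler_wpM2l ?fejer_ge0// ler_wpM2l//.
  set t := tdist1 _ _ _.
  rewrite -subr_ge0 (_ : _ - t = (2 * dl)^-1 * (t - dl) ^+ 2).
    by rewrite mulr_ge0 ?sqr_ge0// invr_ge0 mulr_ge0// ltW.
  by field; rewrite gt_eqF.
apply: (@le_trans _ _ (\int[mu]_y (\sum_(i < d) (C * (dl / 2) * fejer N (tsub x y) +
       C * (2 * dl)^-1 * (fejer N (tsub x y) * tdist1 i x y ^+ 2))))).
  apply: le_Int bound.
    by apply: bmf_norm; apply: bmfM => //; apply: bmfB => //; exact: bmf_cst.
  by apply: bmf_sum => i; apply: bmfD; apply: bmfM => //; exact: bmf_cst.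
rewrite Int_sum; last first.
  by move=> i; apply: bmfD; apply: bmfM => //; exact: bmf_cst.
have e2 i : \int[mu]_y (C * (dl / 2) * fejer N (tsub x y) +
       C * (2 * dl)^-1 * (fejer N (tsub x y) * tdist1 i x y ^+ 2)) =
    C * (dl / 2) + C * (2 * dl)^-1 * (2 / N%:R).
  rewrite IntD; [|by apply: bmfM => //; exact: bmf_cst..].
  by rewrite (IntZ _ _ bF) (IntZ _ _ (b1 i)) Int_fejer// Int_fejer_dist// mulr1.
under eq_bigr do rewrite e2.
rewrite sumr_const card_ord -[_ *+ d]mulr_natr.
have -> : e = D * dl by rewrite /dl mulrC divfK ?gt_eqF.
apply: (@le_trans _ _ (C * dl * d%:R)).
  rewrite ler_wpM2r// -mulrA -mulrDr ler_wpM2l//.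
  apply: (@le_trans _ _ (dl / 2 + (2 * dl)^-1 * dl ^+ 2)).
    by rewrite lerD2l ler_wpM2l// invr_ge0 mulr_ge0// ltW.
  by rewrite le_eqVlt; apply/orP; left; apply/eqP; field; rewrite gt_eqF.
by rewrite mulrAC ler_wpM2r ?(ltW dl0)// /D lerDl.
Qed.

Lemma Int_PL_tsubr G x : PL G -> \int[mu]_y G (tsub x y) = \int[mu]_y G y.
Proof.
move=> hG; apply/eqP; rewrite -subr_eq0 -normr_le0; apply/ler_addgt0Pr => e e0.
rewrite add0r.
have [N [P [hP PG]]] := PL_approx hG (divr_gt0 e0 (ltr0n _ 2)).
have bG := PL_bmf hG; have bP := trig_bmf hP.
have -> : \int[mu]_y G (tsub x y) - \int[mu]_y G y =
   \int[mu]_y (G (tsub x y) - P (tsub x y)) + \int[mu]_y (P y - G y).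
  rewrite !IntB//; try exact: bmf_tsubr.
  by rewrite (Int_trig_tsubr x hP); ring.
rewrite (le_trans (ler_normD _ _))// [X in _ <= X]splitr lerD// Int_norm_le//.
- by apply: bmfB; exact: bmf_tsubr.
- by move=> y; rewrite distrC.
- exact: bmfB.
Qed.

Lemma Int_PL_tsubl G y : PL G -> \int[mu]_x G (tsub x y) = \int[mu]_x G x.
Proof.
move=> hG; apply/eqP; rewrite -subr_eq0 -normr_le0; apply/ler_addgt0Pr => e e0.
rewrite add0r.
have [N [P [hP PG]]] := PL_approx hG (divr_gt0 e0 (ltr0n _ 2)).
have bG := PL_bmf hG; have bP := trig_bmf hP.
have -> : \int[mu]_x G (tsub x y) - \int[mu]_x G x =
   \int[mu]_x (G (tsub x y) - P (tsub x y)) + \int[mu]_x (P x - G x).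
  rewrite !IntB//; try exact: bmf_tsubl.
  by rewrite (Int_trig_tsubl y hP); ring.
rewrite (le_trans (ler_normD _ _))// [X in _ <= X]splitr lerD// Int_norm_le//.
- by apply: bmfB; exact: bmf_tsubl.
- by move=> x; rewrite distrC.
- exact: bmfB.
Qed.

End Fejer.

Lemma continuous_normpow (R : realType) (q : R) : 0 < q ->
  continuous (fun t : R => `|t| `^ q).
Proof.
move=> q0 t; have [->|t0] := eqVneq t 0.
  apply/cvgrPdist_le => e e0; rewrite normr0 powR0 ?gt_eqF//.
  near=> s; rewrite sub0r normrN ger0_norm ?powR_ge0//.
  have -> : e = (e `^ q^-1) `^ q by rewrite -powRrM mulVf ?gt_eqF// powRr1// ltW.
  apply: ge0_ler_powR; rewrite ?nnegrE ?powR_ge0 ?(ltW q0)//.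
  near: s; apply/nbhs_ballP; exists (e `^ q^-1); first by rewrite /= powR_gt0.
  by move=> s; rewrite /ball /= sub0r normrN => /ltW.
have c1 : {for `|t|, continuous (fun s : R => s `^ q)}.
  apply/differentiable_continuous/derivable1_diffP.
  by apply: derivable_powR; rewrite in_itv/= andbT normr_gt0.
exact: (continuous_comp (@norm_continuous _ _ t) c1).
Unshelve. all: by end_near.
Qed.

(** * Bounds in L^q on a probability space *)

Section Lbound.
Context d0 (T : measurableType d0) (R : realType) (P : probability T R).
Implicit Types (f g h : T -> R) (p q c a b M : R).

(** A real upper bound in place of the extended real norm: bounds then combine by ordinary
    arithmetic, and measurability travels with them. *)
Definition Lb p f c :=
  measurable_fun setT f /\ (('N[P]_(p%:E)[EFin \o f]) <= c%:E)%E.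

Lemma Lb_ge0 p f c : Lb p f c -> 0 <= c.
Proof. by move=> [_ h]; rewrite -lee_fin (le_trans _ h)// Lnorm_ge0. Qed.

Lemma Lb_le p f c c' : c <= c' -> Lb p f c -> Lb p f c'.
Proof. by move=> cc' [mf h]; split => //; rewrite (le_trans h)// lee_fin. Qed.

Lemma Lb_intE p f c : 0 < p -> 0 <= c -> measurable_fun setT f ->
  Lb p f c <-> (\int[P]_x (`|f x| `^ p)%:E <= (c `^ p)%:E)%E.
Proof.
move=> p0 c0 mf.
have E : ('N[P]_(p%:E)[EFin \o f] = (\int[P]_x (`|f x| `^ p)%:E) `^ p^-1)%E.
  by rewrite unlock; congr (_ `^ _)%E; apply: eq_integral => x _.
have I0 : (0 <= \int[P]_x (`|f x| `^ p)%:E)%E.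
  by apply: integral_ge0 => x _; rewrite lee_fin powR_ge0.
rewrite /Lb E; case: (integral _ _ _) I0 => [r||] // r0.
  rewrite poweR_EFin !lee_fin; rewrite lee_fin in r0; split => [[_ h]|h].
    have := ge0_ler_powR (ltW p0) (powR_ge0 _ _) c0 h.
    by rewrite -powRrM mulVf ?gt_eqF// powRr1.
  split => //; have := ge0_ler_powR (r := p^-1) _ r0 (powR_ge0 _ _) h.
  by rewrite invr_ge0 (ltW p0) -powRrM mulfV ?gt_eqF// powRr1//; exact.
rewrite poweRyr ?invr_neq0 ?gt_eqF//; split => [[_]|]; by rewrite leye_eq.
Qed.

Lemma Lb_add p f g a b : 1 <= p -> Lb p f a -> Lb p g b ->
  Lb p (fun x => f x + g x) (a + b).
Proof.
move=> p1 [mf fa] [mg gb]; split; first exact: measurable_funD.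
by rewrite EFinD (le_trans (minkowski_EFin P mf mg p1))// leeD.
Qed.

Lemma Lb_dom p f g c : 0 < p -> measurable_fun setT f ->
  {ae P, forall x, `|f x| <= `|g x|} -> Lb p g c -> Lb p f c.
Proof.
move=> p0 mf fg hg; have c0 := Lb_ge0 hg.
have mg := hg.1; have := (Lb_intE p0 c0 mg).1 hg => Hg.
apply/(Lb_intE p0 c0 mf); apply: le_trans Hg.
have mp (k : T -> R) : measurable_fun setT k ->
    measurable_fun setT (fun x => (`|k x| `^ p)%:E).
  move=> mk; apply/measurable_EFinP.
  apply: (measurableT_comp (f := fun t : R => `|t| `^ p)) => //.
  by apply: (measurableT_comp (measurable_powR p)).
apply: ae_ge0_le_integral => //.
- exact: mp.
- exact: mp.
- apply: filterS fg => x fgx _; rewrite lee_fin.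
  by apply: ge0_ler_powR => //; rewrite ?nnegrE ?ltW.
Qed.

Lemma Lb_ae p f g c : 0 < p -> measurable_fun setT f ->
  {ae P, forall x, f x = g x} -> Lb p g c -> Lb p f c.
Proof.
move=> p0 mf fg; apply: Lb_dom => //.
by apply: filterS fg => x ->.
Qed.

Lemma Lb_sup p f c : 0 < p -> measurable_fun setT f ->
  {ae P, forall x, `|f x| <= c} -> 0 <= c -> Lb p f c.
Proof.
move=> p0 mf fc c0; apply: (@Lb_dom _ _ (fun=> c)) => //.
  by apply: filterS fc => x; rewrite (ger0_norm c0).
apply/Lb_intE => //; rewrite integral_cst//= (ger0_norm c0).
have -> : P setT = 1%E by exact: probability_setT.
by rewrite mule1.
Qed.

Lemma Lb_scale p f a c : 0 < p -> Lb p f c -> Lb p (fun x => a * f x) (`|a| * c).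
Proof.
move=> p0 hf; have c0 := Lb_ge0 hf; have mf := hf.1.
have maf : measurable_fun setT (fun x => a * f x) by exact: measurable_funM.
apply/Lb_intE => //; first by rewrite mulr_ge0.
have -> : (\int[P]_x (`|a * f x| `^ p)%:E =
    (`|a| `^ p)%:E * \int[P]_x (`|f x| `^ p)%:E)%E.
  rewrite -ge0_integralZl//.
  - by apply: eq_integral => x _; rewrite normrM powRM// EFinM.
  - apply/measurable_EFinP; apply: (measurableT_comp (measurable_powR p)).
    exact: measurableT_comp.
rewrite powRM// EFinM lee_wpmul2l ?lee_fin ?powR_ge0//.
exact/Lb_intE.
Qed.

Lemma Lb_mul_sup p f g a c : 0 < p -> measurable_fun setT f ->
  (forall x, `|f x| <= a) -> Lb p g c -> Lb p (fun x => f x * g x) (a * c).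
Proof.
move=> p0 mf fa hg; have mg := hg.1.
have [a0|a0] := leP 0 a; last first.
  have [x|e] := pselect (exists x : T, True).
    by case: x => x _; have := le_lt_trans (le_trans (normr_ge0 _) (fa x)) a0; rewrite ltxx.
  have T0 : [set: T] = set0 by apply/seteqP; split => // x _; case: e; exists x.
  have := probability_setT P; rewrite T0 measure0 => /eqP.
  by rewrite eqe eq_sym oner_eq0.
have := Lb_scale a p0 hg; rewrite (ger0_norm a0); apply: Lb_dom => //.
  exact: measurable_funM.
by apply: aeW => x; rewrite !normrM (ger0_norm a0) ler_wpM2r.
Qed.

Lemma Lb_cst0 p c : 0 < p -> 0 <= c -> Lb p (fun=> 0) c.
Proof.
move=> p0 c0; apply: Lb_sup => //; apply: aeW => x; by rewrite normr0.
Qed.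

Lemma Lb_sum p (I : Type) (s : seq I) (F : I -> T -> R) (c : I -> R) : 1 <= p ->
  (forall i, Lb p (F i) (c i)) ->
  Lb p (fun x => \sum_(i <- s) F i x) (\sum_(i <- s) c i).
Proof.
move=> p1 hF; elim: s => [|i s ih].
  under eq_fun do rewrite big_nil; rewrite big_nil; apply: Lb_cst0 => //.
  exact: lt_le_trans p1.
by under eq_fun do rewrite big_cons; rewrite big_cons; exact: Lb_add.
Qed.

Lemma Lb_N p f c : 0 < p -> Lb p f c -> Lb p (fun x => - f x) c.
Proof.
move=> p0 /(Lb_scale (-1) p0); rewrite normrN normr1 mul1r.
by under eq_fun do rewrite mulN1r.
Qed.

Lemma Lb_B p f g a b : 1 <= p -> Lb p f a -> Lb p g b ->
  Lb p (fun x => f x - g x) (a + b).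
Proof. by move=> p1 hf hg; apply: Lb_add => //; apply: Lb_N => //; exact: lt_le_trans p1. Qed.

Lemma Lb_norm p f c : 0 < p -> Lb p f c -> Lb p (fun x => `|f x|) c.
Proof.
move=> p0 hf; have mf := hf.1; apply: Lb_dom hf => //; first exact: measurableT_comp.
by apply: aeW => x; rewrite normr_id.
Qed.

Lemma Lb_Lfun p f c : Lb p f c -> f \in Lfun P p%:E.
Proof.
move=> [mf h]; rewrite inE; apply/andP; split; first by rewrite inE.
by apply/mem_set; rewrite /finite_norm; apply: le_lt_trans h _; rewrite ltry.
Qed.

Lemma Lfun_Lb p f c : f \in Lfun P p%:E ->
  ('N[P]_(p%:E)[EFin \o f] <= c%:E)%E -> Lb p f c.
Proof. by rewrite inE => /andP[]; rewrite inE /= => mf _ h; split. Qed.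

Lemma Lb_integrable_power p f c : 0 < p -> Lb p f c ->
  P.-integrable setT (fun x => (`|f x| `^ p)%:E).
Proof.
move=> p0 hf; have c0 := Lb_ge0 hf; have mf := hf.1.
apply/integrableP; split.
  apply/measurable_EFinP; apply: (measurableT_comp (measurable_powR p)).
  exact: measurableT_comp.
apply: le_lt_trans (ltry (c `^ p)).
under eq_integral do rewrite gee0_abs ?lee_fin ?powR_ge0//.
exact/Lb_intE.
Qed.

Lemma Lb_hoelder p q f g a b : 0 < p -> 0 < q -> p^-1 + q^-1 = 1 ->
  Lb p f a -> Lb q g b -> (\int[P]_x (`|f x * g x|)%:E <= (a * b)%:E)%E.
Proof.
move=> p0 q0 pq hf hg.
have := hoelder P hf.1 hg.1 p0 q0 pq.
rewrite Lnorm1 => h; rewrite EFinM; apply: (le_trans h).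
by apply: lee_pmul; rewrite ?Lnorm_ge0//; [case: hf|case: hg].
Qed.

Lemma Lb_L1 p f c : 1 <= p -> Lb p f c -> (\int[P]_x (`|f x|)%:E <= c%:E)%E.
Proof.
move=> p1 hf; have c0 := Lb_ge0 hf.
have p0 : 0 < p by exact: lt_le_trans p1.
have [p1e|pn1] := eqVneq p 1.
  rewrite p1e in hf; have := (Lb_intE ltr01 c0 hf.1).1 hf; rewrite powRr1//.
  by under eq_integral do rewrite powRr1//.
have p1' : 1 < p by rewrite lt_neqAle eq_sym pn1.
have q0 : 0 < (1 - p^-1)^-1 by rewrite invr_gt0 subr_gt0 invf_lt1.
have := Lb_hoelder p0 q0 _ hf (@Lb_sup _ (fun=> 1) 1 q0 _ _ ler01).
rewrite invrK addrC subrK mulr1 => /(_ erefl) h.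
have {h} := h (measurable_cst _) (aeW _ (fun x => _)).
under eq_integral do rewrite mulr1.
by apply; rewrite normr1.
Qed.

Lemma Lb_integrable p f c : 1 <= p -> Lb p f c -> P.-integrable setT (EFin \o f).
Proof.
move=> p1 hf; apply/integrableP; split; first by apply/measurable_EFinP; case: hf.
by apply: le_lt_trans (ltry c); exact: Lb_L1 p1 hf.
Qed.

(** Cauchy-Schwarz for the powers |f|^(q/2) and |g|^(q/2). The loss of integrability is paid back by
    the Bernstein inequality [blk_half]. *)
Lemma Lb_mul_half q f g a b : 0 < q -> Lb q f a -> Lb q g b ->
  Lb (q / 2) (fun x => f x * g x) (a * b).
Proof.
move=> q0 hf hg; have [a0 b0] := (Lb_ge0 hf, Lb_ge0 hg).
have [mf mg] := (hf.1, hg.1).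
have q20 : 0 < q / 2 by rewrite divr_gt0.
have mfg : measurable_fun setT (fun x => f x * g x) by exact: measurable_funM.
apply/Lb_intE => //; first exact: mulr_ge0.
have hp (k : T -> R) c : 0 <= c -> Lb q k c -> Lb 2 (fun x => `|k x| `^ (q / 2)) (c `^ (q / 2)).
  move=> c0 hk; have mk := hk.1.
  have mk2 : measurable_fun setT (fun x => `|k x| `^ (q / 2)).
    by apply: (measurableT_comp (measurable_powR (q / 2))); exact: measurableT_comp.
  apply/Lb_intE => //; first exact: powR_ge0.
  rewrite -powRrM divfK//.
  under eq_integral do rewrite (ger0_norm (powR_ge0 _ _)) -powRrM divfK//.
  exact/Lb_intE.
have h2 : (2^-1 + 2^-1 = 1 :> R) by rewrite [RHS]splitr div1r.
have := Lb_hoelder (ltr0n _ 2) (ltr0n _ 2) h2 (hp f a a0 hf) (hp g b b0 hg).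
rewrite -powRM//; apply: le_trans; apply: ge0_le_integral => //.
- apply/measurable_EFinP; apply: (measurableT_comp (measurable_powR (q / 2))).
  exact: measurableT_comp.
- apply/measurable_EFinP; apply: measurableT_comp => //; apply: measurable_funM.
    by apply: (measurableT_comp (measurable_powR (q / 2))); exact: measurableT_comp.
  by apply: (measurableT_comp (measurable_powR (q / 2))); exact: measurableT_comp.
- move=> x _; rewrite lee_fin [X in _ <= X]ger0_norm ?mulr_ge0 ?powR_ge0//.
  by rewrite normrM powRM.
Qed.

(** Interpolation between L^(q/2) and L^oo, from |f|^q <= M^(q/2) |f|^(q/2). *)
Lemma Lb_interp q f M c : 0 < q -> measurable_fun setT f -> (forall x, `|f x| <= M) ->
  0 <= M -> Lb (q / 2) f c -> Lb q f (Num.sqrt (M * c)).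
Proof.
move=> q0 mf fM M0 hf; have c0 := Lb_ge0 hf.
have q20 : 0 < q / 2 by rewrite divr_gt0.
apply/(Lb_intE q0 (sqrtr_ge0 _) mf).
have -> : Num.sqrt (M * c) `^ q = M `^ (q / 2) * c `^ (q / 2).
  rewrite -powR12_sqrt ?mulr_ge0// -powRrM [2^-1 * q]mulrC powRM//.
rewrite EFinM.
apply: (@le_trans _ _ ((M `^ (q / 2))%:E * \int[P]_x (`|f x| `^ (q / 2))%:E)%E); last first.
  by rewrite lee_wpmul2l ?lee_fin ?powR_ge0//; exact/Lb_intE.
have mp r : measurable_fun setT (fun x => (`|f x| `^ r)%:E).
  apply/measurable_EFinP; apply: (measurableT_comp (measurable_powR r)).
  exact: measurableT_comp.
rewrite -ge0_integralZl//.
  apply: ge0_le_integral => //.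
    under eq_fun do rewrite -EFinM; apply/measurable_EFinP.
    apply: measurable_funM => //; apply: (measurableT_comp (measurable_powR _)).
    exact: measurableT_comp.
  move=> x _; rewrite -EFinM lee_fin.
  have -> : `|f x| `^ q = `|f x| `^ (q / 2) * `|f x| `^ (q / 2).
    rewrite -powRD; first by rewrite -splitr.
    by rewrite -splitr gt_eqF.
  by rewrite ler_wpM2r ?powR_ge0// ge0_ler_powR ?nnegrE// ltW.
by rewrite lee_fin powR_ge0.
Qed.

Lemma Lb_fatou q (F : nat -> T -> R) f c : 0 < q -> 0 <= c ->
  (forall n, Lb q (F n) c) -> measurable_fun setT f ->
  {ae P, forall x, F n x @[n --> \oo] --> f x} -> Lb q f c.
Proof.
move=> q0 c0 hF mf Ff; apply/Lb_intE => //.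
have mp (k : T -> R) : measurable_fun setT k -> measurable_fun setT (fun x => (`|k x| `^ q)%:E).
  move=> mk; apply/measurable_EFinP; apply: (measurableT_comp (measurable_powR q)).
  exact: measurableT_comp.
have := @fatou _ _ _ P setT measurableT (fun n x => (`|F n x| `^ q)%:E)
  (fun n => mp _ (hF n).1) (fun n x _ => powR_ge0 _ _).
move=> h; apply: (le_trans _ (le_trans h _)).
  rewrite le_eqVlt; apply/orP; left; apply/eqP.
  apply: ae_eq_integral => //; first exact: mp.
    apply: measurableT_comp => //; apply: measurable_fun_limn_esup => n.
    by apply: measurableT_comp => //; exact: mp (hF n).1.
  apply: filterS Ff => x Fx _; apply/esym.
  have cF : (`|F n x| `^ q)%:E @[n --> \oo] --> (`|f x| `^ q)%:E.
    apply: cvg_EFin; first by near=> n.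
    exact: (cvg_comp _ _ Fx (continuous_normpow q0 (x := f x))).
  by have [-> _] := cvg_limn_einf_sup cF.
rewrite limn_einf_lim; apply: lime_le; first exact: is_cvg_einfs.
apply: nearW => n; apply: le_trans ((Lb_intE q0 c0 (hF n).1).1 (hF n)).
apply: ereal_inf_lbound; exists n => //=.
Unshelve. all: by end_near.
Qed.

End Lbound.
Arguments Lb {d0 T R} P p f c.

Section DominatedLb.
Context d0 (T : measurableType d0) (R : realType) (P : probability T R).

Lemma measurable_normpow (q : R) (k : T -> R) : measurable_fun setT k ->
  measurable_fun setT (fun x => (`|k x| `^ q)%:E).
Proof.
move=> mk; apply/measurable_EFinP; apply: (measurableT_comp (measurable_powR q)).
exact: measurableT_comp.
Qed.

Lemma Lb_dct q (h : nat -> T -> R) (H : T -> R) (c : R) : 0 < q ->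
  (forall n, measurable_fun setT (h n)) -> Lb P q H c ->
  (forall n x, `|h n x| <= H x) ->
  {ae P, forall x, h n x @[n --> \oo] --> (0 : R)} ->
  forall e : R, 0 < e -> exists n, Lb P q (h n) e.
Proof.
move=> q0 mh hH hHx h0 e e0.
have ceq : 0 < e `^ q by rewrite powR_gt0.
have := @dominated_convergence _ T R P setT measurableT
  (fun n x => (`|h n x| `^ q)%:E) (cst 0%E) (fun x => (`|H x| `^ q)%:E)
  (fun n => measurable_normpow q (mh n)) (measurable_cst _).
case.
- apply: filterS h0 => x h0x _.
  have := cvg_comp _ _ h0x (continuous_normpow q0 (x := 0)).
  rewrite /= normr0 powR0 ?gt_eqF// => cc.
  apply: cvg_EFin; first by near=> n.
  exact: cc.
- exact: Lb_integrable_power hH.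
- apply: aeW => x n _; rewrite gee0_abs ?lee_fin ?powR_ge0//.
  have Hx0 : 0 <= H x by rewrite (le_trans _ (hHx n x)).
  by rewrite ?lee_fin ge0_ler_powR ?nnegrE ?(ltW q0)// (ger0_norm Hx0).
move=> _ _; rewrite integral0 => cv.
have /fine_cvgP[_ /cvgrPdist_le/(_ _ ceq)] := cv.
move=> [n _ /(_ n (leqnn n))]; rewrite /= sub0r normrN => hn.
exists n; apply/(Lb_intE P q0 (ltW e0) (mh n)).
have fn : (\int[P]_x (`|h n x| `^ q)%:E)%E \is a fin_num.
  rewrite ge0_fin_numE; last by apply: integral_ge0 => x _; rewrite lee_fin powR_ge0.
  have := Lb_integrable_power q0 hH => /integrableP[_]; apply: le_lt_trans.
  apply: ge0_le_integral => //.
  - exact: measurable_normpow.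
  - by apply: measurableT_comp => //; apply: measurable_normpow; case: hH.
  - move=> x _; rewrite gee0_abs ?lee_fin ?powR_ge0//.
    have Hx0 : 0 <= H x by rewrite (le_trans _ (hHx n x)).
    by rewrite ?lee_fin ge0_ler_powR ?nnegrE ?(ltW q0)// (ger0_norm Hx0).
by rewrite -(fineK fn) lee_fin (le_trans (ler_norm _)).
Unshelve. all: by end_near.
Qed.

(** Completeness of L^q in the form used throughout. The L^1 norms are summable, so the sum of the
    |g_i| is finite almost everywhere by monotone convergence, and the series converges absolutely
    there. Fatou's lemma then bounds each tail. *)
Lemma series_Lb q (g : nat -> T -> R) (c : nat -> R) (C : R) : 1 <= q ->
  (forall i, Lb P q (g i) (c i)) -> (forall n, \sum_(i < n) c i <= C) ->
  exists G : T -> R, measurable_fun setT G /\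
    {ae P, forall x, \sum_(i < n) g i x @[n --> \oo] --> G x} /\
    forall n (e : R), 0 <= e -> (forall m, \sum_(n <= i < m) c i <= e) ->
      Lb P q (fun x => G x - \sum_(i < n) g i x) e.
Proof.
move=> q1 hg hC; have q0 : 0 < q by exact: lt_le_trans q1.
have mg i : measurable_fun setT (g i) := (hg i).1.
pose S n x := \sum_(i < n) g i x.
have mS n : measurable_fun setT (S n).
  by apply: measurable_sum => i; exact: mg.
(* The upper limit is measurable on the whole space, also where the series diverges. *)
pose G x := fine (limn_esup (fun n => (S n x)%:E)).
have mG : measurable_fun setT G.
  apply: measurableT_comp => //; apply: measurable_fun_limn_esup => n.
  exact/measurable_EFinP.
have SG : {ae P, forall x, S n x @[n --> \oo] --> G x}.
  pose h n x : \bar R := (`|g n x|)%:E.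
  have mh n : measurable_fun setT (h n).
    by apply/measurable_EFinP; apply: measurableT_comp.
  have h0 n x : setT x -> (0 <= h n x)%E by rewrite lee_fin.
  have Ih : (\int[P]_x (\sum_(n <oo) h n x) <= C%:E)%E.
    rewrite integral_nneseries//; apply: lime_le.
      apply: is_cvg_nneseries => n _ _; apply: integral_ge0 => x _; exact: h0.
    apply: nearW => n; apply: (@le_trans _ _ (\sum_(0 <= i < n) (c i)%:E)%E).
      by apply: lee_sum => i _; exact: Lb_L1 q1 (hg i).
    by rewrite sumEFin lee_fin big_mkord.
  have iH : P.-integrable setT (fun x => (\sum_(n <oo) h n x)%E).
    apply/integrableP; split.
      by apply: ge0_emeasurable_sum => // n x _ _; exact: h0.
    apply: (le_lt_trans _ (ltry C)); apply: le_trans Ih.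
    rewrite le_eqVlt; apply/orP; left; apply/eqP; apply: eq_integral => x _.
    by rewrite gee0_abs//; apply: nneseries_ge0 => n _ _; exact: h0.
  have := integrable_ae measurableT iH.
  apply: filterS => x /(_ I) fx.
  have cvS : cvgn (series (fun i => g i x)).
    apply: normed_cvg.
    apply: nondecreasing_is_cvgn.
      by apply: nondecreasing_series => n _ _; exact: normr_ge0.
    exists (fine (\sum_(n <oo) h n x)%E) => _ [n _ <-].
    rewrite -lee_fin fineK// /series/= -sumEFin.
    exact: (nneseries_lim_ge n (fun i _ _ => h0 i x I)).
  have cS : S n x @[n --> \oo] --> limn (series (fun i => g i x)).
    have -> : (fun n => S n x) = series (fun i => g i x).
      by apply/funext => n; rewrite /series/= big_mkord.
    exact: cvS.
  have cE : (S n x)%:E @[n --> \oo] --> (limn (series (fun i => g i x)))%:E.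
    by apply: cvg_EFin; [near=> n|exact: cS].
  rewrite /G; have [_ ->] := cvg_limn_einf_sup cE.
  exact: cS.
exists G; split => //; split => // n e e0 he.
apply: (@Lb_fatou _ _ _ P q (fun m x => S (n + m)%N x - S n x)) => //.
- move=> m.
  have -> : (fun x => S (n + m)%N x - S n x) = (fun x => \sum_(n <= i < n + m) g i x).
    apply/funext => x; rewrite /S -!(big_mkord xpredT (fun i => g i x)).
    by rewrite (big_cat_nat (n := n))//= ?leq_addr// addrAC subrr add0r.
  by apply: Lb_le (he (n + m)%N) _; exact: Lb_sum.
- exact: (measurable_funB mG (mS n)).
- apply: filterS SG => x cx; apply: cvgB; last exact: cvg_cst.
  have -> : (fun m => S (n + m)%N x) = (fun m => S (m + n)%N x).
    by apply/funext => m; rewrite addnC.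
  by rewrite (cvg_shiftn n (fun m => S m x)).
Unshelve. all: by end_near.
Qed.

End DominatedLb.

(** * Density of trigonometric polynomials and uniqueness of Fourier coefficients *)

Section TorusCell.
Context (R : realType).

Lemma Int_tnth d (i : 'I_d) (phi : R -> R) : bmf (phi : measurableTypeR R -> R) ->
  \int[torus R d]_x phi (tnth x i) = \int[uniform_prob (@ltr01 R)]_t phi t.
Proof.
move=> hphi; elim: d i => [[]//|d ih] i.
have mt (n : nat) (j : 'I_n) : bmf (fun x : n.-tuple R => phi (tnth x j)).
  case: hphi => mp [M Mp]; split; last by exists M.
  by apply: (measurableT_comp mp); exact: measurable_tnth.
rewrite Int_torusS//; have [j ->|->] := unliftP ord0 i.
  under eq_Rintegral do rewrite /cons_pair tnthS -[phi _]mul1r.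
  rewrite (Int_prod (uniform_prob (@ltr01 R)) (torus R d) (g := fun=> 1)
    (h := fun x => phi (tnth x j)) (@bmf_cst _ _ _ _) (mt d j)).
  by rewrite IntC mul1r ih.
transitivity (\int[(uniform_prob (@ltr01 R) \x torus R d)%E]_z (phi z.1 * 1)).
  by apply: eq_Rintegral => z _; rewrite mulr1.
rewrite (Int_prod (uniform_prob (@ltr01 R)) (torus R d) (g := phi) (h := fun=> 1) hphi (@bmf_cst _ _ _ _)).
by rewrite IntC mulr1.
Qed.

(** The measure of a coordinate is Lebesgue measure on [0, 1], and the two end points are null. The
    strict inequalities are what the sine functions in [approx_ray] need. *)
Lemma ae_cell d (i : 'I_d) : {ae torus R d, forall x, 0 < tnth x i < 1}.
Proof.
pose B : set (measurableTypeR R) := ~` `]0%R, 1%R[%classic.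
have mB : measurable B by apply: measurableC; exact: measurable_itv.
have bB : bmf (fun t : measurableTypeR R => \1_B t : R).
  split; first exact: measurable_indic.
  by exists 1 => t; rewrite indicE; case: (_ \in _); rewrite ?normr1 ?normr0.
have I0 : \int[uniform_prob (@ltr01 R)]_t (\1_B t : R) = 0.
  apply: EFin_inj; rewrite Int_uniform//.
  rewrite integral_indic//= setIC.
  have -> : (`[0%R, 1%R] `&` B)%classic = [set 0%R] `|` [set 1%R] :> set R.
    apply/seteqP; split => t /=; rewrite /B /= !in_itv /=.
      move=> [/andP[t0 t1] /negP]; rewrite negb_and -!leNgt => /orP[h|h].
        by left; apply/eqP; rewrite eq_le h t0.
      by right; apply/eqP; rewrite eq_le h t1.
    by case=> -> ; rewrite ?lexx ?ler01 ?ltxx ?andbF; split => //.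
  apply/eqP; rewrite -measure_le0; apply: (le_trans (measureU2 _ _ _)) => //.
  by rewrite -[X in (_ <= X)%E]adde0; apply: leeD; rewrite le_eqVlt; apply/orP; left; apply/eqP; exact: lebesgue_measure_set1.
have mA : measurable (fun x : d.-tuple R => B (tnth x i)).
  have -> : (fun x : d.-tuple R => B (tnth x i)) = setT `&` (@tnth d R)^~ i @^-1` B.
    by rewrite setTI.
  exact: (measurable_tnth i).
exists (fun x : d.-tuple R => B (tnth x i)); split => //.
have := Int_tnth i bB; rewrite I0.
have -> : (fun x : d.-tuple R => \1_B (tnth x i) : R) = \1_(fun x : d.-tuple R => B (tnth x i)).
  by apply/funext => x; rewrite !indicE; congr (_%:R); congr nat_of_bool; apply/idP/idP; rewrite !inE.
rewrite /Rintegral integral_indic// setIT.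
have fm : torus R d (fun x : d.-tuple R => B (tnth x i)) \is a fin_num by apply: fin_num_measure.
by move=> h; rewrite -(fineK fm) h.
Qed.

End TorusCell.

Section Density.
Context (R : realType) (d : nat).
Local Notation mu := (torus R d).
Implicit Types (x y : d.-tuple R) (f g h G w : d.-tuple R -> R).

Section Weighted.
Variable w : d.-tuple R -> R.
Hypothesis w0 : forall x, 0 <= w x.
Hypothesis wi : mu.-integrable setT (EFin \o w).

Local Notation ind A := (\1_A : d.-tuple R -> R).

Lemma bmf_indic (A : set (d.-tuple R)) : measurable A -> bmf (ind A).
Proof.
move=> mA; split; first exact: measurable_indic.
by exists 1 => t; rewrite indicE; case: (_ \in _); rewrite ?normr1 ?normr0.
Qed.

Definition WI h : R := \int[mu]_x (w x * h x).

Lemma WI_le f g : bmf f -> bmf g -> (forall x, f x <= g x) -> WI f <= WI g.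
Proof.
move=> bf bg fg; apply: le_Rintegral => //; try exact: integrable_mulr_bmf.
by move=> x _; rewrite ler_wpM2l.
Qed.

Lemma WI_add f g : bmf f -> bmf g -> WI (fun x => f x + g x) = WI f + WI g.
Proof.
move=> bf bg; rewrite /WI -RintegralD//; try exact: integrable_mulr_bmf.
by apply: eq_Rintegral => x _; rewrite mulrDr.
Qed.

Lemma WI_dct (f : nat -> d.-tuple R -> R) : (forall n, bmf (f n)) ->
  (forall n x, `|f n x| <= 1) ->
  {ae mu, forall x, f n x @[n --> \oo] --> (0 : R)} ->
  forall e : R, 0 < e -> exists n, WI (fun x => `|f n x|) <= e.
Proof.
move=> bf f1 f0 e e0.
have mw : measurable_fun setT w by apply/measurable_EFinP; exact: measurable_int wi.
have := @dominated_convergence _ _ R mu setT measurableT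
  (fun n x => (w x * `|f n x|)%:E) (cst 0%E) (EFin \o w).
case.
- move=> n; apply/measurable_EFinP; apply: measurable_funM => //.
  by apply: measurableT_comp => //; case: (bf n).
- exact: measurable_cst.
- apply: filterS f0 => x fx _; apply: cvg_EFin; first by near=> n.
  rewrite -[X in _ --> X](mulr0 (w x)); apply: cvgM; first exact: cvg_cst.
  by apply/norm_cvg0P; exact: fx.
- exact: wi.
- apply: aeW => x n _; rewrite gee0_abs ?lee_fin ?mulr_ge0//.
  by rewrite -[X in _ <= X]mulr1 ler_wpM2l.
move=> _ _; rewrite integral0 => cv.
have /fine_cvgP[_ /cvgrPdist_le/(_ _ e0)] := cv.
move=> [n _ /(_ n (leqnn n))]; rewrite /= sub0r normrN => hn.
by exists n; exact: le_trans (ler_norm _) hn.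
Unshelve. all: by end_near.
Qed.

(** The weight [w] is kept general for two applications: [|h|] in the uniqueness theorem
    [fourier_eq0], and 1 for density in L^q. *)
Definition approximable (A : set (d.-tuple R)) := measurable A /\
  forall e : R, 0 < e -> exists G, PL G /\ (forall x, 0 <= G x <= 1) /\
    WI (fun x => `|ind A x - G x|) <= e.

Lemma approx_bmf (A : set (d.-tuple R)) G : measurable A -> PL G ->
  bmf (fun x => `|ind A x - G x|).
Proof.
by move=> mA hG; apply: bmf_norm; apply: bmfB; [exact: bmf_indic|exact: PL_bmf].
Qed.

Lemma approxC (A : set (d.-tuple R)) : approximable A -> approximable (~` A).
Proof.
move=> [mA hA]; split; first exact: measurableC.
move=> e e0; have [G [hG [G01 GA]]] := hA e e0.
exists (fun x => 1 + (-1) * G x); split.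
  by apply: PL_D; [exact: PL_cst|apply: PL_M => //; exact: PL_cst].
split; first by move=> x; have := G01 x; lra.
apply: le_trans GA; rewrite le_eqVlt; apply/orP; left; apply/eqP.
apply: eq_Rintegral => x _; congr (_ * _).
rewrite indicC -normrN; congr `|_|.
by rewrite indicE; case: (x \in A); rewrite /=; ring.
Qed.

Lemma approxI (A B : set (d.-tuple R)) : approximable A -> approximable B ->
  approximable (A `&` B).
Proof.
move=> [mA hA] [mB hB]; split; first exact: measurableI.
move=> e e0; have e20 : 0 < e / 2 by rewrite divr_gt0.
have [G [hG [G01 GA]]] := hA _ e20; have [H [hH [H01 HB]]] := hB _ e20.
exists (fun x => G x * H x); split; first exact: PL_M.
split.
  move=> x; have /andP[g0 g1] := G01 x; have /andP[h0 h1] := H01 x.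
  by rewrite mulr_ge0//= -[X in _ <= X]mulr1 ler_pM.
rewrite [X in _ <= X]splitr; apply: le_trans (lerD GA HB).
rewrite -WI_add; [|exact: approx_bmf..].
apply: WI_le.
- by apply: approx_bmf; [exact: measurableI|exact: PL_M].
- by apply: bmfD; exact: approx_bmf.
move=> x; rewrite indicI /=.
have /andP[g0 g1] := G01 x; have /andP[h0 h1] := H01 x.
have -> : ind A x * ind B x - G x * H x =
   (ind A x - G x) * ind B x + G x * (ind B x - H x) by ring.
rewrite (le_trans (ler_normD _ _))// !normrM lerD//.
  rewrite -[X in _ <= X]mulr1 ler_wpM2l// indicE.
  by case: (_ \in _); rewrite ?normr1 ?normr0.
by rewrite (ger0_norm g0) -[X in _ <= X]mul1r ler_wpM2r.
Qed.

Lemma approxU (A B : set (d.-tuple R)) : approximable A -> approximable B ->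
  approximable (A `|` B).
Proof.
move=> hA hB; rewrite -[A `|` B]setCK setCU; apply: approxC.
by apply: approxI; exact: approxC.
Qed.

Lemma approx0 : approximable set0.
Proof.
split; first exact: measurable0.
move=> e e0; exists (fun=> 0); split; first exact: PL_cst.
split; first by move=> x; rewrite lexx ler01.
suff -> : WI (fun x => `|\1_set0 x - 0|) = 0 by exact: ltW.
transitivity (\int[mu]_x (0 : R)); last exact: IntC.
by apply: eq_Rintegral => x _; rewrite indic0 subr0 normr0 mulr0.
Qed.

Lemma approx_lim (A : set (d.-tuple R)) (F : nat -> d.-tuple R -> R) : measurable A ->
  (forall n, PL (F n)) -> (forall n x, 0 <= F n x <= 1) ->
  {ae mu, forall x, F n x @[n --> \oo] --> ind A x} -> approximable A.
Proof.
move=> mA hF F01 FA; split => // e e0.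
have h1 n x : `|ind A x - F n x| <= 1.
  have /andP[f0 f1] := F01 n x; rewrite indicE.
  by case: (x \in A) => /=; rewrite ler_norml; apply/andP; split; lra.
have h2 : {ae mu, forall x, ind A x - F n x @[n --> \oo] --> (0 : R)}.
  apply: filterS FA => x Fx; rewrite -(subrr (ind A x)).
  by apply: cvgB => //; exact: cvg_cst.
have [n hn] := WI_dct (fun n => bmfB (bmf_indic mA) (PL_bmf (hF n))) h1 h2 e0.
by exists (F n).
Qed.

Lemma approx_bigcup (F : nat -> set (d.-tuple R)) :
  (forall n, approximable (F n)) -> approximable (\bigcup_n F n).
Proof.
move=> hF.
pose B n := \big[setU/set0]_(i < n) F i.
have hB n : approximable (B n).
  by apply: big_ind => //; [exact: approx0|move=> ? ?; exact: approxU].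
have mU : measurable (\bigcup_n F n) by apply: bigcupT_measurable => n; case: (hF n).
split=> // e e0; have e20 : 0 < e / 2 by rewrite divr_gt0.
have h1 n x : `|ind (\bigcup_n F n) x - ind (B n) x| <= 1.
  rewrite !indicE.
  by case: (x \in \bigcup_n F n); case: (x \in B n) => /=; rewrite ler_norml; apply/andP; split; lra.
have h2 : {ae mu, forall x, ind (\bigcup_n F n) x - ind (B n) x @[n --> \oo] --> (0 : R)}.
  apply: aeW => x; apply/cvgrPdist_le => eps eps0.
  have [[i _ Fi]|nF] := pselect ((\bigcup_n F n) x).
    exists i.+1 => // n /= ni; rewrite !indicE !mem_set//; first by rewrite subrr subr0 normr0 ltW.
      by rewrite /B -bigcup_mkord; exists i.
    by exists i.
  near=> n; rewrite !indicE !memNset//; first by rewrite subrr subr0 normr0 ltW.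
  by rewrite /B -bigcup_mkord => -[i _ Fi]; apply: nF; exists i.
have [n hn] := WI_dct (fun n => bmfB (bmf_indic mU) (bmf_indic (hB n).1)) h1 h2 e20.
have [G [hG [G01 GB]]] := (hB n).2 _ e20.
exists G; split => //; split => //.
rewrite [X in _ <= X]splitr; apply: le_trans (lerD hn GB).
have bB : bmf (ind (B n)) by apply: bmf_indic; case: (hB n).
have bU : bmf (fun x => `|ind (\bigcup_n F n) x - ind (B n) x|).
  by apply: bmf_norm; apply: bmfB => //; exact: bmf_indic.
have bG : bmf (fun x => `|ind (B n) x - G x|) by apply: approx_bmf => //; case: (hB n).
rewrite -WI_add//; apply: WI_le.
- exact: approx_bmf.
- exact: bmfD.
move=> x; set a := ind _ x; set b := ind _ x.
have -> : a - G x = (a - b) + (b - G x) by ring.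
exact: ler_normD.
Unshelve. all: by end_near.
Qed.

Lemma approx_ray (i : 'I_d) (a : R) : approximable [set x | a < tnth x i].
Proof.
have mS : measurable [set x : d.-tuple R | a < tnth x i].
  have -> : [set x : d.-tuple R | a < tnth x i] = setT `&` (@tnth d R)^~ i @^-1` `]a, +oo[.
    by rewrite setTI; apply/seteqP; split => x /=; rewrite in_itv /= andbT.
  exact: (measurable_tnth i).
have [a1|a1] := leP 1 a.
  apply: (@approx_lim _ (fun _ _ => 0)) => //.
  - by move=> _; exact: PL_cst.
  - by move=> _ x; rewrite lexx ler01.
  - have := ae_cell R i; apply: filterS => x /andP[x0 x1].
    rewrite indicE memNset; first exact: cvg_cst.
    by rewrite /= ltNge => /negP; apply; rewrite (le_trans (ltW x1)).
pose b := Num.max a 0.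
have b0 : 0 <= b by rewrite le_max lexx orbT.
have b1 : b < 1 by rewrite gt_max a1 ltr01.
(* On the open cell [g] is positive exactly for b < t < 1. The single factors are not 1-periodic,
   but by 2 sin A sin B = cos (A - B) - cos (A + B) their product is a trigonometric polynomial of
   degree 1. The functions min (1, n g+) then converge to the indicator of the half-space. *)
pose g x : R := 2 * sin (pi * (tnth x i - b)) * sin (pi * (1 - tnth x i)).
have gE x : g x = cos (pi * (b + 1)) * complex.Re (ek (basis i) x) +
    sin (pi * (b + 1)) * complex.Im (ek (basis i) x) + - cos (pi * (1 - b)).
  rewrite /ek dot_basis /= /g; set t := tnth x i.
  have e1 : 2 * pi * t - pi * (b + 1) = pi * (t - b) - pi * (1 - t) by ring.
  have e2 : pi * (1 - b) = pi * (t - b) + pi * (1 - t) by ring.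
  have -> : cos (pi * (b + 1)) * cos (2 * pi * t) + sin (pi * (b + 1)) * sin (2 * pi * t) =
      cos (2 * pi * t - pi * (b + 1)) by rewrite cosB; ring.
  by rewrite e1 e2 cosB cosD; ring.
have PLg : PL g.
  have -> : g = fun x => cos (pi * (b + 1)) * complex.Re (ek (basis i) x) +
    sin (pi * (b + 1)) * complex.Im (ek (basis i) x) + - cos (pi * (1 - b)).
    by apply/funext.
  have [h1 h2] := PL_ek R (basis i).
  apply: PL_D; last exact: PL_cst.
  by apply: PL_D; apply: PL_M => //; exact: PL_cst.
pose gp x := - Num.min (- g x) 0.
have gpE x : gp x = Num.max (g x) 0 by rewrite /gp oppr_min opprK oppr0.
have PLgp : PL gp.
  have -> : gp = fun x => -1 * Num.min (-1 * g x) 0.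
    by apply/funext => x; rewrite /gp !mulN1r.
  apply: PL_M; first exact: PL_cst.
  apply: PL_bnd; last exact: PL_cst.
  by apply: PL_M => //; exact: PL_cst.
apply: (@approx_lim _ (fun n x => Num.min 1 (n%:R * gp x))) => //.
- by move=> n; apply: PL_bnd; [exact: PL_cst|apply: PL_M => //; exact: PL_cst].
- move=> n x; rewrite le_min ler01 /= mulr_ge0//; first by rewrite ge_min lexx.
  by rewrite gpE le_max lexx orbT.
have := ae_cell R i; apply: filterS => x /andP[x0 x1].
have s1 : 0 < sin (pi * (1 - tnth x i)).
  apply: sin_gt0_pi; rewrite mulr_gt0 ?pi_gt0 ?subr_gt0//=.
  by rewrite -[X in _ < X]mulr1 ltr_pM2l ?pi_gt0// ltrBlDr ltrDl.
rewrite indicE; have [ax|ax] := ltP a (tnth x i).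
  rewrite mem_set//=.
  have bx : b < tnth x i by rewrite gt_max ax x0.
  have gx : 0 < gp x.
    rewrite gpE lt_max mulr_gt0// mulr_gt0//; apply: sin_gt0_pi.
    rewrite mulr_gt0 ?pi_gt0 ?subr_gt0//=.
    rewrite -[X in _ < X]mulr1 ltr_pM2l ?pi_gt0// ltrBlDr (lt_le_trans x1)//.
    by rewrite lerDl.
  apply/cvgrPdist_le => e e0; near=> n.
  rewrite min_l ?subrr ?normr0 ?(ltW e0)//.
  by rewrite -ler_pdivrMr// mul1r; near: n; exact: nbhs_infty_ger.
rewrite memNset/=; last by rewrite ltNge ax.
have -> : gp x = 0.
  rewrite gpE; apply/max_idPr; rewrite /g pmulr_lle0// pmulr_rle0//.
  have bx : tnth x i <= b by rewrite le_max ax.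
  rewrite -oppr_ge0 -sinN -mulrN opprB; apply: sin_ge0_pi.
  rewrite mulr_ge0 ?pi_ge0 ?subr_ge0//= -[X in _ <= X]mulr1 ler_pM2l ?pi_gt0//.
  by rewrite lerBlDr (le_trans (ltW b1))// lerDl ltW.
under eq_fun do rewrite mulr0; rewrite min_r ?ler01//; exact: cvg_cst.
Unshelve. all: by end_near.
Qed.

(** The approximable sets form a sigma-algebra and contain the half-spaces, which generate the
    measurable sets. *)
Lemma approx_sigma (A : set (d.-tuple R)) : measurable A -> approximable A.
Proof.
have sA : sigma_algebra setT approximable.
  split; first exact: approx0.
  - by move=> B hB; rewrite setTD; exact: approxC.
  - exact: approx_bigcup.
have hG (i : 'I_d) (B : set (measurableTypeR R)) : measurable B ->
    approximable ((@tnth d R)^~ i @^-1` B).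
  have -> : measurable = (@RGenOInfty.G R).-sigma.-measurable :> set (set (measurableTypeR R)).
    exact: RGenOInfty.measurableE.
  suff h : (@RGenOInfty.G R).-sigma.-measurable `<=`
     [set B | approximable ((@tnth d R)^~ i @^-1` B)] by move=> /h.
  apply: smallest_sub.
    split.
    - by rewrite /= preimage_set0; exact: approx0.
    - by move=> C /= hC; rewrite setTD preimage_setC; exact: approxC.
    - by move=> F /= hF; rewrite preimage_bigcup; exact: approx_bigcup.
  move=> C [a ->] /=; rewrite (_ : _ @^-1` _ = [set x | a < tnth x i]); first exact: approx_ray.
  by apply/seteqP; split => x /=; rewrite in_itv /= andbT.
suff h : measurable `<=` approximable by move=> /h.
apply: smallest_sub => //.
apply: (big_ind (fun S : set (set (d.-tuple R)) => S `<=` approximable)) => //.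
  by move=> S S' h h' C [/h|/h'].
by move=> i _ C [B mB <-]; rewrite setTI; exact: hG.
Qed.

End Weighted.
End Density.

Lemma mul_div_add1_le (R : realType) (a e : R) : 0 <= a -> 0 < e -> a * (e / (a + 1)) <= e.
Proof.
move=> a0 e0; have a1 : 0 < a + 1 by rewrite ltr_wpDl.
by rewrite mulrA ler_pdivrMr// mulrDr mulr1 mulrC lerDl ltW.
Qed.

Section Uniqueness.
Context (R : realType) (d : nat).
Local Notation mu := (torus R d).
Implicit Types (x y : d.-tuple R) (f g h G w : d.-tuple R -> R).

Lemma Int_mul_trig0 N h P : mu.-integrable setT (EFin \o h) ->
  (forall k, fourier h k = 0) -> trig N P -> \int[mu]_x (h x * P x) = 0.
Proof.
move=> ih h0 hP; suff : (\int[mu]_x (h x * P x))%:C%C = 0 :> R[i] by case.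
rewrite -cint_real.
have -> : (fun x => (h x * P x)%:C%C) = fun x =>
    \sum_(k <- box d N) fourier P k * ((h x)%:C%C * ek (- (- k)) x).
  apply/funext => x; rewrite rmorphM /= (trig_rep hP) mulr_sumr; apply: eq_bigr => k _.
  by rewrite opprK mulrCA.
rewrite cintegrable_sum; last first.
  by move=> k; apply: cintegrableZ; apply: cintegrable_mul => //; exact: cbmf_ek.
rewrite big1// => k _; rewrite cintegrable_intZ -?fourierE// ?h0 ?mulr0//.
by apply: cintegrable_mul => //; exact: cbmf_ek.
Qed.

Lemma Int_mul_PL0 h G : mu.-integrable setT (EFin \o h) ->
  (forall k, fourier h k = 0) -> PL G -> \int[mu]_x (h x * G x) = 0.
Proof.
move=> ih h0 hG; apply/eqP; rewrite -normr_le0; apply/ler_addgt0Pr => e e0.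
rewrite add0r.
pose H := \int[mu]_x `|h x|.
have H0 : 0 <= H by apply: Rintegral_ge0.
have H1 : 0 < H + 1 by rewrite ltr_wpDl.
have [N [P [hP PG]]] := PL_approx hG (divr_gt0 e0 H1).
have [bG bP] := (PL_bmf hG, trig_bmf hP).
have iah : mu.-integrable setT (EFin \o (fun x => `|h x|)).
  exact: (integrable_norm ih).
have -> : \int[mu]_x (h x * G x) = \int[mu]_x (h x * (G x - P x)).
  rewrite -[LHS]subr0 -(Int_mul_trig0 ih h0 hP) -RintegralB//; try exact: integrable_mulr_bmf.
  by apply: eq_Rintegral => x _; rewrite mulrBr.
have iGP : mu.-integrable setT (EFin \o (fun x => h x * (G x - P x))).
  by apply: integrable_mulr_bmf => //; exact: bmfB.
apply: le_trans (le_normr_Rintegral _ iGP) _ => //.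
apply: (@le_trans _ _ (\int[mu]_x (`|h x| * (e / (H + 1))))).
  apply: le_Rintegral => //.
  - exact: (integrable_norm iGP).
  - by apply: integrable_mulr_bmf => //; exact: bmf_cst.
  - by move=> x _; rewrite normrM ler_wpM2l// distrC.
by rewrite RintegralZr// mul_div_add1_le.
Qed.

(** Orthogonality to the characters passes to [PL] functions by uniform approximation, then to
    indicators by approximation with weight |h|. Testing with the sets where h >= 0 and h < 0 gives
    that the integral of |h| vanishes. *)
Lemma fourier_eq0 h : mu.-integrable setT (EFin \o h) ->
  (forall k, fourier h k = 0) -> {ae mu, forall x, h x = 0}.
Proof.
move=> ih h0.
have mh : measurable_fun setT h by apply/measurable_EFinP; exact: measurable_int ih.
have iah : mu.-integrable setT (EFin \o (fun x => `|h x|)) by exact: (integrable_norm ih).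
have hA (A : set (d.-tuple R)) : measurable A -> \int[mu]_x (h x * \1_A x) = 0.
  move=> mA; apply/eqP; rewrite -normr_le0; apply/ler_addgt0Pr => e e0; rewrite add0r.
  have [_ /(_ e e0) [G [hG [_ GA]]]] :=
    approx_sigma (fun x => normr_ge0 (h x)) iah mA.
  have bGA : bmf (fun x => (\1_A : d.-tuple R -> R) x - G x).
    by apply: bmfB; [exact: bmf_indic|exact: PL_bmf].
  have -> : \int[mu]_x (h x * \1_A x) = \int[mu]_x (h x * (\1_A x - G x)).
    rewrite -[LHS]subr0 -(Int_mul_PL0 ih h0 hG) -RintegralB//.
    - by apply: eq_Rintegral => x _; rewrite mulrBr.
    - by apply: integrable_mulr_bmf => //; exact: bmf_indic.
    - by apply: integrable_mulr_bmf => //; exact: PL_bmf.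
  apply: le_trans (le_normr_Rintegral _ _) _ => //; first exact: integrable_mulr_bmf.
  apply: le_trans GA; rewrite le_eqVlt; apply/orP; left; apply/eqP.
  by apply: eq_Rintegral => x _; rewrite normrM.
have mP : measurable [set x | 0 <= h x].
  have -> : [set x | 0 <= h x] = setT `&` h @^-1` `[0, +oo[.
    by rewrite setTI; apply/seteqP; split => x /=; rewrite in_itv /= andbT.
  exact: mh.
have I0 : \int[mu]_x `|h x| = 0.
  have bP := bmf_indic mP.
  have bN := bmf_indic (measurableC mP).
  transitivity (\int[mu]_x (h x * \1_[set x | 0 <= h x] x - h x * \1_(~` [set x | 0 <= h x]) x)).
    apply: eq_Rintegral => x _; rewrite !indicE in_setC.
    have [hx|hx] := leP 0 (h x).
      by rewrite mem_set//= mulr1 mulr0 subr0 ger0_norm.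
    rewrite memNset/=; last by rewrite leNgt hx.
    by rewrite mulr0 mulr1 sub0r ltr0_norm.
  rewrite RintegralB//; try exact: integrable_mulr_bmf.
  by rewrite !hA ?subrr//; exact: measurableC.
have : (\int[mu]_x `|(EFin \o h) x| = 0)%E.
  have fi : (\int[mu]_x (`|h x|)%:E)%E \is a fin_num by exact: integrable_fin_num.
  by rewrite -[LHS](fineK fi); congr EFin.
move/(ae_eq_integral_abs mu measurableT (measurable_int _ ih)).
by apply: filterS => x /(_ I) [].
Qed.

Lemma fourier_inj f g : mu.-integrable setT (EFin \o f) ->
  mu.-integrable setT (EFin \o g) -> fourier f = fourier g ->
  {ae mu, forall x, f x = g x}.
Proof.
move=> fi gi fg.
have : {ae mu, forall x, (f \- g) x = 0}.
  apply: fourier_eq0; first exact: integrableB_real.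
  by move=> k; rewrite fourierB// fg /= subrr.
by apply: filterS => x /eqP; rewrite subr_eq0 => /eqP.
Qed.

End Uniqueness.

Section LqDensity.
Context (R : realType) (d : nat).
Local Notation mu := (torus R d).
Implicit Types (x y : d.-tuple R) (f g h G w : d.-tuple R -> R).
Variable q : R.
Hypothesis q1 : 1 <= q.
Let q0 : 0 < q. Proof. exact: lt_le_trans q1. Qed.

Definition dense f := forall e : R, 0 < e -> exists G, PL G /\ Lb mu q (fun x => f x - G x) e.

(** As |1_A - G| <= 1, its [q]-th power is at most itself, so approximation in L^1 is enough. *)
Lemma dense_indic (A : set (d.-tuple R)) : measurable A -> dense (\1_A : d.-tuple R -> R).
Proof.
move=> mA e e0; have eq0 : 0 < e `^ q by rewrite powR_gt0.
have [_ /(_ _ eq0) [G [hG [G01 GA]]]] :=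
  approx_sigma (w := fun=> 1) (fun=> ler01) (bmf_integrable mu (@bmf_cst _ _ _ _)) mA.
have bG := approx_bmf mA hG.
have mG : measurable_fun setT (fun x => (\1_A : d.-tuple R -> R) x - G x).
  by apply: measurable_funB; [exact: measurable_indic|case: hG].
exists G; split => //; apply/(Lb_intE mu q0 (ltW e0) mG).
apply: (@le_trans _ _ (\int[mu]_x (`|(\1_A : d.-tuple R -> R) x - G x|)%:E)%E).
  apply: ge0_le_integral => //.
  - by apply: measurable_normpow.
  - by apply/measurable_EFinP; apply: measurableT_comp.
  - move=> x _; rewrite lee_fin; set t := `|_|.
    have t0 : 0 <= t by exact: normr_ge0.
    have t1 : t <= 1.
      rewrite /t; have /andP[g0 g1] := G01 x; rewrite indicE.
      by case: (x \in A) => /=; rewrite ler_norml; apply/andP; split; lra.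
    have [->|tn0] := eqVneq t 0; first by rewrite powR0// gt_eqF.
    rewrite -[X in _ <= X](powRr1 t0); apply: ger_powR => //.
    by rewrite lt_neqAle eq_sym tn0 t0 t1.
rewrite -Int_EFin// lee_fin; apply: le_trans GA.
by rewrite le_eqVlt; apply/orP; left; apply/eqP; apply: eq_Rintegral => x _; rewrite mul1r.
Qed.

Lemma dense_add f g : dense f -> dense g -> dense (fun x => f x + g x).
Proof.
move=> hf hg e e0; have e20 : 0 < e / 2 by rewrite divr_gt0.
have [F [hF fF]] := hf _ e20; have [G [hG gG]] := hg _ e20.
exists (fun x => F x + G x); split; first exact: PL_D.
have := Lb_add q1 fF gG; rewrite -splitr.
suff -> : (fun x => f x - F x + (g x - G x)) = (fun x => f x + g x - (F x + G x)) by [].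
by apply/funext => x; ring.
Qed.

Lemma dense_cst0 : dense (fun=> 0).
Proof.
move=> e e0; exists (fun=> 0); split; first exact: PL_cst.
by under eq_fun do rewrite subrr; apply: Lb_cst0 => //; exact: ltW.
Qed.

Lemma dense_scale (a : R) f : dense f -> dense (fun x => a * f x).
Proof.
move=> hf e e0; have a1 : 0 < `|a| + 1 by rewrite ltr_wpDl.
have [F [hF fF]] := hf _ (divr_gt0 e0 a1).
exists (fun x => a * F x); split; first by apply: PL_M => //; exact: PL_cst.
have := Lb_scale a q0 fF.
have -> : (fun x => a * (f x - F x)) = (fun x => a * f x - a * F x).
  by apply/funext => x; ring.
by apply: Lb_le; exact: mul_div_add1_le.
Qed.

Lemma dense_lim f : (forall e : R, 0 < e -> exists h, dense h /\ Lb mu q (fun x => f x - h x) e) ->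
  dense f.
Proof.
move=> hf e e0; have e20 : 0 < e / 2 by rewrite divr_gt0.
have [h [dh fh]] := hf _ e20; have [G [hG hG2]] := dh _ e20.
exists G; split => //; have := Lb_add q1 fh hG2; rewrite -splitr.
suff -> : (fun x => f x - h x + (h x - G x)) = (fun x => f x - G x) by [].
by apply/funext => x; ring.
Qed.

Import HBNNSimple.

Lemma dense_nnsfun (h : {nnsfun (d.-tuple R) >-> R}) : dense (h : d.-tuple R -> R).
Proof.
have -> : (h : d.-tuple R -> R) = fun x =>
    \sum_(y <- finmap.enum_fset (fset_set (range h))) y * (\1_(h @^-1` [set y]) : d.-tuple R -> R) x.
  by apply/funext => x; rewrite fimfunE fsbig_finite//=.
elim: (finmap.enum_fset (fset_set (range h))) => [|y s ih].
  by under eq_fun do rewrite big_nil; exact: dense_cst0.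
under eq_fun do rewrite big_cons; apply: dense_add => //; apply: dense_scale.
by apply: dense_indic; exact: measurable_sfunP.
Qed.

Lemma dense_nonneg f c : (forall x, 0 <= f x) -> Lb mu q f c -> dense f.
Proof.
move=> f0 hf; have mf := hf.1.
have mEf : measurable_fun setT (EFin \o f) by exact/measurable_EFinP.
pose s := nnsfun_approx measurableT mEf.
have f0' x : setT x -> (0 <= (EFin \o f) x)%E by rewrite /= lee_fin.
have sf n x : s n x <= f x.
  by have := le_approx n f0' (I : setT x); rewrite -nnsfun_approxE lee_fin.
have s0 n x : 0 <= s n x by exact: fun_ge0.
apply: dense_lim => e e0.
have h1 n : measurable_fun setT (fun x => f x - s n x) by exact: measurable_funB.
have h2 n x : `|f x - s n x| <= f x.
  by rewrite ger0_norm ?subr_ge0// lerBlDr lerDl.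
have h3 : {ae mu, forall x, f x - s n x @[n --> \oo] --> (0 : R)}.
  apply: aeW => x; rewrite -(subrr (f x)); apply: cvgB; first exact: cvg_cst.
  have := cvg_nnsfun_approx measurableT mEf f0' (I : setT x).
  by move=> /fine_cvgP[_]; exact.
have [n hn] := Lb_dct q0 h1 hf h2 h3 e0.
by exists (s n); split => //; exact: dense_nnsfun.
Qed.

Lemma Lb_dense f c : Lb mu q f c -> dense f.
Proof.
move=> hf; have mf := hf.1.
have hp : dense (fun x => Num.max (f x) 0).
  apply: (@dense_nonneg _ c) => [x|]; first by rewrite le_max lexx orbT.
  apply: Lb_dom hf => //; first exact: measurable_maxr.
  by apply: aeW => x; case: (leP 0 (f x)) => h; rewrite ?normr0 ?max_l ?max_r ?normr0// ltW.
have hn : dense (fun x => Num.max (- f x) 0).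
  apply: (@dense_nonneg _ c) => [x|]; first by rewrite le_max lexx orbT.
  apply: Lb_dom hf => //; first by apply: measurable_maxr => //; exact: measurableT_comp.
  by apply: aeW => x; case: (leP 0 (- f x)) => h; rewrite ?normr0 ?normrN ?max_l ?max_r ?normrN ?normr0// ltW.
have := dense_add hp (dense_scale (-1) hn).
suff -> : (fun x => Num.max (f x) 0 + -1 * Num.max (- f x) 0) = f by [].
apply/funext => x; case: (leP 0 (f x)) => h; case: (leP 0 (- f x)) => h'; lra.
Qed.

Lemma Lb_trig_dense f c (e : R) : Lb mu q f c -> 0 < e ->
  exists N P, trig N P /\ Lb mu q (fun x => f x - P x) e.
Proof.
move=> /Lb_dense hf e0; have e20 : 0 < e / 2 by rewrite divr_gt0.
have [G [hG fG]] := hf _ e20; have [N [P [hP PG]]] := PL_approx hG e20.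
exists N, P; split => //.
have hGP : Lb mu q (fun x => G x - P x) (e / 2).
  apply: Lb_sup => //; last exact: ltW.
    by case: (PL_bmf hG) => mG _; case: (trig_bmf hP) => mP _; exact: measurable_funB.
  by apply: aeW => x; rewrite distrC.
have := Lb_add q1 fG hGP; rewrite -splitr.
suff -> : (fun x => f x - G x + (G x - P x)) = (fun x => f x - P x) by [].
by apply/funext => x; ring.
Qed.

End LqDensity.

(** * Distributions in L^q and coefficientwise limits *)

Section ComplexLimit.
Context (R : realType).

Definition ccvg (u : nat -> R[i]) (l : R[i]) :=
  forall e : R, 0 < e -> exists N, forall n, (N <= n)%N -> cmod (u n - l) <= e.

Lemma ccvg_uniq u l l' : ccvg u l -> ccvg u l' -> l = l'.
Proof.
move=> h h'; apply/eqP; rewrite -subr_eq0; have : cmod (l - l') <= 0.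
  apply/ler_addgt0Pr => e e0; rewrite add0r.
  have e20 : 0 < e / 2 by rewrite divr_gt0.
  have [N hN] := h _ e20; have [N' hN'] := h' _ e20.
  pose n := maxn N N'.
  have -> : l - l' = - (u n - l) + (u n - l') by ring.
  rewrite (le_trans (cmodD _ _))// cmodN [X in _ <= X]splitr lerD//.
    by apply: hN; rewrite leq_maxl.
  by apply: hN'; rewrite leq_maxr.
move=> h0; rewrite -normr_eq0 cmodE.
by have -> : cmod (l - l') = 0 by apply/eqP; rewrite eq_le h0 cmod_ge0.
Qed.

Lemma ccvgD u v l l' : ccvg u l -> ccvg v l' -> ccvg (fun n => u n + v n) (l + l').
Proof.
move=> h h' e e0; have e20 : 0 < e / 2 by rewrite divr_gt0.
have [N hN] := h _ e20; have [N' hN'] := h' _ e20.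
exists (maxn N N') => n; rewrite geq_max => /andP[n1 n2].
have -> : u n + v n - (l + l') = (u n - l) + (v n - l') by ring.
by rewrite (le_trans (cmodD _ _))// [X in _ <= X]splitr lerD// ?hN ?hN'.
Qed.

Lemma ccvgM a u l : ccvg u l -> ccvg (fun n => a * u n) (a * l).
Proof.
move=> h e e0; have a1 : 0 < cmod a + 1 by rewrite ltr_wpDl ?cmod_ge0.
have [N hN] := h _ (divr_gt0 e0 a1); exists N => n /hN hn.
rewrite -mulrBr cmodM; apply: le_trans (mul_div_add1_le (cmod_ge0 a) e0).
by rewrite ler_wpM2l ?cmod_ge0.
Qed.

Lemma ccvg_cst l : ccvg (fun=> l) l.
Proof. by move=> e e0; exists 0%N => n _; rewrite subrr cmod0 ltW. Qed.

Lemma ccvg_sum (I : Type) (s : seq I) (u : I -> nat -> R[i]) (l : I -> R[i]) :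
  (forall i, ccvg (u i) (l i)) ->
  ccvg (fun n => \sum_(i <- s) u i n) (\sum_(i <- s) l i).
Proof.
move=> h; elim: s => [|i s ih].
  by under eq_fun do rewrite big_nil; rewrite big_nil; exact: ccvg_cst.
by under eq_fun do rewrite big_cons; rewrite big_cons; exact: ccvgD.
Qed.

End ComplexLimit.

Section LqDistributions.
Context (R : realType) (d : nat).
Local Notation mu := (torus R d).
Implicit Types (x y : d.-tuple R) (f g h : d.-tuple R -> R) (c : distr R d).
Variable q : R.
Hypothesis q1 : 1 <= q.
Let q0 : 0 < q. Proof. exact: lt_le_trans q1. Qed.

Lemma cmod_ek_le1 k x : cmod (ek k x : R[i]) <= 1.
Proof. by rewrite cmod_ek. Qed.

Lemma normIm_cmod (z : R[i]) : `|complex.Im z| <= cmod z.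
Proof. by rewrite -[X in X <= _]sqrtr_sqr ler_wsqrtr// lerDr sqr_ge0. Qed.

(** The factor 2 comes from estimating the real and the imaginary part separately. *)
Lemma fourier_bound f (A : R) k : Lb mu q f A -> cmod (fourier f k) <= 2 * A.
Proof.
move=> hf; have intf := Lb_integrable q1 hf; have [[m1 _] [m2 _]] := cbmf_ek R k.
have hI (a : d.-tuple R -> R) : bmf a -> (forall x, `|a x| <= 1) -> `|\int[mu]_x (f x * a x)| <= A.
  move=> ba a1; apply: le_trans (le_normr_Rintegral _ _) _ => //; first exact: integrable_mulr_bmf.
  have iaf : mu.-integrable setT (EFin \o (fun x => `|f x|)) by exact: (integrable_norm intf).
  apply: (@le_trans _ _ (\int[mu]_x `|f x|)).
    apply: le_Rintegral => //.
      by apply: (integrable_norm (integrable_mulr_bmf intf ba)).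
    by move=> x _; rewrite normrM -[X in _ <= X]mulr1 ler_wpM2l.
  rewrite -lee_fin /Rintegral fineK; last exact: integrable_fin_num.
  exact: Lb_L1 q1 hf.
have [b1 b2] := cbmf_ek R k.
have A1 := hI _ b1 (fun x => le_trans (normRe_cmod _) (cmod_ek_le1 k x)).
have A2 := hI _ b2 (fun x => le_trans (normIm_cmod _) (cmod_ek_le1 k x)).
have -> : fourier f k = (\int[mu]_x (f x * complex.Re (ek k x)))%:C%C +
    (0 +i* (- \int[mu]_x (f x * complex.Im (ek k x))))%C.
  by apply/eqP; rewrite eq_complex /= addr0 add0r !eqxx.
rewrite (le_trans (cmodD _ _))// [2 * A]mulr_natl mulr2n lerD//.
  by rewrite cmod_real.
by rewrite /cmod /nsq /= expr0n /= add0r sqrrN sqrtr_sqr.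
Qed.

(** [Lq_norm] is an infimum: a strict bound on it yields [LQ] ([norm_LQ]), whereas [LQ] yields a
    non-strict bound ([LQ_norm]). *)
Definition LQ c (A : R) := exists2 g, Lb mu q g A & fourier g = c.

Lemma LQ_ge0 c A : LQ c A -> 0 <= A.
Proof. by move=> [g /Lb_ge0]. Qed.

Lemma LQ_le c A A' : A <= A' -> LQ c A -> LQ c A'.
Proof. by move=> AA' [g hg gc]; exists g => //; exact: Lb_le AA' hg. Qed.

Lemma LQ_add c c' A A' : LQ c A -> LQ c' A' -> LQ (c \+ c') (A + A').
Proof.
move=> [g hg <-] [g' hg' <-]; exists (fun x => g x + g' x); first exact: Lb_add.
apply: fourierD; [exact: Lb_integrable q1 hg|exact: Lb_integrable q1 hg'].
Qed.

Lemma LQ_scale (a : R) c A : LQ c A -> LQ (scaleD a c) (`|a| * A).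
Proof.
move=> [g hg <-]; exists (fun x => a * g x); first exact: Lb_scale.
by rewrite fourierZ//; exact: Lb_integrable q1 hg.
Qed.

Lemma LQ_bound c A k : LQ c A -> cmod (c k) <= 2 * A.
Proof. by move=> [g hg <-]; exact: fourier_bound. Qed.

Lemma LQ_norm c A : LQ c A -> (Lq_norm q c <= A%:E)%E.
Proof.
move=> [g hg gc]; apply: le_trans hg.2; apply: ereal_inf_lbound => /=.
by exists g => //; split => //; exact: Lb_Lfun hg.
Qed.

Lemma norm_LQ c (A : R) : (Lq_norm q c < A%:E)%E -> LQ c A.
Proof.
move=> /ereal_inf_lt[_ [g [gL gc] <-] gA].
by exists g => //; apply: Lfun_Lb gL (ltW gA).
Qed.

Lemma norm_fin_LQ c : (Lq_norm q c < +oo)%E -> exists A, LQ c A.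
Proof.
move=> h; have : (0 <= Lq_norm q c)%E.
  by apply: le_ereal_inf_tmp => _ [g _ <-]; exact: Lnorm_ge0.
move: h; case E : (Lq_norm q c) => [r||] // _ _; exists (r + 1).
by apply: norm_LQ; rewrite E lte_fin ltrDl.
Qed.

Lemma fourier_sum (I : Type) (s : seq I) (F : I -> d.-tuple R -> R) k :
  (forall i, mu.-integrable setT (EFin \o F i)) ->
  mu.-integrable setT (EFin \o (fun x => \sum_(i <- s) F i x)) /\
  fourier (fun x => \sum_(i <- s) F i x) k = \sum_(i <- s) fourier (F i) k.
Proof.
move=> hF; elim: s => [|i s [ih1 ih2]].
  split.
    by under eq_fun do rewrite big_nil; apply: bmf_integrable; exact: bmf_cst.
  have -> : (fun x => \sum_(i <- [::]) F i x) = (fun=> 0) by apply/funext => x; rewrite big_nil.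
  rewrite big_nil /fourier.
  under eq_Rintegral do rewrite mul0r.
  under [X in (_ -i* X)%C]eq_Rintegral do rewrite mul0r.
  by rewrite (IntC mu) oppr0.
have -> : (fun x => \sum_(j <- i :: s) F j x) = F i \+ (fun x => \sum_(j <- s) F j x).
  by apply/funext => x; rewrite big_cons.
split; first exact: (integrableD_real (hF i) ih1).
by rewrite fourierD//= ih2 big_cons.
Qed.

Lemma tail_small (A : nat -> R) (C : R) : (forall i, 0 <= A i) -> (forall n, \sum_(i < n) A i <= C) ->
  forall e : R, 0 < e -> exists N, forall n m, (N <= n)%N -> \sum_(n <= i < m) A i <= e.
Proof.
move=> A0 AC e e0.
pose E := [set \sum_(i < n) A i | n in setT].
have sE : has_sup E.
  by split; [exists (\sum_(i < 0) A i), 0%N|exists C => _ [n _ <-]].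
have [_ [N _ <-] hN] := sup_adherent e0 sE.
exists N => n m Nn; have [nm|mn] := leqP n m; last first.
  by rewrite big_geq ?(ltW e0)// ltnW.
have hm : \sum_(i < m) A i <= sup E by apply: sup_upper_bound => //; exists m.
have hn : \sum_(i < N) A i <= \sum_(i < n) A i.
  rewrite -!(big_mkord xpredT A) [X in _ <= X](big_cat_nat (leq0n N) Nn)//=.
  by rewrite lerDl sumr_ge0.
move: hm; rewrite -(big_mkord xpredT A) (big_cat_nat (leq0n n) nm)//= big_mkord.
by move: hN hn; lra.
Qed.

Lemma Lb_series (g : nat -> d.-tuple R -> R) (A : nat -> R) (C : R) :
  (forall i, Lb mu q (g i) (A i)) -> (forall n, \sum_(i < n) A i <= C) ->
  exists G, [/\ Lb mu q G C, {ae mu, forall x, \sum_(i < n) g i x @[n --> \oo] --> G x} &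
    forall k, ccvg (fun n => \sum_(i < n) fourier (g i) k) (fourier G k)].
Proof.
move=> hgL hC.
have A0 i : 0 <= A i := Lb_ge0 (hgL i).
have C0 : 0 <= C by have := hC 0%N; rewrite big_ord0.
have [G [mG [aG hG]]] := series_Lb q1 hgL hC.
have GL : Lb mu q G C.
  have := hG 0%N C C0; have -> : (fun x => G x - \sum_(i < 0) g i x) = G.
    by apply/funext => x; rewrite big_ord0 subr0.
  by apply => m; rewrite big_mkord.
exists G; split => // k e e0.
have e20 : 0 < e / 2 by rewrite divr_gt0.
have [N hN] := tail_small A0 hC e20.
exists N => n Nn.
have iG := Lb_integrable q1 GL.
have ig i := Lb_integrable q1 (hgL i).
have [isum es] := fourier_sum (index_enum 'I_n) k (fun i : 'I_n => ig i).
rewrite -es -cmodN opprB.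
have := fourierB iG isum => /(congr1 (fun F => F k)) /= <-.
have -> : e = 2 * (e / 2) by field.
by apply: fourier_bound; apply: hG; [exact: ltW|move=> m; exact: hN].
Qed.

Lemma LQ_series_ex (c : nat -> distr R d) (A : nat -> R) (C : R) :
  (forall i, LQ (c i) (A i)) -> (forall n, \sum_(i < n) A i <= C) ->
  exists2 l, LQ l C & forall k, ccvg (fun n => \sum_(i < n) c i k) (l k).
Proof.
move=> hc hC.
have hc' i : exists g, Lb mu q g (A i) /\ fourier g = c i.
  by have [g h1 h2] := hc i; exists g.
have [g hg] := choice hc'.
have [G [GL _ hG]] := Lb_series (fun i => (hg i).1) hC.
exists (fourier G); first by exists G.
move=> k; have := hG k; congr (ccvg _ _); apply/funext => n.
by apply: eq_bigr => i _; rewrite (hg i).2.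
Qed.

Lemma LQ_series (c : nat -> distr R d) (A : nat -> R) (C : R) (l : distr R d) :
  (forall i, LQ (c i) (A i)) -> (forall n, \sum_(i < n) A i <= C) ->
  (forall k, ccvg (fun n => \sum_(i < n) c i k) (l k)) -> LQ l C.
Proof.
move=> hc hC hl; have [l' hl' cl'] := LQ_series_ex hc hC.
suff -> : l = l' by [].
by apply/funext => k; apply: ccvg_uniq (hl k) (cl' k).
Qed.

Lemma LQ_trig_series c (A e : R) : LQ c A -> 0 < e ->
  exists (P : nat -> d.-tuple R -> R) (N : nat -> nat) (B : nat -> R),
    [/\ forall i, trig (N i) (P i), forall i, Lb mu q (P i) (B i),
        forall n, \sum_(i < n) B i <= A + e &
        forall k, ccvg (fun n => \sum_(i < n) fourier (P i) k) (c k)].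
Proof.
move=> [g hg gc] e0.
(* Successive approximations differ by at most [ep n + ep n.+1]. Starting from e / 8, these errors
   sum to less than [e]; the induction carries the reserve [3 * ep n]. *)
pose ep n := e / 2 ^+ n.+3.
have ep0 n : 0 < ep n by rewrite divr_gt0 ?exprn_gt0.
have hQ n : exists z : nat * (d.-tuple R -> R),
    trig z.1 z.2 /\ Lb mu q (fun x => g x - z.2 x) (ep n).
  by have [N [P [h1 h2]]] := Lb_trig_dense q1 hg (ep0 n); exists (N, P).
have [QN hQN] := choice hQ.
pose Q n := (QN n).2; pose M n := (QN n).1.
have tQ n : trig (M n) (Q n) := (hQN n).1.
have gQ n : Lb mu q (fun x => g x - Q n x) (ep n) := (hQN n).2.
pose P n := if n is n'.+1 then (fun x => Q n'.+1 x - Q n' x) else Q 0%N.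
pose B n := if n is n'.+1 then ep n'.+1 + ep n' else A + ep 0%N.
exists P, (fun n => maxn (M n) (M n.-1)), B; split.
- case=> [|n] /=; first by apply: trig_mono (tQ 0%N); exact: leq_maxl.
  apply: trigB; first by apply: trig_mono (tQ n.+1); exact: leq_maxl.
  by apply: trig_mono (tQ n); exact: leq_maxr.
- case=> [|n] /=.
    have := Lb_B q1 hg (gQ 0%N).
    suff -> : (fun x => g x - (g x - Q 0%N x)) = Q 0%N by [].
    by apply/funext => x; ring.
  have := Lb_B q1 (gQ n) (gQ n.+1); rewrite addrC.
  suff -> : (fun x => g x - Q n x - (g x - Q n.+1 x)) = (fun x => Q n.+1 x - Q n x) by [].
  by apply/funext => x; ring.
- have hB n : \sum_(i < n.+1) B i + 3 * ep n <= A + e.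
    elim: n => [|n ih].
      have e8 : e = 8 * ep 0%N by rewrite /ep; field.
      by rewrite big_ord1 /= [X in _ <= _ + X]e8; move: (ep0 0%N); lra.
    rewrite big_ord_recr /=; apply: le_trans ih; rewrite -addrA lerD2l.
    have -> : ep n = 2 * ep n.+1 by rewrite /ep !exprS; field; rewrite expf_neq0.
    by have := ep0 n.+1; lra.
  case=> [|n]; first by rewrite big_ord0 addr_ge0 ?(ltW e0)// (Lb_ge0 hg).
  by apply: le_trans (hB n); rewrite lerDl mulr_ge0// ltW.
- move=> k; have -> : (fun n => \sum_(i < n) fourier (P i) k) =
     (fun n => if n is n'.+1 then fourier (Q n') k else 0).
    apply/funext; elim=> [|n ih]; first by rewrite big_ord0.
    rewrite big_ord_recr /= ih; case: n {ih} => [|n]; first by rewrite add0r.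
    rewrite /P /= -[X in X + _ = _]/(fourier (Q n) k).
    have -> : (fun x => Q n.+1 x - Q n x) = Q n.+1 \- Q n by [].
    rewrite fourierB; [by rewrite /= addrC subrK|exact: trig_integrable (tQ _)..].
  move=> eps eps0.
  have [N hN] : exists N, 2 * ep N <= eps.
    pose N := (Num.truncn (e / eps)).+1; exists N.
    rewrite /ep mulrA ler_pdivrMr ?exprn_gt0//.
    have h1 : e <= eps * N%:R.
      by rewrite mulrC -ler_pdivrMr// ltW// truncnS_gt.
    have h2 : N%:R <= 2 ^+ N :> R by rewrite -natrX ler_nat ltnW// ltn_expl.
    have h3 : 2 ^+ N.+3 = 8 * 2 ^+ N :> R by rewrite !exprS; ring.
    rewrite h3; apply: (@le_trans _ _ (2 * (eps * 2 ^+ N))).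
      by rewrite ler_wpM2l// (le_trans h1)// ler_wpM2l// ltW.
    rewrite mulrCA ler_wpM2l ?(ltW eps0)// ler_wpM2r ?exprn_ge0// ler_nat//.
  exists N.+1 => -[//|n]; rewrite ltnS => Nn.
  rewrite -cmodN opprB -gc.
  have /= <- := congr1 (fun F => F k) (fourierB (Lb_integrable q1 hg) (trig_integrable (tQ n))).
  apply: le_trans (fourier_bound k (gQ n)) _; apply: le_trans hN.
  rewrite ler_wpM2l// /ep ler_wpM2l ?(ltW e0)// lef_pV2 ?posrE ?exprn_gt0//.
  by rewrite ler_weXn2l// ?ler1n// !ltnS.
Qed.

(** Refers to each single coefficient of [T c]. Such maps commute with coefficientwise limits of
    series, so they can be extended from polynomials before any continuity is known. *)
Definition finite_rank (T : distr R d -> distr R d) := forall k,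
  exists (s : seq (freq d)) (w : freq d -> R[i]), forall c, T c k = \sum_(l <- s) w l * c l.

(** Expand [c] in a series of polynomials whose norms add up to at most A + e, and apply [T] term by
    term. The excess [e] cannot be removed here; in the applications it is taken equal to [A]. *)
Lemma LQ_ext (T : distr R d -> distr R d) (C : R) : finite_rank T -> 0 <= C ->
  (forall N P A, trig N P -> Lb mu q P A -> LQ (T (fourier P)) (C * A)) ->
  forall c A e, LQ c A -> 0 < e -> LQ (T c) (C * (A + e)).
Proof.
move=> hT C0 hP c A e hc e0.
have [P [N [B [h1 h2 h3 h4]]]] := LQ_trig_series hc e0.
apply: (@LQ_series (fun i => T (fourier (P i))) (fun i => C * B i)).
- by move=> i; exact: hP (h1 i) (h2 i).
- by move=> n; rewrite -mulr_sumr ler_wpM2l.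
- move=> k; have [s [w hw]] := hT k.
  have -> : (fun n => \sum_(i < n) T (fourier (P i)) k) =
    (fun n => \sum_(l <- s) w l * \sum_(i < n) fourier (P i) l).
    apply/funext => n; under eq_bigr do rewrite hw.
    by rewrite exchange_big /=; apply: eq_bigr => l _; rewrite mulr_sumr.
  by rewrite hw; apply: ccvg_sum => l; exact: ccvgM.
Qed.

End LqDistributions.

(** * Convolution kernels *)

Section Young.
Context (R : realType) (d : nat).
Local Notation mu := (torus R d).
Implicit Types (x y : d.-tuple R) (f g h H G : d.-tuple R -> R).

Lemma bmf_pow f (q : R) : 0 < q -> bmf f -> bmf (fun x => `|f x| `^ q).
Proof.
move=> q0 [mf [M Mf]]; split.
  by apply: (measurableT_comp (measurable_powR q)); exact: measurableT_comp.
exists (M `^ q) => x; rewrite ger0_norm ?powR_ge0//.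
have M0 : 0 <= M := le_trans (normr_ge0 _) (Mf x).
by apply: ge0_ler_powR => //; rewrite ?nnegrE ?(ltW q0).
Qed.

Lemma Lb_bmfE (q : R) f c : 0 < q -> 0 <= c -> bmf f ->
  Lb mu q f c <-> \int[mu]_x `|f x| `^ q <= c `^ q.
Proof.
move=> q0 c0 bf; have mf := bf.1.
rewrite -lee_fin Int_EFin; last exact: bmf_pow.
exact: Lb_intE.
Qed.

Lemma young_powR (q t a : R) : 1 <= q -> 0 <= t -> 0 <= a ->
  t * a `^ (q - 1) <= t `^ q / q + (1 - q^-1) * a `^ q.
Proof.
move=> q1 t0 a0; have q0 : 0 < q by exact: lt_le_trans q1.
have [->|qn1] := eqVneq q 1.
  by rewrite subrr powRr0 mulr1 powRr1// invr1 mulr1 subrr mul0r addr0.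
have q1' : 1 < q by rewrite lt_neqAle eq_sym qn1.
have qm0 : 0 < q - 1 by rewrite subr_gt0.
have p0 : 0 < q / (q - 1) by rewrite divr_gt0.
have := conjugate_powR t0 (powR_ge0 a (q - 1)) q0 p0.
rewrite -powRrM mulrCA mulfV ?gt_eqF// mulr1 invf_div => h.
have e : (q - 1) / q = 1 - q^-1 by rewrite mulrBl mulfV ?gt_eqF// mul1r.
have := h; rewrite e addrC subrK => /(_ erefl) /le_trans; apply.
by rewrite lerD2l mulrC.
Qed.

(** Jensen's inequality for the measure [w]: Young's inequality [young_powR] is integrated against
    [w] with [a] equal to the [w]-mean of |g|. The cases of vanishing mass or mean are set apart
    because [a] is a positive quotient. *)
Lemma kernel_jensen (q : R) (w g : d.-tuple R -> R) (kap : R) : 1 <= q -> bmf w -> bmf g ->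
  (forall y, 0 <= w y) -> \int[mu]_y w y = kap ->
  (\int[mu]_y (w y * `|g y|)) `^ q <= kap `^ (q - 1) * \int[mu]_y (w y * `|g y| `^ q).
Proof.
move=> q1 bw bg w0 wk; have q0 : 0 < q by exact: lt_le_trans q1.
set S := \int[mu]_y (w y * `|g y|); set I := \int[mu]_y (w y * `|g y| `^ q).
have k0 : 0 <= kap by rewrite -wk; apply: Rintegral_ge0.
have S0 : 0 <= S by apply: Rintegral_ge0 => y _; rewrite mulr_ge0.
have I0 : 0 <= I by apply: Rintegral_ge0 => y _; rewrite mulr_ge0 ?powR_ge0.
have bwg : bmf (fun y => w y * `|g y|) by apply: bmfM => //; exact: bmf_norm.
have bwp : bmf (fun y => w y * `|g y| `^ q) by apply: bmfM => //; exact: bmf_pow.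
have [kz|kn0] := eqVneq kap 0.
  suff -> : S = 0 by rewrite powR0 ?gt_eqF// mulr_ge0 ?powR_ge0.
  case: (bg) => _ [M Mg]; apply/eqP; rewrite eq_le S0 andbT.
  rewrite -[0](mul0r M) -kz -wk -RintegralZr//; last exact: bmf_integrable.
  apply: le_Int.
  - by apply: bmfM => //; exact: bmf_norm.
  - by apply: bmfM => //; exact: bmf_cst.
  - by move=> y; rewrite ler_wpM2l.
have kp : 0 < kap by rewrite lt_neqAle eq_sym kn0.
have [Sz|Sn0] := eqVneq S 0.
  by rewrite Sz powR0 ?gt_eqF// mulr_ge0 ?powR_ge0.
have Sp : 0 < S by rewrite lt_neqAle eq_sym Sn0.
pose a := S / kap; have a0 : 0 < a by rewrite divr_gt0.
have h : S * a `^ (q - 1) <= I / q + (1 - q^-1) * a `^ q * kap.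
  have -> : S * a `^ (q - 1) = \int[mu]_y (w y * `|g y| * a `^ (q - 1)).
    by rewrite RintegralZr//; apply: bmf_integrable; apply: bmfM => //; exact: bmf_norm.
  have -> : I / q + (1 - q^-1) * a `^ q * kap =
      \int[mu]_y (w y * `|g y| `^ q * q^-1 + (1 - q^-1) * a `^ q * w y).
    rewrite IntD.
    - rewrite RintegralZr//; last first.
        by apply: bmf_integrable; apply: bmfM => //; exact: bmf_pow.
      by rewrite IntZ// wk.
    - by apply: bmfM => //; exact: bmf_cst.
    - by apply: bmfM => //; exact: bmf_cst.
  apply: le_Int.
  - by apply: bmfM => //; exact: bmf_cst.
  - apply: bmfD; last by apply: bmfM => //; exact: bmf_cst.
    by apply: bmfM => //; exact: bmf_cst.
  - move=> y; rewrite -!mulrA [X in _ <= _ + X]mulrA [X in _ <= _ + X]mulrC -mulrDr.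
    by rewrite ler_wpM2l// young_powR// ltW.
have aE : a * a `^ (q - 1) = a `^ q.
  by rewrite -{1}(powRr1 (ltW a0)) -powRD ?(gt_eqF a0) ?implybT// addrC subrK.
have SE : S = a * kap by rewrite /a divfK.
have h2 : a `^ q * kap <= I.
  move: h; rewrite {1}SE mulrAC aE => h.
  have : a `^ q * kap * q^-1 <= I * q^-1 by move: h; rewrite -mulrA; set z := _ * kap; set w' := q^-1; lra.
  by rewrite ler_pM2r ?invr_gt0.
rewrite SE powRM ?(ltW a0) ?(ltW kp)//.
have -> : kap `^ q = kap `^ (q - 1) * kap.
  by rewrite -{3}(powRr1 k0) -powRD ?kn0 ?implybT// subrK.
by rewrite mulrCA ler_wpM2l ?powR_ge0.
Qed.

Lemma bmf_kernel H g : bmf H -> bmf g ->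
  bmf (fun z : d.-tuple R * d.-tuple R => H (tsub z.1 z.2) * g z.2).
Proof.
move=> [mH [M MH]] [mg [M' Mg]]; split.
  apply: measurable_funM; last exact: measurableT_comp.
  by apply: (measurableT_comp mH); exact: measurable_tsub.
by exists (M * M') => z; rewrite normrM ler_pM.
Qed.

(** Formulated for functions dominated by a convolution, since the commutator in [core_high] is not
    a convolution operator itself but has a kernel that a convolution kernel dominates. *)
Lemma young_general (q : R) H g f (c : R) : 1 <= q -> PL H -> (forall x, 0 <= H x) ->
  bmf g -> bmf f -> (forall x, `|f x| <= \int[mu]_y (H (tsub x y) * `|g y|)) ->
  Lb mu q g c -> Lb mu q f ((\int[mu]_x H x) * c).
Proof.
move=> q1 hH H0 bg bf fH hg; have q0 : 0 < q by exact: lt_le_trans q1.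
have bH := PL_bmf hH.
set kap := \int[mu]_x H x.
have k0 : 0 <= kap by apply: Rintegral_ge0.
have c0 := Lb_ge0 hg.
apply/Lb_bmfE => //; first exact: mulr_ge0.
have bS : bmf (fun x => \int[mu]_y (H (tsub x y) * `|g y| `^ q)).
  by apply: (bmf_Int1 mu mu (f := fun z => H (tsub z.1 z.2) * `|g z.2| `^ q)); apply: bmf_kernel (bmf_pow q0 bg).
apply: (@le_trans _ _ (\int[mu]_x (kap `^ (q - 1) * \int[mu]_y (H (tsub x y) * `|g y| `^ q)))).
  apply: le_Int.
  - exact: bmf_pow.
  - by apply: bmfM => //; exact: bmf_cst.
  move=> x; apply: (@le_trans _ _ ((\int[mu]_y (H (tsub x y) * `|g y|)) `^ q)).
    apply: ge0_ler_powR => //; rewrite ?nnegrE ?(ltW q0)//.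
    by apply: le_trans (fH x).
  apply: kernel_jensen => //; first exact: bmf_tsubr.
  exact: Int_PL_tsubr.
rewrite IntZ//.
rewrite (Int_swap mu mu (f := fun x y => H (tsub x y) * `|g y| `^ q)); last first.
  exact: bmf_kernel (bmf_pow q0 bg).
have e y : \int[mu]_x (H (tsub x y) * `|g y| `^ q) = kap * `|g y| `^ q.
  rewrite RintegralZr//; first by rewrite Int_PL_tsubl.
  by apply: bmf_integrable; exact: bmf_tsubl.
under eq_Rintegral do rewrite e.
rewrite IntZ; last exact: bmf_pow.
rewrite mulrA.
have -> : kap `^ (q - 1) * kap = kap `^ q.
  have [->|kn] := eqVneq kap 0; first by rewrite mulr0 powR0// gt_eqF.
  by rewrite -{2}(powRr1 k0) -powRD ?kn ?implybT// subrK.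
rewrite powRM// ler_wpM2l ?powR_ge0//.
exact/Lb_bmfE.
Qed.

Lemma conv_bmf K g : bmf K -> bmf g -> bmf (conv K g).
Proof.
move=> bK bg.
exact: (bmf_Int1 mu mu (f := fun z => K (tsub z.1 z.2) * g z.2)) (bmf_kernel bK bg).
Qed.

Lemma conv_abs K g x : bmf K -> bmf g ->
  `|conv K g x| <= \int[mu]_y (`|K (tsub x y)| * `|g y|).
Proof.
move=> bK bg; have bKg : bmf (fun y => K (tsub x y) * g y).
  by apply: bmfM => //; exact: bmf_tsubr.
apply: le_trans (le_normr_Rintegral _ _) _ => //; first exact: bmf_integrable.
rewrite le_eqVlt; apply/orP; left; apply/eqP.
by apply: eq_Rintegral => y _; rewrite normrM.
Qed.

Lemma young (q : R) K g (c kap : R) : 1 <= q -> PL K -> bmf g ->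
  \int[mu]_x `|K x| <= kap -> Lb mu q g c -> Lb mu q (conv K g) (kap * c).
Proof.
move=> q1 hK bg Kk hg; have bK := PL_bmf hK.
have := young_general (H := fun x => `|K x|) q1 (PL_norm hK) (fun x => normr_ge0 _) bg
  (conv_bmf bK bg) (fun x => conv_abs x bK bg) hg.
by apply: Lb_le; rewrite ler_wpM2r// (Lb_ge0 hg).
Qed.

(** The constant equals kap^(1 - 1/q) M^(1/q), the bound for [K] in the conjugate exponent that
    results from interpolating between L^1 and L^oo. *)
Lemma young_sup (q : R) K g (c kap M : R) : 1 <= q -> PL K -> bmf g ->
  \int[mu]_x `|K x| <= kap -> (forall x, `|K x| <= M) -> Lb mu q g c ->
  forall x, `|conv K g x| <= (kap `^ (q - 1) * M) `^ q^-1 * c.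
Proof.
move=> q1 hK bg Kk KM hg x; have q0 : 0 < q by exact: lt_le_trans q1.
have bK := PL_bmf hK; have c0 := Lb_ge0 hg.
have M0 : 0 <= M := le_trans (normr_ge0 _) (KM x).
have k0 : 0 <= \int[mu]_x `|K x| by apply: Rintegral_ge0.
have bKx : bmf (fun y => `|K (tsub x y)|) by apply: bmf_norm; exact: bmf_tsubr.
have := kernel_jensen q1 bKx bg (fun y => normr_ge0 _) (Int_PL_tsubr x (PL_norm hK)).
set S := \int[mu]_y _; set I := \int[mu]_y (_ * _ `^ q) => h.
have hI : I <= M * c `^ q.
  apply: (@le_trans _ _ (\int[mu]_y (M * `|g y| `^ q))).
    apply: le_Int.
    - by apply: bmfM => //; exact: bmf_pow.
    - by apply: bmfM; [exact: bmf_cst|exact: bmf_pow].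
    - by move=> y; rewrite ler_wpM2r// powR_ge0.
  rewrite IntZ; last exact: bmf_pow.
  by rewrite ler_wpM2l//; exact/Lb_bmfE.
apply: le_trans (conv_abs x bK bg) _; rewrite -/S.
have S0 : 0 <= S by apply: Rintegral_ge0 => y _; rewrite mulr_ge0.
have hS : S `^ q <= kap `^ (q - 1) * M * c `^ q.
  apply: le_trans h _; rewrite -mulrA; apply: ler_pM => //; rewrite ?powR_ge0//.
    by apply: Rintegral_ge0 => y _; rewrite mulr_ge0 ?powR_ge0.
  by apply: ge0_ler_powR; rewrite ?nnegrE ?subr_ge0// (le_trans k0).
have kp0 : 0 <= kap by exact: le_trans k0 Kk.
have -> : S = (S `^ q) `^ q^-1 by rewrite -powRrM mulfV ?gt_eqF// powRr1.
have -> : c = (c `^ q) `^ q^-1 by rewrite -powRrM mulfV ?gt_eqF// powRr1.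
rewrite -powRM ?mulr_ge0 ?powR_ge0//.
apply: ge0_ler_powR; rewrite ?nnegrE ?mulr_ge0 ?powR_ge0 ?invr_ge0 ?(ltW q0)//.
Qed.

End Young.

(** * L^1 bounds for kernels through differences of their symbols *)

Section OneDimIntegral.
Context (R : realType).
Local Notation U := (uniform_prob (@ltr01 R)).

Definition tor1 (t : R) : R := cmod (cis (2 * pi * t) - 1).

Lemma tor1E t : tor1 t = 2 * `|sin (pi * t)|.
Proof.
have e2 : 2 * pi * t = pi * t + pi * t by ring.
have -> : tor1 t = Num.sqrt ((2 * sin (pi * t)) ^+ 2).
  rewrite /tor1 /cmod /nsq /= subr0; congr Num.sqrt.
  have := cos2Dsin2 (pi * t); rewrite e2 cosD sinD.
  set s := sin _; set c := cos _ => h.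
  have -> : (c * c - s * s - 1) ^+ 2 + (s * c + c * s) ^+ 2 = (c ^+ 2 + s ^+ 2) ^+ 2 - 2 * (c ^+ 2 - s ^+ 2) + 1 by ring.
  rewrite h (_ : c ^+ 2 = 1 - s ^+ 2); last by rewrite -h; ring.
  by ring.
by rewrite sqrtr_sqr normrM ger0_norm.
Qed.

(** By sin t = 2 sin (t/2) cos (t/2): on [0, pi/4] the cosine is at least 2^(-1/2), and the mean
    value theorem transfers this to a lower bound for the sine. *)
Lemma sin_ge_half (t : R) : 0 <= t -> t <= pi / 2 -> t / 2 <= sin t.
Proof.
move=> t0 tp.
have pi4 : pi / 4 = pi / 2 / 2 :> R by field.
have c4 (s : R) : 0 <= s -> s <= pi / 4 -> Num.sqrt 2^-1 <= cos s.
  move=> s0 sp.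
  have cs0 : 0 <= cos s.
    by apply: cos_ge0_pihalf; rewrite (le_trans _ s0) ?oppr_le0 ?divr_ge0 ?pi_ge0//= (le_trans sp)// pi4 ler_pdivrMr// ler_peMr ?divr_ge0 ?pi_ge0// ler1n.
  rewrite -(ger0_norm cs0) -sqrtr_sqr ler_wsqrtr//.
  have : 0 <= cos (s + s).
    apply: cos_ge0_pihalf; apply/andP; split.
      by rewrite (le_trans _ (addr_ge0 s0 s0))// oppr_le0 divr_ge0 ?pi_ge0.
    by rewrite [X in _ <= X]splitr -pi4 lerD.
  rewrite cosD => h; have := cos2Dsin2 s; rewrite !expr2 => h2.
  move: h h2; set c := cos s; set z := sin s => h h2; lra.
pose s := t / 2.
have s0 : 0 <= s by rewrite divr_ge0.
have sp : s <= pi / 4 by rewrite pi4 ler_pM2r.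
have ss : s / Num.sqrt 2 <= sin s.
  have [->|sn0] := eqVneq s 0; first by rewrite mul0r sin0.
  have sgt : 0 < s by rewrite lt_neqAle eq_sym sn0.
  have [c /andP[]] := @MVT R (@sin R) (@cos R) 0 s sgt (fun x _ => is_derive_sin x)
     (continuous_subspaceT (@continuous_sin R)).
  rewrite !bnd_simp => c0 cs; rewrite sin0 !subr0 => ->.
  rewrite mulrC ler_wpM2r// -sqrtrV//; apply: c4; first exact: ltW.
  exact: le_trans (ltW cs) sp.
have -> : sin t = 2 * sin s * cos s.
  by rewrite [in LHS](_ : t = s + s) ?sinD; [ring|rewrite /s -splitr].
have h2 : 0 < Num.sqrt 2 :> R by rewrite sqrtr_gt0.
apply: (@le_trans _ _ (2 * (s / Num.sqrt 2) * Num.sqrt 2^-1)).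
  have -> : 2 * (s / Num.sqrt 2) * Num.sqrt 2^-1 = s * (2 * (Num.sqrt 2 ^+ 2)^-1).
    by rewrite sqrtrV// expr2; field; rewrite gt_eqF.
  by rewrite sqr_sqrtr// mulfV// mulr1.
apply: ler_pM; rewrite ?mulr_ge0 ?sqrtr_ge0 ?divr_ge0//.
  by rewrite ler_wpM2l.
exact: c4.
Qed.

Lemma tor1_ge t : 0 <= t <= 1 -> 2 * Num.min t (1 - t) <= tor1 t.
Proof.
move=> /andP[t0 t1]; rewrite tor1E ler_wpM2l//.
have h (s : R) : 0 <= s -> s <= 2^-1 -> s <= sin (pi * s).
  move=> s0 s2; apply: le_trans (sin_ge_half _ _).
  - rewrite mulrAC ler_peMl//; rewrite ler_pdivlMr// mul1r.
    by have := pi_ge2 R.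
  - by rewrite mulr_ge0 ?pi_ge0.
  - by rewrite ler_wpM2l ?pi_ge0.
have [t2|t2] := leP t 2^-1.
  rewrite min_l; last by lra.
  by rewrite (le_trans (h _ t0 t2))// ler_norm.
rewrite min_r; last by lra.
have -> : sin (pi * t) = sin (pi * (1 - t)).
  by rewrite mulrBr mulr1 sinB sinpi cospi; ring.
by rewrite (le_trans (h _ _ _))// ?ler_norm//; lra.
Qed.

Definition cauchyk (L t : R) : R := (1 + L ^+ 2 * tor1 t ^+ 2)^-1.

Lemma cauchyk_den (L t : R) : 1 <= 1 + L ^+ 2 * tor1 t ^+ 2.
Proof. by rewrite lerDl mulr_ge0 ?sqr_ge0. Qed.

Lemma cauchyk_ge0 (L t : R) : 0 <= cauchyk L t.
Proof. by rewrite invr_ge0 (le_trans _ (cauchyk_den L t)). Qed.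

Lemma cauchyk_le1 (L t : R) : cauchyk L t <= 1.
Proof. by rewrite invf_le1 ?cauchyk_den// (lt_le_trans _ (cauchyk_den L t)). Qed.

Lemma bmf_cauchyk (L : R) : bmf (cauchyk L : measurableTypeR R -> R).
Proof.
split; last by exists 1 => t; rewrite ger0_norm ?cauchyk_ge0 ?cauchyk_le1.
apply: continuous_measurable_fun => t.
apply: (@cvgV _ _ _ _ (fun t => 1 + L ^+ 2 * tor1 t ^+ 2)).
  by rewrite gt_eqF// (lt_le_trans _ (cauchyk_den L t)).
have ct : tor1 s @[s --> t] --> tor1 t.
  rewrite (_ : tor1 = fun s => 2 * `|sin (pi * s)|); last by apply/funext => s; exact: tor1E.
  apply: cvgM; first exact: cvg_cst.
  apply: cvg_norm; apply: continuous_cvg; first exact: continuous_sin.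
  by apply: cvgM; [exact: cvg_cst|exact: cvg_id].
by apply: cvgD; [exact: cvg_cst|apply: cvgM; [exact: cvg_cst|rewrite !expr2; apply: cvgM]].
Qed.

(** By [tor1_ge] the integrand is dominated on the cell by two Cauchy densities, centred at 0 and at
    1. Their primitive is an arctangent, and pi / 2 < 2 gives the constant. *)
Lemma Int_cauchyk (L : R) : 0 < L -> \int[U]_t cauchyk L t <= 2 / L.
Proof.
move=> L0.
pose h (s : R) := (1 + (2 * L * s) ^+ 2)^-1.
have h0 s : 0 < 1 + (2 * L * s) ^+ 2 by rewrite ltr_wpDr// sqr_ge0.
have ch : continuous h.
  move=> s; apply: cvgV; first by rewrite gt_eqF.
  by apply: cvgD; [exact: cvg_cst|apply: cvgM; apply: cvgM; (exact: cvg_cst || exact: cvg_id)].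
pose f (t : R) := h t + h (1 - t).
have cf : continuous f.
  move=> t; apply: cvgD; first exact: ch.
  apply: (@continuous_comp _ _ _ (fun t : R => 1 - t) h); last exact: ch.
  by apply: cvgB; [exact: cvg_cst|exact: cvg_id].
have bh (g : R -> R) : continuous g -> bmf ((fun t => h (g t)) : measurableTypeR R -> R).
  move=> cg; split.
    apply: continuous_measurable_fun => t; apply: (@continuous_comp _ _ _ g h); [exact: cg|exact: ch].
  exists 1 => t; rewrite ger0_norm ?invr_ge0 ?(ltW (h0 _))// invf_le1//.
  by rewrite lerDl sqr_ge0.
have bf : bmf (f : measurableTypeR R -> R).
  apply: bmfD; first by apply: (bh id) => t; exact: cvg_id.
  by apply: (bh (fun t => 1 - t)) => t; apply: cvgB; [exact: cvg_cst|exact: cvg_id].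
pose F (t : R) := (2 * L)^-1 * (atan (2 * L * t) - atan (2 * L * (1 - t))).
have dF (t : R) : is_derive t 1 F (f t).
  rewrite /F /f /h.
  apply: is_derive_eq; rewrite /GRing.scale /=.
  by field; rewrite !gt_eqF//; have := h0 t; have := h0 (1 - t).
have le : \int[U]_t cauchyk L t <= \int[U]_t f t.
  have b1 := bmf_cauchyk L.
  have bi : bmf ((fun t => \1_(`[0, 1] : set R) t) : measurableTypeR R -> R).
    split; first by apply: measurable_indic; exact: measurable_itv.
    by exists 1 => t; rewrite indicE; case: (_ \in _); rewrite ?normr1 ?normr0.
  have -> : \int[U]_t cauchyk L t = \int[U]_t (cauchyk L t * \1_(`[0, 1] : set R) t).
    apply: EFin_inj; rewrite !Int_uniform//; last exact: bmfM.
    by apply: eq_integral => t t01; rewrite indicE t01 mulr1.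
  apply: le_Int => // [|t]; first exact: bmfM.
  rewrite indicE; case: (boolP (t \in _)) => [|]; rewrite ?mulr1 ?mulr0.
    rewrite inE/= in_itv/= => t01.
    have := tor1_ge t01; rewrite /cauchyk /f.
    case: (leP t (1 - t)) => _ h1.
      apply: (@le_trans _ _ (h t)); last by rewrite lerDl invr_ge0 ltW.
      rewrite lef_pV2 ?posrE ?(lt_le_trans _ (cauchyk_den L t))// lerD2l -mulrA mulrCA exprMn ler_wpM2l ?sqr_ge0//.
      by case/andP: t01 => t0 _; rewrite ler_sqr ?nnegrE ?mulr_ge0 ?cmod_ge0.
    apply: (@le_trans _ _ (h (1 - t))); last by rewrite lerDr invr_ge0 ltW.
    rewrite lef_pV2 ?posrE ?(lt_le_trans _ (cauchyk_den L t))// lerD2l -mulrA mulrCA exprMn ler_wpM2l ?sqr_ge0//.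
    by case/andP: t01 => _ t1; rewrite ler_sqr ?nnegrE ?mulr_ge0 ?cmod_ge0 ?subr_ge0.
  by move=> _; rewrite /f addr_ge0// invr_ge0 ltW.
apply: (le_trans le); rewrite (Int_FTC bf cf dF) /F subrr subr0 mulr0 mulr1 atan0 subr0 sub0r.
rewrite -mulrBr opprK -mulr2n invfM -mulrA (mulrC 2 L^-1) (mulrCA 2^-1) ler_wpM2l ?invr_ge0 ?(ltW L0)//.
rewrite -[atan _ *+ 2]mulr_natr mulrCA mulVf ?pnatr_eq0// mulr1.
have := atan_ltpi2 (2 * L) => a.
exact: le_trans (ltW a) (ltW (pihalf_lt2 R)).
Qed.

End OneDimIntegral.

Section TensorIntegral.
Context (R : realType).
Local Notation U := (uniform_prob (@ltr01 R)).

Lemma bmf_prod_tnth d (g : 'I_d -> R -> R) (P : pred 'I_d) :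
  (forall i, bmf (g i : measurableTypeR R -> R)) ->
  bmf (fun x : d.-tuple R => \prod_(i < d | P i) g i (tnth x i)).
Proof.
move=> hg.
have -> : (fun x : d.-tuple R => \prod_(i < d | P i) g i (tnth x i)) =
   (fun x => \prod_(i <- index_enum 'I_d) (if P i then g i (tnth x i) else 1)).
  by apply/funext => x; rewrite big_mkcond.
elim: (index_enum 'I_d) => [|i s ih].
  by under eq_fun do rewrite big_nil; exact: bmf_cst.
under eq_fun do rewrite big_cons; apply: bmfM => //.
case: (P i); last exact: bmf_cst.
have [mg [M Mg]] := hg i; split; last by exists M.
by apply: (measurableT_comp mg); exact: measurable_tnth.
Qed.

Lemma Int_prod_tnth d (g : 'I_d -> R -> R) :
  (forall i, bmf (g i : measurableTypeR R -> R)) ->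
  \int[torus R d]_x (\prod_(i < d) g i (tnth x i)) = \prod_(i < d) \int[U]_t g i t.
Proof.
elim: d g => [|d ih] g hg.
  rewrite big_ord0; under eq_Rintegral do rewrite big_ord0.
  exact: (IntC (torus R 0)).
rewrite Int_torusS; last exact: bmf_prod_tnth.
transitivity (\int[(U \x torus R d)%E]_z (g ord0 z.1 * \prod_(i < d) g (lift ord0 i) (tnth z.2 i))).
  apply: eq_Rintegral => z _; rewrite big_ord_recl; congr (_ * _).
  by apply: eq_bigr => i _; rewrite /= tnthS.
have b2 : bmf (fun x : d.-tuple R => \prod_(i < d) g (lift ord0 i) (tnth x i)).
  by apply: (@bmf_prod_tnth d (fun i => g (lift ord0 i)) xpredT) => i; exact: hg.
rewrite (Int_prod U (torus R d) (hg ord0) b2).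
by rewrite big_ord_recl (ih (fun i => g (lift ord0 i))).
Qed.

End TensorIntegral.

Section KernelBound.
Context (R : realType) (d : nat).
Local Notation mu := (torus R d).
Local Notation basis := (@basis d).
Implicit Types (f g : freq d -> R[i]) (s : seq 'I_d).

(** The coefficients of the product of [syn N f] with [ek (basis j) - 1], by [syn_diff]; this fixes
    the direction of the difference. *)
Definition dif (j : 'I_d) f : freq d -> R[i] := fun k => f (k - basis j) - f k.

(* Discrete analogue of |D^t f| <= A L^-|t| for the multi-indices t with entries 0 or 1 in [s]. *)
Fixpoint flat s (L A : R) f : Prop :=
  if s is j :: s' then flat s' L A f /\ flat s' L (A / L) (dif j f)
  else forall k, cmod (f k) <= A.

Definition supp_box M f := forall k, k \notin box d M -> f k = 0.

Lemma basis_box j : basis j \in box d 1.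
Proof. by apply/boxP => i; rewrite /Defs.freq /basis; case: (_ == _). Qed.

Lemma supp_box_shift j M N f : supp_box M f -> (M < N)%N ->
  forall k, k \notin box d N -> f (k - basis j) = 0.
Proof.
move=> fM MN k kN; apply: fM; apply: contra kN => kM.
have := boxD kM (basis_box j); rewrite subrK => h.
by apply: sub_box h; rewrite addn1.
Qed.

Lemma supp_box_mono M N f : (M <= N)%N -> supp_box M f -> supp_box N f.
Proof. by move=> MN fM k kN; apply: fM; apply: contra kN; exact: sub_box. Qed.

Lemma supp_box_dif M j f : supp_box M f -> supp_box M.+1 (dif j f).
Proof.
move=> fM k kN; rewrite /dif (supp_box_shift _ fM (ltnSn M))//.
by rewrite (supp_box_mono (leqnSn M) fM)// subr0.
Qed.

Definition cweight (L : R) s (x : d.-tuple R) : R :=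
  \prod_(j <- s) (1 + L ^+ 2 * nsq (ek (basis j) x - 1)).

Lemma bmf_cweight L s : bmf (cweight L s).
Proof.
rewrite /cweight; elim: s => [|j s ih].
  by under eq_fun do rewrite big_nil; exact: bmf_cst.
under eq_fun do rewrite big_cons; apply: bmfM => //.
apply: bmfD; first exact: bmf_cst.
apply: bmfM; first exact: bmf_cst.
have [h1 h2] := cbmfD (cbmf_ek R (basis j) : cbmf (fun x : d.-tuple R => ek (basis j) x)) (@cbmf_cst _ (d.-tuple R) R (-1)).
by rewrite /nsq; apply: bmfD; rewrite /GRing.exp /=; apply: bmfM.
Qed.

(** Each factor of the weight adds to Parseval's sum for [f] the one for [dif j f], whose bound
    [A / L] cancels [L ^+ 2]: a factor 2 per direction. A difference enlarges the support by one,
    whence the room [size s] in the box. *)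
Lemma flat_Int s L A f N M : 0 < L -> flat s L A f -> supp_box M f ->
  (M + size s <= N)%N ->
  \int[mu]_x (nsq (syn N f x) * cweight L s x) <=
    2 ^+ size s * (size (box d N))%:R * A ^+ 2.
Proof.
move=> L0; elim: s A f M => [|j s ih] A f M /=.
  move=> fA fM _.
  under eq_Rintegral do rewrite /cweight big_nil mulr1.
  rewrite parseval expr0 mul1r mulr_natl.
  have -> : A ^+ 2 *+ size (box d N) = \sum_(k <- box d N) A ^+ 2 by rewrite big_const_seq count_predT; elim: (size _) => [|n ihn] /=; rewrite ?mulr0n// mulrS ihn.
  apply: ler_sum => k _; rewrite -cmod_sqr ler_sqr ?nnegrE ?cmod_ge0//.
  exact: le_trans (cmod_ge0 _) (fA k).
move=> [f1 f2] fM; rewrite addnS => MN.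
have e : (fun x => nsq (syn N f x) * cweight L (j :: s) x) =
   (fun x => nsq (syn N f x) * cweight L s x + L ^+ 2 * (nsq (syn N (dif j f) x) * cweight L s x)).
  apply/funext => x; rewrite /cweight big_cons -/(cweight L s x).
  have -> : nsq (syn N (dif j f) x) = nsq (syn N f x) * nsq (ek (basis j) x - 1).
    rewrite -nsqM syn_diff//.
      by apply: (supp_box_mono _ fM); lia.
    by apply: (supp_box_shift _ fM); lia.
  by ring.
rewrite e IntD; last 2 first.
- by apply: bmfM; [exact: bmf_nsq_syn|exact: bmf_cweight].
- by apply: bmfM; [exact: bmf_cst|apply: bmfM; [exact: bmf_nsq_syn|exact: bmf_cweight]].
rewrite IntZ; last by apply: bmfM; [exact: bmf_nsq_syn|exact: bmf_cweight].
have i1 := ih _ _ _ f1 fM (ltac:(lia)).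
have i2 := ih _ _ _ f2 (supp_box_dif j fM) (ltac:(lia)).
apply: (le_trans (lerD i1 (ler_wpM2l (sqr_ge0 L) i2))).
rewrite [2 ^+ (size s).+1]exprS le_eqVlt; apply/orP; left; apply/eqP; field; rewrite ?gt_eqF//.
Qed.

Lemma PL_cmod_syn N f : PL (fun x => cmod (syn N f x)).
Proof.
split.
  have [h _] := bmf_nsq_syn N f.
  have hs : measurable_fun setT (Num.sqrt : R -> R).
    by apply: continuous_measurable_fun; exact: sqrt_continuous.
  exact: (measurableT_comp hs h).
exists (\sum_(k <- box d N) cmod (f k) * \sum_(i < d) `|k i|%:~R).
  by apply: sumr_ge0 => k _; rewrite mulr_ge0 ?cmod_ge0//; apply: sumr_ge0 => i _; rewrite ler0z.
move=> x y.
have h a b : `|cmod a - cmod b| <= cmod (a - b : R[i]).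
  rewrite ler_norml; have := cmodD (a - b) b; have := cmodD (b - a) a; rewrite !subrK -(cmodN (b - a)) (opprB b a) => h1 h2.
  by apply/andP; split; lra.
apply: (le_trans (h _ _)); rewrite /syn -sumrB (le_trans (cmod_sum _ _))// mulr_suml.
apply: ler_sum => k _; rewrite -mulrBr cmodM -mulrA ler_wpM2l ?cmod_ge0//.
apply: (le_trans (ek_dist k x y)); rewrite mulr_suml.
apply: ler_sum => i _; rewrite ler_wpM2l ?ler0z//.
by rewrite /tdist (bigD1 i)//= lerDl; apply: sumr_ge0 => l _; exact: tdist1_ge0.
Qed.

(* Cauchy-Schwarz with the weight [cweight L], whose inverse has integral at most (2 / L)^d, then Parseval. *)
Lemma kernel_L1 L A (c0 : R) f N M : 0 < L -> 0 < A -> 1 <= c0 ->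
  flat (enum 'I_d) L A f -> supp_box M f -> (M + d <= N)%N ->
  (N.*2.+1)%:R <= c0 * L ->
  \int[mu]_x cmod (syn N f x) <= (2 * c0) ^+ d * A.
Proof.
move=> L0 A0 c1 fl fM MN NL.
have c00 : 0 < c0 by exact: lt_le_trans c1.
pose w x := cweight L (enum 'I_d) x.
have wE x : (w x)^-1 = \prod_(i < d) cauchyk L (tnth x i).
  rewrite /w /cweight big_enum /= -prodfV; apply: eq_bigr => i _.
  by rewrite /cauchyk /tor1 cmod_sqr /ek dot_basis.
have bwi : bmf (fun x => (w x)^-1).
  under eq_fun do rewrite wE.
  apply: (@bmf_prod_tnth _ d (fun=> cauchyk L) xpredT) => i; exact: bmf_cauchyk.
have w1 x : 0 < w x.
  by apply: prodr_gt0 => j _; rewrite ltr_wpDr// mulr_ge0 ?sqr_ge0 ?nsq_ge0.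
(* Cauchy-Schwarz is used as a <= la a^2 w / 2 + 1 / (2 la w). With this [la] the powers of [L]
   cancel in both integrals, and each is a multiple of [A]. *)
pose la := (L ^+ d * A)^-1.
have la0 : 0 < la by rewrite invr_gt0 mulr_gt0 ?exprn_gt0.
have bn : bmf (fun x => nsq (syn N f x) * w x) by apply: bmfM; [exact: bmf_nsq_syn|exact: bmf_cweight].
apply: (@le_trans _ _ (\int[mu]_x (la / 2 * (nsq (syn N f x) * w x) + (2 * la)^-1 * (w x)^-1))).
  apply: le_Int.
  - exact: PL_bmf (PL_cmod_syn _ _).
  - by apply: bmfD; apply: bmfM => //; exact: bmf_cst.
  - move=> x; rewrite -cmod_sqr; set a := cmod _; set b := w x.
    have b0 : 0 < b := w1 x.
    rewrite -subr_ge0.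
    have -> : la / 2 * (a ^+ 2 * b) + (2 * la)^-1 * b^-1 - a = (la * a * b - 1) ^+ 2 / (2 * la * b).
      by field; rewrite !gt_eqF.
    by rewrite divr_ge0 ?sqr_ge0// !mulr_ge0// ltW.
rewrite IntD; [|by apply: bmfM => //; exact: bmf_cst|by apply: bmfM => //; exact: bmf_cst].
rewrite !IntZ//.
have h1 : \int[mu]_x (nsq (syn N f x) * w x) <= 2 ^+ d * (c0 * L) ^+ d * A ^+ 2.
  have := @flat_Int (enum 'I_d) L A f N M L0 fl fM; rewrite size_enum_ord => /(_ MN) h.
  apply: (le_trans h); rewrite ler_wpM2r ?sqr_ge0// ler_wpM2l ?exprn_ge0//.
  by rewrite size_box natrX lerXn2r ?nnegrE ?mulr_ge0 ?(ltW c00) ?(ltW L0).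
have h2 : \int[mu]_x (w x)^-1 <= (2 / L) ^+ d.
  under eq_Rintegral do rewrite wE.
  rewrite (@Int_prod_tnth _ d (fun=> cauchyk L)); last by move=> i; exact: bmf_cauchyk.
  rewrite -[X in _ <= _ ^+ X]card_ord -prodr_const; apply: ler_prod => i _.
  rewrite Int_cauchyk// andbT.
  by apply: Rintegral_ge0 => t _; exact: cauchyk_ge0.
apply: (le_trans (lerD (ler_wpM2l _ h1) (ler_wpM2l _ h2))); rewrite ?invr_ge0 ?mulr_ge0 ?(ltW la0)//.
have -> : la / 2 * (2 ^+ d * (c0 * L) ^+ d * A ^+ 2) = (2 * c0) ^+ d * A / 2.
  by rewrite /la !exprMn; field; rewrite !gt_eqF ?exprn_gt0.
have -> : (2 * la)^-1 * (2 / L) ^+ d = 2 ^+ d * A / 2.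
  by rewrite /la !exprMn exprVn; field; rewrite !gt_eqF ?exprn_gt0.
rewrite [X in _ <= X]splitr lerD2l !ler_wpM2r ?invr_ge0 ?(ltW A0)//.
by rewrite lerXn2r ?nnegrE ?mulr_ge0 ?(ltW c00)// ler_peMr.
Qed.

End KernelBound.

(** * Symbols and dyadic blocks *)

Section JapaneseBracket.
Context (R : realType) (d : nat).
Implicit Types (x : 'I_d -> R) (k : freq d) (e : R).

(** The squared bracket of 2 pi x. It is defined for real arguments, not only for frequencies, so
    that differences of symbols can be estimated by derivatives. *)
Definition jb x : R := 1 + \sum_(i < d) (2 * pi * x i) ^+ 2.
Definition jp e x : R := jb x `^ (e / 2).
Definition fr k : 'I_d -> R := fun i => (k i)%:~R.
Definition jf e k : R := jp e (fr k).
Definition shift x (t : R) (j : 'I_d) : 'I_d -> R := fun i => x i + t * (j == i)%:R.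

Lemma jb_ge1 x : 1 <= jb x.
Proof. by rewrite lerDl sumr_ge0// => i _; exact: sqr_ge0. Qed.

Lemma jb_gt0 x : 0 < jb x.
Proof. exact: lt_le_trans ltr01 (jb_ge1 x). Qed.

Lemma jp_gt0 e x : 0 < jp e x.
Proof. by rewrite powR_gt0// jb_gt0. Qed.

Lemma jpD a b x : jp (a + b) x = jp a x * jp b x.
Proof. by rewrite /jp mulrDl powRD// (gt_eqF (jb_gt0 x)) implybT. Qed.

Lemma jp0 x : jp 0 x = 1.
Proof. by rewrite /jp mul0r powRr0. Qed.

Lemma jpN e x : jp (- e) x = (jp e x)^-1.
Proof. by rewrite /jp mulNr powRN. Qed.

Lemma jp_pow e x : jp e x = jp 1 x `^ e.
Proof. by rewrite /jp -powRrM; congr (_ `^ _); rewrite mulrC mul1r. Qed.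

Lemma jp1_ge1 x : 1 <= jp 1 x.
Proof.
have h : (0 : R) <= 1 / 2 by rewrite divr_ge0.
by have := ler_powR (jb_ge1 x) h; rewrite powRr0.
Qed.

Lemma jp1_sqr x : jp 1 x ^+ 2 = jb x.
Proof. by rewrite expr2 -jpD /jp divff// powRr1// ltW// jb_gt0. Qed.

Lemma pi8 : 2 * pi <= 8 :> R.
Proof.
have h := ltW (pihalf_lt2 R).
have -> : 2 * pi = pi / 2 * 4 :> R by field.
by rewrite (_ : 8 = 2 * 4) ?ler_pM2r//; rewrite -natrM.
Qed.

Lemma pi1 : 1 <= 2 * pi :> R.
Proof. by have := pi_ge2 R => h; rewrite (le_trans _ (ler_peMl _ _))// ?pi_ge0//; lra. Qed.

Lemma coord_jp x i : `|x i| <= jp 1 x.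
Proof.
rewrite -[jp 1 x]ger0_norm ?(ltW (jp_gt0 _ _))// -ler_sqr ?nnegrE// !real_normK ?num_real// jp1_sqr.
rewrite /jb (bigD1 i)//= addrCA.
apply: (@le_trans _ _ ((2 * pi * x i) ^+ 2)).
  by rewrite exprMn ler_peMl ?sqr_ge0// exprn_ege1// pi1.
by rewrite lerDl addr_ge0// sumr_ge0// => l _; exact: sqr_ge0.
Qed.

(** From (a + b)^2 <= 2 a^2 + 2 b^2 and 2 pi <= 8: with S the sum in [jb x], 1 + 128 + 2 S <= 130 (1
    + S). *)
Lemma jb_shift x t j : `|t| <= 1 -> jb (shift x t j) <= 130 * jb x.
Proof.
move=> t1.
have t2 : t ^+ 2 <= 1 by rewrite -real_normK ?num_real// exprn_ile1.
have h : forall i, (2 * pi * shift x t j i) ^+ 2 <= 2 * (2 * pi * x i) ^+ 2 + 128 * (j == i)%:R.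
  move=> i; rewrite /shift; case: eqP => _; last by rewrite !mulr0 !addr0 ler_peMl ?sqr_ge0// ler1n.
  rewrite !mulr1 mulrDr; set a := 2 * pi * x i; set b := 2 * pi * t.
  have b2 : b ^+ 2 <= 64.
    rewrite /b exprMn (le_trans (ler_wpM2l (sqr_ge0 _) t2))// mulr1.
    rewrite (_ : 64 = 8 ^+ 2); last by rewrite -natrX.
    by rewrite lerXn2r ?nnegrE ?pi8 ?mulr_ge0 ?pi_ge0.
  by have := sqr_ge0 (a - b); rewrite sqrrB sqrrD; lra.
rewrite /jb; have -> : 130 * (1 + \sum_(i < d) (2 * pi * x i) ^+ 2) = 1 + (129 + 130 * \sum_(i < d) (2 * pi * x i) ^+ 2) :> R by ring.
rewrite lerD2l (le_trans (ler_sum _ (fun i _ => h i)))// big_split /= -!mulr_sumr.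
have -> : \sum_(i < d) (j == i)%:R = 1 :> R.
  by rewrite (bigD1 j)//= eqxx big1 ?addr0// => i /negbTE; rewrite eq_sym => ->.
rewrite mulr1 addrC lerD//; first by rewrite ler_nat.
by rewrite ler_wpM2r ?sumr_ge0 ?ler_nat// => i _; exact: sqr_ge0.
Qed.

Lemma shiftK x t j : shift (shift x t j) (- t) j = x.
Proof. by apply/funext => i; rewrite /shift; ring. Qed.

Lemma pow_comp (a b M e : R) : 0 < a -> 0 < b -> 1 <= M -> a <= M * b -> b <= M * a ->
  a `^ e <= M `^ `|e| * b `^ e.
Proof.
move=> a0 b0 M1 ab ba; have M0 : 0 < M by exact: lt_le_trans M1.
have [e0|e0] := leP 0 e.
  rewrite ger0_norm// -powRM ?(ltW M0) ?(ltW b0)//.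
  by apply: ge0_ler_powR => //; rewrite nnegrE ?mulr_ge0// ltW.
rewrite ltr0_norm//.
have h : b `^ (- e) <= M `^ (- e) * a `^ (- e).
  rewrite -powRM ?(ltW M0) ?(ltW a0)//.
  by apply: ge0_ler_powR => //; rewrite ?nnegrE ?mulr_ge0 ?oppr_ge0// ltW.
have pa := powR_gt0 e a0; have pb := powR_gt0 e b0.
move: h; rewrite !(powRN a) !(powRN b) => h.
have := ler_wpM2r (mulr_ge0 (ltW pa) (ltW pb)) h.
rewrite (_ : (b `^ e)^-1 * _ = a `^ e); last by field; rewrite gt_eqF.
rewrite (_ : _ * _^-1 * _ = M `^ (- e) * b `^ e)//.
by field; rewrite gt_eqF.
Qed.

Lemma jp_shift e x t j : `|t| <= 1 -> jp e (shift x t j) <= 130 `^ `|e / 2| * jp e x.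
Proof.
move=> t1; apply: pow_comp; rewrite ?jb_gt0 ?ler1n ?jb_shift//.
by rewrite -[in X in X <= _](shiftK x t j) jb_shift// normrN.
Qed.

End JapaneseBracket.

Section RealSymbols.
Context (R : realType) (d : nat).
Local Notation fn := (('I_d -> R) -> R).
Implicit Types (f g : fn) (x : 'I_d -> R) (e : R) (u : seq 'I_d).

(** A class that contains the powers of the bracket and is closed under partial derivatives, each of
    which lowers the order by one ([sym_pd]). The rule [sym_eq] takes care of the arithmetic of the
    orders. *)
Inductive sym : R -> fn -> Prop :=
 | sym_jp e : sym e (fun x => jp e x)
 | sym_coord j : sym 1 (fun x => x j)
 | sym_cst c : sym 0 (fun=> c)
 | sym_zero e : sym e (fun=> 0)
 | sym_mul a b f g : sym a f -> sym b g -> sym (a + b) (fun x => f x * g x)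
 | sym_add e f g : sym e f -> sym e g -> sym e (fun x => f x + g x)
 | sym_eq e e' f : e = e' -> sym e f -> sym e' f.

Definition pd (j : 'I_d) f g :=
  forall x (t : R), is_derive t 1 (fun s => f (shift x s j)) (g (shift x t j)).

Lemma sym_pd e f j : sym e f -> exists2 g, pd j f g & sym (e - 1) g.
Proof.
elim => {e f}.
- move=> e; exists (fun x => (4 * pi ^+ 2 * e) * (x j * jp (e - 2) x)).
    move=> x t.
    have dj : is_derive t 1 (fun s => jb (shift x s j)) (8 * pi ^+ 2 * shift x t j j).
      have hs i : is_derive t 1 (fun s => (2 * pi * shift x s j i) ^+ 2)
          (8 * pi ^+ 2 * shift x t j i * (j == i)%:R).
        rewrite /shift; apply: is_derive_eq; rewrite /GRing.scale /=; ring.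
      rewrite /jb.
      have := is_deriveD (is_derive_cst (1 : R) t 1) (@is_derive_sum _ _ _ _ (fun i s => (2 * pi * shift x s j i) ^+ 2) t 1 _ hs).
      rewrite add0r (_ : \sum_(i < d) _ = 8 * pi ^+ 2 * shift x t j j).
        move=> h; have -> : (fun s => 1 + \sum_(i < d) (2 * pi * shift x s j i) ^+ 2) =
          (fun=> 1) + \sum_(i < d) (fun s => (2 * pi * shift x s j i) ^+ 2); last exact: h.
        by apply/funext => s; rewrite !fctE /= fct_sumE.
      rewrite (bigD1 j)//= eqxx mulr1 big1 ?addr0// => i /negbTE; rewrite eq_sym => ->.
      by rewrite mulr0.
    have := @is_derive1_comp _ (fun b => b `^ (e / 2)) _ t _ _ (is_derive1_powR (e / 2) (jb_gt0 (shift x t j))) dj.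
    move=> h; apply: (@is_derive_eq _ _ _ _ _ _ _ _ h).
    by rewrite /jp (_ : (e - 2) / 2 = e / 2 - 1); [field|field].
  apply: (@sym_eq (0 + (1 + (e - 2)))); first by ring.
  by apply: sym_mul; [exact: sym_cst|apply: sym_mul; [exact: sym_coord|exact: sym_jp]].
- move=> i; exists (fun=> (j == i)%:R).
    by move=> x t; rewrite /shift; apply: is_derive_eq; rewrite /GRing.scale /=; ring.
  by apply: (@sym_eq 0); [ring|exact: sym_cst].
- by move=> c; exists (fun=> 0); [move=> x t; exact: is_derive_cst|exact: sym_zero].
- by move=> e; exists (fun=> 0); [move=> x t; exact: is_derive_cst|exact: sym_zero].
- move=> a b f g sf [f' df sf'] sg [g' dg sg'].
  exists (fun x => f x * g' x + f' x * g x).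
    move=> x t; have := is_deriveM (df x t) (dg x t) => h.
    by apply: (@is_derive_eq _ _ _ _ _ _ _ _ h); rewrite /GRing.scale /=; ring.
  apply: sym_add.
    by apply: (@sym_eq (a + (b - 1))); [ring|exact: sym_mul].
  by apply: (@sym_eq ((a - 1) + b)); [ring|exact: sym_mul].
- move=> e f g _ [f' df sf'] _ [g' dg sg'].
  exists (fun x => f' x + g' x); last exact: sym_add.
  by move=> x t; exact: is_deriveD (df x t) (dg x t).
- by move=> e e' f <- _ [f' df sf']; exists f'.
Qed.

Lemma sym_bound e f : sym e f -> exists2 C, 0 <= C & forall x, `|f x| <= C * jp e x.
Proof.
elim => {e f}.
- by move=> e; exists 1 => // x; rewrite mul1r ger0_norm// ltW// jp_gt0.
- by move=> j; exists 1 => // x; rewrite mul1r coord_jp.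
- by move=> c; exists `|c| => // x; rewrite jp0 mulr1.
- by move=> e; exists 0 => // x; rewrite normr0 mul0r.
- move=> a b f g _ [C C0 fC] _ [D D0 gD]; exists (C * D); first exact: mulr_ge0.
  by move=> x; rewrite jpD normrM mulrACA ler_pM.
- move=> e f g _ [C C0 fC] _ [D D0 gD]; exists (C + D); first exact: addr_ge0.
  by move=> x; rewrite mulrDl (le_trans (ler_normD _ _))// lerD.
- by move=> e e' f <-.
Qed.

Definition Dj (j : 'I_d) f : fn := fun x => f (shift x (- 1) j) - f x.
Fixpoint Dl u f : fn := if u is j :: u' then Dj j (Dl u' f) else f.

Lemma Dl_comm u j f : Dl u (Dj j f) = Dj j (Dl u f).
Proof.
elim: u => //= i u ->; apply/funext => x; rewrite /Dj.
have -> : shift (shift x (-1) i) (-1) j = shift (shift x (-1) j) (-1) i.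
  by apply/funext => l; rewrite /shift; ring.
by ring.
Qed.

Lemma Dl_pd u j f g : pd j f g -> pd j (Dl u f) (Dl u g).
Proof.
move=> fg; elim: u => //= i u ih x t; rewrite /Dj.
have e s : shift (shift x s j) (-1) i = shift (shift x (-1) i) s j.
  by apply/funext => l; rewrite /shift; ring.
under eq_fun do rewrite e.
by rewrite e; apply: is_deriveB; exact: ih.
Qed.

(** A difference is a derivative at an intermediate point. Differences commute with derivatives, so
    the induction applies to [g]; the intermediate point is at distance at most 1, where brackets
    are comparable by [jp_shift]. *)
Lemma sym_Dl u e f : sym e f ->
  exists2 C, 0 <= C & forall x, `|Dl u f x| <= C * jp (e - (size u)%:R) x.
Proof.
elim: u e f => [|j u ih] e f sf /=.
  by have [C C0 fC] := sym_bound sf; exists C => // x; rewrite subr0.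
have [g fg sg] := sym_pd j sf; have [C C0 gC] := ih _ _ sg.
have dfg := Dl_pd u fg.
exists (C * 130 `^ `|(e - (size u).+1%:R) / 2|); first by rewrite mulr_ge0// powR_ge0.
move=> x; rewrite /Dj.
pose h s := Dl u f (shift x s j).
have dh (s : R) : is_derive s 1 h (Dl u g (shift x s j)) by exact: dfg.
have [|c] := @MVT R h (fun s => Dl u g (shift x s j)) (-1) 0 (ltrN10 R) (fun s _ => dh s).
  by apply: derivable_within_continuous => s _; have [] := dh s.
rewrite in_itv/= => /andP[c1 c2]; rewrite /h.
have -> : shift x 0 j = x by apply/funext => i; rewrite /shift mul0r addr0.
rewrite opprK add0r mulr1 => E; rewrite distrC E (le_trans (gC _))// -mulrA.
rewrite (_ : e - 1 - (size u)%:R = e - (size u).+1%:R); last by rewrite -natr1; ring.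
rewrite ler_wpM2l//.
by apply: jp_shift; rewrite ler0_norm ?(ltW c2)// lerNl ltW.
Qed.

End RealSymbols.

Section LatticeSymbols.
Context (R : realType) (d : nat).
Local Notation basis := (@basis d).
Implicit Types (f g : freq d -> R[i]) (s : seq 'I_d) (k : freq d) (e A : R).

Lemma fr_basis k j : fr R (k - basis j) = shift (fr R k) (- 1) j.
Proof.
apply/funext => i; rewrite /fr /shift /basis -mulrz_nat; set b := (j == i).
by rewrite [(k - _) i]/(k i - _) intrD rmorphN /= mulN1r -pmulrn mulrz_nat.
Qed.

Lemma jf_gt0 e k : 0 < jf e k :> R.
Proof. exact: jp_gt0. Qed.

Lemma jf_shift e k j : jf e (k - basis j) <= 130 `^ `|e / 2| * jf e k :> R.
Proof. by rewrite /jf fr_basis jp_shift// normrN normr1. Qed.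

(* Discrete analogue of |D^t f| <= A <k>^(e - |t|), t as in [flat]. *)
Fixpoint scls s e A f : Prop :=
  if s is j :: s' then scls s' e A f /\ scls s' (e - 1) A (dif j f)
  else forall k, cmod (f k) <= A * jf e k.

Lemma scls_base s e A f : scls s e A f -> forall k, cmod (f k) <= A * jf e k.
Proof. by elim: s => //= j s ih [/ih]. Qed.

Lemma scls_ge0 s e A f : scls s e A f -> 0 <= A.
Proof. by move=> /scls_base /(_ 0) /(le_trans (cmod_ge0 _)); rewrite pmulr_lge0// jf_gt0. Qed.

Lemma scls_le s e A B f : A <= B -> scls s e A f -> scls s e B f.
Proof.
move=> AB; elim: s e f => [|j s ih] e f /=.
  by move=> h k; rewrite (le_trans (h k))// ler_wpM2r// ltW// jf_gt0.
by move=> [h1 h2]; split; exact: ih.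
Qed.

Lemma scls_add s e A B f g : scls s e A f -> scls s e B g ->
  scls s e (A + B) (fun k => f k + g k).
Proof.
elim: s e f g => [|j s ih] e f g /=.
  by move=> h1 h2 k; rewrite mulrDl (le_trans (cmodD _ _))// lerD.
move=> [f1 f2] [g1 g2]; split; first exact: ih.
have -> : dif j (fun k => f k + g k) = (fun k => dif j f k + dif j g k).
  by apply/funext => k; rewrite /dif opprD addrACA.
exact: ih.
Qed.

Lemma scls_opp s e A f : scls s e A f -> scls s e A (fun k => - f k).
Proof.
elim: s e f => [|j s ih] e f /=; first by move=> h k; rewrite cmodN.
move=> [f1 f2]; split; first exact: ih.
have -> : dif j (fun k => - f k) = (fun k => - dif j f k).
  by apply/funext => k; rewrite /dif opprB opprK addrC.
exact: ih.
Qed.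

Lemma dif_comm i j f : dif i (fun k => f (k - basis j)) = (fun k => dif i f (k - basis j)).
Proof. by apply/funext => k; rewrite /dif addrAC. Qed.

Lemma scls_shift s e j : exists2 C : R, 0 <= C & forall A f, scls s e A f ->
  scls s e (C * A) (fun k => f (k - basis j)).
Proof.
elim: s e => [|i s ih] e /=.
  exists (130 `^ `|e / 2|); first exact: powR_ge0.
  move=> A f h k; apply: (le_trans (h _)).
  have A0 : 0 <= A by apply: (@scls_ge0 [::] e A f).
  by rewrite mulrAC mulrC ler_wpM2r// jf_shift.
have [C1 C10 h1] := ih e; have [C2 C20 h2] := ih (e - 1).
exists (C1 + C2); first exact: addr_ge0.
move=> A f [f1 f2]; have A0 := scls_ge0 f1; split.
  by apply: scls_le (h1 _ _ f1); rewrite ler_wpM2r// lerDl.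
by rewrite dif_comm; apply: scls_le (h2 _ _ f2); rewrite ler_wpM2r// lerDr.
Qed.

Lemma dif_mul j f g : dif j (fun k => f k * g k) =
  (fun k => dif j f k * g (k - basis j) + f k * dif j g k).
Proof. by apply/funext => k; rewrite /dif; ring. Qed.

Lemma scls_mul s e1 e2 : exists2 C : R, 0 <= C & forall A B f g,
  scls s e1 A f -> scls s e2 B g -> scls s (e1 + e2) (C * A * B) (fun k => f k * g k).
Proof.
elim: s e1 e2 => [|j s ih] e1 e2 /=.
  exists 1 => // A B f g hf hg k.
  by rewrite mul1r cmodM /jf jpD mulrACA; apply: ler_pM; rewrite ?cmod_ge0.
have [C1 C10 h1] := ih e1 e2; have [C2 C20 h2] := ih (e1 - 1) e2.
have [C3 C30 h3] := ih e1 (e2 - 1); have [D D0 hD] := scls_shift s e2 j.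
exists (C1 + (C2 * D + C3)); first by rewrite !addr_ge0// mulr_ge0.
move=> A B f g [f1 f2] [g1 g2]; have A0 := scls_ge0 f1; have B0 := scls_ge0 g1; split.
  by apply: scls_le (h1 _ _ _ _ f1 g1); rewrite -!mulrA ler_wpM2r ?mulr_ge0// lerDl addr_ge0// mulr_ge0.
rewrite dif_mul; apply: (@scls_le _ _ (C2 * A * (D * B) + C3 * A * B)).
  have -> : C2 * A * (D * B) + C3 * A * B = (C2 * D + C3) * (A * B) by ring.
  by rewrite -!mulrA ler_wpM2r ?mulr_ge0// lerDr.
apply: scls_add.
  by rewrite addrAC; apply: h2 => //; exact: hD.
by rewrite -addrA; exact: h3.
Qed.

Definition rst (F : ('I_d -> R) -> R) : freq d -> R[i] := fun k => (F (fr R k))%:C%C.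

(** Weaker than [sym], but closed under the differences [Dj] ([symD_Dj]), to which [comm_step]
    applies it. *)
Definition symD e (F : ('I_d -> R) -> R) := forall u,
  exists2 C, 0 <= C & forall x, `|Dl u F x| <= C * jp (e - (size u)%:R) x.

Lemma sym_symD e F : sym e F -> symD e F.
Proof. by move=> sF u; exact: sym_Dl. Qed.

Lemma symD_Dj e F j : symD e F -> symD (e - 1) (Dj j F).
Proof.
move=> sF u; have [C C0 h] := sF (j :: u); exists C => // x.
rewrite Dl_comm (le_trans (h x))// (_ : e - (size (j :: u))%:R = e - 1 - (size u)%:R)//.
by rewrite /= -natr1; ring.
Qed.

Lemma dif_rst j F : dif j (rst F) = rst (Dj j F).
Proof. by apply/funext => k; rewrite /dif /rst fr_basis /Dj rmorphB. Qed.

Lemma symD_scls s e F : symD e F -> exists2 A, 0 <= A & scls s e A (rst F).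
Proof.
elim: s e F => [|j s ih] e F sF /=.
  have [C C0 h] := sF [::]; exists C => // k; rewrite /rst cmod_real.
  by have := h (fr R k); rewrite /= subr0.
have [A A0 hA] := ih _ _ sF; have [B B0 hB] := ih _ _ (symD_Dj j sF).
exists (A + B); first exact: addr_ge0.
split; first by apply: scls_le hA; rewrite lerDl.
by rewrite dif_rst; apply: scls_le hB; rewrite lerDr.
Qed.

(** The [l]-th dyadic annulus up to the factor [B]. The bracket replaces |k|, so that level 0
    includes the zero frequency. *)
Definition ann (B : R) (l : nat) k := jf 1 k <= B * 2 ^+ l /\ 2 ^+ l <= B * jf 1 k.

Lemma jf1_shift k j : jf 1 (k - basis j) <= 130 * jf 1 k :> R.
Proof.
apply: (le_trans (jf_shift 1 k j)); rewrite ler_wpM2r ?(ltW (jf_gt0 _ _))//.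
rewrite -[X in _ <= X]powRr1 ?ler0n//; apply: ler_powR; first by rewrite ler1n.
by rewrite ger0_norm ?divr_ge0//; lra.
Qed.

Lemma jf1_shift' k j : jf 1 k <= 130 * jf 1 (k - basis j) :> R.
Proof.
have e1 : fr R k = shift (fr R (k - basis j)) 1 j.
  by rewrite fr_basis -[X in shift _ X _](opprK 1) shiftK.
rewrite {1}/jf e1; apply: (le_trans (jp_shift 1 _ _ _)); first by rewrite normr1.
rewrite ler_wpM2r ?(ltW (jf_gt0 _ _))//.
rewrite -[X in _ <= X]powRr1 ?ler0n//; apply: ler_powR; first by rewrite ler1n.
by rewrite ger0_norm ?divr_ge0//; lra.
Qed.

Lemma flat_le s L A A' f : A <= A' -> flat s L A f -> 0 < L -> flat s L A' f.
Proof.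
move=> + + L0; elim: s A A' f => [|i t iht] A A' f AA /=.
  by move=> h k; exact: le_trans (h k) AA.
by move=> [f1 f2]; split; [exact: iht AA f1|apply: iht f2; rewrite ler_pM2r ?invr_gt0].
Qed.

(** On the annulus the bracket may be replaced by 2^l up to a constant. [B] varies in the induction
    because a difference has a larger support: one step in frequency costs the factor 130. *)
Lemma flat_of_scls s e (B : R) : 1 <= B -> exists2 C : R, 0 <= C & forall l A f,
  scls s e A f -> (forall k, f k != 0 -> ann B l k) ->
  flat s (2 ^+ l) (C * 2 `^ (l%:R * e) * A) f.
Proof.
elim: s e B => [|j s ih] e B B1 /=.
  exists (B `^ `|e|); first exact: powR_ge0.
  move=> l A f h fB k; have A0 : 0 <= A := @scls_ge0 [::] e A f h.
  have [->|fk] := eqVneq (f k) 0.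
    by rewrite cmod0 !mulr_ge0// powR_ge0.
  rewrite (le_trans (h k))// mulrC ler_wpM2r//.
  have [h1 h2] := fB k fk.
  have -> : 2 `^ (l%:R * e) = (2 ^+ l) `^ e :> R by rewrite powRrM powR_mulrn.
  by rewrite /jf jp_pow; apply: pow_comp; rewrite ?jp_gt0 ?exprn_gt0.
have [C1 C10 h1] := ih e B B1.
have [|C2 C20 h2] := ih (e - 1) (130 * B); first by rewrite mulr_ege1// ler1n.
exists (C1 + C2); first exact: addr_ge0.
move=> l A f [f1 f2] fB; have A0 := scls_ge0 f1; split.
  apply: flat_le (h1 l A f f1 fB) _; last by rewrite exprn_gt0.
  by rewrite -!mulrA ler_wpM2r ?mulr_ge0 ?powR_ge0// lerDl.
apply: flat_le (h2 l A _ f2 _) _; last by rewrite exprn_gt0.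
  have -> : 2 `^ (l%:R * (e - 1)) = 2 `^ (l%:R * e) / 2 ^+ l :> R.
    by rewrite mulrBr mulr1 powRD ?pnatr_eq0 ?implybT// powRN powR_mulrn.
  rewrite -!mulrA [_^-1 * A]mulrC ler_wpM2r ?mulr_ge0 ?powR_ge0 ?invr_ge0 ?exprn_ge0//.
  by rewrite lerDr.
move=> k; rewrite /dif => fk.
have [fk0|fk0] := eqVneq (f k) 0.
  have [h3 h4] : ann B l (k - basis j) by apply: fB; apply: contra fk => /eqP ->; rewrite fk0 subr0.
  split.
    by rewrite (le_trans (jf1_shift' k j))// -mulrA ler_wpM2l.
  by rewrite (le_trans h4)// [130 * B]mulrC -mulrA ler_wpM2l ?jf1_shift// (le_trans _ B1).
have [h3 h4] := fB k fk0; split.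
  by rewrite (le_trans h3)// ler_wpM2r ?exprn_ge0// ler_peMl ?ler1n// (le_trans _ B1).
by rewrite (le_trans h4)// ler_wpM2r ?(ltW (jf_gt0 _ _))// ler_peMl ?ler1n// (le_trans _ B1).
Qed.

End LatticeSymbols.

(** * Tensor product cutoffs and dyadic block operators *)

Section DyadicTensor.
Context (R : realType) (d : nat).
Local Notation basis := (@basis d).
Implicit Types (k : freq d) (s : seq 'I_d) (L : R).

Lemma notin_box N k : k \notin box d N -> exists i, N%:Z < `|k i|.
Proof.
move=> h; apply: contrapT => h2; move/negP: h; apply; apply/boxP => i.
by rewrite leNgt; apply/negP => hi; apply: h2; exists i.
Qed.

(** The trapezoid of de la Vallee Poussin kernels: 1 for |t| <= L, 0 for |t| >= 2 L, linear in
    between. Lipschitz continuity is all that one difference per coordinate asks for. *)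
Definition vtrap L (t : int) : R := Num.max 0 (Num.min 1 (2 - `|t|%:~R / L)).

Lemma vtrap01 L t : 0 <= vtrap L t <= 1.
Proof. by rewrite /vtrap le_max lexx /= ge_max ler01 ge_min lexx. Qed.

Lemma vtrap_lip L (s t : int) : 0 < L -> `|vtrap L s - vtrap L t| <= `|s - t|%:~R / L.
Proof.
move=> L0; have L1 : 0 < L^-1 by rewrite invr_gt0.
have h : `|(`|s|%:~R / L - `|t|%:~R / L : R)| <= `|s - t|%:~R / L.
  rewrite -mulrBl normrM (gtr0_norm L1) ler_pM2r// -rmorphB /= -intr_norm ler_int.
  exact: ler_dist_dist.
move: h; rewrite /vtrap; set a := _ / L; set b := `|t|%:~R / L; set c := `|s - t|%:~R / L.
rewrite !ler_norml => /andP[h1 h2].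
case: (leP 1 (2 - a)) => ?; case: (leP 1 (2 - b)) => ?; rewrite ?(max_r ler01);
  case: (leP 0 (2 - a)) => ?; case: (leP 0 (2 - b)) => ?; apply/andP; split; lra.
Qed.

Lemma vtrap1 L t : 0 < L -> `|t|%:~R <= L -> vtrap L t = 1.
Proof.
move=> L0 tL; have h : `|t|%:~R / L <= 1 by rewrite ler_pdivrMr// mul1r.
by rewrite /vtrap min_l ?max_r//; lra.
Qed.

Lemma vtrap0 L t : 0 < L -> 2 * L <= `|t|%:~R -> vtrap L t = 0.
Proof.
move=> L0 tL; have h : 2 <= `|t|%:~R / L by rewrite ler_pdivlMr.
by rewrite /vtrap max_l// ge_min; apply/orP; right; lra.
Qed.

Lemma vtrapN L t : vtrap L (- t) = vtrap L t.
Proof. by rewrite /vtrap normrN. Qed.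

(** The product of trapezoids, already differenced in the coordinates in [S]. Differences in
    distinct coordinates act on distinct factors, so the family is stable under them. *)
Definition tens L (S : {set 'I_d}) k : R :=
  \prod_(i < d) (if i \in S then vtrap L (k i - 1) - vtrap L (k i) else vtrap L (k i)).

(** 24 = 8 * 3, from 2 pi <= 8 and the support |k_i| <= 3 L of [tens]. *)
Definition cbox : R := 1 + 24 * d%:R.

Lemma cbox_ge1 : 1 <= cbox.
Proof. by rewrite lerDl mulr_ge0. Qed.

Lemma jf1_box k (L : R) : 1 <= L -> (forall i, `|k i|%:~R <= 3 * L) -> jf 1 k <= cbox * L.
Proof.
move=> L1 kL; have L0 : 0 <= L by exact: le_trans L1.
have c0 : 0 <= cbox by exact: le_trans cbox_ge1.
rewrite -ler_sqr ?nnegrE ?mulr_ge0// ?(ltW (jf_gt0 _ _))// /jf jp1_sqr /jb exprMn.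
apply: (@le_trans _ _ (1 + \sum_(i < d) (24 * L) ^+ 2)).
  rewrite lerD2l; apply: ler_sum => i _.
  rewrite -[X in X <= _]real_normK ?num_real// lerXn2r ?nnegrE ?mulr_ge0//.
  rewrite normrM (_ : 24 * L = 8 * (3 * L)); last by ring.
  rewrite ger0_norm ?mulr_ge0 ?pi_ge0// ler_pM ?mulr_ge0 ?pi_ge0 ?pi8//.
  by rewrite /fr -intr_norm.
rewrite sumr_const card_ord -[_ *+ d]mulr_natr [(24 * L) ^+ 2]exprMn.
apply: (@le_trans _ _ (L ^+ 2 + 24 ^+ 2 * L ^+ 2 * d%:R)).
  by rewrite lerD2r exprn_ege1.
rewrite (_ : _ + _ = (1 + 24 ^+ 2 * d%:R) * L ^+ 2); last by ring.
have hd : d%:R <= d%:R ^+ 2 :> R by rewrite -natrX ler_nat; nia.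
by rewrite ler_wpM2r ?sqr_ge0// /cbox; nra.
Qed.

Lemma tens_box L (S : {set 'I_d}) k : 1 <= L -> tens L S k != 0 -> forall i, `|k i|%:~R <= 3 * L.
Proof.
move=> L1 + i; have L0 : 0 < L by exact: lt_le_trans L1.
rewrite /tens; apply: contraR; rewrite -ltNge => kL.
have z1 : vtrap L (k i) = 0 by apply: vtrap0 => //; lra.
have z2 : vtrap L (k i - 1) = 0.
  apply: vtrap0 => //.
  have : `|k i|%:~R <= `|k i - 1|%:~R + 1 :> R.
    by rewrite -[1 in X in _ <= X]/(1%:~R) -intrD ler_int; lia.
  by lra.
by rewrite (bigD1 i)//= z1 z2 subr0 if_same mul0r.
Qed.

Lemma tens_le L (S : {set 'I_d}) k : 1 <= L -> `|tens L S k| <= L ^- #|S|.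
Proof.
move=> L1; have L0 : 0 < L by exact: lt_le_trans L1.
rewrite /tens normr_prod.
apply: (@le_trans _ _ (\prod_(i < d) (if i \in S then L^-1 else 1))).
  apply: ler_prod => i _; rewrite normr_ge0 /=; case: ifP => _.
    rewrite (le_trans (vtrap_lip _ _ L0))// (_ : _ - _ = -1 :> int) ?normrN ?normr1 ?mul1r//.
    by lia.
  by have /andP[h1 h2] := vtrap01 L (k i); rewrite ger0_norm.
by rewrite -big_mkcond /= prodr_const exprVn.
Qed.

(** [dif j] maps [tens L S] to [tens L (j |: S)]. Each differenced coordinate gains 1 / L, which the
    bracket on the support matches up to [cbox]. As [s] is duplicate free and disjoint from [S], no
    coordinate is differenced twice. *)
Lemma tens_scls L (S : {set 'I_d}) s : 1 <= L -> uniq s -> (forall j, j \in s -> j \notin S) ->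
  scls s (- #|S|%:R) (cbox ^+ d) (fun k => (tens L S k)%:C%C).
Proof.
move=> L1; have L0 : 0 < L by exact: lt_le_trans L1.
have c1 := cbox_ge1; have c0 : 0 < cbox by exact: lt_le_trans c1.
elim: s S => [|j s ih] S /=.
  move=> _ _ k; rewrite cmod_real.
  have [->|tk] := eqVneq (tens L S k) 0.
    by rewrite normr0 mulr_ge0 ?exprn_ge0 ?(ltW c0) ?(ltW (jf_gt0 _ _)).
  apply: (le_trans (tens_le S k L1)).
  rewrite /jf jpN jp_pow powR_mulrn ?(ltW (jp_gt0 _ _))//.
  have h := jf1_box L1 (tens_box L1 tk).
  rewrite ler_pdivlMr ?exprn_gt0 ?jp_gt0// mulrC ler_pdivrMr ?exprn_gt0//.
  apply: (@le_trans _ _ ((cbox * L) ^+ #|S|)).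
    by rewrite lerXn2r ?nnegrE ?mulr_ge0 ?(ltW c0) ?(ltW L0) ?(ltW (jp_gt0 _ _)).
  rewrite exprMn ler_wpM2r ?exprn_ge0 ?(ltW L0)// ler_weXn2l//.
  by have := max_card (mem S); rewrite card_ord.
move=> /andP[js us] sS; split; first by apply: ih => // i si; apply: sS; rewrite inE si orbT.
have jS : j \notin S by apply: sS; rewrite inE eqxx.
have -> : dif j (fun k => (tens L S k)%:C%C) = (fun k => (tens L (j |: S) k)%:C%C).
  apply/funext => k; rewrite /dif -rmorphB; congr (_%:C)%C.
  rewrite /tens (bigD1 j)//= [X in _ - X](bigD1 j)//= [RHS](bigD1 j)//=.
  rewrite (negbTE jS) setU11.
  have -> : (k - basis j) j = k j - 1 by rewrite [LHS]/(k j - (j == j)%:Z) eqxx.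
  have e1 : \prod_(i < d | i != j) (if i \in S then vtrap L ((k - basis j) i - 1) - vtrap L ((k - basis j) i) else vtrap L ((k - basis j) i))
    = \prod_(i < d | i != j) (if i \in S then vtrap L (k i - 1) - vtrap L (k i) else vtrap L (k i)).
    by apply: eq_bigr => i ij; rewrite basisB_ne.
  rewrite e1 -mulrBl; congr (_ * _); apply: eq_bigr => i ij.
  by rewrite in_setU1 (negbTE ij).
have -> : - #|S|%:R - 1 = - #|j |: S|%:R :> R by rewrite cardsU1 jS add1n -natr1 opprD.
apply: ih => // i si; rewrite in_setU1 negb_or sS ?inE ?si ?orbT// andbT.
by apply: contraNneq js => <-.
Qed.

Definition Vl (l : nat) k : R := tens (2 ^+ l) finset.set0 k.

Lemma VlE l k : Vl l k = \prod_(i < d) vtrap (2 ^+ l) (k i).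
Proof. by rewrite /Vl /tens; apply: eq_bigr => i _; rewrite finset.in_set0. Qed.

Lemma Vl_scls l : scls (enum 'I_d) 0 (cbox ^+ d) (fun k => (Vl l k)%:C%C).
Proof.
have := @tens_scls (2 ^+ l) finset.set0 (enum 'I_d); rewrite cards0 oppr0; apply.
- by rewrite exprn_ege1// ler1n.
- exact: enum_uniq.
- by move=> j _; rewrite finset.in_set0.
Qed.

Lemma VlN l k : Vl l (- k) = Vl l k.
Proof. by rewrite !VlE; apply: eq_bigr => i _; exact: vtrapN. Qed.

Lemma Vl1 l k : k \in box d (2 ^ l) -> Vl l k = 1.
Proof.
move=> /boxP kl; rewrite VlE big1// => i _; apply: vtrap1; rewrite ?exprn_gt0//.
by rewrite -natrX -[X in _ <= X]mulrz_nat ler_int natz; exact: kl.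
Qed.

Lemma Vl0 l k : k \notin box d (2 ^ l.+1) -> Vl l k = 0.
Proof.
move=> /notin_box[i ki]; rewrite VlE (bigD1 i)//= vtrap0 ?mul0r ?exprn_gt0//.
by rewrite -exprS -natrX -[X in X <= _]mulrz_nat ler_int natz ltW.
Qed.

(** Dyadic blocks of tensor type, used for all operator bounds. The blocks of the Besov norm, made
    from [chi], enter only through the norms of the pieces of [u]. *)
Definition be (l : nat) k : R := if l is l'.+1 then Vl l k - Vl l' k else Vl 0 k.

Lemma sum_be n k : \sum_(l < n.+1) be l k = Vl n k.
Proof.
elim: n => [|n ih]; first by rewrite big_ord_recr big_ord0 /= add0r.
by rewrite big_ord_recr /= ih addrC subrK.
Qed.

Lemma be_scls : exists2 C : R, 0 <= C & forall l, scls (enum 'I_d) 0 C (fun k => (be l k)%:C%C).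
Proof.
have c0 : 0 <= cbox ^+ d by rewrite exprn_ge0// (le_trans _ cbox_ge1).
exists (cbox ^+ d + cbox ^+ d); first exact: addr_ge0.
case=> [|l] /=; first by apply: scls_le (Vl_scls 0); rewrite lerDl.
under eq_fun do rewrite rmorphB.
by apply: scls_add; [exact: Vl_scls|apply: scls_opp; exact: Vl_scls].
Qed.

Lemma be_supp l : supp_box (2 ^ l.+1) (fun k => (be l k)%:C%C).
Proof.
move=> k; case: l => [|l] kl /=; first by rewrite Vl0.
by rewrite !Vl0 ?subr0//; apply: contra kl; apply: sub_box; rewrite leq_exp2l.
Qed.

Lemma be_ann l k : be l k != 0 -> ann (1 + 24 * d%:R : R) l k.
Proof.
have c1 := cbox_ge1.
move=> bk; split.
  apply: jf1_box; first by rewrite exprn_ege1// ler1n.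
  move=> i; have : k \in box d (2 ^ l.+1).
    by apply: contraNT bk => /be_supp /eqP; rewrite (inj_eq (can_inj (fun x => erefl : complex.Re (x%:C)%C = x))).
  move=> /boxP /(_ i) ki; apply: (@le_trans _ _ (2 * 2 ^+ l)).
    by rewrite -exprS -natrX -[X in _ <= X]mulrz_nat ler_int natz.
  by rewrite ler_pM2r ?exprn_gt0// ler_nat.
case: l bk => [|l] bk; first by rewrite expr0 mulr_ege1// jp1_ge1.
have : k \notin box d (2 ^ l).
  apply: contra bk => kl /=; rewrite !Vl1 ?subrr//.
  by apply: sub_box kl; rewrite leq_exp2l.
move=> /notin_box[i ki].
apply: (@le_trans _ _ (jf 1 k)); last by rewrite ler_peMl// (ltW (jf_gt0 _ _)).
rewrite -ler_sqr ?nnegrE ?exprn_ge0 ?(ltW (jf_gt0 _ _))// /jf jp1_sqr /jb (bigD1 i)//= addrCA.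
apply: (@le_trans _ _ ((2 * pi * fr R k i) ^+ 2)); last first.
  by rewrite lerDl addr_ge0// sumr_ge0// => m _; exact: sqr_ge0.
rewrite -[X in _ <= X]real_normK ?num_real// lerXn2r ?nnegrE ?exprn_ge0// normrM exprS.
rewrite ger0_norm ?mulr_ge0 ?pi_ge0// ler_pM ?exprn_ge0//.
  by rewrite ler_peMr//; have := pi_ge2 R; lra.
by rewrite /fr -intr_norm -natrX -[X in X <= _]mulrz_nat ler_int natz ltW.
Qed.

End DyadicTensor.

Section BlockOperators.
Context (R : realType) (d : nat).
Local Notation mu := (torus R d).
Implicit Types (k : freq d) (e rho q c : R) (th : nat -> freq d -> R).

(** What the kernel estimates use of a dyadic family: symbol bounds of order 0, localization to
    annuli, evenness and an explicit support. Both [be] and the wider [fat] qualify. *)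
Definition block th := [/\ exists2 B : R, 0 <= B & forall l, scls (enum 'I_d) 0 B (fun k => (th l k)%:C%C),
  exists2 B : R, 1 <= B & forall l k, th l k != 0 -> ann B l k,
  forall l k, th l (- k) = th l k &
  forall l, supp_box (2 ^ l.+3) (fun k => (th l k)%:C%C)].

(** Equal to 1 on the support of [be l] translated by frequencies in [box d (2 ^ kk)] with kk + 4 <=
    l ([fat1]). For l < 3 there is no lower cutoff. *)
Definition fat (l : nat) k : R := Vl R l.+2 k - (if (l < 3)%N then 0 else Vl R (l - 3) k).

Lemma block_be : block (@be R d).
Proof.
split.
- exact: be_scls.
- by exists (1 + 24 * d%:R); [rewrite lerDl mulr_ge0|exact: be_ann].
- by case=> [|l] k /=; rewrite !VlN.
- move=> l; apply: supp_box_mono (@be_supp R d l); rewrite leq_exp2l//; lia.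
Qed.

Lemma fat_supp l : supp_box (2 ^ l.+3) (fun k => (fat l k)%:C%C).
Proof.
move=> k kl; rewrite /fat Vl0// sub0r; case: ifP => h; first by rewrite oppr0.
rewrite Vl0 ?oppr0//; apply: contra kl; apply: sub_box; rewrite leq_exp2l//; lia.
Qed.

Lemma block_fat : block fat.
Proof.
have c1 := cbox_ge1 R d.
have c0 : 0 <= cbox R d ^+ d by rewrite exprn_ge0// (le_trans _ c1).
split.
- exists (cbox R d ^+ d + cbox R d ^+ d); first exact: addr_ge0.
  move=> l; rewrite /fat; case: (ltnP l 3) => _.
    by under eq_fun do rewrite subr0; apply: scls_le (Vl_scls R d _); rewrite lerDl.
  under eq_fun do rewrite rmorphB.
  by apply: scls_add; [exact: Vl_scls|apply: scls_opp; exact: Vl_scls].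
- exists (8 * (1 + 24 * d%:R)); first by rewrite mulr_ege1// ?ler1n// lerDl mulr_ge0.
  move=> l k fk; split.
    have kb : k \in box d (2 ^ l.+3).
      apply: contraNT fk => /fat_supp /(congr1 (@complex.Re R)) /= ->.
      by rewrite eqxx.
    rewrite mulrAC mulrC.
    have h8 : (1 : R) <= 8 * 2 ^+ l by rewrite mulr_ege1 ?ler1n// exprn_ege1// ler1n.
    apply: (le_trans (jf1_box h8 _)); last by [].
    move/boxP : kb => kb i; apply: (@le_trans _ _ (8 * 2 ^+ l)).
      by rewrite (_ : 8 = 2 ^+ 3); [rewrite -exprD -natrX -[X in _ <= X]mulrz_nat ler_int natz; exact: kb|rewrite -natrX].
    by rewrite ler_peMl ?(le_trans _ h8)// ler1n.
  have j1 : 1 <= jf 1 k :> R by exact: jp1_ge1.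
  have j0 : 0 <= jf 1 k :> R by exact: le_trans j1.
  have cc : 0 <= 24 * d%:R :> R by rewrite mulr_ge0.
  have [l3|l3] := ltnP l 3.
    apply: (@le_trans _ _ 8).
      by rewrite (_ : 8 = 2 ^+ 3); [rewrite ler_weXn2l ?ler1n// ltnW|rewrite -natrX].
    by rewrite -mulrA ler_peMr// mulr_ege1// lerDl.
  have [m lm] : exists m, l = m.+3 by exists (l - 3)%N; lia.
  have km : k \notin box d (2 ^ m).
    apply: contra fk => km; rewrite /fat lm (_ : (m.+3 < 3)%N = false)// (_ : (m.+3 - 3)%N = m); last by lia.
    by rewrite !Vl1 ?subrr//; apply: sub_box km; rewrite leq_exp2l//; lia.
  have [i ki] := notin_box km.
  apply: (@le_trans _ _ (8 * jf 1 k)); last first.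
    by rewrite -mulrA ler_wpM2l// ler_peMl// lerDl.
  rewrite lm (_ : 2 ^+ m.+3 = 8 * 2 ^+ m); last by rewrite !exprS; ring.
  rewrite ler_wpM2l//; apply: (le_trans _ (coord_jp (fr R k) i)).
  by rewrite /fr -intr_norm -natrX -[X in X <= _]mulrz_nat ler_int natz ltW.
- by move=> l k; rewrite /fat !VlN.
- exact: fat_supp.
Qed.

Lemma flat_block th e F : block th -> symD e F -> exists2 C : R, 0 < C & forall l,
  flat (enum 'I_d) (2 ^+ l) (C * 2 `^ (l%:R * e)) (fun k => (F (fr R k) * th l k)%:C%C).
Proof.
move=> [[B B0 hB] [B' B1 hB'] _ _] sF; have [A A0 hA] := symD_scls (enum 'I_d) sF.
have [C C0 hC] := scls_mul (enum 'I_d) e (0 : R).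
have [D D0 hD] := flat_of_scls (enum 'I_d) e B1.
exists (D * (C * A * B) + 1); first by rewrite ltr_wpDl// !mulr_ge0.
move=> l; have := hC _ _ _ _ hA (hB l); rewrite addr0 => h.
have {}hD := hD l _ _ h.
have -> : (fun k => (F (fr R k) * th l k)%:C%C) = (fun k => rst F k * (th l k)%:C%C).
  by apply/funext => k; rewrite rmorphM.
apply: flat_le (hD _) _; last by rewrite exprn_gt0.
  by rewrite mulrAC ler_wpM2r ?powR_ge0// lerDl.
by move=> k hk; apply: hB'; apply: contra hk => /eqP ->; rewrite mulr0.
Qed.

(** The additional [d] leaves room for the [d] differences taken in [kernel_L1]. *)
Definition NN (l : nat) : nat := (2 ^ l.+3 + d)%N.

Lemma NN_bound l : ((NN l).*2.+1)%:R <= (17 + 2 * d%:R) * 2 ^+ l :> R.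
Proof.
have -> : (17 + 2 * d%:R) * 2 ^+ l = ((17 + 2 * d) * 2 ^ l)%:R :> R.
  by rewrite natrM natrD natrX natrM.
rewrite ler_nat /NN !expnS; have : (0 < 2 ^ l)%N by rewrite expn_gt0.
by nia.
Qed.

Lemma flat_base s (L A : R) (f : freq d -> R[i]) : flat s L A f -> forall k, cmod (f k) <= A.
Proof. by elim: s => //= j s ih [/ih]. Qed.

Lemma flat_kernel (C0 : R) f l : 0 < C0 ->
  flat (enum 'I_d) (2 ^+ l) C0 f -> supp_box (2 ^ l.+3) f ->
  \int[mu]_x cmod (syn (NN l) f x) <= (2 * (17 + 2 * d%:R)) ^+ d * C0.
Proof.
move=> C00 fl fM; apply: (@kernel_L1 _ _ (2 ^+ l) C0 (17 + 2 * d%:R) f (NN l) (2 ^ l.+3)) => //.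
  - have : (0 : R) <= 2 * d%:R by rewrite mulr_ge0.
    by lra.
  - exact: NN_bound.
Qed.

Lemma flat_kernel_sup (C0 : R) f l x : 0 <= C0 ->
  flat (enum 'I_d) (2 ^+ l) C0 f ->
  cmod (syn (NN l) f x) <= (17 + 2 * d%:R) ^+ d * 2 ^+ (l * d) * C0.
Proof.
move=> C00 fl; rewrite /syn (le_trans (cmod_sum _ _))//.
apply: (@le_trans _ _ (\sum_(k <- box d (NN l)) C0)).
  by apply: ler_sum => k _; rewrite cmodM cmod_ek mulr1; exact: flat_base fl k.
rewrite big_const_seq count_predT.
have -> : forall n, iter n (+%R C0) 0 = n%:R * C0.
  by elim=> [|n ih] /=; rewrite ?mul0r// ih -nat1r mulrDl mul1r.
by rewrite ler_wpM2r// size_box natrX exprM -exprMn lerXn2r ?nnegrE ?NN_bound// mulr_ge0 ?exprn_ge0// addr_ge0// mulr_ge0.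
Qed.

(** The block [l] of the Bessel potential of order [rho], realized as a convolution so that Young's
    inequality applies. *)
Definition blk th rho l (g : d.-tuple R -> R) : d.-tuple R -> R :=
  conv (reS (NN l) (fun k => (jf rho k * th l k)%:C%C)) g.

Lemma jfN rho k : jf rho (- k) = jf rho k :> R.
Proof.
rewrite /jf /jp /jb; congr (_ `^ _); congr (1 + _); apply: eq_bigr => i _.
by rewrite /fr [(- k) i]/(- k i) rmorphN /= mulrN sqrrN.
Qed.

Lemma block_herm th rho l : block th -> hermitian (fun k => (jf rho k * th l k)%:C%C : R[i]).
Proof. by move=> [_ _ h _]; apply: hermitian_even => k; rewrite jfN h. Qed.

Lemma blk_trig th rho l g : block th -> mu.-integrable setT (EFin \o g) -> trig (NN l) (blk th rho l g).
Proof. by move=> bt ig; apply: conv_trig => //; apply: trig_reS; exact: block_herm. Qed.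

Lemma supp_NN l f : supp_box (2 ^ l.+3) f -> forall k, k \notin box d (NN l) -> f k = 0 :> R[i].
Proof. by move=> fM; apply: supp_box_mono fM; rewrite leq_addr. Qed.

Lemma blk_fourier th rho l g k : block th -> mu.-integrable setT (EFin \o g) ->
  fourier (blk th rho l g) k = (jf rho k * th l k)%:C%C * fourier g k.
Proof.
move=> bt ig; rewrite /blk (fourier_conv (N := NN l))//; last by apply: trig_reS; exact: block_herm.
rewrite fourier_reS; last exact: block_herm.
case: ifPn => // kN; have [_ _ _ ts] := bt.
by rewrite rmorphM /= (supp_NN (ts l) kN) mulr0.
Qed.

Lemma sym_J rho : symD rho (fun x : 'I_d -> R => jp rho x).
Proof. by apply: sym_symD; exact: sym_jp. Qed.

Lemma supp_blk th rho l : block th -> supp_box (2 ^ l.+3) (fun k => (jf rho k * th l k)%:C%C).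
Proof. by move=> [_ _ _ ts] k kN; rewrite rmorphM /= (ts l k kN) mulr0. Qed.

Lemma blk_kernel th rho : block th -> exists2 C : R, 0 < C & forall l,
  \int[mu]_x `|reS (NN l) (fun k => (jf rho k * th l k)%:C%C) x| <= C * 2 `^ (l%:R * rho) /\
  forall x, `|reS (NN l) (fun k => (jf rho k * th l k)%:C%C) x| <= C * 2 `^ (l%:R * rho) * 2 ^+ (l * d).
Proof.
move=> bt; have [C C0 hC] := flat_block bt (sym_J rho).
pose c0 : R := 17 + 2 * d%:R.
have h17 : (0 : R) <= 2 * d%:R by rewrite mulr_ge0.
have c00 : 1 <= c0 by rewrite /c0; lra.
exists ((2 * c0) ^+ d * C); first by rewrite mulr_gt0// exprn_gt0// mulr_gt0// (lt_le_trans _ c00).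
move=> l; have p0 : 0 < C * 2 `^ (l%:R * rho) by rewrite mulr_gt0// powR_gt0.
split.
  have hk := flat_kernel p0 (hC l) (@supp_blk th rho l bt).
  rewrite -[X in _ <= X]mulrA; apply: (le_trans _ hk).
  apply: le_Int.
  - by apply: bmf_norm; apply: PL_bmf; exact: PL_reS.
  - by apply: PL_bmf; exact: PL_cmod_syn.
  - by move=> x; exact: normRe_cmod.
move=> x; apply: (le_trans (normRe_cmod _)).
apply: (le_trans (flat_kernel_sup x (ltW p0) (hC l))).
rewrite -/c0 -!mulrA [2 ^+ (l * d) * _]mulrC -!mulrA ler_wpM2r//.
  by rewrite !mulr_ge0 ?exprn_ge0 ?powR_ge0 ?(ltW C0).
rewrite lerXn2r ?nnegrE ?mulr_ge0 ?(le_trans _ c00)// ler_peMl ?ler1n//.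
exact: le_trans c00.
Qed.

Lemma blk_Lb th rho : block th -> exists2 C : R, 0 < C & forall l q g c, 1 <= q -> bmf g ->
  Lb mu q g c -> Lb mu q (blk th rho l g) (C * 2 `^ (l%:R * rho) * c).
Proof.
move=> bt; have [C C0 hC] := blk_kernel rho bt; exists C => // l q g c q1 bg gc.
have [h1 _] := hC l.
by apply: young => //; exact: PL_reS.
Qed.

(** Bernstein's inequality from L^q to L^oo: the kernel is bounded by some K in L^1 and by K 2^(l d)
    in L^oo, and [young_sup] combines these to K 2^(l d / q). *)
Lemma blk_sup th rho q : 1 <= q -> block th -> exists2 C : R, 0 < C & forall l g c, bmf g ->
  Lb mu q g c -> forall x, `|blk th rho l g x| <= C * 2 `^ (l%:R * rho) * 2 `^ (l%:R * (d%:R / q)) * c.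
Proof.
move=> q1 bt; have [C C0 hC] := blk_kernel rho bt; exists C => // l g c bg gc x.
have [h1 h2] := hC l; have q0 : 0 < q by exact: lt_le_trans q1.
have K0 : 0 < C * 2 `^ (l%:R * rho) by rewrite mulr_gt0// powR_gt0.
have := young_sup q1 (PL_reS _ _) bg h1 h2 gc x.
suff -> : ((C * 2 `^ (l%:R * rho)) `^ (q - 1) * (C * 2 `^ (l%:R * rho) * 2 ^+ (l * d))) `^ q^-1 =
  C * 2 `^ (l%:R * rho) * 2 `^ (l%:R * (d%:R / q)) by [].
set K := C * _; rewrite mulrA -[X in _ * X * _](powRr1 (ltW K0)) -powRD ?(gt_eqF K0) ?implybT// subrK.
rewrite powRM ?powR_ge0 ?exprn_ge0// -powRrM mulfV ?gt_eqF// powRr1 ?(ltW K0)//.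
by rewrite -powR_mulrn// -powRrM natrM mulrA.
Qed.

(** Bernstein's inequality from L^(q/2) to L^q: the supremum costs 2^(2 l d / q), and interpolation
    with L^(q/2) halves the exponent. *)
Lemma blk_half th rho q : 2 <= q -> block th -> exists2 C : R, 0 < C & forall l g c, bmf g ->
  Lb mu (q / 2) g c -> Lb mu q (blk th rho l g) (C * 2 `^ (l%:R * rho) * 2 `^ (l%:R * (d%:R / q)) * c).
Proof.
move=> q2 bt; have q1 : 1 <= q / 2 by rewrite ler_pdivlMr// mul1r.
have q0 : 0 < q by exact: lt_le_trans q2.
have [C1 C10 h1] := blk_Lb rho bt; have [C2 C20 h2] := blk_sup rho q1 bt.
exists (C1 + C2); first exact: addr_gt0.
move=> l g c bg gc; have c0 := Lb_ge0 gc.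
have := h1 l _ _ _ q1 bg gc; have := h2 l g c bg gc.
set p := 2 `^ (l%:R * rho); set z := 2 `^ _ => hs hl.
have p0 : 0 <= p by exact: powR_ge0.
have z0 : 0 <= z by exact: powR_ge0.
have bb : bmf (blk th rho l g) by apply: conv_bmf => //; apply: PL_bmf; exact: PL_reS.
have [mb _] := bb.
have M0 : 0 <= C2 * p * z * c by rewrite !mulr_ge0// ltW.
apply: Lb_le (Lb_interp q0 mb hs M0 hl).
set y := 2 `^ (l%:R * (d%:R / q)).
have y0 : 0 <= y by exact: powR_ge0.
have zy : z = y ^+ 2.
  rewrite /z /y -powR_mulrn ?powR_ge0// -powRrM; congr (_ `^ _).
  by field; rewrite gt_eqF.
rewrite -[X in _ <= X]ger0_norm; last by rewrite !mulr_ge0// addr_ge0// ltW.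
rewrite -sqrtr_sqr ler_wsqrtr// zy.
have -> : C2 * p * y ^+ 2 * c * (C1 * p * c) = C1 * C2 * (p * y * c) ^+ 2 by ring.
have -> : ((C1 + C2) * p * y * c) ^+ 2 = (C1 + C2) ^+ 2 * (p * y * c) ^+ 2 by ring.
rewrite ler_wpM2r ?sqr_ge0// sqrrD.
by have := sqr_ge0 C1; have := sqr_ge0 C2; have := mulr_ge0 (ltW C10) (ltW C20); lra.
Qed.

Lemma trig_supp N M (g : d.-tuple R -> R) : trig N g -> supp_box M (fourier g) -> trig M g.
Proof.
move=> gN gM.
have -> : g = reS M (fourier g).
  apply: (@trig_inj _ _ (maxn N M)).
  - by apply: trig_mono gN; exact: leq_maxl.
  - by apply: (trig_mono (leq_maxr N M)); apply: trig_reS; apply: hermitian_fourier; exact: trig_integrable gN.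
  apply/funext => k; rewrite fourier_reS; last by apply: hermitian_fourier; exact: trig_integrable gN.
  by case: ifPn => // /gM.
by apply: trig_reS; apply: hermitian_fourier; exact: trig_integrable gN.
Qed.

Lemma be_trig rho l g : mu.-integrable setT (EFin \o g) -> trig (2 ^ l.+1) (blk (@be R d) rho l g).
Proof.
move=> ig; apply: (trig_supp (blk_trig rho l block_be ig)) => k kl.
by rewrite blk_fourier//; [rewrite rmorphM /= be_supp// mulr0 mul0r|exact: block_be].
Qed.

(** The Bessel potential on polynomials. Any bound on the degree may serve as [N]; different choices
    are identified by [trig_eq]. *)
Definition Jop rho N (g : d.-tuple R -> R) := reS N (fun k => (jf rho k)%:C%C * fourier g k).

Lemma Jop_herm rho N g : trig N g -> hermitian (fun k => (jf rho k)%:C%C * fourier g k : R[i]).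
Proof.
move=> gN; apply: hermitianM; first by apply: hermitian_even => k; exact: jfN.
by apply: hermitian_fourier; exact: trig_integrable gN.
Qed.

Lemma Jop_trig rho N g : trig N g -> trig N (Jop rho N g).
Proof. by move=> gN; apply: trig_reS; exact: Jop_herm gN. Qed.

Lemma Jop_fourier rho N g k : trig N g -> fourier (Jop rho N g) k = (jf rho k)%:C%C * fourier g k.
Proof.
move=> gN; rewrite fourier_reS; last exact: Jop_herm gN.
by case: ifPn => // kN; rewrite (trig_fourier0 gN kN) mulr0.
Qed.

End BlockOperators.

Section FlatCalculus.
Context (R : realType) (d : nat).
Implicit Types (f g : freq d -> R[i]) (s : seq 'I_d) (L A B : R).

Lemma flat_ge0 s L A f : flat s L A f -> 0 <= A.
Proof. by move=> /flat_base /(_ 0); exact: le_trans (cmod_ge0 _). Qed.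

Lemma flat_add s L A B f g : flat s L A f -> flat s L B g -> flat s L (A + B) (fun k => f k + g k).
Proof.
elim: s A B f g => [|j s ih] A B f g /=.
  by move=> h1 h2 k; rewrite (le_trans (cmodD _ _))// lerD.
move=> [f1 f2] [g1 g2]; split; first exact: ih.
rewrite mulrDl (_ : dif j _ = fun k => dif j f k + dif j g k); first exact: ih.
by apply/funext => k; rewrite /dif opprD addrACA.
Qed.

Lemma flat_opp s L A f : flat s L A f -> flat s L A (fun k => - f k).
Proof.
elim: s A f => [|j s ih] A f /=; first by move=> h k; rewrite cmodN.
move=> [f1 f2]; split; first exact: ih.
rewrite (_ : dif j _ = fun k => - dif j f k); first exact: ih.
by apply/funext => k; rewrite /dif opprB opprK addrC.
Qed.

Lemma flat_shift s L A f m : flat s L A f -> flat s L A (fun k => f (k + m)).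
Proof.
elim: s A f => [|j s ih] A f /=; first by move=> h k.
move=> [f1 f2]; split; first exact: ih.
rewrite (_ : dif j _ = fun k => dif j f (k + m)); first exact: ih.
by apply/funext => k; rewrite /dif addrAC.
Qed.

Lemma flat_mul s L A B f g : 0 < L -> flat s L A f -> flat s L B g ->
  flat s L (3 ^+ size s * A * B) (fun k => f k * g k).
Proof.
move=> L0; elim: s A B f g => [|j s ih] A B f g /=.
  by move=> h1 h2 k; rewrite mul1r cmodM ler_pM ?cmod_ge0.
move=> [f1 f2] [g1 g2]; have A0 := flat_ge0 f1; have B0 := flat_ge0 g1; split.
  apply: flat_le (ih _ _ _ _ f1 g1) L0; rewrite exprS -!mulrA ler_peMl ?ler1n//.
  by rewrite !mulr_ge0// exprn_ge0.
rewrite dif_mul.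
have g1' : flat s L B (fun k => g (k - basis j)) by exact: flat_shift g1.
apply: flat_le (flat_add (ih _ _ _ _ f2 g1') (ih _ _ _ _ f1 g2)) (L0).
have -> : 3 ^+ size s * (A / L) * B + 3 ^+ size s * A * (B / L) = 2 * (3 ^+ size s * A * B / L) by ring.
have -> : 3 ^+ (size s).+1 * A * B / L = 3 * (3 ^+ size s * A * B / L) by rewrite exprS; ring.
have x0 : 0 <= 3 ^+ size s * A * B / L by apply: divr_ge0; [apply: mulr_ge0 => //; apply: mulr_ge0 => //; by apply: exprn_ge0|exact: ltW].
by lra.
Qed.

Lemma flat_cst0 s L A : 0 < L -> 0 <= A -> flat s L A (fun=> 0 : R[i]).
Proof.
move=> L0; elim: s A => [|j s ih] A A0 /=; first by move=> _; rewrite cmod0.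
split; first exact: ih.
rewrite (_ : dif j _ = fun=> 0); first by apply: ih; rewrite divr_ge0// ltW.
by apply/funext => k; rewrite /dif subrr.
Qed.

End FlatCalculus.

(** * Products with trigonometric polynomials *)

Section CommutatorSymbol.
Context (R : realType) (d : nat).
Variable r : R.
Implicit Types (k m : freq d).

Lemma fat1 l kk k m : (kk + 4 <= l)%N -> m \in box d (2 ^ kk) -> be R l k != 0 ->
  fat R l (k + m) = 1.
Proof.
move=> kl mk bk.
have k1 : k \in box d (2 ^ l.+1).
  by apply: contraNT bk => /(@be_supp R d l k) /(congr1 (@complex.Re R)) /= ->; rewrite eqxx.
have [l' ll] : exists l', l = l'.+4 by exists (l - 4)%N; lia.
have kk2 : (2 ^ kk <= 2 ^ l')%N by rewrite leq_exp2l//; lia.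
have l0 : (0 < 2 ^ l')%N by rewrite expn_gt0.
rewrite /fat (_ : (l < 3)%N = false); last by lia.
rewrite Vl1; last by apply: sub_box (boxD k1 mk); rewrite ll !expnS; lia.
rewrite Vl0 ?subr0//.
apply: contra bk => km.
have kb : k \in box d (2 ^ l'.+3).
  have := boxD km (etrans (boxN _ _) mk); rewrite addrK.
  apply: sub_box; rewrite (_ : (l - 3).+1 = l'.+2); last by lia.
  by rewrite !expnS; lia.
by rewrite ll /be !Vl1 ?subrr//; apply: sub_box kb; rewrite leq_exp2l.
Qed.

Definition thr l k : R := jf (- r) k * be R l k.

(** The factor [fat R l (k + m)], equal to 1 where [thr] lives, is inserted to localize the
    increment to the annulus 2^l, where it has order r - 1. Together with the order - r of [thr]
    this leaves 2^-l, uniformly in [m]. *)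
Lemma comm_step : exists2 C : R, 0 < C & forall l kk j m, (kk + 4 <= l)%N -> m \in box d (2 ^ kk) ->
  flat (enum 'I_d) (2 ^+ l) (C * 2 ^- l)
    (fun k => (Dj j (fun x => jp r x) (fr R (k + m)) * thr l k)%:C%C).
Proof.
have hD (j : 'I_d) : exists C : R, 0 < C /\ forall l,
   flat (enum 'I_d) (2 ^+ l) (C * 2 `^ (l%:R * (r - 1))) (fun k => (Dj j (fun x => jp r x) (fr R k) * fat R l k)%:C%C).
  by have [C C0 h] := flat_block (block_fat R d) (symD_Dj j (@sym_J R d r)); exists C.
have {hD}[C hC] := choice hD.
have [B B0 hB] := flat_block (block_be R d) (@sym_J R d (- r)).
pose S := \sum_(j < d) C j.
have S0 j : C j <= S.
  rewrite /S (bigD1 j)//= lerDl sumr_ge0// => i _; exact: ltW (hC i).1.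
exists (3 ^+ size (enum 'I_d) * (S + 1) * B).
  rewrite !mulr_gt0 ?exprn_gt0// ltr_wpDl// sumr_ge0// => i _; exact: ltW (hC i).1.
move=> l kk j m kl mk.
have e1 : (fun k => (Dj j (fun x => jp r x) (fr R (k + m)) * thr l k)%:C%C : R[i]) =
  (fun k => (Dj j (fun x => jp r x) (fr R (k + m)) * fat R l (k + m))%:C%C * (thr l k)%:C%C).
  apply/funext => k; rewrite -rmorphM; congr (_%:C)%C.
  have [b0|b0] := eqVneq (be R l k) 0; first by rewrite /thr b0 !mulr0.
  by rewrite (fat1 kl mk b0) mulr1.
rewrite e1.
have L0 : 0 < 2 ^+ l :> R by rewrite exprn_gt0.
apply: flat_le (flat_mul L0 (flat_shift m ((hC j).2 l)) (hB l)) L0.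
have -> : 2 `^ (l%:R * (r - 1)) = 2 `^ (l%:R * r) / 2 ^+ l :> R.
  by rewrite mulrBr mulr1 powRD ?pnatr_eq0 ?implybT// powRN powR_mulrn.
have -> : 2 `^ (l%:R * - r) = (2 `^ (l%:R * r))^-1 :> R by rewrite mulrN powRN.
have p0 : 0 < 2 `^ (l%:R * r) :> R by rewrite powR_gt0.
have -> : 3 ^+ size (enum 'I_d) * (C j * (2 `^ (l%:R * r) / 2 ^+ l)) * (B * (2 `^ (l%:R * r))^-1)
  = (3 ^+ size (enum 'I_d) * C j * B) * 2 ^- l by field; rewrite !gt_eqF.
rewrite ler_wpM2r ?invr_ge0 ?exprn_ge0// ler_wpM2r ?(ltW B0)// ler_wpM2l ?exprn_ge0//.
by rewrite (le_trans (S0 j))// lerDl.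
Qed.

Definition kapm m l k : R[i] := ((jf r (k + m) - jf r k) * thr l k)%:C%C.

Definition cnt m : nat := (\sum_(i < d) `|m i|)%N.

(** Walk from [k] to [k + m] along unit vectors, bounding each of the [cnt m] increments by
    [comm_step]. Every step of the induction moves a coordinate of [m] towards 0, so the box is
    never left. *)
Lemma kapm_flat : exists2 C : R, 0 < C & forall l kk m, (kk + 4 <= l)%N -> m \in box d (2 ^ kk) ->
  flat (enum 'I_d) (2 ^+ l) ((cnt m)%:R * (C * 2 ^- l)) (kapm m l).
Proof.
have [C C0 hC] := comm_step; exists C => // l kk m kl.
have L0 : 0 < 2 ^+ l :> R by rewrite exprn_gt0.
move: {2}(cnt m) (erefl (cnt m)) => n; elim: n m => [|n ih] m cm mk.
  have m0 i : m i = 0.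
    apply/eqP; rewrite -absz_eq0; move/eqP: cm; rewrite /cnt sum_nat_eq0 => /forallP /(_ i).
    by [].
  have -> : kapm m l = (fun=> 0).
    apply/funext => k; rewrite /kapm (_ : k + m = k) ?subrr ?mul0r//.
    by apply/funext => i; change (k i + m i = k i :> int); rewrite m0; lia.
  by rewrite cm mul0r; apply: flat_cst0.
have [i mi] : exists i, m i != 0.
  apply: contrapT => h; have : cnt m = 0%N.
    rewrite /cnt big1// => i _; apply/eqP; rewrite absz_eq0.
    by apply/negPn/negP => hi; apply: h; exists i.
  by rewrite cm.
have bii : basis i i = 1 by rewrite /basis eqxx.
have bij j : j != i -> basis i j = 0 by rewrite /basis eq_sym => /negbTE ->.
have cntE (m' : freq d) : (forall j, j != i -> m' j = m j) -> `|m' i|%N = `|m i|.-1 -> cnt m' = n.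
  move=> h1 h2; apply/eqP; rewrite -eqSS -cm /cnt (bigD1 i)//= [X in _ == X](bigD1 i)//= h2.
  rewrite (eq_bigr (fun j => `|m j|%N)); last by move=> j ij; rewrite h1.
  by rewrite -addSn prednK// lt0n absz_eq0.
have boxE (m' : freq d) : (forall j, j != i -> m' j = m j) -> `|m' i|%N = `|m i|.-1 -> m' \in box d (2 ^ kk).
  move=> h1 h2; apply/boxP => j; have := elimT (boxP _ _) mk j.
  have [->|ji] := eqVneq j i; last by rewrite h1.
  by move: h2; lia.
rewrite cm (_ : n.+1%:R = n%:R + 1 :> R); last by rewrite natr1.
rewrite mulrDl mul1r.
have [mp|mn] := ltP 0 (m i).
  pose m' := m - basis i.
  have h1 j : j != i -> m' j = m j by move=> ji; exact: basisB_ne.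
  have h2 : `|m' i|%N = `|m i|.-1 by change (`|(m i - basis i i : int)|%N = `|m i|.-1); rewrite bii; lia.
  have -> : kapm m l = (fun k => kapm m' l k + - (Dj i (fun x => jp r x) (fr R (k + m)) * thr l k)%:C%C).
    apply/funext => k; rewrite /kapm -rmorphN -rmorphD /Dj -fr_basis -!/(jf r _).
    by congr (_%:C)%C; rewrite /m' addrA; ring.
  apply: flat_add; last by apply: flat_opp; exact: hC kl mk.
  by have := ih m' (cntE _ h1 h2) (boxE _ h1 h2); rewrite cntE.
pose m' := m + basis i.
have h1 j : j != i -> m' j = m j by move=> ji; change (m j + basis i j = m j :> int); rewrite bij//; lia.
have h2 : `|m' i|%N = `|m i|.-1 by change (`|(m i + basis i i : int)|%N = `|m i|.-1); rewrite bii; lia.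
have -> : kapm m l = (fun k => kapm m' l k + (Dj i (fun x => jp r x) (fr R (k + m')) * thr l k)%:C%C).
  apply/funext => k; rewrite /kapm -rmorphD /Dj -fr_basis -!/(jf r _).
  have -> : k + m' - basis i = k + m by rewrite /m' addrA addrK.
  by congr (_%:C)%C; ring.
apply: flat_add; last by apply: hC kl (boxE _ h1 h2).
by have := ih m' (cntE _ h1 h2) (boxE _ h1 h2); rewrite cntE.
Qed.

Lemma kapm_supp m l : supp_box (2 ^ l.+1) (kapm m l).
Proof.
move=> k kl; rewrite /kapm /thr !rmorphM /=.
by rewrite (@be_supp R d l k kl) !mulr0.
Qed.

Lemma cnt_le m kk : m \in box d (2 ^ kk) -> (cnt m <= d * 2 ^ kk)%N.
Proof.
move=> /boxP mk; rewrite /cnt; apply: (@leq_trans (\sum_(i < d) 2 ^ kk)).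
  by apply: leq_sum => i _; have := mk i; lia.
by rewrite sum_nat_const card_ord.
Qed.

Lemma kapm_kernel : exists2 C : R, 0 < C & forall l kk m, (kk + 4 <= l)%N -> m \in box d (2 ^ kk) ->
  \int[torus R d]_x cmod (syn (NN d l) (kapm m l) x) <= C * 2 ^+ kk * 2 ^- l.
Proof.
have [C C0 hC] := kapm_flat.
pose c1 : R := (2 * (17 + 2 * d%:R)) ^+ d.
have c10 : 0 < c1.
  have h : (0 : R) <= 2 * d%:R by rewrite mulr_ge0.
  by rewrite exprn_gt0// mulr_gt0//; lra.
exists (c1 * ((d.+1)%:R * C)); first by rewrite !mulr_gt0.
move=> l kk m kl mk; have L0 : 0 < 2 ^+ l :> R by rewrite exprn_gt0.
have h0 : 0 < (d.+1)%:R * C * 2 ^+ kk * 2 ^- l by rewrite !mulr_gt0// ?exprn_gt0// invr_gt0.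
rewrite -!mulrA; apply: (le_trans (flat_kernel h0 _ _)); last by rewrite /c1 -!mulrA.
  apply: flat_le (hC l kk m kl mk) L0.
  have -> : d.+1%:R * C * 2 ^+ kk * 2 ^- l = (d.+1%:R * 2 ^+ kk) * (C * 2 ^- l) by ring.
  rewrite ler_wpM2r ?mulr_ge0 ?invr_ge0 ?(ltW C0) ?(ltW L0)//.
  rewrite -natrX -natrM ler_nat (leq_trans (cnt_le mk))// leq_mul2r leqnSn orbT//.
by apply: (supp_box_mono _ (@kapm_supp m l)); rewrite leq_exp2l//; lia.
Qed.

End CommutatorSymbol.

Section HighFrequency.
Context (R : realType) (d : nat).
Local Notation mu := (torus R d).
Variable r : R.
Local Notation be := (@be R d).
Implicit Types (k m n : freq d) (a g H : d.-tuple R -> R).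

Lemma trig_eq N M (f g : d.-tuple R -> R) : trig N f -> trig M g -> fourier f = fourier g -> f = g.
Proof.
move=> fN gM; apply: (@trig_inj _ _ (maxn N M)).
- by apply: trig_mono fN; exact: leq_maxl.
- by apply: trig_mono gM; exact: leq_maxr.
Qed.

Lemma big_uniq_sub (T : eqType) (V : nmodType) (s t : seq T) (F : T -> V) :
  uniq s -> uniq t -> {subset s <= t} -> (forall x, x \notin s -> F x = 0) ->
  \sum_(x <- t) F x = \sum_(x <- s) F x.
Proof.
move=> us ut st F0.
rewrite (bigID (fun x => x \in s))/= [X in _ + X]big1 ?addr0; last by move=> x; exact: F0.
rewrite -big_filter; apply: perm_big; apply: uniq_perm => //; first exact: filter_uniq.
by move=> x; rewrite mem_filter; apply/andP/idP => [[]//|xs]; split=> //; exact: st.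
Qed.

Lemma big_box_translate (V : nmodType) M N P m (F : freq d -> V) : m \in box d M ->
  (M + N <= P)%N -> (forall k, k \notin box d N -> F k = 0) ->
  \sum_(n <- box d P) F (n - m) = \sum_(k <- box d N) F k.
Proof.
move=> mM MNP F0.
have -> : \sum_(k <- box d N) F k = \sum_(n <- map (fun k => k + m) (box d N)) F (n - m).
  by rewrite [RHS]big_map; apply: eq_bigr => k _; rewrite addrK.
apply: big_uniq_sub.
- by rewrite map_inj_uniq ?box_uniq//; exact: addIr.
- exact: box_uniq.
- move=> _ /mapP[k kN ->]; rewrite addrC; apply: sub_box (boxD mM kN); exact: MNP.
- move=> n nN; apply: F0; apply: contra nN => nN; apply/mapP; exists (n - m) => //.
  by rewrite subrK.
Qed.

Lemma csyn_conv N (c : freq d -> R[i]) H x : bmf H ->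
  \sum_(k <- box d N) c k * fourier H k * ek k x =
  cint mu (fun y => syn N c (tsub x y) * (H y)%:C%C).
Proof.
move=> bH; have iH := bmf_integrable mu bH.
have cH : cbmf (fun y => (H y)%:C%C : R[i]) by exact: cbmf_real.
transitivity (\sum_(k <- box d N) cint mu (fun y => (c k * ek k x) * ((H y)%:C%C * ek (- k) y))).
  apply: eq_bigr => k _; rewrite cintZ; last by apply: cbmfM => //; exact: cbmf_ek.
  by rewrite -fourierE//; ring.
rewrite -cint_sum; last first.
  by move=> k; apply: cbmfM; [exact: cbmf_cst|apply: cbmfM => //; exact: cbmf_ek].
congr (cint mu _); apply/funext => y; rewrite /syn mulr_suml; apply: eq_bigr => k _.
by rewrite ek_tsub; ring.
Qed.

(** The dominating kernel has L^1 norm at most b kap times the number of frequencies, and (2 2^kk +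
    1)^d <= 3^d 2^(kk d). *)
Lemma kernel_family_Lb q kk b B (c : freq d -> R) (K : freq d -> d.-tuple R -> R) H D kap :
  1 <= q -> (forall m, PL (K m)) -> (forall m x, 0 <= K m x) -> (forall m, 0 <= c m <= b) ->
  (forall m, m \in box d (2 ^ kk) -> \int[mu]_x K m x <= kap) ->
  bmf H -> bmf D -> Lb mu q H B ->
  (forall x, `|D x| <= \int[mu]_y ((\sum_(m <- box d (2 ^ kk)) c m * K m (tsub x y)) * `|H y|)) ->
  Lb mu q D ((3 ^+ d * 2 ^+ (kk * d) * (b * kap)) * B).
Proof.
move=> q1 PK K0 cb Kk bH bD HB Dx.
pose Hk x := \sum_(m <- box d (2 ^ kk)) c m * K m x.
have PHk : PL Hk by apply: PL_sum => m; apply: PL_M => //; exact: PL_cst.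
have Hk0 x : 0 <= Hk x.
  by apply: sumr_ge0 => m _; rewrite mulr_ge0//; have /andP[] := cb m.
have bK m : bmf (K m) by exact: PL_bmf.
have kap0 : 0 <= kap.
  apply: (le_trans _ (Kk 0 (box0 d _))).
  by apply: Rintegral_ge0 => x _; exact: K0.
have b0 : 0 <= b by have /andP[h1 h2] := cb 0; exact: le_trans h2.
apply: Lb_le (young_general q1 PHk Hk0 bH bD Dx HB).
rewrite ler_wpM2r ?(Lb_ge0 HB)// /Hk Int_sum; last by move=> m; apply: bmfM => //; exact: bmf_cst.
apply: (@le_trans _ _ (\sum_(m <- box d (2 ^ kk)) b * kap)).
  rewrite big_seq [X in _ <= X]big_seq; apply: ler_sum => m mk; rewrite IntZ//.
  have /andP[h1 h2] := cb m; apply: ler_pM => //; last exact: Kk.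
  by apply: Rintegral_ge0 => x _; exact: K0.
rewrite big_const_seq count_predT.
have -> : forall n : nat, iter n (+%R (b * kap)) 0 = n%:R * (b * kap).
  by elim=> [|n ih] /=; rewrite ?mul0r// ih -nat1r mulrDl mul1r.
rewrite ler_wpM2r ?mulr_ge0// size_box -!natrX -natrM ler_nat expnM -expnMn.
have k0 : (0 < 2 ^ kk)%N by rewrite expn_gt0.
have h : ((2 ^ kk).*2.+1 <= 3 * 2 ^ kk)%N by lia.
by case: (posnP d) => [->|d0] //; rewrite leq_exp2r.
Qed.

Lemma Int_abs_le (f h : d.-tuple R -> R) : bmf f -> bmf h -> (forall x, `|f x| <= h x) ->
  `|\int[mu]_x f x| <= \int[mu]_x h x.
Proof.
move=> bf bh fh; rewrite ler_norml -mulN1r -IntZ//; apply/andP; split; apply: le_Int => //.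
- by apply: bmfM => //; exact: bmf_cst.
- by move=> x; rewrite mulN1r; have := fh x; rewrite ler_norml => /andP[].
- by move=> x; exact: le_trans (ler_norm _) (fh x).
Qed.

(* The commutator has the symbol <k + m>^r - <k>^r on the frequencies m of a; as |m| <= d 2^kk it is a sum of
   at most d 2^kk increments along unit vectors, each of which gains a factor 2^-l. *)
Lemma core_high q : 1 <= q -> exists2 C : R, 0 < C & forall kk l P a b H B,
  (kk + 4 <= l)%N -> (2 ^ kk + NN d l <= P)%N -> trig (2 ^ kk) a -> Lb mu q a b ->
  bmf H -> Lb mu q H B ->
  Lb mu q (fun x => Jop r P (fun x => a x * blk be (- r) l H x) x - a x * blk be 0 l H x)
    (C * (2 ^+ (kk * d.+1) * 2 ^- l) * b * B).
Proof.
move=> q1; have [C C0 hC] := kapm_kernel d r.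
exists (2 * 3 ^+ d * C); first by rewrite !mulr_gt0// exprn_gt0.
move=> kk l P a b H B kl kP aN ab bH HB.
have iH := bmf_integrable mu bH; have b0 := Lb_ge0 ab.
have bl0 := blk_trig (- r) l (block_be R d) iH.
have bl1 := blk_trig 0 l (block_be R d) iH.
have tag : trig P (fun x => a x * blk be (- r) l H x).
  by apply: (trig_mono kP); exact: trigM.
(* The kernel of the commutator. For each frequency [m] of [a] it is a convolution kernel modulated
   by [ek m x]; after taking absolute values only convolutions remain, with coefficients |fourier a
   m| <= 2 b. *)
pose G x y : R[i] := \sum_(m <- box d (2 ^ kk)) fourier a m * ek m x * syn (NN d l) (kapm r m l) (tsub x y).
pose D x := Jop r P (fun x => a x * blk be (- r) l H x) x - a x * blk be 0 l H x.
have cG x : cbmf (fun y => G x y).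
  apply: cbmf_sum => m; apply: cbmfM; first exact: cbmf_cst.
  have [h1 h2] := cbmf_syn (NN d l) (kapm r m l).
  by split; [exact: (bmf_tsubr x h1)|exact: (bmf_tsubr x h2)].
have DE x : (D x)%:C%C = cint mu (fun y => G x y * (H y)%:C%C).
  have -> : cint mu (fun y => G x y * (H y)%:C%C) =
    \sum_(m <- box d (2 ^ kk)) fourier a m * ek m x *
      \sum_(k <- box d (NN d l)) kapm r m l k * fourier H k * ek k x.
    transitivity (\sum_(m <- box d (2 ^ kk)) cint mu (fun y => (fourier a m * ek m x) *
        (syn (NN d l) (kapm r m l) (tsub x y) * (H y)%:C%C))).
      rewrite -cint_sum; last first.
        move=> m; apply: cbmfM; first exact: cbmf_cst.
        apply: cbmfM; last exact: cbmf_real.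
        have [h1 h2] := cbmf_syn (NN d l) (kapm r m l).
        by split; [exact: (bmf_tsubr x h1)|exact: (bmf_tsubr x h2)].
      congr (cint mu _); apply/funext => y; rewrite /G mulr_suml; apply: eq_bigr => m _.
      by rewrite mulrA.
    apply: eq_bigr => m _; rewrite cintZ; first by rewrite csyn_conv.
    apply: cbmfM; last exact: cbmf_real.
    have [h1 h2] := cbmf_syn (NN d l) (kapm r m l).
    by split; [exact: (bmf_tsubr x h1)|exact: (bmf_tsubr x h2)].
  rewrite /D rmorphB rmorphM /= reS_syn; last exact: Jop_herm tag.
  have -> : syn P (fun k => (jf r k)%:C%C * fourier (fun x => a x * blk be (- r) l H x) k) x =
    \sum_(m <- box d (2 ^ kk)) fourier a m * ek m x *
      \sum_(k <- box d (NN d l)) (jf r (k + m) * thr r l k)%:C%C * fourier H k * ek k x.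
    transitivity (\sum_(n <- box d P) \sum_(m <- box d (2 ^ kk))
       fourier a m * ek m x * ((jf r ((n - m) + m) * thr r l (n - m))%:C%C * fourier H (n - m) * ek (n - m) x)).
      apply: eq_bigr => n _.
      have := fourierM n aN (trig_integrable bl0); rewrite /= => ->.
      rewrite mulr_sumr mulr_suml; apply: eq_bigr => m _.
      rewrite blk_fourier//; last exact: block_be.
      rewrite subrK /thr; have -> : ek n x = ek m x * ek (n - m) x :> R[i] by rewrite -ekD addrC subrK.
      by rewrite !rmorphM /=; ring.
    rewrite exchange_big /=; apply: eq_big_seq => m mk.
    rewrite -mulr_sumr; congr (_ * _).
    rewrite (@big_box_translate _ (2 ^ kk) (NN d l) P m (fun k => (jf r (k + m) * thr r l k)%:C%C * fourier H k * ek k x))//.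
    have [_ _ _ ts] := block_be R d.
    by move=> k kN; rewrite /thr !rmorphM /= (supp_NN (ts l) kN) !mulr0 !mul0r.
  rewrite (trig_rep aN) (trig_rep bl1) /syn mulr_suml -sumrB.
  apply: eq_bigr => m _; rewrite -mulrBr; congr (_ * _); rewrite -sumrB.
  apply: eq_bigr => k _; rewrite blk_fourier//; last exact: block_be.
  rewrite -!mulrBl; congr (_ * _ * _); rewrite /kapm mulrBl rmorphB; congr (_ - _).
  by rewrite /thr mulrA -jpD subrr.
have DE2 x : D x = \int[mu]_y (complex.Re (G x y) * H y).
  have := congr1 (@complex.Re R) (DE x); rewrite /= => ->.
  by apply: eq_Rintegral => y _; rewrite cReM /= mulr0 subr0.
have bD : bmf D.
  apply: bmfB; first by apply: trig_bmf; exact: Jop_trig tag.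
  by apply: bmfM; [exact: trig_bmf aN|exact: trig_bmf bl1].
have := @kernel_family_Lb q kk (2 * b) B (fun m => cmod (fourier a m)) (fun m x => cmod (syn (NN d l) (kapm r m l) x)) H D (C * 2 ^+ kk * 2 ^- l) q1.
have -> : 3 ^+ d * 2 ^+ (kk * d) * (2 * b * (C * 2 ^+ kk * 2 ^- l)) * B = 2 * 3 ^+ d * C * (2 ^+ (kk * d.+1) * 2 ^- l) * b * B.
  by rewrite mulnS exprD; ring.
apply => //.
- by move=> m; exact: PL_cmod_syn.
- by move=> m x; exact: cmod_ge0.
- by move=> m; rewrite cmod_ge0 /=; exact: fourier_bound ab.
- by move=> m mk; exact: hC.
- move=> x; rewrite DE2.
  have bK : bmf (fun y => \sum_(m <- box d (2 ^ kk)) cmod (fourier a m) * cmod (syn (NN d l) (kapm r m l) (tsub x y))).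
    apply: bmf_sum => m; apply: bmfM; first exact: bmf_cst.
    exact: (bmf_tsubr x (PL_bmf (PL_cmod_syn (NN d l) (kapm r m l)))).
  apply: Int_abs_le.
  + by apply: bmfM => //; have [] := cG x.
  + by apply: bmfM => //; exact: bmf_norm.
  + move=> y; rewrite normrM ler_wpM2r// (le_trans (normRe_cmod _))// (le_trans (cmod_sum _ _))//.
    by apply: ler_sum => m _; rewrite !cmodM cmod_ek mulr1.
Qed.

End HighFrequency.

Section ProductEstimate.
Context (R : realType) (d : nat).
Local Notation mu := (torus R d).
Local Notation be := (@be R d).
Local Notation fat := (@fat R d).
Implicit Types (a g H : d.-tuple R -> R) (l kk N P n : nat).

Lemma count6 kk : ((kk + 5).+1 <= 6 * kk.+1)%N.
Proof. by lia. Qed.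

Lemma countK kk : (d.+1 * kk + 4 <= (d + 5) * kk.+1)%N.
Proof. by nia. Qed.

Lemma countK4 kk : (kk + 4 <= d.+1 * kk + 4)%N.
Proof. by nia. Qed.

Lemma p2D (x y : R) : 2 `^ (x + y) = 2 `^ x * 2 `^ y :> R.
Proof. by rewrite powRD// pnatr_eq0 implybT. Qed.

Lemma p2_gt0 (x : R) : 0 < 2 `^ x :> R.
Proof. by rewrite powR_gt0. Qed.

Lemma p2_ge0 (x : R) : 0 <= 2 `^ x :> R.
Proof. exact: powR_ge0. Qed.

Lemma p2_le (x y : R) : x <= y -> 2 `^ x <= 2 `^ y :> R.
Proof. by move=> xy; apply: ler_powR => //; rewrite ler1n. Qed.

Lemma p2_ge1 (x : R) : 0 <= x -> 1 <= 2 `^ x :> R.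
Proof. by move=> x0; have := p2_le x0; rewrite powRr0. Qed.

(** The blocks telescope to [Vl R n], which is 1 on the spectrum of [g]. *)
Lemma be_decomp rho n N g x : trig N g -> (N <= 2 ^ n)%N ->
  Jop rho N g x = \sum_(m < n.+1) blk be rho m g x.
Proof.
move=> gN Nn; have ig := trig_integrable gN.
suff -> : Jop rho N g = (fun x => \sum_(m < n.+1) blk be rho m g x) by [].
apply: (@trig_eq _ _ N (NN d n)); first exact: Jop_trig gN.
  apply: trig_sum => m; apply: trig_mono (be_trig rho m ig).
  by rewrite (leq_trans _ (leq_addr _ _))// leq_exp2l//; have := ltn_ord m; lia.
apply/funext => k; rewrite Jop_fourier//.
have := fourier_sum (index_enum 'I_n.+1) (F := fun m : 'I_n.+1 => blk be rho m g) k.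
move=> /(_ (fun m => trig_integrable (be_trig rho m ig))) [_ ->].
transitivity ((jf rho k * Vl R n k)%:C%C * fourier g k).
  have [kN|kN] := boolP (k \in box d N).
    by rewrite Vl1 ?mulr1//; apply: sub_box kN.
  by rewrite (trig_fourier0 gN kN) !mulr0.
rewrite -sum_be mulr_sumr rmorph_sum mulr_suml /=; apply: eq_bigr => m _.
by rewrite blk_fourier//; exact: block_be.
Qed.

Lemma Jop0 N g : trig N g -> Jop 0 N g = g.
Proof.
move=> gN; apply: (@trig_eq _ _ N N) => //; first exact: Jop_trig.
by apply/funext => k; rewrite Jop_fourier// /jf jp0 mul1r.
Qed.

(** Bernstein's inequality on each of the [kk.+1] blocks. The number of blocks is a harmless factor,
    because the Besov exponent strictly exceeds theta in the end. *)
Lemma trig_sup q : 1 <= q -> exists2 C : R, 0 < C & forall kk a b, trig (2 ^ kk) a -> Lb mu q a b ->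
  forall x, `|a x| <= C * (kk.+1)%:R * 2 `^ (kk%:R * (d%:R / q)) * b.
Proof.
move=> q1; have [C C0 hC] := blk_sup 0 q1 (block_be R d).
have q0 : 0 < q by exact: lt_le_trans q1.
exists C => // kk a b aN ab x; have b0 := Lb_ge0 ab.
rewrite -(Jop0 aN) (@be_decomp _ kk)//.
apply: (le_trans (ler_norm_sum _ _ _)).
apply: (@le_trans _ _ (\sum_(m < kk.+1) C * 2 `^ (kk%:R * (d%:R / q)) * b)).
  apply: ler_sum => m _.
  apply: (le_trans (hC m a b (trig_bmf aN) ab x)).
  rewrite mulr0 powRr0 mulr1 ler_wpM2r// ler_wpM2l ?(ltW C0)// p2_le// ler_wpM2r ?divr_ge0 ?(ltW q0)//.
  by rewrite ler_nat -ltnS.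
rewrite sumr_const card_ord -[_ *+ kk.+1]mulr_natl.
by rewrite [X in X <= _](_ : _ = C * kk.+1%:R * 2 `^ (kk%:R * (d%:R / q)) * b)//; ring.
Qed.

Lemma Lb_sum_in p (I : eqType) (s : seq I) (F : I -> d.-tuple R -> R) (c : I -> R) : 1 <= p ->
  (forall i, i \in s -> Lb mu p (F i) (c i)) ->
  Lb mu p (fun x => \sum_(i <- s) F i x) (\sum_(i <- s) c i).
Proof.
move=> p1; elim: s => [|i s ih] h.
  by rewrite big_nil; under eq_fun do rewrite big_nil; apply: Lb_cst0; rewrite ?(lt_le_trans _ p1).
rewrite big_cons; under eq_fun do rewrite big_cons.
apply: Lb_add => //; first by apply: h; rewrite inE eqxx.
by apply: ih => j js; apply: h; rewrite inE js orbT.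
Qed.

Variables (q r theta : R).
Hypothesis q2 : 2 <= q.
Hypothesis th_d : d%:R / q <= theta.
Hypothesis th_r : `|r| <= theta.

Let q1 : 1 <= q.
Proof. by rewrite (le_trans _ q2)// ler1n. Qed.
Let q0 : 0 < q.
Proof. exact: lt_le_trans q1. Qed.
Let dq0 : 0 <= d%:R / q.
Proof. by rewrite divr_ge0// ltW. Qed.
Let th0 : 0 <= theta.
Proof. exact: le_trans th_d. Qed.

(** m r - l r <= (K - l) r <= (K - l) theta, and l d / q <= l theta. *)
Lemma low_exponent_pos (m l K : R) : 0 <= r -> 0 <= m <= K -> 0 <= l <= K ->
  m * r + (l * - r + l * (d%:R / q)) <= K * theta.
Proof.
move=> r0 /andP[m0 mK] /andP[l0 lK].
have rt : r <= theta by rewrite (le_trans (ler_norm _) th_r).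
have h1 : m * r <= K * r by rewrite ler_wpM2r.
have h2 : (K - l) * r <= (K - l) * theta by rewrite ler_wpM2l// subr_ge0.
have h3 : l * (d%:R / q) <= l * theta by rewrite ler_wpM2l.
by lra.
Qed.

Lemma low_exponent_neg (m l K : R) : r <= 0 -> 0 <= m <= K -> 0 <= l <= K ->
  m * r + (m * (d%:R / q) + l * - r) <= K * theta.
Proof.
move=> r0 /andP[m0 mK] /andP[l0 lK].
have rt : - r <= theta by rewrite -(ler0_norm r0).
have h3 : m * (d%:R / q) <= m * theta by rewrite ler_wpM2l.
have h4 : K * theta >= m * theta by rewrite ler_wpM2r.
have h5 : K * theta >= l * theta by rewrite ler_wpM2r.
have [lm|lm] := leP l m.
  have : (m - l) * - r >= 0 by rewrite mulr_ge0 ?subr_ge0// oppr_ge0.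
  by lra.
have : (l - m) * - r <= (l - m) * theta by rewrite ler_wpM2l// subr_ge0 ltW.
by lra.
Qed.

Definition gblock l H := blk be (- r) l H.

(** The product has frequencies up to 2^(kk + 5), so at most kk + 6 output blocks occur. For r >= 0
    Bernstein's inequality is applied to the factor [gblock]; for r < 0 to the output block, after
    the product has been put in L^(q/2). The opposite choices could produce the exponent |r| + d/q
    instead of the maximum of the two. *)
Lemma low_block : exists2 C : R, 0 < C & forall kk l P a b H B, (l < kk + 4)%N ->
  (2 ^ kk + 2 ^ l.+1 <= P)%N -> trig (2 ^ kk) a -> Lb mu q a b -> bmf H -> Lb mu q H B ->
  Lb mu q (Jop r P (fun x => a x * gblock l H x)) (C * (kk.+1)%:R * 2 `^ (kk%:R * theta) * (b * B)).
Proof.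
have bb := block_be R d.
have [C1 C10 h1] := blk_Lb (- r) bb; have [C2 C20 h2] := blk_sup (- r) q1 bb.
have [C3 C30 h3] := blk_Lb r bb; have [C4 C40 h4] := blk_half r q2 bb.
exists (6 * (C3 * C2 + C4 * C1) * 2 `^ (5 * theta)).
  by rewrite !mulr_gt0 ?p2_gt0// addr_gt0// mulr_gt0.
move=> kk l P a b H B lk kP aN ab bH HB.
have iH := bmf_integrable mu bH; have b0 := Lb_ge0 ab; have B0 := Lb_ge0 HB.
have gN : trig (2 ^ l.+1) (gblock l H) := be_trig (- r) l iH.
have tag : trig (2 ^ kk + 2 ^ l.+1) (fun x => a x * gblock l H x) by exact: trigM.
have tagP := trig_mono kP tag.
have bag := trig_bmf tag.
have mg : measurable_fun setT (gblock l H) by have [] := trig_bmf gN.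
pose X := fun x => a x * gblock l H x.
have -> : Jop r P X = (fun x => \sum_(m < (kk + 5).+1) blk be r m X x).
  have -> : Jop r P X = Jop r (2 ^ kk + 2 ^ l.+1) X.
    apply: (@trig_eq _ _ P (2 ^ kk + 2 ^ l.+1)); [exact: Jop_trig|exact: Jop_trig|].
    by apply/funext => k; rewrite !Jop_fourier.
  apply/funext => x; apply: be_decomp => //.
  have h : (2 ^ l.+1 <= 2 ^ (kk + 4))%N by rewrite leq_exp2l//; lia.
  have h' : (2 ^ kk <= 2 ^ (kk + 4))%N by rewrite leq_exp2l// leq_addr.
  have e5 : (kk + 5 = (kk + 4).+1)%N by rewrite addnS.
  by rewrite e5 [X in (_ <= X)%N]expnS [X in (_ <= X)%N]mul2n -addnn leq_add.
have e5' : 5 + kk%:R = (5 + kk)%:R :> R by rewrite natrD.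
have key (m : 'I_(kk + 5).+1) : Lb mu q (blk be r m X) ((C3 * C2 + C4 * C1) * 2 `^ (5 * theta) * 2 `^ (kk%:R * theta) * (b * B)).
  have mK : 0 <= ((m : nat)%:R : R) <= 5 + kk%:R.
    by rewrite e5' ler0n ler_nat (addnC 5) -ltnS ltn_ord.
  have lK : 0 <= (l%:R : R) <= 5 + kk%:R.
    by rewrite e5' ler0n ler_nat (addnC 5) (leq_trans (ltnW lk))// leq_add2l.
  rewrite -(mulrA _ (2 `^ (5 * theta))) -p2D -mulrDl.
  have [r0|r0] := leP 0 r.
    have s2 := h2 l H B bH HB.
    have Xb : Lb mu q X ((C2 * 2 `^ (l%:R * - r) * 2 `^ (l%:R * (d%:R / q)) * B) * b).
      have := Lb_mul_sup q0 mg s2 ab; rewrite /X; under eq_fun do rewrite mulrC.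
      by [].
    apply: Lb_le (h3 m q X _ q1 bag Xb).
    have -> : C3 * 2 `^ ((m : nat)%:R * r) * (C2 * 2 `^ (l%:R * - r) * 2 `^ (l%:R * (d%:R / q)) * B * b)
      = C3 * C2 * (2 `^ ((m : nat)%:R * r) * (2 `^ (l%:R * - r) * 2 `^ (l%:R * (d%:R / q)))) * (b * B) by ring.
    rewrite -!p2D ler_wpM2r ?mulr_ge0//; apply: ler_pM.
    - by rewrite mulr_ge0// ltW.
    - exact: p2_ge0.
    - by rewrite lerDl mulr_ge0// ltW.
    - by apply: p2_le; exact: low_exponent_pos.
  have Xb := Lb_mul_half q0 ab (h1 l q H B q1 bH HB).
  apply: Lb_le (h4 m X _ bag Xb).
  have -> : C4 * 2 `^ ((m : nat)%:R * r) * 2 `^ ((m : nat)%:R * (d%:R / q)) * (b * (C1 * 2 `^ (l%:R * - r) * B))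
    = C4 * C1 * (2 `^ ((m : nat)%:R * r) * (2 `^ ((m : nat)%:R * (d%:R / q)) * 2 `^ (l%:R * - r))) * (b * B) by ring.
  rewrite -!p2D ler_wpM2r ?mulr_ge0//; apply: ler_pM.
  - by rewrite mulr_ge0// ltW.
  - exact: p2_ge0.
  - by rewrite lerDr mulr_ge0// ltW.
  - by apply: p2_le; apply: low_exponent_neg => //; exact: ltW.
apply: Lb_le (Lb_sum (index_enum 'I_(kk + 5).+1) q1 key).
rewrite sumr_const card_ord -[_ *+ _]mulr_natl.
set Y := (C3 * C2 + C4 * C1) * _ * _ * _.
have -> : 6 * (C3 * C2 + C4 * C1) * 2 `^ (5 * theta) * kk.+1%:R * 2 `^ (kk%:R * theta) * (b * B) = (6 * kk.+1%:R) * Y.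
  by rewrite /Y; ring.
rewrite ler_wpM2r//; first by rewrite /Y !mulr_ge0 ?p2_ge0// addr_ge0// mulr_ge0// ltW.
by rewrite -natrM ler_nat count6.
Qed.

(** Here the product stays in the annulus 2^l, so the potential of order [r] is [blk fat r l] and
    2^(l r) cancels the 2^(- l r) of [gblock]; only the supremum of [a] is left. *)
Lemma mid_block : exists2 C : R, 0 < C & forall kk l P a b H B, (kk + 4 <= l)%N ->
  (2 ^ kk + 2 ^ l.+1 <= P)%N -> trig (2 ^ kk) a -> Lb mu q a b -> bmf H -> Lb mu q H B ->
  Lb mu q (Jop r P (fun x => a x * gblock l H x)) (C * (kk.+1)%:R * 2 `^ (kk%:R * theta) * (b * B)).
Proof.
have bb := block_be R d; have bf := block_fat R d.
have [C1 C10 h1] := blk_Lb (- r) bb; have [C2 C20 h2] := trig_sup q1.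
have [C3 C30 h3] := blk_Lb r bf.
exists (C3 * C2 * C1); first by rewrite !mulr_gt0.
move=> kk l P a b H B lk kP aN ab bH HB.
have iH := bmf_integrable mu bH; have b0 := Lb_ge0 ab; have B0 := Lb_ge0 HB.
have gN : trig (2 ^ l.+1) (gblock l H) := be_trig (- r) l iH.
have tag : trig (2 ^ kk + 2 ^ l.+1) (fun x => a x * gblock l H x) by exact: trigM.
have tagP := trig_mono kP tag; have bag := trig_bmf tag.
pose X := fun x => a x * gblock l H x.
have -> : Jop r P X = blk fat r l X.
  apply: (@trig_eq _ _ P (NN d l)); [exact: Jop_trig|by apply: blk_trig => //; exact: trig_integrable tag|].
  apply/funext => k; rewrite Jop_fourier// blk_fourier//; last exact: trig_integrable tag.
  have [f1|f1] := eqVneq (fat l k) 1; first by rewrite f1 mulr1.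
  suff -> : fourier X k = 0 by rewrite !mulr0.
  have := fourierM k aN (trig_integrable gN); rewrite /= => ->.
  rewrite big_seq big1// => m mk.
  rewrite blk_fourier// rmorphM /=.
  have -> : be l (k - m) = 0; last by rewrite mulr0 mul0r mulr0.
  by apply/eqP; apply: contraNT f1 => hb; rewrite -(fat1 lk mk hb) subrK.
have ma : measurable_fun setT a by have [] := trig_bmf aN.
have Xb := Lb_mul_sup q0 ma (h2 kk a b aN ab) (h1 l q H B q1 bH HB).
apply: Lb_le (h3 l q X _ q1 bag Xb).
have -> : C3 * 2 `^ (l%:R * r) * (C2 * kk.+1%:R * 2 `^ (kk%:R * (d%:R / q)) * b * (C1 * 2 `^ (l%:R * - r) * B)) =
  C3 * C2 * C1 * kk.+1%:R * (2 `^ (kk%:R * (d%:R / q))) * (b * B) * (2 `^ (l%:R * r) * 2 `^ (l%:R * - r)) by ring.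
rewrite -p2D mulrN subrr powRr0 mulr1; apply: ler_wpM2r; first by rewrite mulr_ge0.
apply: ler_wpM2l; first by rewrite !mulr_ge0// ltW.
by apply: p2_le; rewrite ler_wpM2l.
Qed.

Lemma geo_tail (K n : nat) : \sum_(K <= l < n) 2 ^- l <= 2 * 2 ^- K :> R.
Proof.
have [nK|Kn] := leqP n K; first by rewrite big_geq// mulr_ge0// invr_ge0 exprn_ge0.
suff h : \sum_(K <= l < n) 2 ^- l = 2 * 2 ^- K - 2 * 2 ^- n :> R.
  by rewrite h lerBlDr lerDl mulr_ge0// invr_ge0 exprn_ge0.
elim: n Kn => // n ih; rewrite ltnS leq_eqVlt => /orP[/eqP <-|Kn].
  by rewrite big_nat1 exprS; field; rewrite expf_neq0.
rewrite big_nat_recr ?ih//=; last exact: ltnW.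
by rewrite exprS; field; rewrite !expf_neq0.
Qed.

Lemma Jop_sum N (I : Type) (s : seq I) (F : I -> d.-tuple R -> R) x : (forall i, trig N (F i)) ->
  Jop r N (fun x => \sum_(i <- s) F i x) x = \sum_(i <- s) Jop r N (F i) x.
Proof.
move=> FN; have sF : trig N (fun x => \sum_(i <- s) F i x) by exact: trig_sum.
suff -> : Jop r N (fun x => \sum_(i <- s) F i x) = (fun x => \sum_(i <- s) Jop r N (F i) x) by [].
apply: (@trig_eq _ _ N N); [exact: Jop_trig|by apply: trig_sum => i; exact: Jop_trig|].
apply/funext => k; rewrite Jop_fourier//.
have [_ ->] := fourier_sum s k (fun i => trig_integrable (FN i)).
have [_ ->] := fourier_sum s k (fun i => trig_integrable (Jop_trig r (FN i))).
by rewrite mulr_sumr; apply: eq_bigr => i _; rewrite Jop_fourier.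
Qed.

(** Commutators are summed over the blocks of H = <D>^r g, beside the term a H in which the
    potential has been moved past [a]. One factor [kk.+1] comes from the supremum bounds and output
    blocks, the other from the number of levels below [K]. *)
Theorem product_estimate : exists2 C : R, 0 < C & forall kk N P a b g B,
  trig (2 ^ kk) a -> Lb mu q a b -> trig N g -> Lb mu q (Jop r N g) B -> (2 ^ kk + N <= P)%N ->
  Lb mu q (Jop r P (fun x => a x * g x)) (C * (kk.+1)%:R ^+ 2 * 2 `^ (kk%:R * theta) * (b * B)).
Proof.
have [C1 C10 h1] := low_block; have [C2 C20 h2] := mid_block.
have [C3 C30 h3] := trig_sup q1; have [C4 C40 h4] := blk_Lb 0 (block_be R d).
have [C5 C50 h5] := @core_high R d r q q1.
exists ((d + 5)%:R * (C1 + C2 + C3 * C4) + C3 + C5).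
  by rewrite !addr_gt0// mulr_gt0 ?ltr0n ?addnS// !addr_gt0// mulr_gt0.
move=> kk N P a b g B aN ab gN gB kP.
pose H := Jop r N g; have HN : trig N H by exact: Jop_trig.
have bH := trig_bmf HN; have iH := trig_integrable HN.
have b0 := Lb_ge0 ab; have B0 := Lb_ge0 gB.
(* From level [K] on, the bounds 2^(kk (d + 1) - l) of [core_high] add up to a constant independent
   of [kk]. Below [K] the two halves of the commutator are bounded separately, at the cost of K <=
   (d + 5) (kk + 1) levels. *)
pose K := (d.+1 * kk + 4)%N; pose n := (K + N)%N.
have KE : (K <= (d + 5) * kk.+1)%N by exact: countK.
have KE2 : (kk + 4 <= K)%N by exact: countK4.
have Kn : (K <= n)%N by exact: leq_addr.
have NNn : (N <= n)%N by exact: leq_addl.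
have Nn : (N <= 2 ^ n)%N.
  by rewrite (leq_trans (ltnW (ltn_expl N (ltnSn 1))))// leq_exp2l.
pose Q := (P + (2 ^ kk + NN d n))%N.
have aH (l : nat) : trig (2 ^ kk + 2 ^ l.+1) (fun x => a x * gblock l H x).
  by apply: trigM => //; exact: be_trig.
have lQ (l : nat) : (l <= n)%N -> (2 ^ kk + NN d l <= Q)%N.
  by move=> ln; rewrite (leq_trans _ (leq_addl _ _))// leq_add2l leq_add2r leq_exp2l// !ltnS.
have lQ' (l : nat) : (l <= n)%N -> (2 ^ kk + 2 ^ l.+1 <= Q)%N.
  move=> ln; apply: leq_trans (lQ l ln); rewrite leq_add2l (leq_trans _ (leq_addr _ _))// leq_exp2l//.
  exact: leqW (leqW (leqnn _)).
have PQ : (P <= Q)%N by exact: leq_addr.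
have tag : trig P (fun x => a x * g x) by apply: (trig_mono kP); exact: trigM.
pose T l := Jop r Q (fun x => a x * gblock l H x).
pose Z l := blk be 0 l H.
have gE x : g x = \sum_(l < n.+1) gblock l H x.
  rewrite -(@be_decomp _ n N)//.
  suff -> : Jop (- r) N H = g by [].
  apply: (@trig_eq _ _ N N) => //; first exact: Jop_trig.
  apply/funext => k; rewrite !Jop_fourier// mulrA -rmorphM /= /jf -jpD addNr jp0 mul1r.
  by [].
have HE x : H x = \sum_(l < n.+1) Z l x by rewrite -(@be_decomp _ n N)// Jop0.
(* By [gE] the sum of the [T l] is the left-hand side, and by [HE] the sum of the a Z_l is a H. *)
have -> : Jop r P (fun x => a x * g x) = (fun x => a x * H x +
   (\sum_(0 <= l < K) (T l x - a x * Z l x) + \sum_(K <= l < n.+1) (T l x - a x * Z l x))).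
  have -> : Jop r P (fun x => a x * g x) = Jop r Q (fun x => a x * g x).
    apply: (@trig_eq _ _ P Q); [exact: Jop_trig|by apply: Jop_trig; exact: trig_mono tag|].
    by apply/funext => k; rewrite !Jop_fourier//; exact: trig_mono tag.
  apply/funext => x.
  rewrite -big_cat_nat ?leq0n//; last exact: leqW.
  rewrite big_mkord sumrB -mulr_sumr -HE addrC subrK.
  rewrite /T -(@Jop_sum Q _ (index_enum 'I_n.+1) (fun l : 'I_n.+1 => fun x => a x * gblock l H x)).
    by congr (Jop r Q _ x); apply/funext => y; rewrite gE mulr_sumr.
  by move=> l; apply: trig_mono (aH l); apply: lQ'; rewrite -ltnS.
pose E := (kk.+1)%:R ^+ 2 * 2 `^ (kk%:R * theta) * (b * B).
have E0 : 0 <= E by rewrite !mulr_ge0 ?p2_ge0 ?exprn_ge0.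
have k1 : 1 <= (kk.+1)%:R :> R by rewrite ler1n.
have kE : (kk.+1)%:R * 2 `^ (kk%:R * theta) * (b * B) <= E.
  have -> : E = kk.+1%:R * (kk.+1%:R * 2 `^ (kk%:R * theta) * (b * B)) by rewrite /E; ring.
  by rewrite ler_peMl// !mulr_ge0 ?p2_ge0.
have oneE : b * B <= E.
  apply: le_trans kE; rewrite ler_peMl ?mulr_ge0// mulr_ege1//.
  by apply: p2_ge1; rewrite mulr_ge0.
have supa x : `|a x| <= C3 * kk.+1%:R * 2 `^ (kk%:R * theta) * b.
  apply: (le_trans (h3 kk a b aN ab x)); rewrite ler_wpM2r// ler_wpM2l ?mulr_ge0 ?(ltW C30)//.
  by apply: p2_le; rewrite ler_wpM2l.
have ma : measurable_fun setT a by have [] := trig_bmf aN.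
have b1 : Lb mu q (fun x => a x * H x) (C3 * E).
  apply: Lb_le (Lb_mul_sup q0 ma supa gB).
  have -> : C3 * kk.+1%:R * 2 `^ (kk%:R * theta) * b * B = C3 * (kk.+1%:R * 2 `^ (kk%:R * theta) * (b * B)) by ring.
  by rewrite ler_wpM2l// ltW.
have b2 : Lb mu q (fun x => \sum_(0 <= l < K) (T l x - a x * Z l x)) ((d + 5)%:R * (C1 + C2 + C3 * C4) * E).
  have step l : l \in index_iota 0 K -> Lb mu q (fun x => T l x - a x * Z l x)
      ((C1 + C2 + C3 * C4) * (kk.+1%:R * 2 `^ (kk%:R * theta) * (b * B))).
    rewrite mem_index_iota /= => lK; rewrite mulrDl.
    have ln : (l <= n)%N by exact: leq_trans (ltnW lK) Kn.
    apply: Lb_B => //.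
      have p0 : 0 <= kk.+1%:R * 2 `^ (kk%:R * theta) * (b * B) by rewrite !mulr_ge0 ?p2_ge0.
      have [lk|lk] := ltnP l (kk + 4).
        apply: Lb_le (h1 kk l Q a b H B lk (lQ' l ln) aN ab bH gB).
        rewrite (_ : C1 * _ * _ * _ = C1 * (kk.+1%:R * 2 `^ (kk%:R * theta) * (b * B))); last by ring.
        by rewrite ler_wpM2r// lerDl ltW.
      apply: Lb_le (h2 kk l Q a b H B lk (lQ' l ln) aN ab bH gB).
      rewrite (_ : C2 * _ * _ * _ = C2 * (kk.+1%:R * 2 `^ (kk%:R * theta) * (b * B))); last by ring.
      by rewrite ler_wpM2r// lerDr ltW.
    have := Lb_mul_sup q0 ma supa (h4 l q H B q1 bH gB).
    apply: Lb_le; rewrite mulr0 powRr0 mulr1.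
    by rewrite (_ : _ * (C4 * B) = C3 * C4 * (kk.+1%:R * 2 `^ (kk%:R * theta) * (b * B)))//; ring.
  apply: Lb_le (Lb_sum_in q1 step).
  rewrite big_const_seq count_predT size_iota subn0.
  set Y := (C1 + _ + _) * _.
  have -> : forall i : nat, iter i (+%R Y) 0 = i%:R * Y.
    by elim=> [|i ih] /=; rewrite ?mul0r// ih -nat1r mulrDl mul1r.
  have -> : (d + 5)%:R * (C1 + C2 + C3 * C4) * E = ((d + 5)%:R * kk.+1%:R) * Y.
    by rewrite /Y /E; ring.
  rewrite ler_wpM2r//; first by rewrite /Y !mulr_ge0 ?p2_ge0// !addr_ge0 ?mulr_ge0// ltW.
  by rewrite -natrM ler_nat.
have b3 : Lb mu q (fun x => \sum_(K <= l < n.+1) (T l x - a x * Z l x)) (C5 * E).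
  have step l : l \in index_iota K n.+1 -> Lb mu q (fun x => T l x - a x * Z l x)
      ((C5 * 2 ^+ (kk * d.+1) * b * B) * 2 ^- l).
    rewrite mem_index_iota ltnS => /andP[Kl ln].
    have := h5 kk l Q a b H B _ (lQ l ln) aN ab bH gB.
    rewrite (_ : (C5 * (2 ^+ (kk * d.+1) / 2 ^+ l) * b * B) = (C5 * 2 ^+ (kk * d.+1) * b * B) * 2 ^- l); last by ring.
    by apply; exact: leq_trans Kl.
  apply: Lb_le (Lb_sum_in q1 step).
  rewrite -mulr_sumr.
  have y0 : 0 <= C5 * 2 ^+ (kk * d.+1) * b * B by rewrite !mulr_ge0 ?exprn_ge0 ?(ltW C50).
  apply: (le_trans (ler_wpM2l y0 (geo_tail K n.+1))).
  have -> : C5 * 2 ^+ (kk * d.+1) * b * B * (2 * 2 ^- K) = C5 * (b * B) * (2 * 2 ^- 4).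
    by rewrite /K exprD mulnC; field; rewrite expf_neq0.
  rewrite -[X in _ <= X]mulr1 ler_pM ?mulr_ge0 ?(ltW C50) ?invr_ge0 ?exprn_ge0//.
    by rewrite ler_wpM2l// ltW.
  by rewrite -natrX ler_pdivrMr// mul1r ler_nat.
have := Lb_add q1 b1 (Lb_add q1 b2 b3).
rewrite (_ : C3 * E + _ = ((d + 5)%:R * (C1 + C2 + C3 * C4) + C3 + C5) * kk.+1%:R ^+ 2 * 2 `^ (kk%:R * theta) * (b * B))//.
by rewrite /E; ring.
Qed.

End ProductEstimate.

Ltac pos0 := repeat match goal with
 | |- is_true (0 <= _ * _) => apply: mulr_ge0
 | |- is_true (0 <= _ + _) => apply: addr_ge0
 | |- is_true (0 <= _ ^-1) => rewrite invr_ge0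
 | |- is_true (0 <= _ ^+ 2) => exact: sqr_ge0
 | |- is_true (0 <= _ ^+ _) => apply: exprn_ge0
 | |- is_true (0 <= _ `^ _) => exact: powR_ge0
 | _ => first [done | exact: ltW | assumption]
end.

(** * Riesz transforms *)

Section TaylorBound.
Context (R : realType).

Lemma taylor2_ge (g g1 g2 : R -> R) (K : R) :
  (forall s : R, is_derive s 1 g (g1 s)) -> (forall s : R, is_derive s 1 g1 (g2 s)) ->
  (forall s, 0 <= s <= 1 -> K <= g2 s) -> g 0 + g1 0 + K / 2 <= g 1.
Proof.
move=> dg dg1 hK.
have h1 s : 0 <= s -> s <= 1 -> g1 0 + K * s <= g1 s.
  rewrite le_eqVlt => /predU1P[<-|s0] s1; first by rewrite mulr0 addr0.
  have [|c] := @MVT R g1 g2 0 s s0 (fun x _ => dg1 x).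
    by apply: derivable_within_continuous => x _; have [] := dg1 x.
  rewrite in_itv/= => /andP[c0 cs]; rewrite subr0 => E.
  rewrite addrC -lerBrDr E ler_wpM2r ?(ltW s0)//; apply: hK.
  by rewrite (ltW c0)/= (le_trans (ltW cs)).
pose H s := g s - (g1 0 * s + K / 2 * s ^+ 2).
have dH (s : R) : is_derive s 1 H (g1 s - (g1 0 + K * s)).
  have d2 : is_derive s 1 (fun s => g1 0 * s + K / 2 * s ^+ 2) (g1 0 + K * s).
    by apply: is_derive_eq; rewrite /GRing.scale /=; field.
  exact: is_deriveB (dg s) d2.
have [|c] := @MVT R H (fun s => g1 s - (g1 0 + K * s)) 0 1 ltr01 (fun x _ => dH x).
  by apply: derivable_within_continuous => x _; have [] := dH x.
rewrite in_itv/= => /andP[c0 c1]; rewrite /H => E.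
have := h1 c (ltW c0) (ltW c1); move: E; rewrite !mulr0 !mulr1 expr0n expr1n /= mulr0 mulr1 addr0 !subr0.
by move=> E h; lra.
Qed.

End TaylorBound.

Section BellmanFunction.
Context (R : realType).
Variable p : R.
Hypothesis p2 : 2 <= p.

Definition ba : R := p / 2.
Definition bb : R := p / (p - 1) / 2.
Definition bg : R := 1 - ba^-1.
(** Makes the last summand of [bellman] contribute 11 W th to the Hessian: 10 offset the loss in
    [bellman_algebra], one yields the term in w2^2 of [line2_ge]. *)
Definition bA : R := 11 / (bb * (2 * bb - 1)).

Lemma ba_ge1 : 1 <= ba. Proof. by rewrite ler_pdivlMr// mul1r. Qed.
Lemma ba_gt0 : 0 < ba. Proof. exact: lt_le_trans ba_ge1. Qed.
Let pm1 : 0 < p - 1. Proof. by rewrite subr_gt0 (lt_le_trans _ p2)// ltr1n. Qed.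
Let p0 : 0 < p. Proof. exact: lt_le_trans p2. Qed.
Lemma bb_gt0 : 0 < bb. Proof. by rewrite !divr_gt0. Qed.
Lemma bb_le1 : bb <= 1.
Proof. by rewrite ler_pdivrMr// mul1r ler_pdivrMr//; move: p2; lra. Qed.
Lemma bb2_gt0 : 0 < 2 * bb - 1.
Proof.
rewrite (_ : 2 * bb - 1 = (p - 1)^-1) ?invr_gt0//.
by rewrite /bb; field; rewrite gt_eqF.
Qed.
Lemma bA_gt0 : 0 < bA. Proof. by rewrite divr_gt0// mulr_gt0 ?bb_gt0 ?bb2_gt0. Qed.
Lemma bg_ge0 : 0 <= bg.
Proof. by rewrite subr_ge0 invf_le1 ?ba_gt0// ba_ge1. Qed.
Lemma bg_le1 : bg <= 1.
Proof. by rewrite lerBlDr lerDl invr_ge0 ltW// ba_gt0. Qed.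
Lemma bb_bg : 1 - bb^-1 = - bg.
Proof. by rewrite /bg /bb /ba; field; rewrite !gt_eqF. Qed.

(* Z = y^a and W = x^b are the two summands of E, with z, w their proportions;
   al and be are the logarithmic derivatives of y and x along a line. *)
Lemma bellman_algebra (z w al be om th : R) : 0 <= z -> 0 <= w -> z + w = 1 ->
  al ^+ 2 <= 2 * om -> be ^+ 2 <= 2 * th ->
  om / 2 - 10 * (w * th) <=
  om + 2 * bg * al * (ba * z * al + bb * w * be)
  - bg / ba * (ba * z * al + bb * w * be) ^+ 2
  + bg * (ba * (ba - 1) * z * al ^+ 2 + ba * z * om + bb * (bb - 1) * w * be ^+ 2 + bb * w * th).
Proof.
move=> z0 w0 zw alo beo.
have a1 := ba_ge1; have a0 := ba_gt0; have b0 := bb_gt0; have b1 := bb_le1; have b2 := bb2_gt0.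
have g0 := bg_ge0; have g1 := bg_le1.
have om0 : 0 <= om by have := sqr_ge0 al; lra.
have th0 : 0 <= th by have := sqr_ge0 be; lra.
have z1 : z <= 1 by lra.
have w1 : w <= 1 by lra.
have -> : om + 2 * bg * al * (ba * z * al + bb * w * be) - bg / ba * (ba * z * al + bb * w * be) ^+ 2
  + bg * (ba * (ba - 1) * z * al ^+ 2 + ba * z * om + bb * (bb - 1) * w * be ^+ 2 + bb * w * th)
  = om + bg * ba * z * (1 - z + ba) * al ^+ 2 + 2 * bg * bb * w * (1 - z) * al * be
    - bg / ba * bb ^+ 2 * w ^+ 2 * be ^+ 2 + bg * ba * z * om
    + bg * bb * w * (th - (1 - bb) * be ^+ 2).
  by field; rewrite gt_eqF.
have -> : 1 - z = w by lra.
have t1 : 0 <= bg * ba * z * (w + ba) * al ^+ 2 by pos0.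
have t2 : 0 <= bg * ba * z * om by pos0.
have t3 : 0 <= bg * bb * w * (th - (1 - bb) * be ^+ 2).
  apply: mulr_ge0; first by pos0.
  rewrite subr_ge0.
  apply: (@le_trans _ _ ((1 - bb) * (2 * th))); first by rewrite ler_wpM2l// subr_ge0.
  have : 0 <= (2 * bb - 1) * th by rewrite mulr_ge0// ltW.
  by lra.
have c1 : 0 <= bg * bb * w <= 1.
  apply/andP; split; first by pos0.
  have h1 : bg * bb <= 1 by apply: mulr_ile1 => //; exact: ltW.
  by apply: mulr_ile1 => //; pos0.
have t4 : - (om / 2 + 8 * (w * th)) <= 2 * bg * bb * w * w * al * be.
  set k := bg * bb * w in c1 *.
  have e : 2 * bg * bb * w * w * al * be = 2 * k * w * al * be by rewrite /k; ring.
  rewrite e.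
  have h1 : 0 <= (al / 2 + 2 * k * w * be) ^+ 2 by exact: sqr_ge0.
  have h2 : k ^+ 2 * w ^+ 2 * be ^+ 2 <= w * (2 * th).
    have /andP[k0 k1] := c1.
    have hk : k ^+ 2 * w ^+ 2 <= w.
      apply: (@le_trans _ _ (1 * w)); last by rewrite mul1r.
      apply: ler_pM; [exact: sqr_ge0|exact: sqr_ge0|by rewrite exprn_ile1|].
      by rewrite expr2; apply: ler_piMl.
    exact: (le_trans (ler_wpM2r (sqr_ge0 be) hk) (ler_wpM2l w0 beo)).
  move: h1; rewrite sqrrD.
  have -> : (al / 2) ^+ 2 = al ^+ 2 / 4 by field.
  have -> : (2 * k * w * be) ^+ 2 = 4 * (k ^+ 2 * w ^+ 2 * be ^+ 2) by ring.
  have -> : al / 2 * (2 * k * w * be) *+ 2 = 2 * k * w * al * be by rewrite -mulr_natl; field.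
  by lra.
have t5 : bg / ba * bb ^+ 2 * w ^+ 2 * be ^+ 2 <= 2 * (w * th).
  have -> : 2 * (w * th) = w * (2 * th) by ring.
  have hk : bg / ba * bb ^+ 2 * w ^+ 2 <= w.
    apply: (@le_trans _ _ (1 * w)); last by rewrite mul1r.
    apply: ler_pM; [by pos0|exact: sqr_ge0| |by rewrite expr2; apply: ler_piMl].
    apply: mulr_ile1; [by pos0|exact: sqr_ge0| |by rewrite exprn_ile1// ltW].
    by apply: mulr_ile1 => //; [by pos0|rewrite invf_le1].
  exact: (le_trans (ler_wpM2r (sqr_ge0 be) hk) (ler_wpM2l w0 beo)).
by lra.
Qed.

(* Up to lower order terms, [bellman] is z^2 (|z|^p + |e|^p')^(1 - 2/p) + A |e|^p' with p' = p / (p - 1); its Hessian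
   dominates the form bE^bg dz^2 + bE^-bg de^2, hence 2 |dz de|. *)
Definition bE (z e : R) : R := (1 + z ^+ 2) `^ ba + (1 + e ^+ 2) `^ bb.
Definition bellman (z e : R) : R := (1 + z ^+ 2) * bE z e `^ bg + bA * (1 + e ^+ 2) `^ bb.
(** [bG1] and [bG2] are the partial derivatives of [bellman] in [z] and in [e]; see [line_base]. *)
Definition bG1 (z e : R) : R :=
  2 * z * bE z e `^ bg + (1 + z ^+ 2) * (bg * bE z e `^ (bg - 1) * (ba * (1 + z ^+ 2) `^ (ba - 1) * (2 * z))).
Definition bG2 (z e : R) : R :=
  (1 + z ^+ 2) * (bg * bE z e `^ (bg - 1) * (bb * (1 + e ^+ 2) `^ (bb - 1) * (2 * e)))
  + bA * (bb * (1 + e ^+ 2) `^ (bb - 1) * (2 * e)).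

Lemma y_gt0 (z : R) : 0 < 1 + z ^+ 2. Proof. by rewrite ltr_wpDr// sqr_ge0. Qed.
Lemma bE_gt0 z e : 0 < bE z e. Proof. by rewrite addr_gt0// powR_gt0// y_gt0. Qed.

Lemma bG1_mono z e : 0 <= bG1 z e * z.
Proof.
have y0 := y_gt0 z; have E0 := bE_gt0 z e.
have -> : bG1 z e * z = z ^+ 2 * (2 * bE z e `^ bg + (1 + z ^+ 2) * (bg * bE z e `^ (bg - 1) * (ba * (1 + z ^+ 2) `^ (ba - 1) * 2))).
  by rewrite /bG1; ring.
by rewrite mulr_ge0 ?sqr_ge0// addr_ge0 ?mulr_ge0 ?powR_ge0 ?bg_ge0 ?(ltW y0)// ltW// ba_gt0.
Qed.

Lemma bG2_mono z e : 0 <= bG2 z e * e.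
Proof.
have y0 := y_gt0 z; have E0 := bE_gt0 z e.
have -> : bG2 z e * e = e ^+ 2 * ((1 + z ^+ 2) * (bg * bE z e `^ (bg - 1) * (bb * (1 + e ^+ 2) `^ (bb - 1) * 2)) + bA * (bb * (1 + e ^+ 2) `^ (bb - 1) * 2)).
  by rewrite /bG2; ring.
have b0 := bb_gt0; have g0 := bg_ge0; have A0 := bA_gt0; have x0 := y_gt0 e.
by pos0.
Qed.

Lemma powRB1 (x r : R) : 0 < x -> x `^ (r - 1) = x `^ r / x.
Proof. by move=> x0; rewrite powRD ?(gt_eqF x0) ?implybT// powRN powRr1// ltW. Qed.

Lemma y_le_E z e : (1 + z ^+ 2) * bE z e `^ bg <= bE z e.
Proof.
have y0 := y_gt0 z; have E0 := bE_gt0 z e.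
have h : 1 + z ^+ 2 <= bE z e `^ ba^-1.
  have e1 : 1 + z ^+ 2 = ((1 + z ^+ 2) `^ ba) `^ ba^-1.
    by rewrite -powRrM mulfV ?gt_eqF ?ba_gt0// powRr1// ltW.
  rewrite {1}e1.
  apply: ge0_ler_powR; rewrite ?nnegrE ?powR_ge0 ?invr_ge0 ?(ltW ba_gt0) ?(ltW E0)//.
  by rewrite lerDl powR_ge0.
apply: (le_trans (ler_wpM2r (powR_ge0 _ _) h)).
rewrite -powRD ?(gt_eqF E0) ?implybT// (_ : ba^-1 + bg = 1); last by rewrite /bg; ring.
by rewrite powRr1// ltW.
Qed.

Lemma bellman_le z e : bellman z e <= (1 + bA) * bE z e.
Proof.
rewrite mulrDl mul1r lerD ?y_le_E// ler_wpM2l ?(ltW bA_gt0)//.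
by rewrite lerDr powR_ge0.
Qed.

Lemma bellman_ge0 z e : 0 <= bellman z e.
Proof. by rewrite addr_ge0// mulr_ge0 ?powR_ge0 ?(ltW bA_gt0) ?(ltW (y_gt0 _)). Qed.

Section Line.
Variables z0 e0 w1 w2 : R.
Let Y (s : R) := 1 + (z0 + s * w1) ^+ 2.
Let X (s : R) := 1 + (e0 + s * w2) ^+ 2.
Let dY (s : R) := 2 * (z0 + s * w1) * w1.
Let dX (s : R) := 2 * (e0 + s * w2) * w2.
Let E (s : R) := Y s `^ ba + X s `^ bb.
Let dE (s : R) := ba * Y s `^ (ba - 1) * dY s + bb * X s `^ (bb - 1) * dX s.
Let ddE (s : R) := (ba * ((ba - 1) * Y s `^ (ba - 1 - 1) * dY s) * dY s + ba * Y s `^ (ba - 1) * (2 * w1 ^+ 2))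
  + (bb * ((bb - 1) * X s `^ (bb - 1 - 1) * dX s) * dX s + bb * X s `^ (bb - 1) * (2 * w2 ^+ 2)).

Definition line (s : R) := bellman (z0 + s * w1) (e0 + s * w2).
Definition line1 (s : R) := dY s * E s `^ bg + Y s * (bg * E s `^ (bg - 1) * dE s) + bA * (bb * X s `^ (bb - 1) * dX s).
Definition line2 (s : R) := (2 * w1 ^+ 2) * E s `^ bg + dY s * (bg * E s `^ (bg - 1) * dE s)
  + (dY s * (bg * E s `^ (bg - 1) * dE s)
     + Y s * (bg * ((bg - 1) * E s `^ (bg - 1 - 1) * dE s) * dE s + bg * E s `^ (bg - 1) * ddE s))
  + bA * (bb * ((bb - 1) * X s `^ (bb - 1 - 1) * dX s) * dX s + bb * X s `^ (bb - 1) * (2 * w2 ^+ 2)).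

Let Y0 s : 0 < Y s. Proof. exact: y_gt0. Qed.
Let X0 s : 0 < X s. Proof. exact: y_gt0. Qed.
Let E0 s : 0 < E s. Proof. exact: bE_gt0. Qed.

Let is_dY (s : R) : is_derive s 1 Y (dY s).
Proof. by rewrite /Y /dY; apply: is_derive_eq; rewrite /GRing.scale /=; ring. Qed.
Let is_dX (s : R) : is_derive s 1 X (dX s).
Proof. by rewrite /X /dX; apply: is_derive_eq; rewrite /GRing.scale /=; ring. Qed.
Let is_ddY (s : R) : is_derive s 1 dY (2 * w1 ^+ 2).
Proof. by rewrite /dY; apply: is_derive_eq; rewrite /GRing.scale /=; ring. Qed.
Let is_ddX (s : R) : is_derive s 1 dX (2 * w2 ^+ 2).
Proof. by rewrite /dX; apply: is_derive_eq; rewrite /GRing.scale /=; ring. Qed.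

Let is_pow (F dF : R -> R) (r s : R) : 0 < F s -> is_derive s 1 F (dF s) ->
  is_derive s 1 (fun s => F s `^ r) (r * F s `^ (r - 1) * dF s).
Proof.
move=> F0 dFs; have h := @is_derive1_comp _ (fun b => b `^ r) _ s _ _ (is_derive1_powR r F0) dFs.
by apply: (@is_derive_eq _ _ _ _ _ _ _ _ h); ring.
Qed.

Let is_mul (F G : R -> R) (s f g : R) : is_derive s 1 F f -> is_derive s 1 G g ->
  is_derive s 1 (fun s => F s * G s) (f * G s + F s * g).
Proof.
move=> dF dG; have h := is_deriveM dF dG.
by apply: (@is_derive_eq _ _ _ _ _ _ _ _ h); rewrite /GRing.scale /=; ring.
Qed.

Let is_scale (c : R) (F : R -> R) (s f : R) : is_derive s 1 F f -> is_derive s 1 (fun s => c * F s) (c * f).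
Proof.
move=> dF; have h := is_mul (is_derive_cst c s 1) dF.
by apply: (@is_derive_eq _ _ _ _ _ _ _ _ h); rewrite mul0r add0r.
Qed.

Let is_add (F G : R -> R) (s f g : R) : is_derive s 1 F f -> is_derive s 1 G g ->
  is_derive s 1 (fun s => F s + G s) (f + g).
Proof. exact: is_deriveD. Qed.

Let is_dE (s : R) : is_derive s 1 E (dE s).
Proof. by apply: is_add; apply: is_pow. Qed.

Let is_ddE (s : R) : is_derive s 1 dE (ddE s).
Proof.
by apply: is_add; apply: is_mul => //; apply: is_scale; apply: is_pow.
Qed.

Lemma is_line (s : R) : is_derive s 1 line (line1 s).
Proof.
exact: (is_add (is_mul (is_dY s) (is_pow bg (E0 s) (is_dE s))) (is_scale bA (is_pow bb (X0 s) (is_dX s)))).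
Qed.

Lemma is_line1 (s : R) : is_derive s 1 line1 (line2 s).
Proof.
have dEg := is_mul (is_scale bg (is_pow (bg - 1) (E0 s) (is_dE s))) (is_ddE s).
exact: (is_add (is_add (is_mul (is_ddY s) (is_pow bg (E0 s) (is_dE s))) (is_mul (is_dY s) dEg))
  (is_scale bA (is_mul (is_scale bb (is_pow (bb - 1) (X0 s) (is_dX s))) (is_ddX s)))).
Qed.

(** The lower bound on the Hessian. With Y G factored out, the first summand of [bellman] is
    [bellman_algebra] for the proportions Z / E and W / E. The weight of w2^2 arises because bb - 1
    = - bb bg and X^bb <= E, so that X^(bb - 1) >= E^(- bg). *)
Lemma line2_ge (s : R) :
  E s `^ bg * w1 ^+ 2 + E s `^ (- bg) * w2 ^+ 2 <= line2 s.
Proof.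
have y0 := Y0 s; have x0 := X0 s; have e_0 := E0 s.
have hE : E s = Y s `^ ba + X s `^ bb by [].
have YE : Y s * E s `^ bg <= E s := y_le_E _ _.
have XW : E s `^ (- bg) <= X s `^ bb / X s.
  rewrite -powRB1// (_ : bb - 1 = bb * (- bg)); last first.
    by rewrite -bb_bg mulrBr mulr1 mulfV// gt_eqF// bb_gt0.
  rewrite powRrM !powRN lef_pV2 ?posrE ?powR_gt0//.
  by apply: ge0_ler_powR; rewrite ?bg_ge0 ?nnegrE ?powR_ge0 ?(ltW e_0)// hE lerDr powR_ge0.
rewrite /line2 /ddE /dE !powRB1//.
set G := E s `^ bg; set Z := Y s `^ ba; set W := X s `^ bb.
have G0 : 0 < G by rewrite powR_gt0.
have Z0 : 0 < Z by rewrite powR_gt0.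
have W0 : 0 < W by rewrite powR_gt0.
pose al := dY s / Y s; pose be := dX s / X s.
pose om := 2 * w1 ^+ 2 / Y s; pose th := 2 * w2 ^+ 2 / X s.
have alo : al ^+ 2 <= 2 * om.
  rewrite /al /om /dY expr_div_n ler_pdivrMr ?exprn_gt0//.
  rewrite (_ : _ * Y s ^+ 2 = 4 * w1 ^+ 2 * Y s); last by field; rewrite gt_eqF.
  rewrite /Y; set t := z0 + s * w1.
  rewrite (_ : _ * (1 + t ^+ 2) = (2 * t * w1) ^+ 2 + 4 * w1 ^+ 2); last by ring.
  by rewrite lerDl mulr_ge0 ?sqr_ge0.
have beo : be ^+ 2 <= 2 * th.
  rewrite /be /th /dX expr_div_n ler_pdivrMr ?exprn_gt0//.
  rewrite (_ : _ * X s ^+ 2 = 4 * w2 ^+ 2 * X s); last by field; rewrite gt_eqF.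
  rewrite /X; set t := e0 + s * w2.
  rewrite (_ : _ * (1 + t ^+ 2) = (2 * t * w2) ^+ 2 + 4 * w2 ^+ 2); last by ring.
  by rewrite lerDl mulr_ge0 ?sqr_ge0.
have th0 : 0 <= th by have := sqr_ge0 be; lra.
have zw : Z / E s + W / E s = 1 by rewrite -mulrDl -hE mulfV// gt_eqF.
have alg := @bellman_algebra (Z / E s) (W / E s) al be om th (divr_ge0 (ltW Z0) (ltW e_0)) (divr_ge0 (ltW W0) (ltW e_0)) zw alo beo.
set rhs := (X in _ <= X).
have -> : rhs = Y s * G * (om + 2 * bg * al * (ba * (Z / E s) * al + bb * (W / E s) * be)
  - bg / ba * (ba * (Z / E s) * al + bb * (W / E s) * be) ^+ 2
  + bg * (ba * (ba - 1) * (Z / E s) * al ^+ 2 + ba * (Z / E s) * om + bb * (bb - 1) * (W / E s) * be ^+ 2 + bb * (W / E s) * th))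
  + bA * (W * (bb * th - bb * (1 - bb) * be ^+ 2)).
  rewrite /rhs /al /be /om /th /bg; field.
  by rewrite !gt_eqF// ba_gt0.
have YG0 : 0 <= Y s * G by rewrite mulr_ge0 ?ltW.
have s1 := ler_wpM2l YG0 alg.
have b0 := bb_gt0; have b2 := bb2_gt0.
have s2 : 11 * (W * th) <= bA * (W * (bb * th - bb * (1 - bb) * be ^+ 2)).
  apply: (@le_trans _ _ (bA * (W * (bb * (2 * bb - 1) * th)))).
    rewrite (_ : bA * _ = 11 * (W * th))// /bA; field.
    by rewrite !gt_eqF.
  rewrite ler_wpM2l ?(ltW bA_gt0)// ler_wpM2l ?(ltW W0)//.
  have h : bb * (1 - bb) * be ^+ 2 <= bb * (1 - bb) * (2 * th).
    by rewrite ler_wpM2l// mulr_ge0 ?(ltW b0)// subr_ge0 bb_le1.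
  by move: h; lra.
have s3 : Y s * G * (W / E s * th) <= W * th.
  rewrite (_ : _ * _ = (Y s * G / E s) * (W * th)); last by field; rewrite gt_eqF.
  apply: ler_piMl; first by pos0.
  by rewrite ler_pdivrMr// mul1r.
have s4 : Y s * G * (om / 2) = G * w1 ^+ 2 by rewrite /om; field; rewrite gt_eqF.
have s5 : E s `^ (- bg) * w2 ^+ 2 <= W * th.
  rewrite (_ : W * th = W / X s * (2 * w2 ^+ 2)); last by rewrite /th; field; rewrite gt_eqF.
  apply: ler_pM => //; rewrite ?powR_ge0 ?sqr_ge0//.
  by have := sqr_ge0 w2; lra.
move: s1; rewrite mulrBr s4 (_ : Y s * G * (10 * _) = 10 * (Y s * G * (W / E s * th))); last by ring.
by move=> s1; lra.
Qed.

Lemma line_base : line1 0 = bG1 z0 e0 * w1 + bG2 z0 e0 * w2.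
Proof.
rewrite /line1 /bG1 /bG2 /E /dE /Y /X /dY /dX /bE !mul0r !addr0.
by ring.
Qed.

End Line.

(** A step of length at most 1 changes [bE] by a factor of at most 3^ba, hence its powers of
    exponent bg or - bg by at most 3^(ba bg) = 3^(ba - 1). *)
Definition bc : R := 3 `^ (- (ba - 1)).
Lemma bc_gt0 : 0 < bc. Proof. by rewrite powR_gt0. Qed.

Lemma y_comp (z w : R) : `|w| <= 1 -> 1 + (z + w) ^+ 2 <= 3 * (1 + z ^+ 2).
Proof.
move=> w1; have h : w ^+ 2 <= 1 by rewrite -real_normK ?num_real// exprn_ile1.
have e : (z + w) ^+ 2 = 2 * z ^+ 2 + 2 * w ^+ 2 - (z - w) ^+ 2 by ring.
by rewrite e; have := sqr_ge0 (z - w); have := sqr_ge0 z; lra.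
Qed.

Lemma E_comp z e w1 w2 : `|w1| <= 1 -> `|w2| <= 1 -> bE (z + w1) (e + w2) <= 3 `^ ba * bE z e.
Proof.
move=> h1 h2; rewrite /bE mulrDr lerD//.
  rewrite -powRM ?ler0n ?(ltW (y_gt0 _))//; apply: ge0_ler_powR; rewrite ?nnegrE ?(ltW ba_gt0) ?(ltW (y_gt0 _)) ?y_comp//.
  by rewrite mulr_ge0// ltW// y_gt0.
apply: (@le_trans _ _ (3 `^ bb * (1 + e ^+ 2) `^ bb)).
  rewrite -powRM ?ler0n ?(ltW (y_gt0 _))//; apply: ge0_ler_powR; rewrite ?nnegrE ?(ltW bb_gt0) ?(ltW (y_gt0 _)) ?y_comp//.
  by rewrite mulr_ge0// ltW// y_gt0.
rewrite ler_wpM2r ?powR_ge0//; apply: ler_powR; first by rewrite ler1n.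
exact: le_trans bb_le1 ba_ge1.
Qed.

(** The summands 1 in [bE] make it comparable along steps of length at most 1. The Hessian bound at
    the base point therefore controls the whole Taylor remainder, although the step is not
    infinitesimal. *)
Lemma bellman_taylor z e w1 w2 : `|w1| <= 1 -> `|w2| <= 1 ->
  bellman z e + (bG1 z e * w1 + bG2 z e * w2)
  + bc / 2 * (bE z e `^ bg * w1 ^+ 2 + bE z e `^ (- bg) * w2 ^+ 2)
  <= bellman (z + w1) (e + w2).
Proof.
move=> h1 h2.
have := @taylor2_ge R (line z e w1 w2) (line1 z e w1 w2) (line2 z e w1 w2)
  (bc * (bE z e `^ bg * w1 ^+ 2 + bE z e `^ (- bg) * w2 ^+ 2)) (is_line z e w1 w2) (is_line1 z e w1 w2).
rewrite line_base /line !mul0r !addr0 !mul1r => H.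
rewrite [bc / 2 * _]mulrAC; apply: H => s /andP[s0 s1].
apply: le_trans (line2_ge z e w1 w2 s).
have n1 : `|s * w1| <= 1 by rewrite normrM (ger0_norm s0) mulr_ile1.
have n2 : `|s * w2| <= 1 by rewrite normrM (ger0_norm s0) mulr_ile1.
have c1 := E_comp z e n1 n2.
have c2 : bE z e <= 3 `^ ba * bE (z + s * w1) (e + s * w2).
  have := @E_comp (z + s * w1) (e + s * w2) (- (s * w1)) (- (s * w2)).
  by rewrite !addrK !normrN; apply.
rewrite -/(bE (z + s * w1) (e + s * w2)).
have M1 : 1 <= 3 `^ ba :> R.
  have h3 : (1 : R) <= 3 by rewrite ler1n.
  by have := ler_powR h3 (ltW ba_gt0); rewrite powRr0.
have bgE r : `|r| = bg -> bc * bE z e `^ r <= bE (z + s * w1) (e + s * w2) `^ r.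
  move=> rg; have := @pow_comp R _ _ _ r (bE_gt0 z e) (bE_gt0 (z + s * w1) (e + s * w2)) M1 c2 c1.
  rewrite rg -powRrM => h.
  have ag : ba * bg = ba - 1 by rewrite /bg mulrBr mulr1 mulfV// gt_eqF// ba_gt0.
  rewrite ag in h; apply: (le_trans (ler_wpM2l (ltW bc_gt0) h)).
  by rewrite mulrA /bc -powRD ?pnatr_eq0 ?implybT// addNr powRr0 mul1r.
rewrite mulrDr; apply: lerD; rewrite mulrA; apply: ler_wpM2r; rewrite ?sqr_ge0//; apply: bgE.
  by rewrite ger0_norm// bg_ge0.
by rewrite normrN ger0_norm// bg_ge0.
Qed.

End BellmanFunction.

(** * Discrete harmonic extensions and their Bellman energy *)

Section DiscreteHeat.
Context (R : realType) (d : nat).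
Variables (p : R) (de : R).
Hypothesis p2 : 2 <= p.
Hypothesis de0 : 0 < de.
Implicit Types (k : freq d) (j : 'I_d) (x : d.-tuple R).

(* With step [de], [hrho k ^+ n] is the decaying solution of the discretized equation u'' = (1 - Delta) u at the
   frequency k. *)
Definition hs k : R := de ^+ 2 / 2 + \sum_(j < d) (1 - cos (2 * pi * ((k j)%:~R * de))).
Definition hrho k : R := 1 + hs k - Num.sqrt (hs k ^+ 2 + 2 * hs k).

Lemma hs_gt0 k : 0 < hs k.
Proof.
rewrite ltr_pwDl ?divr_gt0 ?exprn_gt0//; apply: sumr_ge0 => j _.
by rewrite subr_ge0 cos_le1.
Qed.

Let sq0 k : 0 <= hs k ^+ 2 + 2 * hs k.
Proof. by have h := ltW (hs_gt0 k); pos0. Qed.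

Lemma hrho_eq k : hrho k ^+ 2 + 1 = (2 + 2 * hs k) * hrho k.
Proof.
have := sqr_sqrtr (sq0 k); rewrite /hrho; set z := Num.sqrt _ => h.
have -> : (1 + hs k - z) ^+ 2 + 1 = (1 + hs k) ^+ 2 + 1 + z ^+ 2 - 2 * (1 + hs k) * z by ring.
by rewrite h; ring.
Qed.

Lemma hrho_gt0 k : 0 < hrho k.
Proof.
rewrite subr_gt0 -[X in _ < X]ger0_norm; last by rewrite addr_ge0// ltW// hs_gt0.
rewrite -sqrtr_sqr ltr_sqrt; last by rewrite exprn_gt0// ltr_pwDr// ?hs_gt0// ltW.
by rewrite (_ : (1 + hs k) ^+ 2 = 1 + (hs k ^+ 2 + 2 * hs k)) ?ltrDr//; ring.
Qed.

Lemma hrho_lt1 k : hrho k < 1.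
Proof.
have h := hs_gt0 k.
rewrite /hrho -addrA gtrDl subr_lt0 -[X in X < _]ger0_norm ?(ltW h)//.
by rewrite -sqrtr_sqr ltr_sqrt ?ltr_pwDr ?sqr_ge0// ?mulr_gt0// ltrDl mulr_gt0.
Qed.

Lemma hrhoN k : hrho (- k) = hrho k.
Proof.
rewrite /hrho /hs; congr (1 + _ - Num.sqrt (_ ^+ 2 + 2 * _));
 congr (_ + _); apply: eq_bigr => j _; congr (1 - _);
 by rewrite [(- k) j]/(- k j) rmorphN /= mulNr mulrN cosN.
Qed.

Definition sh j (t : R) : d.-tuple R := [tuple (if j == i then t else 0) | i < d].

Lemma dot_sh k j t : dot k (sh j t) = (k j)%:~R * t.
Proof.
rewrite /dot (bigD1 j)//= tnth_mktuple eqxx big1 ?addr0// => i ij.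
by rewrite tnth_mktuple eq_sym (negbTE ij) mulr0.
Qed.

Lemma ek_sh k x j t : ek k (tsub x (sh j t)) = ek k x * cis (- (2 * pi * ((k j)%:~R * t))).
Proof. by rewrite ek_tsub {2}/ek dotN dot_sh mulrN. Qed.

Section Evolution.
Variables (N : nat) (f : d.-tuple R -> R).
Hypothesis fN : trig N f.

Definition hc n k : R[i] := ((hrho k ^+ n)%:C)%C * fourier f k.
Definition hu n : d.-tuple R -> R := reS N (hc n).

Lemma hc_herm n : hermitian (hc n).
Proof.
apply: hermitianM; first by apply: hermitian_even => k; rewrite hrhoN.
by apply: hermitian_fourier; exact: trig_integrable fN.
Qed.

Lemma hu_trig n : trig N (hu n).
Proof. by apply: trig_reS; exact: hc_herm. Qed.

Lemma hu_fourier n k : fourier (hu n) k = hc n k.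
Proof.
rewrite fourier_reS; last exact: hc_herm.
by case: ifPn => // kN; rewrite /hc (trig_fourier0 fN kN) mulr0.
Qed.

Lemma hu_syn n x : (hu n x)%:C%C = syn N (hc n) x.
Proof. by rewrite reS_syn//; exact: hc_herm. Qed.

Lemma hu0 : hu 0 = f.
Proof.
apply: (@trig_eq _ _ N N) => //; first exact: hu_trig.
by apply/funext => k; rewrite hu_fourier /hc expr0 mul1r.
Qed.

Lemma hu_shift_syn n x j t : (hu n (tsub x (sh j t)))%:C%C =
  syn N (fun k => hc n k * cis (- (2 * pi * ((k j)%:~R * t)))) x.
Proof.
rewrite hu_syn /syn; apply: eq_bigr => k _; rewrite ek_sh.
by rewrite mulrA mulrAC.
Qed.

Lemma cisDN t : cis t + cis (- t) = (2 * cos t)%:C%C :> R[i].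
Proof.
rewrite cisN /cis; apply/eqP; rewrite eq_complex /=; apply/andP; split; apply/eqP; ring.
Qed.

Lemma real_lin (a b c S T : R) (F E : R[i]) : a + b + c * S = T * c ->
  a%:C%C * F * E + b%:C%C * F * E + c%:C%C * F * E * S%:C%C = T%:C%C * (c%:C%C * F * E).
Proof.
move=> h; transitivity ((a + b + c * S)%:C%C * (F * E)); first by rewrite !rmorphD rmorphM /=; ring.
by rewrite h rmorphM /=; ring.
Qed.

(** [hrho_eq] on each frequency: opposite shifts add up to twice a cosine. The right-hand side
    exceeds the 2 + 2 d neighbours by the zero order term [de ^+ 2], which comes from the 1 in 1 -
    Delta. *)
Lemma hu_balance n x :
  hu n.+2 x + hu n x + \sum_(j < d) (hu n.+1 (tsub x (sh j de)) + hu n.+1 (tsub x (sh j (- de))))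
  = (2 + 2 * d%:R + de ^+ 2) * hu n.+1 x.
Proof.
apply: (@complexI R); rewrite rmorphD rmorphD rmorphM rmorph_sum /=.
under eq_bigr => j _ do rewrite rmorphD /= !hu_shift_syn /syn -big_split /=.
rewrite !hu_syn /syn -big_split /= exchange_big /= -big_split /= mulr_sumr.
apply: eq_bigr => k _.
have -> : \sum_(j < d) (hc n.+1 k * cis (- (2 * pi * ((k j)%:~R * de))) * ek k x + hc n.+1 k * cis (- (2 * pi * ((k j)%:~R * - de))) * ek k x)
  = hc n.+1 k * ek k x * (\sum_(j < d) 2 * cos (2 * pi * ((k j)%:~R * de)))%:C%C.
  rewrite rmorph_sum mulr_sumr; apply: eq_bigr => j _ /=.
  by rewrite -cisDN !mulrN opprK; ring.
rewrite /hc; apply: real_lin.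
have -> : hrho k ^+ n.+2 + hrho k ^+ n = hrho k ^+ n * (hrho k ^+ 2 + 1) by rewrite !exprS; ring.
rewrite hrho_eq.
have -> : hs k = de ^+ 2 / 2 + d%:R - \sum_(j < d) cos (2 * pi * ((k j)%:~R * de)).
  by rewrite /hs sumrB sumr_const card_ord addrA.
rewrite -mulr_sumr [hrho k ^+ n.+1]exprS; set S := \sum_(j < d) _.
by field.
Qed.

Definition hsum : R := \sum_(k <- box d N) cmod (fourier f k).

Lemma cmod_rho n k : cmod ((hrho k ^+ n)%:C%C : R[i]) <= 1.
Proof.
by rewrite cmod_real ger0_norm ?exprn_ge0 ?exprn_ile1 ?(ltW (hrho_gt0 k)) ?(ltW (hrho_lt1 k)).
Qed.

Lemma hu_bound n x : `|hu n x| <= hsum.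
Proof.
apply: (le_trans (normRe_cmod _)); apply: (le_trans (cmod_sum _ _)); apply: ler_sum => k _.
rewrite !cmodM cmod_ek mulr1 -[X in _ <= X]mul1r ler_wpM2r ?cmod_ge0//.
exact: cmod_rho.
Qed.

(** A step so small that the extension changes by at most 1 between neighbours, as [bellman_taylor]
    requires: each of the finitely many frequencies may contribute the reciprocal of their number.
    By [near_hsmall] this holds for all small steps. *)
Definition hsmall := forall k, k \in box d N ->
  cmod (fourier f k) * (1 - hrho k) * (size (box d N))%:R <= 1 /\
  forall j t, `|t| = de -> cmod (fourier f k) * cmod (cis (- (2 * pi * ((k j)%:~R * t))) - 1) * (size (box d N))%:R <= 1.

Lemma sum_small (F : freq d -> R[i]) (w : d.-tuple R -> R) x :
  (w x)%:C%C = \sum_(k <- box d N) F k ->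
  (forall k, k \in box d N -> cmod (F k) * (size (box d N))%:R <= 1) -> `|w x| <= 1.
Proof.
move=> wE FE; rewrite -cmod_real wE (le_trans (cmod_sum _ _))//.
have s0 : 0 < (size (box d N))%:R :> R.
  by rewrite ltr0n; case: (box d N) (box0 d N).
apply: (@le_trans _ _ (\sum_(k <- box d N) (size (box d N))%:R^-1)).
  rewrite big_seq [X in _ <= X]big_seq; apply: ler_sum => k kN.
  by rewrite -[X in _ <= X]mul1r ler_pdivlMr//; exact: FE.
rewrite big_const_seq count_predT.
have -> : forall n : nat, iter n (+%R (size (box d N))%:R^-1) 0 = n%:R * (size (box d N))%:R^-1 :> R.
  by elim=> [|n ih] /=; rewrite ?mul0r// ih -nat1r mulrDl mul1r.
by rewrite mulfV// gt_eqF.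
Qed.

Lemma hu_diff_t n x : hsmall -> `|hu n.+1 x - hu n x| <= 1.
Proof.
move=> hsm; apply: (@sum_small (fun k => hc n.+1 k * ek k x - hc n k * ek k x) (fun x => hu n.+1 x - hu n x)).
  by rewrite rmorphB /= !hu_syn /syn sumrB.
move=> k kN; rewrite -mulrBl cmodM cmod_ek mulr1 /hc -mulrBl cmodM.
have [h _] := hsm k kN; apply: le_trans h.
rewrite ler_wpM2r// mulrC ler_wpM2l ?cmod_ge0//.
rewrite -rmorphB cmod_real exprS -[X in `|_ - X|]mul1r -mulrBl normrM distrC.
rewrite (ger0_norm (_ : 0 <= 1 - hrho k)) ?subr_ge0 ?(ltW (hrho_lt1 k))//.
rewrite ger0_norm ?exprn_ge0 ?(ltW (hrho_gt0 k))//.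
rewrite ler_piMr ?subr_ge0 ?(ltW (hrho_lt1 k))// exprn_ile1 ?(ltW (hrho_gt0 k)) ?(ltW (hrho_lt1 k))//.
Qed.

Lemma hu_diff_x n x j t : hsmall -> `|t| = de -> `|hu n (tsub x (sh j t)) - hu n x| <= 1.
Proof.
move=> hsm td; apply: (@sum_small (fun k => hc n k * cis (- (2 * pi * ((k j)%:~R * t))) * ek k x - hc n k * ek k x) (fun x => hu n (tsub x (sh j t)) - hu n x)).
  by rewrite rmorphB /= hu_shift_syn !hu_syn /syn sumrB.
move=> k kN; rewrite -mulrBl cmodM cmod_ek mulr1 -[X in _ - X]mulr1 -mulrBr cmodM /hc cmodM.
have [_ h] := hsm k kN; apply: le_trans (h j t td).
rewrite ler_wpM2r// ler_wpM2r ?cmod_ge0// -[X in _ <= X]mul1r ler_wpM2r ?cmod_ge0//.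
exact: cmod_rho.
Qed.

End Evolution.
End DiscreteHeat.

Section RealSequences.
Context (R : realType).

(** By convexity a single increase would persist and carry the sequence linearly past [M]. *)
Lemma convex_bounded_decr (g : nat -> R) (M : R) :
  (forall n, 0 <= g n.+2 + g n - 2 * g n.+1) -> (forall n, g n <= M) -> forall n, g n <= g 0%N.
Proof.
move=> cg gM.
have inc m j : g m.+1 - g m <= g (m + j).+1 - g (m + j)%N.
  elim: j => [|j ih]; first by rewrite addn0.
  by apply: (le_trans ih); rewrite addnS; have := cg (m + j)%N; lra.
have dec m : g m.+1 <= g m.
  rewrite leNgt; apply/negP => gm; set D := g m.+1 - g m.
  have D0 : 0 < D by rewrite subr_gt0.
  have lin j : g m + j%:R * D <= g (m + j)%N.
    elim: j => [|j ih]; first by rewrite mul0r addr0 addn0.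
    by rewrite addnS -nat1r mulrDl mul1r; have := inc m j; rewrite -/D; lra.
  pose j := Num.bound ((M - g m) / D).
  have hj : (M - g m) / D < j%:R.
    by apply: archi_boundP; rewrite divr_ge0 ?(ltW D0)// subr_ge0 gM.
  have := lin j; have := gM (m + j)%N.
  by rewrite ltr_pdivrMr// in hj; lra.
elim=> [|n ih] //; exact: le_trans (dec n) ih.
Qed.

Lemma cvg_big_seq (I : Type) (s : seq I) (u : I -> nat -> R) (l : I -> R) :
  (forall i, u i n @[n --> \oo] --> l i) ->
  \sum_(i <- s) u i n @[n --> \oo] --> \sum_(i <- s) l i.
Proof.
move=> h; elim: s => [|i s ih].
  by rewrite big_nil; under eq_fun do rewrite big_nil; exact: cvg_cst.
by rewrite big_cons; under eq_fun do rewrite big_cons; apply: cvgD.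
Qed.

End RealSequences.

Section PowerLipschitz.
Context (R : realType) (d : nat).

Lemma powR_lip1 (e K x y : R) : 1 <= x <= K -> 1 <= y <= K ->
  `|x `^ e - y `^ e| <= `|e| * K `^ `|e - 1| * `|x - y|.
Proof.
wlog xy : x y / y < x.
  move=> H hx hy; case: (ltgtP y x) => [yx|xy|->]; first exact: H.
    by rewrite distrC [X in _ <= _ * X]distrC; exact: H.
  by rewrite !subrr normr0 mulr0.
move=> /andP[x1 xK] /andP[y1 yK].
have y0 : 0 < y by exact: lt_le_trans y1.
have [||c] := @MVT R (fun t => t `^ e) (fun t => e * t `^ (e - 1)) y x xy.
- by move=> t; rewrite in_itv/= => /andP[yt _]; apply: is_derive1_powR; exact: lt_trans yt.
- apply: derivable_within_continuous => t; rewrite in_itv/= => /andP[yt _].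
  by have [] := is_derive1_powR e (lt_le_trans y0 yt).
rewrite in_itv/= => /andP[yc cx] ->.
have c1 : 1 <= c by rewrite (le_trans y1)// ltW.
rewrite !normrM ler_wpM2r// ler_wpM2l// ger0_norm ?powR_ge0//.
apply: (@le_trans _ _ (c `^ `|e - 1|)); first by apply: ler_powR => //; exact: ler_norm.
apply: ge0_ler_powR; rewrite ?nnegrE ?normr_ge0 ?(le_trans _ c1)//.
  by rewrite (le_trans _ (le_trans c1 (ltW (lt_le_trans cx xK))))//.
exact: ltW (lt_le_trans cx xK).
Qed.

Lemma PL_powR (e : R) (g : d.-tuple R -> R) : (forall x, 1 <= g x) -> PL g -> PL (fun x => g x `^ e).
Proof.
move=> g1 pg.
have -> : (fun x => g x `^ e) = (fun x => (Num.max 1 (g x)) `^ e).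
  by apply/funext => x; rewrite max_r.
apply: (@PL_comp _ _ (fun t => (Num.max 1 t) `^ e)) => //.
  move=> M; pose K := Num.max 1 M.
  exists (`|e| * K `^ `|e - 1|); first by rewrite mulr_ge0// powR_ge0.
  move=> a a' aM aM'.
  have h (t : R) : `|t| <= M -> 1 <= Num.max 1 t <= K.
    move=> tM; rewrite le_max lexx /= ge_max le_max lexx /= le_max.
    by rewrite (le_trans (ler_norm _) tM) orbT.
  apply: (le_trans (powR_lip1 e (h a aM) (h a' aM'))).
  rewrite ler_wpM2l ?mulr_ge0 ?powR_ge0//.
  rewrite !ler_norml; case: (leP 1 a) => ?; case: (leP 1 a') => ?;
   have := ler_norm (a - a'); have := ler_norm (- (a - a')); rewrite normrN => ? ?; apply/andP; split; lra.
apply: (@measurableT_comp _ _ _ _ _ _ (fun t : R => t `^ e)); first exact: measurable_powR.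
by apply: measurable_maxr; [exact: measurable_cst|exact: measurable_id].
Qed.

End PowerLipschitz.

Section BellmanNeighbours.
Context (R : realType) (d : nat).
Variables (p de : R).
Hypothesis p2 : 2 <= p.

(** The first order Taylor terms, summed over all neighbours, collapse by the two balance equations
    to the zero order term. *)
Lemma neighbour_sum (U V g1 g2 u2 u0 v2 v0 b2 b0 bU : R) (us us' vs vs' bs bs' : 'I_d -> R) :
  u2 + u0 + \sum_(j < d) (us j + us' j) = (2 + 2 * d%:R + de ^+ 2) * U ->
  v2 + v0 + \sum_(j < d) (vs j + vs' j) = (2 + 2 * d%:R + de ^+ 2) * V ->
  (b2 - bU - (g1 * (u2 - U) + g2 * (v2 - V))) + (b0 - bU - (g1 * (u0 - U) + g2 * (v0 - V)))
  + \sum_(j < d) ((bs j - bU - (g1 * (us j - U) + g2 * (vs j - V)))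
                  + (bs' j - bU - (g1 * (us' j - U) + g2 * (vs' j - V)))) =
  b2 + b0 + \sum_(j < d) (bs j + bs' j) - (2 + 2 * d%:R) * bU - de ^+ 2 * (g1 * U + g2 * V).
Proof.
move=> hu' hv'.
have -> : \sum_(j < d) ((bs j - bU - (g1 * (us j - U) + g2 * (vs j - V)))
                  + (bs' j - bU - (g1 * (us' j - U) + g2 * (vs' j - V)))) =
   \sum_(j < d) (bs j + bs' j) - \sum_(j < d) 2 * bU
   - (g1 * (\sum_(j < d) (us j + us' j) - \sum_(j < d) 2 * U)
      + g2 * (\sum_(j < d) (vs j + vs' j) - \sum_(j < d) 2 * V)).
  rewrite -!sumrB !mulr_sumr -big_split -sumrB; apply: eq_bigr => j _ /=.
  by ring.
have cst (c : R) : \sum_(j < d) c = d%:R * c by rewrite sumr_const card_ord mulr_natl.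
rewrite !cst; move: hu' hv'; set SU := \sum_(j < d) (us j + _); set SV := \sum_(j < d) (vs j + _) => hu' hv'.
have eU : SU = (2 + 2 * d%:R + de ^+ 2) * U - u2 - u0 by rewrite -hu'; ring.
have eV : SV = (2 + 2 * d%:R + de ^+ 2) * V - v2 - v0 by rewrite -hv'; ring.
by rewrite eU eV; ring.
Qed.

(** Two Taylor remainders are kept: one spatial neighbour for its [u]-difference and the next time
    step for its [v]-difference. Their weights [G] and [G^-1] are reciprocal, so the
    arithmetic-geometric inequality gives a product of differences free of weights. The sign [sg]
    allows bounds from both sides. *)
Lemma bellman_neighbours (sg U V u2 u0 v2 v0 : R) (us us' vs vs' : 'I_d -> R) (i : 'I_d) :
  `|sg| = 1 ->
  u2 + u0 + \sum_(j < d) (us j + us' j) = (2 + 2 * d%:R + de ^+ 2) * U ->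
  v2 + v0 + \sum_(j < d) (vs j + vs' j) = (2 + 2 * d%:R + de ^+ 2) * V ->
  `|u2 - U| <= 1 -> `|u0 - U| <= 1 -> `|v2 - V| <= 1 -> `|v0 - V| <= 1 ->
  (forall j, `|us j - U| <= 1) -> (forall j, `|us' j - U| <= 1) ->
  (forall j, `|vs j - V| <= 1) -> (forall j, `|vs' j - V| <= 1) ->
  (2 + 2 * d%:R) * bellman p U V + bc p * (sg * ((us' i - U) * (v2 - V))) <=
  bellman p u2 v2 + bellman p u0 v0 +
  \sum_(j < d) (bellman p (us j) (vs j) + bellman p (us' j) (vs' j)).
Proof.
move=> sg1 hu' hv' hu2 hu0 hv2 hv0 hus hus' hvs hvs'.
have c0 := bc_gt0 p; have E0 := bE_gt0 p U V.
have c2 : 0 <= bc p / 2 by rewrite divr_ge0// ltW.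
set g1 := bG1 p U V; set g2 := bG2 p U V; set G := bE p U V `^ bg p; set G' := bE p U V `^ (- bg p).
have G0 : 0 < G by rewrite powR_gt0.
have G'E : G' = G^-1 by rewrite /G' powRN.
have G'0 : 0 < G' by rewrite powR_gt0.
pose T u v := bellman p u v - bellman p U V - (g1 * (u - U) + g2 * (v - V)).
have tay u v : `|u - U| <= 1 -> `|v - V| <= 1 ->
    bc p / 2 * (G * (u - U) ^+ 2 + G' * (v - V) ^+ 2) <= T u v.
  move=> h1 h2; have := bellman_taylor p2 U V h1 h2.
  have -> : U + (u - U) = u by ring.
  have -> : V + (v - V) = v by ring.
  rewrite /T -/g1 -/g2 -/G -/G'; move: (bellman p u v) (bellman p U V) => A B.
  set X := bc p / 2 * _; set Y := g1 * _ + _; lra.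
have part1 u v : `|u - U| <= 1 -> `|v - V| <= 1 -> bc p / 2 * (G * (u - U) ^+ 2) <= T u v.
  move=> h1 h2; apply: le_trans (tay u v h1 h2).
  by rewrite ler_wpM2l// lerDl mulr_ge0 ?sqr_ge0// ltW.
have part2 u v : `|u - U| <= 1 -> `|v - V| <= 1 -> bc p / 2 * (G' * (v - V) ^+ 2) <= T u v.
  move=> h1 h2; apply: le_trans (tay u v h1 h2).
  by rewrite ler_wpM2l// lerDr mulr_ge0 ?sqr_ge0// ltW.
have part0 u v : `|u - U| <= 1 -> `|v - V| <= 1 -> 0 <= T u v.
  move=> h1 h2; apply: le_trans (part1 u v h1 h2).
  by rewrite mulr_ge0// mulr_ge0 ?sqr_ge0// ltW.
have sumT := neighbour_sum g1 g2 (bellman p u2 v2) (bellman p u0 v0) (bellman p U V)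
  (fun j => bellman p (us j) (vs j)) (fun j => bellman p (us' j) (vs' j)) hu' hv'.
have Dsum : bc p / 2 * (G * (us' i - U) ^+ 2) <= \sum_(j < d) (T (us j) (vs j) + T (us' j) (vs' j)).
  rewrite (bigD1 i)//=.
  have q1 : 0 <= \sum_(j < d | j != i) (T (us j) (vs j) + T (us' j) (vs' j)).
    by apply: sumr_ge0 => j _; apply: addr_ge0; exact: part0.
  have q2 := part0 _ _ (hus i) (hvs i); have q3 := part1 _ _ (hus' i) (hvs' i).
  move: q1 q2 q3; set A := \sum_(j < d | _) _; set B := T (us i) _; set C := T (us' i) _; set D := bc p / 2 * _.
  by move=> q1 q2 q3; lra.
have Tp := part2 _ _ hu2 hv2; have Tm := part0 _ _ hu0 hv0.
have prod : sg * ((us' i - U) * (v2 - V)) <= (G * (us' i - U) ^+ 2 + G' * (v2 - V) ^+ 2) / 2.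
  rewrite G'E; move: (us' i - U) (v2 - V) => a b.
  have sg2 : sg ^+ 2 = 1 by rewrite -real_normK ?num_real// sg1 expr1n.
  rewrite -subr_ge0 (_ : _ - _ = (G * a - sg * b) ^+ 2 / (2 * G)).
    by rewrite divr_ge0 ?sqr_ge0// mulr_ge0// ltW.
  rewrite (_ : (G * a - sg * b) ^+ 2 = G ^+ 2 * a ^+ 2 - 2 * G * a * sg * b + sg ^+ 2 * b ^+ 2); last by ring.
  by rewrite sg2; field; rewrite gt_eqF.
have prodc := ler_wpM2l (ltW c0) prod.
have mono : 0 <= de ^+ 2 * (g1 * U + g2 * V).
  by apply: mulr_ge0; [exact: sqr_ge0|apply: addr_ge0; [exact: bG1_mono|exact: bG2_mono]].
move: sumT Dsum Tp Tm prodc mono; rewrite -!/(T _ _).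
set S1 := \sum_(j < d) (T _ _ + _); set S2 := \sum_(j < d) _.
set B2 := bellman p u2 v2; set B0 := bellman p u0 v0; set BU := bellman p U V.
set T2 := T u2 v2; set T0 := T u0 v0; set M := de ^+ 2 * _.
set P1 := G * _; set P2 := G' * _; set Q := sg * _.
have -> : bc p * ((P1 + P2) / 2) = bc p / 2 * P1 + bc p / 2 * P2 by field.
set c1 := bc p / 2 * P1; set c3 := bc p / 2 * P2; set cq := bc p * Q.
move=> e h1 h2 h3 h4 h5; clear -e h1 h2 h3 h4 h5.
have {}e : T2 + T0 + S1 = B2 + B0 + S2 - (2 + 2 * d%:R) * BU - M by exact: e.
by lra.
Qed.

(** By translation invariance the 2 d spatial neighbours have the same integral as [B1] and cancel 2
    d of the 2 + 2 d; a second difference in time remains. *)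
Lemma integrated_energy (c sg : R) (B2 B0 B1 ab : d.-tuple R -> R) (Bs Bs' : 'I_d -> d.-tuple R -> R) :
  bmf B2 -> bmf B0 -> bmf B1 -> bmf ab -> (forall j, bmf (Bs j)) -> (forall j, bmf (Bs' j)) ->
  (forall j, \int[torus R d]_x Bs j x = \int[torus R d]_x B1 x) ->
  (forall j, \int[torus R d]_x Bs' j x = \int[torus R d]_x B1 x) ->
  (forall x, (2 + 2 * d%:R) * B1 x + c * (sg * ab x) <= B2 x + B0 x + \sum_(j < d) (Bs j x + Bs' j x)) ->
  c * (sg * \int[torus R d]_x ab x) <=
  \int[torus R d]_x B2 x + \int[torus R d]_x B0 x - 2 * \int[torus R d]_x B1 x.
Proof.
move=> m2 m0 m1 mab ms ms' Is Is' pw.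
have b1 : bmf (fun x => (2 + 2 * d%:R) * B1 x) by apply: bmfM => //; exact: bmf_cst.
have b2' : bmf (fun x => sg * ab x) by apply: bmfM => //; exact: bmf_cst.
have b2 : bmf (fun x => c * (sg * ab x)) by apply: bmfM => //; exact: bmf_cst.
have b3 : bmf (fun x => \sum_(j < d) (Bs j x + Bs' j x)) by apply: bmf_sum => j; apply: bmfD.
have b4 : bmf (fun x => B2 x + B0 x) by apply: bmfD.
have := le_Int (torus R d) (bmfD b1 b2) (bmfD b4 b3) pw.
rewrite (IntD _ b1 b2) (IntD _ b4 b3) (IntD _ m2 m0) (IntZ _ _ m1) (IntZ _ c b2') (IntZ _ sg mab).
rewrite Int_sum; last by move=> j; apply: bmfD.
under eq_bigr => j _ do rewrite (IntD _ (ms j) (ms' j)) Is Is'.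
move: (\int[torus R d]_x B1 x) (\int[torus R d]_x B2 x) (\int[torus R d]_x B0 x) (\int[torus R d]_x ab x) => I1 I2 I0 Iab.
have cst (c' : R) : \sum_(j < d) c' = d%:R * c' by rewrite sumr_const card_ord mulr_natl.
rewrite cst; set A := c * _; lra.
Qed.

End BellmanNeighbours.

Section BellmanEnergy.
Context (R : realType) (d : nat).
Local Notation mu := (torus R d).
Variables (p de : R).
Hypothesis p2 : 2 <= p.
Hypothesis de0 : 0 < de.
Variables (N : nat) (f h : d.-tuple R -> R) (i : 'I_d).
Hypothesis fN : trig N f.
Hypothesis hN : trig N h.
Hypothesis fs : hsmall de N f.
Hypothesis hs' : hsmall de N h.
Local Notation u := (hu de N f).
Local Notation v := (hu de N h).
Local Notation rho := (@hrho R d de).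

Lemma PL_bellman (a b : d.-tuple R -> R) : PL a -> PL b -> PL (fun x => bellman p (a x) (b x)).
Proof.
move=> pa pb.
have sq (c : d.-tuple R -> R) : PL c -> PL (fun x => 1 + c x ^+ 2) /\ forall x, 1 <= 1 + c x ^+ 2.
  move=> pc; split; last by move=> x; rewrite lerDl sqr_ge0.
  apply: PL_D; first exact: PL_cst.
  by rewrite /GRing.exp /=; exact: PL_M.
have [ya ya1] := sq a pa; have [yb yb1] := sq b pb.
have p1 e (g : d.-tuple R -> R) : (forall x, 1 <= g x) -> 0 <= e -> forall x : d.-tuple R, 1 <= g x `^ e :> R.
  by move=> g1 e0 x; have := ler_powR (g1 x) e0; rewrite powRr0.
have pE : PL (fun x => bE p (a x) (b x)) by apply: PL_D; exact: PL_powR.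
have E1 x : 1 <= bE p (a x) (b x).
  by rewrite /bE (le_trans (p1 _ _ ya1 (ltW (ba_gt0 p2)) x))// lerDl powR_ge0.
apply: PL_D; first by apply: PL_M => //; exact: PL_powR.
by apply: PL_M; [exact: PL_cst|exact: PL_powR].
Qed.

Definition psi n : R := \int[mu]_x bellman p (u n x) (v n x).

Let pu n : PL (u n). Proof. exact: PL_trig (hu_trig de fN n). Qed.
Let pv n : PL (v n). Proof. exact: PL_trig (hu_trig de hN n). Qed.
Let pB n : PL (fun x => bellman p (u n x) (v n x)). Proof. exact: PL_bellman. Qed.

Lemma psi_ge0 n : 0 <= psi n.
Proof. by apply: Rintegral_ge0 => x _; exact: bellman_ge0. Qed.

Lemma psi_bounded : exists M : R, forall n, psi n <= M.
Proof.
pose S := hsum N f + hsum N h.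
have S0 (g : d.-tuple R -> R) : 0 <= hsum N g by apply: sumr_ge0 => k _; exact: cmod_ge0.
pose M := (1 + bA p) * ((1 + S ^+ 2) `^ ba p + (1 + S ^+ 2) `^ bb p).
exists M => n; rewrite -(IntC mu M); apply: le_Int; [exact: PL_bmf|exact: bmf_cst|].
move=> x; apply: (le_trans (bellman_le p2 _ _)).
have A0 : 0 <= 1 + bA p by rewrite addr_ge0// ltW// bA_gt0.
rewrite ler_wpM2l// lerD//; apply: ge0_ler_powR; rewrite ?nnegrE ?addr_ge0 ?sqr_ge0 ?(ltW (ba_gt0 p2)) ?(ltW (bb_gt0 p2))// lerD2l -[X in X <= _]real_normK ?num_real// ler_sqr ?nnegrE ?addr_ge0//.
  by rewrite (le_trans (hu_bound de0 N _ n x))// lerDl.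
by rewrite (le_trans (hu_bound de0 N _ n x))// lerDr.
Qed.

Definition da n x := u n.+1 (tsub x (sh i (- de))) - u n.+1 x.
Definition db n x := v n.+2 x - v n.+1 x.
Definition Jn n : R := \int[mu]_x (da n x * db n x).

Lemma trig_shift g n (t : R) : trig N g -> trig N (fun x => hu de N g n (tsub x (sh i t))).
Proof.
by move=> gN; exists (fun k => hc de g n k * cis (- (2 * pi * ((k i)%:~R * t)))) => x; rewrite hu_shift_syn.
Qed.

Lemma da_trig n : trig N (da n).
Proof. by apply: trigB; [exact: trig_shift|exact: hu_trig]. Qed.

Lemma db_trig n : trig N (db n).
Proof. by apply: trigB; exact: hu_trig. Qed.

Lemma pointwise_energy (sg : R) n x : `|sg| = 1 ->
  (2 + 2 * d%:R) * bellman p (u n.+1 x) (v n.+1 x) + bc p * (sg * (da n x * db n x)) <=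
  bellman p (u n.+2 x) (v n.+2 x) + bellman p (u n x) (v n x) +
  \sum_(j < d) (bellman p (u n.+1 (tsub x (sh j de))) (v n.+1 (tsub x (sh j de)))
    + bellman p (u n.+1 (tsub x (sh j (- de)))) (v n.+1 (tsub x (sh j (- de))))).
Proof.
move=> sg1.
have nde : `|- de| = de by rewrite normrN gtr0_norm.
have ndp : `|de| = de by rewrite gtr0_norm.
have t1 (g : d.-tuple R -> R) : trig N g -> hsmall de N g -> `|hu de N g n x - hu de N g n.+1 x| <= 1.
  by move=> gN hg; rewrite distrC; exact: (hu_diff_t de0 gN n x hg).
exact: (@bellman_neighbours R d p de p2 sg _ _ _ _ _ _ _ _ _ _ i sg1 (hu_balance de0 fN n x) (hu_balance de0 hN n x)
  (hu_diff_t de0 fN n.+1 x fs) (t1 f fN fs) (hu_diff_t de0 hN n.+1 x hs') (t1 h hN hs')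
  (fun j => hu_diff_x de0 fN n.+1 x j fs ndp) (fun j => hu_diff_x de0 fN n.+1 x j fs nde)
  (fun j => hu_diff_x de0 hN n.+1 x j hs' ndp) (fun j => hu_diff_x de0 hN n.+1 x j hs' nde)).
Qed.

Lemma energy_step (sg : R) n : `|sg| = 1 -> bc p * (sg * Jn n) <= psi n.+2 + psi n - 2 * psi n.+1.
Proof.
move=> sg1.
have bBn m : bmf (fun x => bellman p (u m x) (v m x)) by exact: PL_bmf.
have bdab : bmf (fun x => da n x * db n x) by apply: bmfM; [exact: trig_bmf (da_trig n)|exact: trig_bmf (db_trig n)].
exact: (@integrated_energy R d (bc p) sg _ _ _ _ _ _ (bBn n.+2) (bBn n) (bBn n.+1) bdab
  (fun j => bmf_tsubl (sh j de) (bBn n.+1)) (fun j => bmf_tsubl (sh j (- de)) (bBn n.+1))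
  (fun j => Int_PL_tsubl (sh j de) (pB n.+1)) (fun j => Int_PL_tsubl (sh j (- de)) (pB n.+1))
  (fun x => pointwise_energy n x sg1)).
Qed.

Definition ckf k : R := (rho k - 1) * complex.Re ((cis (2 * pi * ((k i)%:~R * de)) - 1) * fourier f k * fourier h (- k)).

(** On each frequency the product of the space and the time difference is a geometric sequence with
    ratio rho^2. Dividing by (1 - rho^2)^2 thus inverts the second difference, which leads to
    [Thn]. *)
Lemma JnE n : Jn n = \sum_(k <- box d N) ckf k * (rho k ^+ 2) ^+ n.+1.
Proof.
have tab : trig (N + N) (fun x => da n x * db n x) := trigM (da_trig n) (db_trig n).
have e0 : (Jn n)%:C%C = fourier (da n \* db n) 0 by rewrite -(Int_fourier0 tab).
rewrite (fourierM 0 (da_trig n) (trig_integrable (db_trig n))) in e0.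
rewrite -[LHS]/(complex.Re ((Jn n)%:C%C)) e0.
have reS' (F : freq d -> R[i]) : complex.Re (\sum_(k <- box d N) F k) = \sum_(k <- box d N) complex.Re (F k).
  by elim: (box d N) => [|k s ih]; rewrite ?big_nil// !big_cons -ih; case: (F k) => a b; case: (\sum_(j <- s) F j).
rewrite reS'; apply: eq_big_seq => k kN.
have -> : fourier (da n) k = hc de f n.+1 k * (cis (2 * pi * ((k i)%:~R * de)) - 1).
  have := @fourier_syn R d N (da n) (fun k => hc de f n.+1 k * cis (- (2 * pi * ((k i)%:~R * - de))) - hc de f n.+1 k).
  move=> -> //; first by rewrite kN !mulrN opprK mulrBr mulr1.
  move=> x; rewrite /da rmorphB /= hu_shift_syn// hu_syn// /syn -sumrB.
  by apply: eq_bigr => l _; rewrite mulrBl.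
have -> : fourier (db n) (0 - k) = (rho k ^+ n.+2 - rho k ^+ n.+1)%:C%C * fourier h (- k).
  have := fourierB (trig_integrable (hu_trig de hN n.+2)) (trig_integrable (hu_trig de hN n.+1)).
  move=> /(congr1 (fun g => g (0 - k))); rewrite /= => ->.
  by rewrite !hu_fourier// sub0r /hc hrhoN -mulrBl rmorphB.
rewrite /hc /ckf.
have -> : (rho k ^+ n.+1)%:C%C * fourier f k * (cis (2 * pi * ((k i)%:~R * de)) - 1) * ((rho k ^+ n.+2 - rho k ^+ n.+1)%:C%C * fourier h (- k))
  = (rho k ^+ n.+1 * (rho k ^+ n.+2 - rho k ^+ n.+1))%:C%C * ((cis (2 * pi * ((k i)%:~R * de)) - 1) * fourier f k * fourier h (- k)) :> R[i].
  by rewrite rmorphM; ring.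
rewrite cReM /= mul0r subr0 -exprM mulnC exprM.
by rewrite [_ ^+ n.+2]exprS [in RHS]expr2; ring.
Qed.

(* Second differences of [Thn] are the energies [Jn], and [Thn 0] tends to the pairing of the Riesz transform of f
   with h as [de] tends to 0; [psi] -/+ a multiple of [Thn] is convex and bounded, hence nonincreasing. *)
Definition Thn n : R := \sum_(k <- box d N) ckf k * (rho k ^+ 2) ^+ n.+1 / (1 - rho k ^+ 2) ^+ 2.

Let r01 k : 0 <= rho k ^+ 2 < 1.
Proof.
have h0 := hrho_gt0 de0 k; have h1 := hrho_lt1 de0 k.
by rewrite sqr_ge0 /= expr_lt1// ltW.
Qed.

Lemma Thn_diff n : Thn n.+2 + Thn n - 2 * Thn n.+1 = Jn n.
Proof.
rewrite JnE /Thn mulr_sumr -big_split -sumrB /=; apply: eq_bigr => k _.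
have /andP[r0 r1] := r01 k; set r := rho k ^+ 2 in r0 r1 *.
have r1' : 1 - r != 0 by rewrite subr_eq0 eq_sym lt_eqF.
by rewrite !(exprS r); field.
Qed.

Lemma Thn_cvg : Thn n @[n --> \oo] --> (0 : R).
Proof.
have -> : (0 : R) = \sum_(k <- box d N) 0 by rewrite big1.
apply: cvg_big_seq => k; have /andP[r0 r1] := r01 k; set r := rho k ^+ 2 in r0 r1 *.
have -> : (fun n => ckf k * r ^+ n.+1 / (1 - r) ^+ 2) = (fun n => (ckf k * r / (1 - r) ^+ 2) * r ^+ n).
  by apply/funext => n; rewrite exprS; ring.
rewrite -[X in _ --> X](mulr0 (ckf k * r / (1 - r) ^+ 2)).
apply: cvgM; first exact: cvg_cst.
by apply: cvg_expr; rewrite ger0_norm.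
Qed.

Lemma bellman_duality : bc p * `|Thn 0| <= psi 0.
Proof.
have [M hM] := psi_bounded.
have Tb : exists T, forall n, `|Thn n| <= T.
  have : bounded_fun Thn by apply: cvg_seq_bounded; apply/cvg_ex; exists 0; exact: Thn_cvg.
  move=> [T [_ hT]]; exists (T + 1) => n; apply: hT => //.
  by rewrite ltrDl.
have [T hT] := Tb; have c0 := bc_gt0 p.
have main (sg : R) : `|sg| = 1 -> bc p * (sg * Thn 0) <= psi 0.
  move=> sg1; pose g n := psi n - bc p * (sg * Thn n).
  have gd : forall n, g n <= g 0%N.
    apply: (@convex_bounded_decr R g (M + bc p * T)).
      move=> n; have := energy_step n sg1; rewrite -Thn_diff /g.
      by move: (Thn n) (Thn n.+1) (Thn n.+2) (psi n) (psi n.+1) (psi n.+2) => t0 t1 t2 s0 s1 s2; lra.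
    move=> n; rewrite /g; apply: lerD; first exact: hM.
    rewrite -mulrN; apply: ler_wpM2l; first exact: ltW.
    by apply: (le_trans (ler_norm _)); rewrite normrN normrM sg1 mul1r; exact: hT.
  have cv : bc p * (sg * Thn n) @[n --> \oo] --> (0 : R).
    rewrite -[X in _ --> X](mulr0 (bc p)); apply: cvgM; first exact: cvg_cst.
    by rewrite -[X in _ --> X](mulr0 sg); apply: cvgM; [exact: cvg_cst|exact: Thn_cvg].
  have cv2 : psi 0 - bc p * (sg * Thn 0) + bc p * (sg * Thn n) @[n --> \oo] --> psi 0 - bc p * (sg * Thn 0) + 0.
    by apply: cvgD => //; exact: cvg_cst.
  (* Let n tend to infinity in [gd]: [psi n] is nonnegative and [Thn n] tends to 0. *)
  rewrite -subr_ge0 -[X in 0 <= X]addr0.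
  apply: (ler_cvg_to (@cvg_cst _ (0 : R) _ \oo _) cv2).
  apply: nearW => n; have := gd n; have := psi_ge0 n; rewrite /g.
  by move: (psi 0) (psi n) (Thn 0) (Thn n) => s0 s1 t0 t1; lra.
have [t0|t0] := leP 0 (Thn 0).
  by rewrite ger0_norm//; have := main 1 (normr1 _); rewrite mul1r.
rewrite ltr0_norm//; have := main (-1); rewrite normrN1 mulN1r; exact.
Qed.

End BellmanEnergy.

(** * Vanishing step and boundedness of the Riesz transforms *)

Section SmallStepLimits.
Context (R : realType).

Definition stp (m : nat) : R := m.+1%:R^-1.

Lemma stp_gt0 m : 0 < stp m. Proof. by rewrite invr_gt0 ltr0n. Qed.

Lemma stp_cvg : stp m @[m --> \oo] --> (0 : R).
Proof. exact: cvg_harmonic. Qed.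

Lemma sin_stp (a : R) : sin (a * stp m) / stp m @[m --> \oo] --> a.
Proof.
have d0 : is_derive (0 : R) 1 (fun t => sin (a * t)) a.
  by apply: is_derive_eq; rewrite /GRing.scale /= mulr0 cos0; ring.
have [dv ev] := d0.
have h : (fun t : R => t^-1 *: (sin (a * (t *: 1 + 0)) - sin (a * 0))) @ 0^' --> 'D_1 (fun t => sin (a * t)) (0 : R) by exact: dv.
rewrite ev in h.
have sn : stp m @[m --> \oo] --> (0 : R)^'.
  move=> A hA; have hA' : nbhs (0 : R) (fun x => x != 0 -> A x) by exact: hA.
  have h2 : \forall m \near \oo, stp m != 0 -> A (stp m) by exact: (stp_cvg hA').
  change (\forall m \near \oo, A (stp m)).
  by apply: filterS h2 => m; apply; rewrite (gt_eqF (stp_gt0 m)).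
have -> : (fun m => sin (a * stp m) / stp m) = (fun t : R => t^-1 *: (sin (a * (t *: 1 + 0)) - sin (a * 0))) \o stp.
  by apply/funext => m; rewrite /= mulr0 sin0 subr0 addr0 /GRing.scale /= mulr1 mulrC.
exact: (cvg_comp _ _ sn h).
Qed.

Lemma cos_stp2 (a : R) : (1 - cos (a * stp m)) / stp m ^+ 2 @[m --> \oo] --> a ^+ 2 / 2.
Proof.
have -> : (fun m => (1 - cos (a * stp m)) / stp m ^+ 2) = (fun m => 2 * (sin (a / 2 * stp m) / stp m) ^+ 2).
  apply/funext => m; have h := stp_gt0 m.
  have e : a * stp m = a / 2 * stp m + a / 2 * stp m by field.
  have := cos2Dsin2 (a / 2 * stp m); rewrite e cosD => hh.
  move: hh; set c := cos _; set z := sin _ => hh.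
  have -> : c * c = 1 - z ^+ 2 by rewrite -expr2; lra.
  by field; rewrite gt_eqF.
have -> : a ^+ 2 / 2 = 2 * ((a / 2) * (a / 2)) by field.
apply: cvgM; first exact: cvg_cst.
by under eq_fun do rewrite expr2; apply: cvgM; exact: sin_stp.
Qed.

Lemma cos_stp1 (a : R) : (1 - cos (a * stp m)) / stp m @[m --> \oo] --> (0 : R).
Proof.
have -> : (fun m => (1 - cos (a * stp m)) / stp m) = (fun m => stp m * ((1 - cos (a * stp m)) / stp m ^+ 2)).
  by apply/funext => m; have h := stp_gt0 m; field; rewrite gt_eqF.
rewrite -[X in _ --> X](mul0r (a ^+ 2 / 2)).
by apply: cvgM; [exact: stp_cvg|exact: cos_stp2].
Qed.

Lemma near_seq (I : eqType) (s : seq I) (P : I -> nat -> Prop) :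
  (forall i, \forall m \near \oo, P i m) -> \forall m \near \oo, forall i, i \in s -> P i m.
Proof.
move=> h; elim: s => [|i s ih]; first by apply: nearW.
near=> m => j; rewrite inE => /predU1P[->|js].
  by near: m; exact: h.
by move: j js; near: m.
Unshelve. all: by end_near. Qed.

End SmallStepLimits.

Lemma Re_cis_sub1 (R : realType) (t : R) (z : R[i]) :
  complex.Re ((cis t - 1) * z) = (cos t - 1) * complex.Re z - sin t * complex.Im z.
Proof. by case: z => a b; rewrite cReM /= subr0. Qed.

Section RieszLimit.
Context (R : realType) (d : nat).
Local Notation mu := (torus R d).
Implicit Types (k : freq d).

Lemma hs_stp k : @hs R d (stp R m) k / stp R m ^+ 2 @[m --> \oo] --> jb (fr R k) / 2.
Proof.
have -> : (fun m => @hs R d (stp R m) k / stp R m ^+ 2) = (fun m => 1 / 2 + \sum_(j < d) (1 - cos (2 * pi * (k j)%:~R * stp R m)) / stp R m ^+ 2).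
  apply/funext => m; have h := stp_gt0 R m.
  rewrite /hs mulrDl -mulr_suml; congr (_ + _); first by field; rewrite gt_eqF.
  by congr (_ / _); apply: eq_bigr => j _; rewrite mulrA.
have h1 : (1 / 2 : R) @[_ --> \oo] --> (1 / 2 : R) by exact: cvg_cst.
have h2 := @cvg_big_seq R 'I_d (index_enum 'I_d) (fun j m => (1 - cos (2 * pi * (k j)%:~R * stp R m)) / stp R m ^+ 2) _ (fun j => @cos_stp2 R (2 * pi * (k j)%:~R)).
have -> : jb (fr R k) / 2 = 1 / 2 + \sum_(j < d) (2 * pi * (k j)%:~R) ^+ 2 / 2.
  by rewrite /jb [LHS]mulrDl [X in _ + X]mulr_suml.
exact: (cvgD h1 h2).
Qed.

(** The discrete decay rate tends to that of the semigroup generated by - (1 - Delta)^(1/2).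
    Rewriting with y = hs / step^2, which has the limit jb / 2, removes the quotient of vanishing
    quantities. *)
Lemma rho_stp k : (1 - @hrho R d (stp R m) k) / stp R m @[m --> \oo] --> (jf 1 k : R).
Proof.
pose y m := @hs R d (stp R m) k / stp R m ^+ 2.
have -> : (fun m => (1 - @hrho R d (stp R m) k) / stp R m) =
   (fun m => Num.sqrt (stp R m * stp R m * (y m * y m) + 2 * y m) - stp R m * y m).
  apply/funext => m; have h := stp_gt0 R m; rewrite /y /hrho.
  set s := hs _ _; set t := stp R m in h *.
  have -> : (1 - (1 + s - Num.sqrt (s ^+ 2 + 2 * s))) / t = Num.sqrt (s ^+ 2 + 2 * s) / t - s / t by ring.
  congr (_ - _); last by field; rewrite gt_eqF.
  have -> : Num.sqrt (s ^+ 2 + 2 * s) / t = Num.sqrt (s ^+ 2 + 2 * s) * Num.sqrt (t^-1 ^+ 2).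
    by rewrite sqrtr_sqr ger0_norm// invr_ge0 ltW.
  rewrite -sqrtrM; last by have h' := ltW (hs_gt0 h k); rewrite -/s in h'; pos0.
  by congr Num.sqrt; field; rewrite gt_eqF.
have cy : y m @[m --> \oo] --> jb (fr R k) / 2 := @hs_stp k.
have -> : jf 1 k = Num.sqrt (0 * 0 * (jb (fr R k) / 2 * (jb (fr R k) / 2)) + 2 * (jb (fr R k) / 2)) - 0 * (jb (fr R k) / 2) :> R.
  rewrite !mul0r add0r subr0 mulrCA mulfV// mulr1 -jp1_sqr sqrtr_sqr ger0_norm//.
  exact: ltW (jp_gt0 _ _).
apply: cvgB; last by apply: cvgM => //; exact: stp_cvg.
apply: continuous_cvg; first exact: sqrt_continuous.
apply: cvgD; last by apply: cvgM => //; exact: cvg_cst.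
by apply: cvgM; apply: cvgM => //; exact: stp_cvg.
Qed.

Lemma rho_cvg1 k : @hrho R d (stp R m) k @[m --> \oo] --> (1 : R).
Proof.
have -> : (fun m => @hrho R d (stp R m) k) = (fun m => 1 - stp R m * ((1 - @hrho R d (stp R m) k) / stp R m)).
  by apply/funext => m; have h := stp_gt0 R m; field; rewrite gt_eqF.
rewrite -[X in _ --> X](subr0 1) -[X in 1 - X](mul0r (jf 1 k : R)).
by apply: cvgB; [exact: cvg_cst|apply: cvgM; [exact: stp_cvg|exact: rho_stp]].
Qed.

Lemma near_le1 (u : nat -> R) : u m @[m --> \oo] --> (0 : R) -> \forall m \near \oo, u m <= 1.
Proof. by move=> h; apply: (cvgr_le _ h); exact: ltr01. Qed.

Lemma near_hsmall N (f : d.-tuple R -> R) : \forall m \near \oo, hsmall (stp R m) N f.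
Proof.
pose P k m := cmod (fourier f k) * (1 - hrho (stp R m) k) * (size (box d N))%:R <= 1 /\
  forall j t, `|t| = stp R m -> cmod (fourier f k) * cmod (cis (- (2 * pi * ((k j)%:~R * t))) - 1) * (size (box d N))%:R <= 1.
suff h k : \forall m \near \oo, P k m by exact: (near_seq (box d N) h).
pose Q j m := cmod (fourier f k) * Num.sqrt (2 * (1 - cos (2 * pi * (k j)%:~R * stp R m))) * (size (box d N))%:R <= 1.
have hQ j : \forall m \near \oo, Q j m.
  apply: near_le1.
  rewrite -[X in _ --> X](mul0r (size (box d N))%:R); apply: cvgM; last exact: cvg_cst.
  rewrite -[X in _ --> X](mulr0 (cmod (fourier f k))); apply: cvgM; first exact: cvg_cst.
  rewrite -[X in _ --> X]sqrtr0; apply: continuous_cvg; first exact: sqrt_continuous.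
  rewrite -[X in _ --> X](mulr0 2); apply: cvgM; first exact: cvg_cst.
  have -> : (fun m => 1 - cos (2 * pi * (k j)%:~R * stp R m)) = (fun m => stp R m * ((1 - cos (2 * pi * (k j)%:~R * stp R m)) / stp R m)).
    by apply/funext => m; have h := stp_gt0 R m; field; rewrite gt_eqF.
  by rewrite -[X in _ --> X](mul0r 0); apply: cvgM; [exact: stp_cvg|exact: cos_stp1].
have hQ' := near_seq (enum 'I_d) hQ.
have h1 : \forall m \near \oo, cmod (fourier f k) * (1 - hrho (stp R m) k) * (size (box d N))%:R <= 1.
  apply: near_le1.
  rewrite -[X in _ --> X](mul0r (size (box d N))%:R); apply: cvgM; last exact: cvg_cst.
  rewrite -[X in _ --> X](mulr0 (cmod (fourier f k))); apply: cvgM; first exact: cvg_cst.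
  by rewrite -[X in _ --> X](subrr 1); apply: cvgB; [exact: cvg_cst|exact: rho_cvg1].
near=> m; split; first by near: m.
move=> j t tm.
have hq : forall j, j \in enum 'I_d -> Q j m by near: m; exact: hQ'.
have := hq j (mem_enum _ j).
rewrite /Q; congr (_ * _ * _ <= _).
rewrite /cmod; congr Num.sqrt; rewrite /nsq /= cosN sinN.
have := cos2Dsin2 (2 * pi * ((k j)%:~R * t)).
have -> : cos (2 * pi * (k j)%:~R * stp R m) = cos (2 * pi * ((k j)%:~R * t)).
  by rewrite -tm; case: (ger0P t) => _; rewrite !mulrA// mulrN cosN.
set c := cos _; set s := sin _ => h.
have -> : (c - 1) ^+ 2 + (- s - 0) ^+ 2 = (c ^+ 2 + s ^+ 2) - 2 * c + 1 by ring.
by rewrite h; ring.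
Unshelve. all: by end_near. Qed.

(** Symbol of the inhomogeneous Riesz transform d_i (1 - Delta)^(-1/2). *)
Definition rz (i : 'I_d) k : R[i] := (0 +i* (2 * pi * (k i)%:~R))%C * ((jf (- 1) k)%:C)%C.

Lemma rz_herm i : hermitian (rz i).
Proof.
move=> k; rewrite /rz cconjM jfN; congr (_ * _); last by rewrite /=; congr (_ +i* _)%C; rewrite oppr0.
by rewrite [(- k) i]/(- k i) rmorphN /= mulrN.
Qed.

Definition riesz i N (f : d.-tuple R -> R) := reS N (fun k => rz i k * fourier f k).

Lemma riesz_herm i N (f : d.-tuple R -> R) : trig N f -> hermitian (fun k => rz i k * fourier f k).
Proof.
move=> fN; apply: hermitianM; first exact: rz_herm.
by apply: hermitian_fourier; exact: trig_integrable fN.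
Qed.

Lemma riesz_trig i N (f : d.-tuple R -> R) : trig N f -> trig N (riesz i N f).
Proof. by move=> fN; apply: trig_reS; exact: riesz_herm fN. Qed.

Lemma riesz_fourier i N (f : d.-tuple R -> R) k : trig N f -> fourier (riesz i N f) k = rz i k * fourier f k.
Proof.
move=> fN; rewrite fourier_reS; last exact: riesz_herm fN.
by case: ifPn => // kN; rewrite (trig_fourier0 fN kN) mulr0.
Qed.

Lemma Int_mul_fourier N (a b : d.-tuple R -> R) : trig N a -> trig N b ->
  \int[mu]_x (a x * b x) = \sum_(k <- box d N) complex.Re (fourier a k * fourier b (- k)).
Proof.
move=> aN bN; have ab : trig (N + N) (fun x => a x * b x) := trigM aN bN.
have e0 : (\int[mu]_x (a x * b x))%:C%C = fourier (a \* b) 0 by rewrite (Int_fourier0 ab).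
rewrite -[LHS]/(complex.Re ((\int[mu]_x (a x * b x))%:C%C)) e0 (fourierM 0 aN (trig_integrable bN)).
elim: (box d N) => [|k s ih]; rewrite ?big_nil// !big_cons -ih sub0r.
by case: (fourier a k * _) => ? ?; case: (\sum_(j <- s) _).
Qed.

(** The limit of [bellman_duality] as the step vanishes. In [Thn] the denominator (1 - rho^2)^2
    contains (1 + rho)^2, which tends to 4, and the cosine part of the difference disappears; the
    pairing is therefore -4 times the limit [L]. *)
Lemma riesz_pairing i N (f h : d.-tuple R -> R) p : 2 <= p -> trig N f -> trig N h ->
  `|\int[mu]_x (riesz i N f x * h x)| <= 4 / bc p * \int[mu]_x bellman p (f x) (h x).
Proof.
move=> p2 fN hN; have c0 := bc_gt0 p.
rewrite (Int_mul_fourier (riesz_trig i fN) hN).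
pose K k := fourier f k * fourier h (- k).
have -> : \sum_(k <- box d N) complex.Re (fourier (riesz i N f) k * fourier h (- k)) =
   (-4) * \sum_(k <- box d N) (1 / 4 * (jf 1 k)^-1 * (2 * pi * (k i)%:~R * complex.Im (K k))).
  rewrite mulr_sumr; apply: eq_bigr => k _; rewrite riesz_fourier// -mulrA -/(K k) /rz -mulrA.
  rewrite !(cReM, cImM) /= /jf jpN.
  by field; rewrite gt_eqF// jp_gt0.
rewrite normrM normrN normr_nat -mulrA ler_wpM2l//.
rewrite [X in _ <= X]mulrC ler_pdivlMr// mulrC.
set L := \sum_(k <- _) _.
have cv : Thn (stp R m) N f h i 0 @[m --> \oo] --> L.
  rewrite /Thn; apply: (@cvg_big_seq R _ (box d N) (fun k m => ckf (stp R m) f h i k * (hrho (stp R m) k ^+ 2) ^+ 1 / (1 - hrho (stp R m) k ^+ 2) ^+ 2)) => k.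
  pose rh m : R := hrho (stp R m) k.
  have -> : (fun m => ckf (stp R m) f h i k * (rh m ^+ 2) ^+ 1 / (1 - rh m ^+ 2) ^+ 2) =
     (fun m => (rh m * rh m) / ((1 + rh m) * (1 + rh m)) * ((1 - rh m) / stp R m)^-1 *
        ((1 - cos (2 * pi * (k i)%:~R * stp R m)) / stp R m * complex.Re (K k) + sin (2 * pi * (k i)%:~R * stp R m) / stp R m * complex.Im (K k))).
    apply/funext => m; rewrite /ckf -/(rh m) -[(cis _ - 1) * _ * _]mulrA -/(K k) Re_cis_sub1.
    move: (complex.Re (K k)) (complex.Im (K k)) => A B.
    have h1 : 0 < stp R m := stp_gt0 R m.
    have r1 : rh m < 1 := hrho_lt1 h1 k.
    have r0 : 0 < rh m := hrho_gt0 h1 k.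
    have -> : 2 * pi * ((k i)%:~R * stp R m) = 2 * pi * (k i)%:~R * stp R m by rewrite mulrA.
    move: (stp R m) h1 (rh m) r0 r1 (cos _) (sin _) => t t0 r r0 r1 C S.
    have e1 : 1 - r != 0 by rewrite subr_eq0 eq_sym lt_eqF.
    have e2 : 1 + r != 0 by rewrite gt_eqF// addr_gt0.
    have -> : 1 - r ^+ 2 = (1 - r) * (1 + r) by ring.
    by field; rewrite e1 e2 gt_eqF.
  have -> : 1 / 4 * (jf 1 k)^-1 * (2 * pi * (k i)%:~R * complex.Im (K k)) =
    (1 * 1) / ((1 + 1) * (1 + 1)) * (jf 1 k)^-1 * (0 * complex.Re (K k) + (2 * pi * (k i)%:~R) * complex.Im (K k)) :> R.
    by field; rewrite gt_eqF// jp_gt0.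
  have cr : rh m @[m --> \oo] --> (1 : R) := @rho_cvg1 k.
  have c1r : 1 + rh m @[m --> \oo] --> (1 + 1 : R) by apply: cvgD => //; exact: cvg_cst.
  apply: cvgM.
    apply: cvgM; last by apply: cvgV; [rewrite gt_eqF// jp_gt0|exact: rho_stp].
    apply: cvgM; first exact: cvgM.
    by apply: cvgV; [rewrite gt_eqF// mulr_gt0|exact: cvgM].
  apply: cvgD; (apply: cvgM; last exact: cvg_cst); [exact: cos_stp1|exact: sin_stp].
have cv2 : bc p * `|Thn (stp R m) N f h i 0| @[m --> \oo] --> bc p * `|L|.
  by apply: cvgM; [exact: cvg_cst|exact: cvg_norm].
apply: (ler_cvg_to cv2 (@cvg_cst _ (\int[mu]_x bellman p (f x) (h x)) _ \oo _)).
near=> m.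
have hf : hsmall (stp R m) N f by near: m; exact: near_hsmall.
have hh : hsmall (stp R m) N h by near: m; exact: near_hsmall.
have := bellman_duality p2 (stp_gt0 R m) i fN hN hf hh.
by rewrite /psi !hu0.
Unshelve. all: by end_near. Qed.

End RieszLimit.

Section RieszBound.
Context (R : realType) (d : nat).
Local Notation mu := (torus R d).
Implicit Types (f g h : d.-tuple R -> R).
Variable p : R.
Hypothesis p2 : 2 <= p.
Local Notation p' := (p / (p - 1)).

Let p0 : 0 < p. Proof. exact: lt_le_trans p2. Qed.
Let pm1 : 0 < p - 1. Proof. by rewrite subr_gt0 (lt_le_trans _ p2)// ltr1n. Qed.
Let p'0 : 0 < p'. Proof. exact: divr_gt0. Qed.
Let p'1 : 1 <= p'. Proof. by rewrite ler_pdivlMr// mul1r lerBlDr lerDl. Qed.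
Let p1 : 1 <= p. Proof. by rewrite (le_trans _ p2)// ler1n. Qed.
Let conj_pp : p^-1 + p'^-1 = 1.
Proof. by field; rewrite !gt_eqF. Qed.

Lemma sq_pow_le (t a : R) : 0 < a -> (1 + t ^+ 2) `^ a <= 2 `^ a * (1 + `|t| `^ (2 * a)).
Proof.
move=> a0; have t0 : 0 <= `|t| by [].
have e : t ^+ 2 = `|t| ^+ 2 by rewrite real_normK ?num_real.
have e2 : `|t| `^ (2 * a) = (t ^+ 2) `^ a by rewrite powRrM powR_mulrn// -e.
have [t1|t1] := leP (t ^+ 2) 1.
  apply: (@le_trans _ _ (2 `^ a)).
    apply: ge0_ler_powR; rewrite ?nnegrE ?(ltW a0) ?addr_ge0 ?sqr_ge0//.
    by rewrite -[X in _ <= X]/(1 + 1) lerD2l.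
  by rewrite ler_peMr ?powR_ge0// lerDl powR_ge0.
apply: (@le_trans _ _ ((2 * t ^+ 2) `^ a)).
  by apply: ge0_ler_powR; [exact: ltW|rewrite nnegrE; pos0|rewrite nnegrE; pos0|lra].
rewrite powRM ?sqr_ge0// ler_wpM2l ?powR_ge0// e2.
by rewrite lerDr.
Qed.

(** The trailing factors 2 bound the integrals of 1 + |f|^p and 1 + |h|^p' in the normalized case;
    the general case follows by homogeneity. *)
Definition bconst : R := 4 / bc p * ((1 + bA p) * (2 `^ ba p * 2 + 2 `^ bb p * 2)).

Lemma bconst_ge0 : 0 <= bconst.
Proof.
have c0 := ltW (bc_gt0 p); have A0 := ltW (bA_gt0 p2).
by rewrite /bconst; pos0.
Qed.

Lemma riesz_pairing1 i N f h : trig N f -> trig N h -> Lb mu p f 1 -> Lb mu p' h 1 ->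
  `|\int[mu]_x (riesz i N f x * h x)| <= bconst.
Proof.
move=> fN hN f1 h1; apply: (le_trans (riesz_pairing i p2 fN hN)).
have c0 := ltW (bc_gt0 p); have A0 := ltW (bA_gt0 p2).
rewrite ler_wpM2l ?divr_ge0//.
have bf := trig_bmf fN; have bh := trig_bmf hN.
have If : \int[mu]_x `|f x| `^ p <= 1.
  by have [+ _] := Lb_bmfE p0 ler01 bf; move=> /(_ f1); rewrite powR1.
have Ih : \int[mu]_x `|h x| `^ p' <= 1.
  by have [+ _] := Lb_bmfE p'0 ler01 bh; move=> /(_ h1); rewrite powR1.
have bfp : bmf (fun x => `|f x| `^ p) := bmf_pow p0 bf.
have bhp : bmf (fun x => `|h x| `^ p') := bmf_pow p'0 bh.
have b1 : bmf (fun x => 2 `^ ba p * (1 + `|f x| `^ p)).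
  by apply: bmfM; [exact: bmf_cst|apply: bmfD => //; exact: bmf_cst].
have b2 : bmf (fun x => 2 `^ bb p * (1 + `|h x| `^ p')).
  by apply: bmfM; [exact: bmf_cst|apply: bmfD => //; exact: bmf_cst].
apply: (@le_trans _ _ (\int[mu]_x ((1 + bA p) * (2 `^ ba p * (1 + `|f x| `^ p) + 2 `^ bb p * (1 + `|h x| `^ p'))))).
  apply: le_Int.
  - by apply: PL_bmf; apply: PL_bellman => //; [exact: PL_trig fN|exact: PL_trig hN].
  - by apply: bmfM; [exact: bmf_cst|apply: bmfD].
  - move=> x; apply: (le_trans (bellman_le p2 _ _)); rewrite ler_wpM2l ?addr_ge0// /bE lerD//.
      have := sq_pow_le (f x) (ba_gt0 p2).
      by rewrite (_ : 2 * ba p = p)//; rewrite /ba; field.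
    have := sq_pow_le (h x) (bb_gt0 p2).
    by rewrite (_ : 2 * bb p = p')//; rewrite /bb; field; rewrite gt_eqF.
rewrite (IntZ mu _ (bmfD b1 b2)) ler_wpM2l ?addr_ge0// (IntD mu b1 b2).
have bc1 : bmf (fun x : d.-tuple R => 1 : R) by exact: bmf_cst.
rewrite (IntZ mu _ (bmfD bc1 bfp)) (IntZ mu _ (bmfD bc1 bhp)) (IntD mu bc1 bfp) (IntD mu bc1 bhp) IntC.
by rewrite lerD// ler_wpM2l ?powR_ge0// -[X in _ <= X]/(1 + 1) lerD2l.
Qed.

Lemma riesz_scale i N (c : R) f : trig N f -> riesz i N (fun x => c * f x) = (fun x => c * riesz i N f x).
Proof.
move=> fN; have cN := trigZ c fN; apply: (@trig_eq _ _ N N); first exact: riesz_trig.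
  by apply: trigZ; exact: riesz_trig.
apply/funext => k; rewrite riesz_fourier// (fourierZ c (trig_integrable fN)) (fourierZ c (trig_integrable (riesz_trig i fN))).
by rewrite /scaleD riesz_fourier//; ring.
Qed.

Lemma riesz_pairing2 i N f h A B : trig N f -> trig N h -> 0 < A -> 0 < B -> Lb mu p f A -> Lb mu p' h B ->
  `|\int[mu]_x (riesz i N f x * h x)| <= bconst * A * B.
Proof.
move=> fN hN A0 B0 fA hB.
have f1 : Lb mu p (fun x => A^-1 * f x) 1.
  by have := Lb_scale A^-1 p0 fA; rewrite ger0_norm ?invr_ge0 ?(ltW A0)// mulVf// gt_eqF.
have h1 : Lb mu p' (fun x => B^-1 * h x) 1.
  by have := Lb_scale B^-1 p'0 hB; rewrite ger0_norm ?invr_ge0 ?(ltW B0)// mulVf// gt_eqF.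
have := riesz_pairing1 i (trigZ A^-1 fN) (trigZ B^-1 hN) f1 h1.
rewrite riesz_scale//.
have bRh : bmf (fun x => riesz i N f x * h x).
  by apply: bmfM; [exact: trig_bmf (riesz_trig i fN)|exact: trig_bmf hN].
have -> : (fun x => A^-1 * riesz i N f x * (B^-1 * h x)) = (fun x => (A^-1 * B^-1) * (riesz i N f x * h x)).
  by apply/funext => x; ring.
rewrite (IntZ mu _ bRh) normrM ger0_norm; last by rewrite mulr_ge0// invr_ge0 ltW.
rewrite -invfM ler_pdivrMl ?mulr_gt0//.
by rewrite (_ : bconst * A * B = A * B * bconst)//; ring.
Qed.

Lemma Lb_limit q g (c : R) : (forall e, 0 < e -> Lb mu q g (c + e)) -> Lb mu q g c.
Proof.
move=> h; split; first by have [] := h 1 ltr01.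
by apply/lee_addgt0Pr => e e0; have [_] := h e e0.
Qed.

(* Test against trigonometric approximations of g |g|^(p-2). *)
Lemma Lb_of_duality g C N : trig N g -> 0 <= C ->
  (forall M h B, trig M h -> 0 < B -> Lb mu p' h B -> `|\int[mu]_x (g x * h x)| <= C * B) ->
  Lb mu p g C.
Proof.
move=> gN C0 H; have bg' := trig_bmf gN.
pose I := \int[mu]_x `|g x| `^ p.
have I0 : 0 <= I by apply: Rintegral_ge0 => x _; exact: powR_ge0.
apply/(Lb_bmfE p0 C0 bg'); rewrite -/I.
have [I00|In0] := eqVneq I 0; first by rewrite I00 powR_ge0.
have Igt : 0 < I by rewrite lt_neqAle eq_sym In0.
pose h0 x := g x * `|g x| `^ (p - 2).
have abs_h0 x : `|h0 x| = `|g x| `^ (p - 1).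
  rewrite /h0 normrM [`|_ `^ _|]ger0_norm ?powR_ge0//.
  have [->|gx] := eqVneq (g x) 0; first by rewrite normr0 mul0r powR0// gt_eqF.
  have n0 : 0 < `|g x| by rewrite normr_gt0.
  rewrite -[X in X * _]powRr1// -powRD ?(gt_eqF n0) ?implybT//; congr (_ `^ _); ring.
have gh0 x : g x * h0 x = `|g x| `^ p.
  have [gx|gx] := eqVneq (g x) 0; first by rewrite gx mul0r normr0 powR0// gt_eqF.
  have n0 : 0 < `|g x| by rewrite normr_gt0.
  rewrite /h0 mulrA -expr2 -real_normK ?num_real// -powR_mulrn// -powRD ?(gt_eqF n0) ?implybT//.
  by congr (_ `^ _); ring.
have [mg [S gS]] := bg'.
have bh0 : bmf h0.
  apply: bmfM => //; split.
    apply: (measurableT_comp (measurable_powR _)); exact: measurableT_comp.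
  exists (S `^ (p - 2)) => x; rewrite ger0_norm ?powR_ge0//.
  have S0 : 0 <= S by exact: le_trans (normr_ge0 _) (gS x).
  by apply: ge0_ler_powR; rewrite ?nnegrE ?subr_ge0.
have Ih0 : \int[mu]_x `|h0 x| `^ p' = I.
  apply: eq_Rintegral => x _; rewrite abs_h0 -powRrM; congr (_ `^ _).
  by field; rewrite gt_eqF.
have Lh0 : Lb mu p' h0 (I `^ p'^-1).
  apply/(Lb_bmfE p'0 (powR_ge0 _ _) bh0); rewrite Ih0 -powRrM mulVf ?gt_eqF//.
  by rewrite powRr1.
have S0 : 0 <= `|S| by [].
have key e : 0 < e -> I <= C * I `^ p'^-1 + e * (C + `|S|).
  move=> e0; have [M [h [hM he]]] := Lb_trig_dense p'1 Lh0 e0.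
  have bh := trig_bmf hM.
  have hB : Lb mu p' h (I `^ p'^-1 + e).
    have := Lb_B p'1 Lh0 he; congr (Lb _ _ _ _); apply/funext => x; ring.
  have B0 : 0 < I `^ p'^-1 + e by rewrite ltr_wpDl ?powR_ge0.
  have h1 := H M h _ hM B0 hB.
  have bgh : bmf (fun x => g x * h x) by exact: bmfM.
  have bd : bmf (fun x => h0 x - h x) by exact: bmfB.
  have bgd : bmf (fun x => g x * (h0 x - h x)) by exact: bmfM.
  have IE : I = \int[mu]_x (g x * h x) + \int[mu]_x (g x * (h0 x - h x)).
    rewrite -(IntD mu bgh bgd); apply: eq_Rintegral => x _.
    by rewrite -mulrDr addrC subrK gh0.
  have h2 : `|\int[mu]_x (g x * (h0 x - h x))| <= `|S| * e.
    have bSd : bmf (fun x => `|S| * `|h0 x - h x|) by apply: bmfM; [exact: bmf_cst|exact: bmf_norm].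
    apply: (le_trans (Int_abs_le bgd bSd _)).
      by move=> x; rewrite normrM ler_wpM2r// (le_trans (gS x))// ler_norm.
    rewrite (IntZ mu _ (bmf_norm bd)) ler_wpM2l//.
    have := Lb_L1 p'1 he; rewrite -(Int_EFin mu (bmf_norm bd)) lee_fin.
    by [].
  rewrite {1}IE; move: h1 h2; rewrite !ler_norml => /andP[_ h1] /andP[_ h2].
  by apply: (le_trans (lerD h1 h2)); rewrite mulrDr mulrDr; lra.
have fin : I <= C * I `^ p'^-1.
  apply/ler_addgt0Pr => e e0.
  have D0 : 0 < C + `|S| + 1 by rewrite ltr_wpDl// addr_ge0.
  apply: (le_trans (key (e / (C + `|S| + 1)) (divr_gt0 e0 D0))).
  rewrite lerD2l mulrAC ler_pdivrMr// ler_wpM2l ?(ltW e0)//.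
  by rewrite lerDl.
have h3 : I `^ p^-1 <= C.
  have e1 : p^-1 = 1 - p'^-1 by move: conj_pp; set a := p^-1; set b := p'^-1; lra.
  rewrite e1 powRD ?(gt_eqF Igt) ?implybT// powRr1// powRN ler_pdivrMr ?powR_gt0//.
have := ge0_ler_powR (ltW p0) (powR_ge0 I p^-1) C0 h3.
by rewrite -powRrM mulVf ?gt_eqF// powRr1.
Qed.

Lemma riesz_mono i N M f : trig N f -> trig M f -> riesz i N f = riesz i M f.
Proof.
move=> fN fM; apply: (@trig_eq _ _ N M); [exact: riesz_trig|exact: riesz_trig|].
by apply/funext => k; rewrite !riesz_fourier.
Qed.

(** Normalization divides by the bound, so it is done for a positive [A'] slightly above [A], and
    the excess is removed by [Lb_limit]. *)
Theorem riesz_bound i N f A : trig N f -> Lb mu p f A -> Lb mu p (riesz i N f) (bconst * A).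
Proof.
move=> fN fA; have A0 := Lb_ge0 fA; have b0 := bconst_ge0.
have main A' : 0 < A' -> Lb mu p f A' -> Lb mu p (riesz i N f) (bconst * A').
  move=> A'0 fA'; apply: (@Lb_of_duality _ _ N); [exact: riesz_trig|by rewrite mulr_ge0// ltW|].
  move=> M h B hM B0 hB.
  have fNM := trig_mono (leq_maxl N M) fN; have hNM := trig_mono (leq_maxr N M) hM.
  rewrite (riesz_mono i fN fNM).
  exact: riesz_pairing2.
apply: Lb_limit => e e0.
have D0 : 0 < bconst + 1 by rewrite ltr_wpDl.
have e1 : 0 < e / (bconst + 1) by exact: divr_gt0.
have AA : A <= A + e / (bconst + 1) by rewrite lerDl ltW.
apply: Lb_le (main _ (ltr_wpDl A0 e1) (Lb_le AA fA)).
rewrite mulrDr lerD2l; exact: mul_div_add1_le b0 e0.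
Qed.

End RieszBound.

(** * Composition with smooth functions *)

Section Differentiability.
Context (R : realType).
Implicit Types (D : set R) (f g : R -> R).

Fixpoint cn (n : nat) D f : Prop :=
  if n is n'.+1 then (forall x, D x -> derivable f x 1) /\ cn n' D (derive1 f) else True.

Lemma smooth_cn D f : smooth_on D f -> forall n, cn n D f.
Proof.
move=> h n; elim: n f h => //= n ih f h; split; first exact: (h 0%N).
by apply: ih => m x Dx; have := h m.+1 x Dx; rewrite /derive1n iterSr.
Qed.

Lemma derive1_near f g x : (\near x, f x = g x) -> derive1 f x = derive1 g x.
Proof. by move=> h; rewrite !derive1E; apply: near_eq_derive h. Qed.

Lemma cn_eq n D f g : open D -> (forall x, D x -> f x = g x) -> cn n D f -> cn n D g.
Proof.
move=> oD; elim: n f g => //= n ih f g fg [h1 h2].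
have nfg x : D x -> \near x, f x = g x.
  by move=> Dx; have : nbhs x D := open_nbhs_nbhs (conj oD Dx); apply: filterS.
split; first by move=> x Dx; apply: near_eq_derivable (nfg x Dx) (h1 x Dx).
by apply: ih h2 => x Dx; apply: derive1_near; exact: nfg.
Qed.

Lemma cn_le n D f : cn n.+1 D f -> cn n D f.
Proof.
elim: n f => //= n ih f [h1 [h2 h3]]; split => //.
by apply: ih; split.
Qed.

Lemma cn_add n D f g : open D -> cn n D f -> cn n D g -> cn n D (fun x => f x + g x).
Proof.
move=> oD; elim: n f g => //= n ih f g [f1 f2] [g1 g2]; split.
  by move=> x Dx; apply: derivableD; [exact: f1|exact: g1].
apply: cn_eq (ih _ _ f2 g2) => // x Dx.
by rewrite [RHS]derive1E (@deriveD _ _ _ f g x 1 (f1 x Dx) (g1 x Dx)) -!derive1E.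
Qed.

Lemma cn_mul n D f g : open D -> cn n D f -> cn n D g -> cn n D (fun x => f x * g x).
Proof.
move=> oD; elim: n f g => //= n ih f g [f1 f2] [g1 g2].
have fn : cn n D f by apply: cn_le; split.
have gn : cn n D g by apply: cn_le; split.
split; first by move=> x Dx; apply: derivableM; [exact: f1|exact: g1].
apply: cn_eq (cn_add oD (ih _ _ f2 gn) (ih _ _ fn g2)) => // x Dx.
rewrite [RHS]derive1E (@deriveM _ _ f g x 1 (f1 x Dx) (g1 x Dx)) -!derive1E.
by rewrite /GRing.scale /= addrC [g x * _]mulrC.
Qed.

Lemma cn_cst n D (c : R) : cn n D (fun=> c).
Proof.
elim: n c => //= n ih c; split; first by move=> x _; exact: derivable_cst.
have -> : derive1 (fun _ : R => c) = fun=> 0 by apply/funext => x; exact: derive1_cst.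
exact: ih.
Qed.

Lemma cn_scale n (c : R) f : cn n setT f -> cn n setT (fun x => f (c * x)).
Proof.
elim: n f => //= n ih f [f1 f2].
have dc (x : R) : is_derive x 1 (fun t : R => c * t) c.
  by apply: is_derive_eq; rewrite /GRing.scale /= mulr1.
have dd (x : R) : is_derive x 1 (fun t => f (c * t)) (derive1 f (c * x) * c).
  have df : is_derive (c * x) 1 f (derive1 f (c * x)).
    by rewrite derive1E; apply: DeriveDef => //; exact: f1.
  exact: (@is_derive1_comp R f (fun t => c * t) x _ _ df (dc x)).
split; first by move=> x _; have [] := dd x.
apply: cn_eq (cn_mul openT (ih _ f2) (@cn_cst n setT c)) => //; first exact: openT.
by move=> x _; rewrite [RHS]derive1E; have [_ ->] := dd x.
Qed.

Lemma cn_union n D E f : cn n D f -> cn n E f -> cn n (D `|` E) f.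
Proof.
elim: n f => //= n ih f [f1 f2] [g1 g2]; split; last exact: ih.
by move=> x [Dx|Ex]; [exact: f1|exact: g1].
Qed.

(** The open half-lines r > 0 and r < 1 / j cover the line. On the first all factors are smooth; on
    the second [eta (j r)] vanishes and the function is constantly 1, whatever [m] is there. For j =
    0 it is 1 everywhere. *)
Lemma regularized_cn (m eta : R -> R) (j n : nat) : smooth_on setT eta ->
  (forall r : R, r <= 1 -> eta r = 0) -> smooth_on [set r | 0 < r] m ->
  cn n setT (regularized m eta j).
Proof.
move=> /smooth_cn he eta0 /smooth_cn hm.
have [->|j0] := eqVneq j 0%N.
  have -> : regularized m eta 0 = fun=> 1.
    by apply/funext => x; rewrite /regularized mul0r eta0 ?ler01// mul0r add0r subr0.
  exact: cn_cst.
have jp : 0 < j%:R :> R by rewrite ltr0n lt0n.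
have o1 : open [set r : R | 0 < r] := @open_gt R 0.
have o2 : open [set r : R | r < j%:R^-1] := @open_lt R _.
have subT k D f : cn k setT f -> cn k D f.
  by elim: k f => //= k ih f [f1 f2]; split; [move=> x _; exact: f1|exact: ih].
have -> : setT = [set r : R | 0 < r] `|` [set r : R | r < j%:R^-1].
  apply/seteqP; split => // x _ /=; have [x0|x0] := ltP 0 x; [by left|right].
  by rewrite (le_lt_trans x0)// invr_gt0.
have ej D : cn n D (fun r => eta (j%:R * r)) by apply: subT; exact: cn_scale.
apply: cn_union.
  apply: cn_add => //; first by apply: cn_mul.
  apply: (@cn_eq _ _ (fun r => 1 + (-1) * eta (j%:R * r))) => //.
    by move=> x _; rewrite mulN1r.
  by apply: cn_add => //; [exact: cn_cst|apply: cn_mul => //; exact: cn_cst].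
apply: (@cn_eq _ _ (fun=> 1)) (@cn_cst _ _ _) => // x /= xj.
by rewrite /regularized eta0 ?mul0r ?add0r ?subr0// mulrC -ler_pdivlMr// mul1r ltW.
Qed.

Lemma lip_of_derive f (a b K : R) : (forall x, derivable f x 1) ->
  (forall x, a <= x <= b -> `|derive1 f x| <= K) ->
  forall x y, a <= x <= b -> a <= y <= b -> `|f x - f y| <= K * `|x - y|.
Proof.
move=> df hK.
have main x y : a <= x <= b -> a <= y <= b -> x <= y -> `|f y - f x| <= K * `|y - x|.
  move=> /andP[ax xb] /andP[ay yb] xy.
  have [||c] := @MVT_segment R f (derive1 f) x y xy.
  - by move=> z _; rewrite derive1E; apply: DeriveDef.
  - by apply: derivable_within_continuous => z _; exact: df.
  rewrite in_itv /= => /andP[xc cy] ->; rewrite normrM ler_wpM2r// hK//.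
  by rewrite (le_trans ax xc) (le_trans cy yb).
move=> x y hx hy; have [xy|/ltW yx] := leP x y; last exact: main.
by rewrite distrC [`|x - y|]distrC main.
Qed.

Lemma derivable_bounded f (a b : R) : a <= b -> (forall x, derivable f x 1) ->
  exists2 K : R, 0 <= K & forall x, a <= x <= b -> `|f x| <= K.
Proof.
move=> ab df.
have cf : {within `[a, b], continuous f} by apply: derivable_within_continuous => z _; exact: df.
have [c1 _ h1] := EVT_max ab cf; have [c2 _ h2] := EVT_min ab cf.
exists (`|f c1| + `|f c2|); first by rewrite addr_ge0.
move=> x hx; have xI : x \in `[a, b] by rewrite in_itv.
have := h1 x xI; have := h2 x xI; have := ler_norm (f c1); have := ler_norm (- f c2).
by rewrite normrN ler_norml; have := normr_ge0 (f c1); have := normr_ge0 (f c2); lra.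
Qed.

End Differentiability.

(** * Polynomial approximation in C^1 with rates *)

Section PolynomialApproximation.
Context (R : realType).
Variable r : R.
Hypothesis r0 : 0 < r.
Implicit Types (f g : R -> R).

(* De Casteljau: [casteljau h n f y] is the expectation of [f] at the end of an n-step walk from [y]
   whose steps are [h] with probability [(X + r) / 2 r] and [0] otherwise; for [y = - r] and
   [h = 2 r / n] it is the Bernstein polynomial of [f] on [[-r, r]]. *)
Definition castw : {poly R} := (2 * r)^-1 *: ('X + r%:P).

Fixpoint casteljau (h : R) (n : nat) f (y : R) : {poly R} :=
  if n is n'.+1 then (1 - castw) * casteljau h n' f y + castw * casteljau h n' f (y + h)
  else (f y)%:P.

Let castE := (hornerD, hornerM, hornerN, hornerC).

Lemma castwE x : castw.[x] = (x + r) / (2 * r).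
Proof. by rewrite /castw !hornerE mulrC. Qed.

Lemma castw01 x : - r <= x <= r -> 0 <= castw.[x] <= 1.
Proof.
move=> /andP[x1 x2]; rewrite castwE ler_pdivrMr ?mulr_gt0// divr_ge0 ?mulr_ge0 ?(ltW r0)//; lra.
Qed.

Lemma size_castw : (size castw <= 2)%N.
Proof. by rewrite (leq_trans (size_scale_leq _ _))// size_XaddC. Qed.

Lemma size_casteljau h n f y : (size (casteljau h n f y) <= n.+1)%N.
Proof.
elim: n y => [|n ih] y /=; first exact: size_polyC_leq1.
have mul2 (p q : {poly R}) : (size p <= 2)%N -> (size q <= n.+1)%N -> (size (p * q)%R <= n.+2)%N.
  move=> sp sq; apply: (leq_trans (size_polyMleq _ _)).
  by move: sp sq; move: (size p) (size q) => a b; lia.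
rewrite (leq_trans (size_polyD _ _))// geq_max !mul2// ?size_castw//.
by rewrite (leq_trans (size_polyD _ _))// geq_max size_polyN size_castw size_poly1.
Qed.

Lemma casteljau_le h n f g x y : - r <= x <= r -> 0 <= h ->
  (forall z, y <= z <= y + n%:R * h -> f z <= g z) ->
  (casteljau h n f y).[x] <= (casteljau h n g y).[x].
Proof.
move=> hx h0; elim: n y => [|n ih] y H /=.
  by rewrite !hornerC H// mul0r addr0 lexx.
have /andP[w0 w1] := castw01 hx.
rewrite !castE; apply: lerD; apply: ler_wpM2l; rewrite ?subr_ge0//; apply: ih => z /andP[z1 z2]; apply: H.
  by rewrite z1 (le_trans z2)// lerD2l ler_wpM2r// ler_nat.
by rewrite (le_trans _ z1) ?lerDl//= (le_trans z2)// -[n.+1]addn1 natrD; lra.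
Qed.

Lemma casteljau_lin h n f g (a : R) x y :
  (casteljau h n (fun z => f z + a * g z) y).[x] = (casteljau h n f y).[x] + a * (casteljau h n g y).[x].
Proof. by elim: n y => [|n ih] y /=; rewrite !castE// !ih; move: castw.[x] => w; ring. Qed.

Lemma casteljau_cst h n (c : R) x y : (casteljau h n (fun=> c) y).[x] = c.
Proof. by elim: n y => [|n ih] y /=; rewrite !castE// !ih; move: castw.[x] => w; ring. Qed.

(** Second moment of the walk about [c]: the square of the mean displacement plus the variance n w
    (1 - w) h^2. *)
Lemma casteljau_sqr h n (c : R) x y : (casteljau h n (fun z => (z - c) ^+ 2) y).[x] =
  (y + n%:R * castw.[x] * h - c) ^+ 2 + n%:R * castw.[x] * (1 - castw.[x]) * h ^+ 2.
Proof.
elim: n y => [|n ih] y /=; rewrite !castE; first by move: castw.[x] => w; ring.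
by rewrite !ih -[n.+1]addn1 natrD; move: castw.[x] => w; ring.
Qed.

Lemma bernstein_approx f (L : R) i : 0 <= L ->
  (forall x y, - r <= x <= r -> - r <= y <= r -> `|f x - f y| <= L * `|x - y|) ->
  exists P : {poly R}, (size P <= (4 ^ i).+1)%N /\
    forall x, - r <= x <= r -> `|f x - P.[x]| <= L * (2 * r) * 2 ^- i.
Proof.
move=> L0 fL; pose n := (4 ^ i)%N; pose h : R := 2 * r / n%:R.
have n0 : 0 < n%:R :> R by rewrite ltr0n expn_gt0.
have h0 : 0 <= h by rewrite divr_ge0 ?mulr_ge0 ?ltW.
exists (casteljau h n f (- r)); split; first exact: size_casteljau.
move=> x hx; set P := casteljau _ _ _ _.
have nh : - r + n%:R * h = r by rewrite /h; field; rewrite gt_eqF.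
pose t : R := 2 ^+ i; have t0 : 0 < t by rewrite exprn_gt0.
have nt : n%:R = t ^+ 2 by rewrite /n /t natrX -exprM mulnC exprM; congr (_ ^+ _); rewrite expr2 -natrM.
(* Chosen so that L |z - x| <= b + a (z - x)^2, with equality at |z - x| = 2 r / t. Since n = t^2,
   the mean of the right-hand side is b (1 + w (1 - w)) <= 2 b, which is the asserted error. *)
pose a := L * (t / (4 * r)); pose b := L * (r / t).
have a0 : 0 <= a by rewrite /a !mulr_ge0 ?invr_ge0 ?(ltW t0)// mulr_ge0 ?(ltW r0).
have V : (casteljau h n (fun z => b + a * (z - x) ^+ 2) (- r)).[x] <= L * (2 * r) * 2 ^- i.
  rewrite casteljau_lin casteljau_cst casteljau_sqr.
  have -> : - r + n%:R * castw.[x] * h - x = 0 by rewrite castwE /h; field; rewrite !gt_eqF.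
  have /andP[w0 w1] := castw01 hx; move: (castw.[x]) w0 w1 => w w0 w1.
  have -> : n%:R * w * (1 - w) * h ^+ 2 = w * (1 - w) * (4 * r ^+ 2 / t ^+ 2).
    by rewrite /h nt; field; rewrite gt_eqF.
  have -> : b + a * (0 ^+ 2 + w * (1 - w) * (4 * r ^+ 2 / t ^+ 2)) = L * (r / t) * (1 + w * (1 - w)).
    by rewrite /a /b; field; rewrite !gt_eqF.
  rewrite -/t (_ : L * (2 * r) / t = L * (r / t) * 2); last by field; rewrite gt_eqF.
  have c0 : 0 <= L * (r / t) by rewrite mulr_ge0// divr_ge0// ltW.
  apply: ler_wpM2l => //; have : 0 <= w * w by rewrite mulr_ge0.
  by move=> ?; rewrite mulrBr mulr1; lra.
have pt z : - r <= z <= r -> `|f z - f x| <= b + a * (z - x) ^+ 2.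
  move=> hz; apply: (le_trans (fL z x hz hx)).
  rewrite /a /b -!mulrA -mulrDr ler_wpM2l//.
  rewrite -[(z - x) ^+ 2]real_normK ?num_real//; move: `|z - x| => u.
  have tr : 0 < t / (4 * r) by rewrite divr_gt0// mulr_gt0.
  have h1 : 0 <= t / (4 * r) * (u - 2 * r / t) ^+ 2 by rewrite mulr_ge0 ?sqr_ge0 ?ltW.
  have e1 : t / (4 * r) * (u - 2 * r / t) ^+ 2 = r / t + t / (4 * r) * u ^+ 2 - u.
    by field; rewrite !gt_eqF.
  by rewrite e1 subr_ge0 in h1; rewrite mulrA.
have up : P.[x] <= f x + L * (2 * r) * 2 ^- i.
  have := @casteljau_le h n f (fun z => f x + 1 * (b + a * (z - x) ^+ 2)) x (- r) hx h0.
  rewrite nh => /(_ _)/le_trans; apply.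
    by move=> z hz; have := pt z hz; rewrite ler_norml mul1r; lra.
  by rewrite (casteljau_lin h n (fun=> f x)) casteljau_cst mul1r lerD2l.
have lo : f x - L * (2 * r) * 2 ^- i <= P.[x].
  have := @casteljau_le h n (fun z => f x + (-1) * (b + a * (z - x) ^+ 2)) f x (- r) hx h0.
  rewrite nh => /(_ _)/(le_trans _); apply.
    by rewrite (casteljau_lin h n (fun=> f x)) casteljau_cst mulN1r lerD2l lerN2.
  by move=> z hz; have := pt z hz; rewrite ler_norml mulN1r; lra.
by rewrite ler_norml; move: up lo; lra.
Qed.

Lemma poly_primitive (q : {poly R}) (c : R) : exists p : {poly R},
  [/\ deriv p = q, p.[0] = c & (size p <= (size q).+1)%N].
Proof.
exists (\poly_(i < (size q).+1) (if i is i'.+1 then q`_i' / i'.+1%:R else c)); split.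
- apply/polyP => i; rewrite coef_deriv coef_poly ltnS.
  case: ltnP => hi; last by rewrite mul0rn nth_default.
  by rewrite -[LHS]mulr_natr mulfVK// pnatr_eq0.
- by rewrite horner_coef0 coef_poly.
- exact: size_poly.
Qed.

(** Induction on [k]: if [Q] is close to f', then [f] minus a primitive of [Q] has a small Lipschitz
    constant, and its Bernstein polynomial gains another 2^-i. Each integration raises the degree by
    one only, so it remains about 4^i for every rate. *)
Lemma jackson k f : cn k.+1 setT f -> exists2 C : R, 0 <= C &
  forall i, exists P : {poly R}, (size P <= 4 ^ i + k.+1)%N /\
    forall x, - r <= x <= r -> `|f x - P.[x]| <= C * (2 ^- i) ^+ k.
Proof.
have rr : - r <= r by move: r0; lra.
elim: k f => [|k ih] f [f1 f2].
  have [K K0 hK] := derivable_bounded rr (fun x => f1 x I).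
  by exists K => // i; exists 0; rewrite size_poly0; split => // x hx; rewrite horner0 subr0 mulr1 hK.
have [C C0 hC] := ih _ f2; exists (C * (2 * r)); first by rewrite mulr_ge0// mulr_ge0// ltW.
move=> i; have [Q [sQ hQ]] := hC i; have [P1 [dP _ sP]] := poly_primitive Q 0.
pose g x := f x - P1.[x].
have dg x : derivable g x 1 by apply: derivableB; [exact: f1|exact: derivable_horner].
have e0 : 0 <= C * (2 ^- i) ^+ k by rewrite mulr_ge0// exprn_ge0// invr_ge0 exprn_ge0.
have lg := @lip_of_derive R g (- r) r (C * (2 ^- i) ^+ k) dg _.
have [x hx|P2 [sP2 hP2]] := bernstein_approx i e0 (lg _).
  rewrite derive1E deriveB; [|exact: f1|exact: derivable_horner].
  by rewrite -!derive1E -derivE dP hQ.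
exists (P1 + P2); split.
  rewrite (leq_trans (size_polyD _ _))// geq_max (leq_trans sP) ?(leq_trans sP2)//; lia.
move=> x hx; rewrite hornerD opprD addrA; apply: (le_trans (hP2 x hx)).
by rewrite exprSr le_eqVlt; apply/predU1P; left; move: (2 ^- i : R) => z; ring.
Qed.

(** Closeness in C^1 is expressed as a Lipschitz bound on the error, the form in which differences
    of two arguments need it. The normalization at 0 adds closeness of the values. *)
Lemma poly_C1_approx k f : cn k.+2 setT f -> exists2 C : R, 0 <= C &
  forall i, exists P : {poly R}, [/\ (size P <= 4 ^ i + k.+2)%N, P.[0] = f 0 &
    forall x y, - r <= x <= r -> - r <= y <= r ->
      `|(f x - P.[x]) - (f y - P.[y])| <= C * (2 ^- i) ^+ k * `|x - y|].
Proof.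
move=> [f1 f2]; have [C C0 hC] := jackson f2; exists C => // i.
have [Q [sQ hQ]] := hC i; have [P [dP P0 sP]] := poly_primitive Q (f 0).
exists P; split => //; first by rewrite (leq_trans sP)//; lia.
apply: (@lip_of_derive R (fun x => f x - P.[x])).
  by move=> x; apply: derivableB; [exact: f1|exact: derivable_horner].
move=> x hx; rewrite derive1E deriveB; [|exact: f1|exact: derivable_horner].
by rewrite -!derive1E -derivE dP hQ.
Qed.

End PolynomialApproximation.

Section DyadicSums.
Context (R : realType).

Lemma pred_le_bound (s t k : nat) : (s <= t + k.+2)%N -> (s.-1 <= t + k.+1)%N.
Proof. lia. Qed.

Lemma succ2_le (l : nat) : (l.+2 <= 2 * l.+1 ^ 2)%N.
Proof. nia. Qed.

Lemma degree_count (i b k : nat) : (((b + 2) * i.+1 + k.+2).+1 <= (b + k + 5) * i.+1)%N.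
Proof. nia. Qed.

Lemma degree_split (i b k : nat) : ((b + 2) * i.+1 + k.+2 = b + k + 4 + i * b.+2)%N.
Proof. lia. Qed.

Lemma half_pow_le (n k : nat) : (0 < k)%N -> (2 ^- n) ^+ k <= 2^-1 ^+ n :> R.
Proof.
case: k => // k _; rewrite -exprVn exprS ler_piMr ?exprn_ge0 ?invr_ge0//.
by rewrite exprn_ile1 ?exprn_ge0 ?invr_ge0// exprn_ile1 ?invr_ge0// invf_le1// ler1n.
Qed.

Lemma succ_le_p2 (a : R) : 0 < a -> exists2 C : R, 0 < C & forall i : nat, i.+1%:R <= C * 2 `^ (i%:R * a).
Proof.
move=> a0; have l0 : 0 < ln 2 :> R by rewrite ln_gt0// ltr1n.
have al : 0 < a * ln 2 by rewrite mulr_gt0.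
exists (1 + (a * ln 2)^-1); first by rewrite addr_gt0// invr_gt0.
move=> i; have e1 : 1 <= 2 `^ (i%:R * a) :> R by apply: p2_ge1; rewrite mulr_ge0// ltW.
have e2 : i%:R * (a * ln 2) <= 2 `^ (i%:R * a).
  rewrite /powR pnatr_eq0 /= mulrA; apply: le_trans (expR_ge1Dx _).
  by rewrite lerDr ler01.
rewrite mulrDl mul1r -[i.+1]addn1 natrD addrC lerD//.
by rewrite ler_pdivlMl// mulrC.
Qed.

Lemma p2_series (e : R) : 0 < e -> exists2 C : R, 0 < C & forall n, \sum_(i < n) 2 `^ (- (i%:R * e)) <= C.
Proof.
move=> e0; pose t : R := 2 `^ (- e).
have t0 : 0 <= t by exact: p2_ge0.
have t1 : t < 1.
  by rewrite /t powRN invf_lt1 ?p2_gt0// /powR pnatr_eq0 /= expR_gt1 mulr_gt0// ln_gt0// ltr1n.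
have d0 : 0 < 1 - t by rewrite subr_gt0.
exists (1 - t)^-1; first by rewrite invr_gt0.
move=> n; rewrite -[X in _ <= X]mul1r ler_pdivlMr//.
have -> : \sum_(i < n) 2 `^ (- (i%:R * e)) = \sum_(i < n) t ^+ i.
  by apply: eq_bigr => i _; rewrite /t -powR_mulrn ?p2_ge0// -powRrM mulNr mulrC.
rewrite (_ : _ * _ = 1 - t ^+ n); first by rewrite lerBlDr lerDl exprn_ge0.
elim: n => [|n ih]; first by rewrite big_ord0 mul0r subrr.
by rewrite big_ord_recr /= mulrDl ih exprS; ring.
Qed.

Lemma p2_poly_series (e : R) : 0 < e ->
  exists2 C : R, 0 < C & forall n, \sum_(i < n) i.+1%:R ^+ 2 * 2 `^ (- (i%:R * e)) <= C.
Proof.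
move=> e0; have e4 : 0 < e / 4 by rewrite divr_gt0.
have [C C0 hC] := succ_le_p2 e4.
have [D D0 hD] := p2_series (divr_gt0 e0 (ltr0Sn R 1)).
exists (C ^+ 2 * D); first by rewrite mulr_gt0// exprn_gt0.
move=> n; apply: (@le_trans _ _ (\sum_(i < n) C ^+ 2 * 2 `^ (- (i%:R * (e / 2))))).
  apply: ler_sum => i _; have h := hC i.
  have -> : C ^+ 2 * 2 `^ (- (i%:R * (e / 2))) = (C * 2 `^ (i%:R * (e / 4))) ^+ 2 * 2 `^ (- (i%:R * e)).
    have e1 : 2 `^ (i%:R * (e / 4)) * 2 `^ (i%:R * (e / 4)) * 2 `^ (- (i%:R * e)) = 2 `^ (- (i%:R * (e / 2))) :> R.
      by rewrite -!p2D; congr (_ `^ _); field.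
    by rewrite -e1; ring.
  by rewrite ler_wpM2r ?p2_ge0// lerXn2r ?nnegrE// mulr_ge0 ?p2_ge0 ?ltW.
by rewrite -mulr_sumr ler_wpM2l// exprn_ge0// ltW.
Qed.

(** Replacing b' by b + (a' - a) costs the first term. The mean value theorem for x -> F (x + de) -
    F x, taken between [a] and [b], gives the second. The shifted points may leave [- rho, rho],
    hence 3 rho. *)
Lemma four_point (F : R -> R) (K1 K2 r rho a a' b b' : R) : 3 * rho <= r ->
  (forall x y, - r <= x <= r -> - r <= y <= r -> `|F x - F y| <= K1 * `|x - y|) ->
  (forall x, derivable F x 1) ->
  (forall x y, - r <= x <= r -> - r <= y <= r -> `|derive1 F x - derive1 F y| <= K2 * `|x - y|) ->
  - rho <= a <= rho -> - rho <= a' <= rho -> - rho <= b <= rho -> - rho <= b' <= rho ->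
  `|(F a' - F a) - (F b' - F b)| <= K1 * `|(a' - a) - (b' - b)| + K2 * (`|a' - a| * `|a - b|).
Proof.
move=> rr l1 dF l2 ha ha' hb hb'.
pose de := a' - a.
have -> : F a' - F a - (F b' - F b) = (F (b + de) - F b') + ((F (a + de) - F a) - (F (b + de) - F b)).
  by rewrite /de (_ : a + (a' - a) = a'); ring.
apply: (le_trans (ler_normD _ _)); apply: lerD.
  rewrite (_ : a' - a - (b' - b) = b + de - b'); last by rewrite /de; ring.
  by apply: l1; rewrite /de; lra.
pose g x := F (x + de) - F x.
have dd (x : R) : is_derive x 1 g (derive1 F (x + de) - derive1 F x).
  have d1 : is_derive x 1 F (derive1 F x) by rewrite derive1E; apply: DeriveDef.
  have d2 : is_derive (x + de) 1 F (derive1 F (x + de)) by rewrite derive1E; apply: DeriveDef.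
  have d3 : is_derive x 1 (fun x : R => x + de) 1 by apply: is_derive_eq; rewrite addr0.
  have := @is_derive1_comp R F (fun x => x + de) x _ _ d2 d3; rewrite mulr1 => d4.
  exact: (@is_deriveB _ _ _ _ _ x 1 _ _ d4 d1).
have dg x : derivable g x 1 by have [] := dd x.
have hg x : - rho <= x <= rho -> `|derive1 g x| <= K2 * `|de|.
  move=> hx; rewrite derive1E; have [_ ->] := dd x.
  apply: (le_trans (l2 _ _ _ _)); rewrite /de; try lra.
  by rewrite (_ : x + (a' - a) - x = a' - a)//; ring.
have := lip_of_derive dg hg ha hb; rewrite -/g mulrA; exact.
Qed.

End DyadicSums.

(** * A series of trigonometric polynomials for F(u) - F(v) *)

Section Composition.
Context (R : realType) (d : nat).
Local Notation mu := (torus R d).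
Implicit Types (ul vl : nat -> d.-tuple R -> R).
Variables (q sg th : R).
Hypothesis q2 : 2 <= q.
Hypothesis th_d : d%:R / q <= th.
Hypothesis th_sg : th < sg.

Let q1 : 1 <= q. Proof. by rewrite (le_trans _ q2)// ler1n. Qed.
Let q0 : 0 < q. Proof. exact: lt_le_trans q1. Qed.
Let th0 : 0 <= th. Proof. by apply: le_trans th_d; rewrite divr_ge0// ltW. Qed.
Let sg0 : 0 < sg. Proof. exact: le_lt_trans th_sg. Qed.

(** A bound of the type B^sg_{q,oo}, which the Besov norm with summability exponent [p] dominates by
    [besov_term]. *)
Definition dyad ul A := forall l, trig (2 ^ l.+1) (ul l) /\ Lb mu q (ul l) (2 `^ (- (l%:R * sg)) * A).

Lemma dyad_ge0 ul A : dyad ul A -> 0 <= A.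
Proof. by move=> /(_ 0%N)[_ /Lb_ge0]; rewrite pmulr_rge0// p2_gt0. Qed.

Definition psum ul J (x : d.-tuple R) : R := \sum_(l < J) ul l x.

Lemma psum_trig ul A J : dyad ul A -> trig (2 ^ J) (psum ul J).
Proof.
move=> h; apply: trig_sum => l; apply: trig_mono (h l).1.
by rewrite leq_exp2l.
Qed.

(** Bernstein's inequality on each level; the gap between [sg] and [th] >= d/q leaves a geometric
    factor that absorbs the polynomial one. *)
Lemma dyad_sup : exists2 C : R, 0 < C & forall ul A, dyad ul A ->
  forall J x, \sum_(l < J) `|ul l x| <= C * A.
Proof.
have [C C0 hC] := @trig_sup R d q q1.
have e0 : 0 < sg - th by rewrite subr_gt0.
have [D D0 hD] := p2_poly_series e0.
exists (C * 2 * 2 `^ th * D); first by rewrite !mulr_gt0 ?p2_gt0.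
move=> ul A h J x; have A0 := dyad_ge0 h.
apply: (@le_trans _ _ (\sum_(l < J) (C * 2 * 2 `^ th * A) * (l.+1%:R ^+ 2 * 2 `^ (- (l%:R * (sg - th)))))).
  apply: ler_sum => l _; have [h1 h2] := h l; apply: (le_trans (hC _ _ _ h1 h2 x)).
  have a1 : l.+2%:R <= 2 * l.+1%:R ^+ 2 :> R.
    by rewrite -natrX -natrM ler_nat; exact: succ2_le.
  have a2 : 2 `^ (l.+1%:R * (d%:R / q)) <= 2 `^ (l.+1%:R * th) :> R by apply: p2_le; rewrite ler_wpM2l.
  have -> : C * 2 * 2 `^ th * A * (l.+1%:R ^+ 2 * 2 `^ (- (l%:R * (sg - th)))) =
    C * (2 * l.+1%:R ^+ 2) * 2 `^ (l.+1%:R * th) * (2 `^ (- (l%:R * sg)) * A).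
    have -> : 2 `^ (- (l%:R * (sg - th))) = 2 `^ (l%:R * th) * 2 `^ (- (l%:R * sg)) :> R.
      by rewrite -p2D; congr (_ `^ _); ring.
    have -> : 2 `^ (l.+1%:R * th) = 2 `^ th * 2 `^ (l%:R * th) :> R.
      by rewrite -p2D; congr (_ `^ _); rewrite -[l.+1]addn1 natrD; ring.
    by move: (2 `^ (l%:R * th)) (2 `^ th) (2 `^ _) => ? ? ?; ring.
  rewrite ler_wpM2r ?mulr_ge0 ?p2_ge0//.
  by apply: ler_pM; rewrite ?p2_ge0//; [rewrite mulr_ge0// ltW|rewrite ler_wpM2l// ltW].
rewrite -mulr_sumr (_ : C * 2 * 2 `^ th * D * A = C * 2 * 2 `^ th * A * D); last by ring.
by have C0' := ltW C0; rewrite ler_wpM2l// !mulr_ge0 ?p2_ge0.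
Qed.

Lemma dyad_block_Lb : exists2 C : R, 0 < C & forall ul A, dyad ul A ->
  forall J m, Lb mu q (fun x => psum ul (J + m) x - psum ul J x) (C * 2 `^ (- (J%:R * sg)) * A).
Proof.
have [D D0 hD] := p2_series sg0.
exists D => // ul A h J m; have A0 := dyad_ge0 h.
have -> : (fun x => psum ul (J + m) x - psum ul J x) = (fun x => \sum_(i < m) ul (J + i)%N x).
  by apply/funext => x; rewrite /psum big_split_ord /= addrAC subrr add0r.
apply: Lb_le (@Lb_sum _ _ _ _ q _ (index_enum 'I_m) (fun i x => ul (J + i)%N x) _ q1 (fun i => (h (J + i)%N).2)).
have -> : \sum_(i < m) 2 `^ (- ((J + i)%:R * sg)) * A = 2 `^ (- (J%:R * sg)) * A * \sum_(i < m) 2 `^ (- (i%:R * sg)).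
  rewrite mulr_sumr; apply: eq_bigr => i _.
  have -> : - ((J + i)%:R * sg) = - (J%:R * sg) + - (i%:R * sg) by rewrite natrD; ring.
  by rewrite p2D mulrAC.
rewrite [X in _ <= X](_ : _ = 2 `^ (- (J%:R * sg)) * A * D); last by ring.
by rewrite ler_wpM2l// mulr_ge0 ?p2_ge0.
Qed.

(* By [product_estimate], B controls the norm on H^{r,q} of multiplication by the sum of the w_i. *)
Definition mser (w : nat -> d.-tuple R -> R) (kk : nat -> nat) (b : nat -> R) (B : R) :=
  (forall i, trig (2 ^ kk i) (w i) /\ Lb mu q (w i) (b i)) /\
  forall n, \sum_(i < n) (kk i).+1%:R ^+ 2 * 2 `^ ((kk i)%:R * th) * b i <= B.

Lemma deg_bound (i k b : nat) : ((4 ^ i + k.+1) * 2 ^ (b * i) <= 2 ^ ((b + 2) * i + k.+2))%N.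
Proof.
have h1 : (4 ^ i + k.+1 <= 2 ^ (2 * i + k.+2))%N.
  rewrite expnD expnM (_ : (2 ^ 2 = 4)%N)//; have := ltn_expl k.+2 (ltnSn 1); have : (0 < 4 ^ i)%N by rewrite expn_gt0.
  by move: (4 ^ i)%N (2 ^ k.+2)%N => a c; nia.
rewrite (_ : ((b + 2) * i + k.+2 = (2 * i + k.+2) + b * i)%N); last by ring.
by rewrite [X in (_ <= X)%N]expnD leq_mul2r h1 orbT.
Qed.

Theorem composition_series (F : R -> R) (A : R) : (forall n, cn n setT F) -> 0 <= A ->
  exists2 C : R, 0 < C & forall ul vl D, dyad ul A -> dyad vl A ->
    dyad (fun l x => ul l x - vl l x) D ->
    exists w kk b, mser w kk b (C * D) /\
      forall x u v, psum ul J x @[J --> \oo] --> u -> psum vl J x @[J --> \oo] --> v ->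
        \sum_(i < n) w i x @[n --> \oo] --> F u - F v.
Proof.
move=> sF A0.
have [C1 C10 hC1] := dyad_sup; have [C2 C20 hC2] := dyad_block_Lb.
pose rho := C1 * A; pose r := 3 * rho + 1.
have rho0 : 0 <= rho by rewrite mulr_ge0// ltW.
have r0 : 0 < r by rewrite /r; move: rho0; lra.
have rr : - r <= r by move: r0; lra.
(* Degree 2^((b + 2) i) enters the multiplier bound with exponent [th], and the level b i
   contributes decay with exponent [sg]. The surplus 1 leaves a factor 2^-i for summation. *)
have [b hb] : exists b : nat, (b.+2)%:R * th + 1 <= b%:R * sg.
  have e0 : 0 < sg - th by rewrite subr_gt0.
  exists (Num.truncn ((2 * th + 1) / (sg - th))).+1.
  have := ltW (truncnS_gt ((2 * th + 1) / (sg - th))); rewrite ler_pdivrMr//.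
  by move: (Num.truncn _) => t; rewrite -[t.+3]addn2 natrD; lra.
(* The polynomial error 2^(- i k) then is at most the decay 2^(- i b sg) of the pieces; k > 0 gives
   convergence of the errors in [cT]. *)
have [k hk] : exists k : nat, b%:R * sg <= k%:R /\ (0 < k)%N.
  by exists (Num.truncn (b%:R * sg)).+1; rewrite ltW// truncnS_gt.
have [dF [dF1 [dF2 _]]] := sF 3.
have dF' x : derivable F x 1 by exact: dF.
have dF1' x : derivable (derive1 F) x 1 by exact: dF1.
have [K1 K10 hK1] := derivable_bounded rr dF1'.
have [K2 K20 hK2] := derivable_bounded rr (fun x => dF2 x I).
have l1 := lip_of_derive dF' hK1; have l2 := lip_of_derive dF1' hK2.
have [C3 C30 hC3] := poly_C1_approx r0 (sF k.+2).
have [P hP] := choice hC3.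
have [G G0 hG] := p2_poly_series (@ltr01 R).
pose Cw := C3 * C1 * 2 + K1 * C2 + K2 * C1 * C2 * A.
have Cw0 : 0 <= Cw by rewrite /Cw !addr_ge0// !mulr_ge0// ltW.
pose M : R := (b + k + 5)%:R ^+ 2 * 2 `^ ((b + k + 4)%:R * th).
have M0 : 0 <= M by rewrite mulr_ge0 ?p2_ge0.
exists (M * Cw * G + 1); first by rewrite ltr_wpDl// !mulr_ge0// ltW.
move=> ul vl D hu hv hd; have D0 := dyad_ge0 hd.
pose T i ul x := (P i).[psum ul (b * i) x].
pose w i x := (T i.+1 ul x - T i ul x) - (T i.+1 vl x - T i vl x).
exists w, (fun i => ((b + 2) * i.+1 + k.+2)%N), (fun i => Cw * 2 `^ (- (i%:R * (b%:R * sg))) * D).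
have bnd ul' A' J x : dyad ul' A' -> `|psum ul' J x| <= C1 * A'.
  by move=> h; apply: le_trans (hC1 _ _ h J x); exact: ler_norm_sum.
have inr z : `|z| <= rho -> - r <= z <= r by rewrite ler_norml /r; move: rho0; lra.
have Ttrig ul' i j : dyad ul' A -> (i <= j)%N -> trig (2 ^ ((b + 2) * j + k.+2)) (T i ul').
  move=> h ij; have [sP _ _] := hP i.
  apply: trig_mono (trig_horner (P i) (psum_trig (b * i) h)).
  apply: (@leq_trans (2 ^ ((b + 2) * i + k.+2))); last first.
    by rewrite leq_exp2l// leq_add2r leq_mul2l ij orbT.
  apply: leq_trans (deg_bound i k b); rewrite leq_mul2r; apply/orP; right.
  exact: pred_le_bound sP.
have wtrig i : trig (2 ^ ((b + 2) * i.+1 + k.+2)) (w i).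
  by apply: trigB; apply: trigB; apply: Ttrig.
split; first split.
- split; first exact: wtrig.
  pose de x := psum ul (b * i + b) x - psum ul (b * i) x.
  pose dd x := psum (fun l x => ul l x - vl l x) (b * i + b) x - psum (fun l x => ul l x - vl l x) (b * i) x.
  pose p := 2 `^ (- (i%:R * (b%:R * sg))) : R.
  have p0 : 0 <= p by exact: p2_ge0.
  have pb : 2 `^ (- ((b * i)%:R * sg)) = p by rewrite /p; congr (_ `^ _); rewrite natrM; ring.
  have hde : Lb mu q de (C2 * p * A) by rewrite -pb; exact: hC2.
  have hdd : Lb mu q dd (C2 * p * D) by rewrite -pb; exact: hC2.
  have ep j : (2 ^- j) ^+ k = 2 `^ (- (j%:R * k%:R)) :> R.
    by rewrite -exprVn -exprM -natrM powRN powR_mulrn// exprVn.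
  have p1 : (2 ^- i) ^+ k <= p by rewrite ep; apply: p2_le; rewrite lerN2 ler_wpM2l// hk.1.
  have p2 : (2 ^- i.+1) ^+ k <= p.
    apply: le_trans p1; rewrite !ep; apply: p2_le; rewrite lerN2 ler_wpM2r// ler_nat//.
  have hg : Lb mu q (fun x => C3 * C1 * 2 * D * p + (K1 * `|dd x| + K2 * C1 * D * `|de x|)) (Cw * p * D).
    have -> : Cw * p * D = C3 * C1 * 2 * D * p + (`|K1| * (C2 * p * D) + `|K2 * C1 * D| * (C2 * p * A)).
      rewrite !ger0_norm//; last by rewrite !mulr_ge0// ltW.
      by rewrite /Cw; ring.
    apply: Lb_add => //.
      by apply: Lb_sup => //; [apply: filterE => x; rewrite ger0_norm// !mulr_ge0// ltW|rewrite !mulr_ge0// ltW].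
    by apply: Lb_add => //; apply: Lb_scale => //; exact: Lb_norm.
  apply: Lb_dom hg => //; first by have [] := trig_bmf (wtrig i).
  apply: filterE => x; rewrite [X in _ <= X]ger0_norm; last first.
    by rewrite !addr_ge0// !mulr_ge0// ltW.
  pose a := psum ul (b * i) x; pose a' := psum ul (b * i.+1) x.
  pose c := psum vl (b * i) x; pose c' := psum vl (b * i.+1) x.
  have ha : `|a| <= rho by exact: bnd hu.
  have ha' : `|a'| <= rho by exact: bnd hu.
  have hc : `|c| <= rho by exact: bnd hv.
  have hc' : `|c'| <= rho by exact: bnd hv.
  have psumB J : psum (fun l x => ul l x - vl l x) J x = psum ul J x - psum vl J x by rewrite /psum sumrB.
  have hac : `|a - c| <= C1 * D by rewrite -psumB; exact: bnd hd.
  have hac' : `|a' - c'| <= C1 * D by rewrite -psumB; exact: bnd hd.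
  have ea : a' - a = de x by rewrite /a' /a /de mulnS addnC.
  have edd : (a' - a) - (c' - c) = dd x by rewrite /dd !psumB /a' /a /c' /c mulnS addnC; ring.
  have nrm z : `|z| <= rho -> - rho <= z <= rho by rewrite ler_norml.
  have := @four_point R F K1 K2 (3 * rho) rho a a' c c' (lexx _).
  have sub z : - (3 * rho) <= z <= 3 * rho -> - r <= z <= r by rewrite /r; lra.
  move=> /(_ (fun x y hx hy => l1 x y (sub x hx) (sub y hy)) dF' (fun x y hx hy => l2 x y (sub x hx) (sub y hy)) (nrm _ ha) (nrm _ ha') (nrm _ hc) (nrm _ hc')).
  rewrite edd ea => h4.
  have [_ _ q1'] := hP i.+1; have [_ _ q0'] := hP i.
  have h1 := q1' _ _ (inr _ ha') (inr _ hc'); have h0 := q0' _ _ (inr _ ha) (inr _ hc).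
  have h1' : `|(F a' - (P i.+1).[a']) - (F c' - (P i.+1).[c'])| <= C3 * p * (C1 * D).
    by apply: (le_trans h1); apply: ler_pM => //; rewrite ?mulr_ge0 ?exprn_ge0 ?invr_ge0 ?exprn_ge0// ler_wpM2l.
  have h0' : `|(F a - (P i).[a]) - (F c - (P i).[c])| <= C3 * p * (C1 * D).
    by apply: (le_trans h0); apply: ler_pM => //; rewrite ?mulr_ge0 ?exprn_ge0 ?invr_ge0 ?exprn_ge0// ler_wpM2l.
  have h5 : K2 * (`|de x| * `|a - c|) <= K2 * C1 * D * `|de x|.
    rewrite (_ : K2 * C1 * D * `|de x| = K2 * (`|de x| * (C1 * D))); last by move: `|de x| => z; ring.
    by rewrite ler_wpM2l// ler_wpM2l.
  (* Polynomials are compared with [F]: the second difference of [F] falls to [four_point], and the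
     two differences of errors to the C^1 closeness of [P i.+1] and [P i]. All three bounds contain
     the distance of [u] and [v]. *)
  have -> : w i x = ((F a' - F a) - (F c' - F c)) - ((F a' - (P i.+1).[a']) - (F c' - (P i.+1).[c'])) + ((F a - (P i).[a]) - (F c - (P i).[c])).
    rewrite /w /T -/a -/a' -/c -/c'; move: (F a') (F a) (F c') (F c) (_.[a']) (_.[a]) (_.[c']) (_.[c]) => *; ring.
  move: h0' h1' h4 h5; move: (F a' - F a - _) (F a' - (P i.+1).[a'] - _) (F a - (P i).[a] - _) => X Y Z.
  move=> hZ hY hX h5; apply: (le_trans (ler_normD _ _)); apply: (le_trans (lerD (ler_normB _ _) (lexx _))).
  apply: (le_trans (lerD (lerD hX hY) hZ)); move: h5; move: (K2 * (_ * _)) (K2 * C1 * D * _) (K1 * _) => U V W h5; lra.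
- move=> n.
  apply: (@le_trans _ _ (\sum_(i < n) (M * Cw * D) * (i.+1%:R ^+ 2 * 2 `^ (- (i%:R * 1))))).
    apply: ler_sum => i _.
    set K := ((b + 2) * i.+1 + k.+2)%N.
    have e1 : K.+1%:R ^+ 2 <= (b + k + 5)%:R ^+ 2 * i.+1%:R ^+ 2 :> R.
      by rewrite -exprMn lerXn2r ?nnegrE// -natrM ler_nat; exact: degree_count.
    have e2 : 2 `^ (K%:R * th) * 2 `^ (- (i%:R * (b%:R * sg))) <= 2 `^ ((b + k + 4)%:R * th) * 2 `^ (- (i%:R * 1)) :> R.
      rewrite -!p2D; apply: p2_le.
      have -> : K%:R * th = (b + k + 4)%:R * th + i%:R * (b.+2%:R * th).
        rewrite mulrA -mulrDl -natrM -natrD; congr (_%:R * _); exact: degree_split.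
      have := ler_wpM2l (ler0n R i) hb; rewrite mulrDr; lra.
    have -> : K.+1%:R ^+ 2 * 2 `^ (K%:R * th) * (Cw * 2 `^ (- (i%:R * (b%:R * sg))) * D) =
      (K.+1%:R ^+ 2 * (2 `^ (K%:R * th) * 2 `^ (- (i%:R * (b%:R * sg))))) * (Cw * D) by ring.
    have -> : M * Cw * D * (i.+1%:R ^+ 2 * 2 `^ (- (i%:R * 1))) =
      ((b + k + 5)%:R ^+ 2 * i.+1%:R ^+ 2 * (2 `^ ((b + k + 4)%:R * th) * 2 `^ (- (i%:R * 1)))) * (Cw * D) by rewrite /M; ring.
    rewrite ler_wpM2r ?mulr_ge0//; exact: ler_pM.
  rewrite -mulr_sumr; apply: (@le_trans _ _ (M * Cw * D * G)); first by rewrite ler_wpM2l// !mulr_ge0.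
  by rewrite (_ : M * Cw * D * G = M * Cw * G * D) ?ler_wpM2r ?lerDl//; ring.
move=> x u v cu cv.
(* At n = 0 both partial sums are empty, so the two copies of [(P 0).[0]] cancel and the telescoping
   series has no initial term. *)
have telE n : \sum_(i < n) w i x = T n ul x - T n vl x.
  elim: n => [|n ih]; last by rewrite big_ord_recr /= ih /w; ring.
  by rewrite big_ord0 /T /psum muln0 !big_ord0 subrr.
have -> : (fun n => \sum_(i < n) w i x) = (fun n => T n ul x - T n vl x) by exact/funext.
have cont y : {for y, continuous F} by apply: differentiable_continuous; apply/derivable1_diffP.
have b0 : (0 < b)%N.
  by case: (b) hb => // hb; exfalso; move: hb th0; rewrite mul0r; lra.
have cT ul' y : dyad ul' A -> psum ul' J x @[J --> \oo] --> y -> T n ul' x @[n --> \oo] --> F y.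
  move=> h cy.
  have cb : psum ul' (b * n) x @[n --> \oo] --> y := cvg_comp _ _ (@cvg_mulnl b b0) cy.
  (* The subtracted term vanishes, as [(P n).[0] = F 0]; it brings the error into the form of the
     Lipschitz bound with 0 as second argument. *)
  pose e n := (F (psum ul' (b * n) x) - T n ul' x) - (F 0 - (P n).[0]).
  have TE n : T n ul' x = F (psum ul' (b * n) x) - e n.
    by have [_ p00 _] := hP n; rewrite /e p00 /T; ring.
  suff h0 : (fun n => F (psum ul' (b * n) x) - e n) n @[n --> \oo] --> F y - 0.
    by rewrite subr0 in h0; have -> : (fun n => T n ul' x) = (fun n => F (psum ul' (b * n) x) - e n) by exact/funext.
  apply: cvgB; first exact: (cvg_comp _ _ cb (cont y)).
  apply: norm_cvg0; apply: (@squeeze_cvgr _ _ _ _ (fun=> 0) (geometric (C3 * rho) 2^-1)).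
  - apply: nearW => n; rewrite normr_ge0 /=; have [_ _ hn] := hP n.
    have hb0 := bnd _ _ (b * n)%N x h.
    apply: (le_trans (hn _ _ (inr _ hb0) _)); first by apply: inr; rewrite normr0.
    rewrite subr0 mulrAC; apply: ler_pM; rewrite ?mulr_ge0 ?exprn_ge0 ?invr_ge0 ?exprn_ge0//; first exact: ler_wpM2l.
    exact: half_pow_le hk.2.
  - exact: cvg_cst.
  - by apply: cvg_geometric; rewrite ger0_norm ?invr_ge0// invf_lt1// ltr1n.
by apply: cvgB; apply: cT.
Qed.

End Composition.

(** * Multiplication operators *)

Section BesselSpaces.
Context (R : realType) (d : nat).
Local Notation mu := (torus R d).
Variable q : R.
Hypothesis q2 : 2 <= q.
Let q1 : 1 <= q. Proof. by rewrite (le_trans _ q2)// ler1n. Qed.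
Let q0 : 0 < q. Proof. exact: lt_le_trans q1. Qed.

Definition Jc r (c : distr R d) : distr R d := fun k => (jf r k)%:C%C * c k.

Lemma bessel_potentialE r (c : distr R d) : bessel_potential r c = Jc r c.
Proof.
apply/funext => k; rewrite /bessel_potential /Jc /jf /jp /jb /absfreq; congr ((_ `^ _)%:C%C * _); congr (1 + _).
rewrite exprMn sqr_sqrtr; last by apply: sumr_ge0 => i _; exact: sqr_ge0.
by rewrite mulr_sumr; apply: eq_bigr => i _; rewrite [in RHS]exprMn.
Qed.

Lemma JcD a b c : Jc a (Jc b c) = Jc (a + b) c.
Proof. by apply/funext => k; rewrite /Jc /jf jpD rmorphM /= mulrA. Qed.

Lemma Jc0 c : Jc 0 c = c.
Proof. by apply/funext => k; rewrite /Jc /jf jp0 mul1r. Qed.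

Lemma JcNK r c : Jc (- r) (Jc r c) = c.
Proof. by rewrite JcD addNr Jc0. Qed.

Lemma JcK r c : Jc r (Jc (- r) c) = c.
Proof. by rewrite JcD subrr Jc0. Qed.

Lemma Jc_add r (c c' : distr R d) : Jc r (c \+ c') = Jc r c \+ Jc r c'.
Proof. by apply/funext => k; rewrite /Jc /= mulrDr. Qed.

Lemma Jc_sub r (c c' : distr R d) : Jc r (c \- c') = Jc r c \- Jc r c'.
Proof. by apply/funext => k; rewrite /Jc /= mulrBr. Qed.

Lemma Jc_scale r (a : R) (c : distr R d) : Jc r (scaleD a c) = scaleD a (Jc r c).
Proof. by apply/funext => k; rewrite /Jc /scaleD mulrCA. Qed.

Lemma Jc_sum r (I : Type) (s : seq I) (F : I -> distr R d) :
  Jc r (fun k => \sum_(i <- s) F i k) = fun k => \sum_(i <- s) Jc r (F i) k.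
Proof. by apply/funext => k; rewrite /Jc mulr_sumr. Qed.

Lemma Jop_Jc r N (g : d.-tuple R -> R) : trig N g -> fourier (Jop r N g) = Jc r (fourier g).
Proof. by move=> gN; apply/funext => k; exact: Jop_fourier. Qed.

Definition Hq r c A := LQ q (Jc r c) A.

Lemma LQ0 (A : R) : 0 <= A -> LQ q ((fun=> 0) : distr R d) A.
Proof.
move=> A0; exists (fun=> 0); first exact: Lb_cst0.
apply/funext => k; rewrite (fourier_syn (N := 0) (c := fun=> 0)) ?if_same// => x.
by rewrite /syn big1// => i _; rewrite mul0r.
Qed.

Lemma LQ_sum (I : Type) (s : seq I) (F : I -> distr R d) (a : I -> R) :
  (forall i, LQ q (F i) (a i)) -> LQ q (fun k => \sum_(i <- s) F i k) (\sum_(i <- s) a i).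
Proof.
move=> h; elim: s => [|i s ih].
  by under eq_fun do rewrite big_nil; rewrite big_nil; exact: LQ0.
under eq_fun do rewrite big_cons; rewrite big_cons; exact: (LQ_add q1 (h i) ih).
Qed.

Lemma norm_Hq r c (A : R) : (bessel_norm r q c < A%:E)%E -> Hq r c A.
Proof. by rewrite /bessel_norm bessel_potentialE; exact: norm_LQ. Qed.

Lemma Hq_norm r c (A : R) : Hq r c A -> (bessel_norm r q c <= A%:E)%E.
Proof. by rewrite /bessel_norm bessel_potentialE; exact: LQ_norm. Qed.

Lemma Hq_fin r c : (bessel_norm r q c < +oo)%E -> exists2 A, 0 < A & Hq r c A.
Proof.
rewrite /bessel_norm bessel_potentialE => /(norm_fin_LQ)[A hA]; exists (A + 1).
  by rewrite ltr_wpDl// (LQ_ge0 hA).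
by apply: LQ_le hA; rewrite lerDl.
Qed.

Lemma Hq_ltoo r c A : Hq r c A -> (bessel_norm r q c < +oo)%E.
Proof. by move=> /Hq_norm/le_lt_trans; apply; rewrite ltry. Qed.

Lemma Hq_scale r (a : R) c A : Hq r c A -> Hq r (scaleD a c) (`|a| * A).
Proof. by rewrite /Hq Jc_scale; exact: LQ_scale. Qed.

Lemma Hq_add r c c' A A' : Hq r c A -> Hq r c' A' -> Hq r (c \+ c') (A + A').
Proof. by rewrite /Hq Jc_add; exact: LQ_add. Qed.

Lemma scaleDN1 (c c' : distr R d) : c \- c' = c \+ scaleD (-1) c'.
Proof. by apply/funext => k; rewrite /scaleD /= rmorphN1 mulN1r. Qed.

Lemma Hq_sub r c c' A A' : Hq r c A -> Hq r c' A' -> Hq r (c \- c') (A + A').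
Proof.
move=> h h'; rewrite scaleDN1; apply: Hq_add => //.
by have := Hq_scale (-1) h'; rewrite normrN1 mul1r.
Qed.

Lemma bounded_linear_bound r1 r0 (M : distr R d -> distr R d) :
  bounded_linear (bessel_norm r1 q) (bessel_norm r0 q) M ->
  exists2 K : R, 0 < K & forall f A, 0 < A -> Hq r1 f A -> Hq r0 (M f) (K * A).
Proof.
move=> [lin opM].
have [K K0 hK] : exists2 K : R, 0 < K & (opnorm (bessel_norm r1 q) (bessel_norm r0 q) M < K%:E)%E.
  move: opM; case: (opnorm _ _ _) => [x| |] // _; last by exists 1 => //; rewrite ltNyr.
  by exists (`|x| + 1); [rewrite ltr_wpDl|rewrite lte_fin (le_lt_trans (ler_norm x))// ltrDl].
exists K => // f A A0 hf.
have h0 : Hq r1 (fun=> 0) 1.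
  by have := LQ0 (@ler01 R); congr (LQ _ _ _); apply/funext => k; rewrite /Jc mulr0.
(* Linearity is available only for combinations [scaleD c f \+ g]; homogeneity is its case g = 0
   once M 0 = 0 is known. *)
have M0 : M (fun=> 0) = fun=> 0.
  have := lin 1 _ _ (Hq_ltoo h0) (Hq_ltoo h0).
  have -> : scaleD 1 (fun=> 0) \+ (fun=> 0) = (fun=> 0) :> distr R d.
    by apply/funext => k; rewrite /scaleD /= mulr0 addr0.
  move=> /(congr1 (fun F : distr R d => F \- M (fun=> 0))) e; apply/funext => k.
  have := congr1 (fun F : distr R d => F k) e; rewrite /= subrr /scaleD rmorph1 mul1r addrK.
  by [].
pose g := scaleD A^-1 f.
have hg : Hq r1 g 1.
  by have := Hq_scale A^-1 hf; rewrite ger0_norm ?invr_ge0 ?(ltW A0)// mulVf// gt_eqF.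
have Mg : Hq r0 (M g) K.
  apply: norm_Hq; apply: le_lt_trans hK; apply: ereal_sup_ubound; exists g => //.
  exact: Hq_norm.
have -> : M f = scaleD A (M g).
  have fE : f = scaleD A g \+ (fun=> 0).
    apply/funext => k; rewrite /g /scaleD /= addr0 mulrA -rmorphM /= mulfV ?mul1r//.
    by rewrite gt_eqF.
  rewrite [in LHS]fE (lin _ _ _ (Hq_ltoo hg) (Hq_ltoo h0)) M0.
  by apply/funext => k /=; rewrite addr0.
by have := Hq_scale A Mg; rewrite gtr0_norm// mulrC.
Qed.

(** The unit ball is given by a non-strict inequality for an infimum, so its elements have an [Hq]
    bound only with a constant above 1; the constant is taken to be 2. *)
Lemma bound_opnorm r1 r0 (M : distr R d -> distr R d) (K : R) :
  (forall f, Hq r1 f 2 -> Hq r0 (M f) K) -> (opnorm (bessel_norm r1 q) (bessel_norm r0 q) M <= K%:E)%E.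
Proof.
move=> h; apply: ge_ereal_sup => _ [f /= hf <-]; apply: Hq_norm; apply: h; apply: norm_Hq.
by apply: (le_lt_trans hf); rewrite lte_fin ltr1n.
Qed.

Lemma Lfun_ex_Lb (g : d.-tuple R -> R) : g \in Lfun mu q%:E -> exists c, Lb mu q g c.
Proof.
move=> gL; have gf : ('N[mu]_(q%:E)[EFin \o g] < +oo)%E.
  by move: gL; rewrite inE => /andP[_ /set_mem].
have := Lnorm_ge0 mu q%:E (EFin \o g); move: gf; case E : ('N[mu]_(q%:E)[EFin \o g])%E => [x||] // _ _.
by exists x; apply: Lfun_Lb gL _; rewrite E.
Qed.

(** Both operators are continuous and agree with the pointwise product on trigonometric polynomials,
    which are dense in H^{r,q}. This identifies the operator selected by [multiplication] with any
    one that is constructed. *)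
Lemma multiplication_unique r (a : d.-tuple R -> R) M M' f : is_multiplication r q a M -> is_multiplication r q a M' ->
  (bessel_norm r q f < +oo)%E -> M f = M' f.
Proof.
move=> [bM mM] [bM' mM'] /Hq_fin[A A0 hf].
have [K K0 hK] := bounded_linear_bound bM; have [K' K'0 hK'] := bounded_linear_bound bM'.
apply/funext => k; apply/eqP; rewrite -subr_eq0.
have jk : (jf r k)%:C%C != 0 :> R[i] by rewrite eq_complex /= negb_and gt_eqF// jp_gt0.
rewrite -(mulrI_eq0 _ (lregP jk)) -normr_eq0 cmodE.
suff h0 : cmod ((jf r k)%:C%C * (M f k - M' f k)) <= 0.
  by rewrite (_ : cmod _ = 0)//; apply/eqP; rewrite eq_le h0 cmod_ge0.
apply/ler_addgt0Pr => e e0; rewrite add0r.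
pose ep := e / (2 * (K + K')).
have KK : 0 < 2 * (K + K') by rewrite mulr_gt0// addr_gt0.
have ep0 : 0 < ep by exact: divr_gt0.
have [g gA gf] := hf; have [N [P [PN gP]]] := Lb_trig_dense q1 gA ep0.
pose h := Jop (- r) N P.
have hN : trig N h := Jop_trig (- r) PN.
have fh : fourier h = Jc (- r) (fourier P) := Jop_Jc (- r) PN.
have [_ [S hS]] := trig_bmf hN.
have hL : Lb mu q h `|S|.
  apply: Lb_sup => //; first by have [] := trig_bmf hN.
  by apply: filterE => x; rewrite (le_trans (hS x))// ler_norm.
have [_ [S' hS']] := trig_bmf PN.
have PL : Lb mu q P `|S'|.
  apply: Lb_sup => //; first by have [] := trig_bmf PN.
  by apply: filterE => x; rewrite (le_trans (hS' x))// ler_norm.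
have hH : Hq r (fourier h) `|S'| by exists P => //; rewrite fh JcK.
have dH : Hq r (f \- fourier h) ep.
  exists (fun x => g x - P x) => //; rewrite Jc_sub fh JcK -gf.
  by rewrite (fourierB (Lb_integrable q1 gA) (trig_integrable PN)).
have fE : f = scaleD 1 (f \- fourier h) \+ fourier h.
  by apply/funext => j; rewrite /scaleD /= mul1r subrK.
have hLf := Lb_Lfun hL.
have E1 : M f = M (f \- fourier h) \+ M (fourier h).
  rewrite [in LHS]fE bM.1 ?(Hq_ltoo dH) ?(Hq_ltoo hH)//.
  by apply/funext => j; rewrite /scaleD /= mul1r.
have E2 : M' f = M' (f \- fourier h) \+ M' (fourier h).
  rewrite [in LHS]fE bM'.1 ?(Hq_ltoo dH) ?(Hq_ltoo hH)//.
  by apply/funext => j; rewrite /scaleD /= mul1r.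
have -> : M f k - M' f k = (M (f \- fourier h) \- M' (f \- fourier h)) k.
  rewrite E1 E2 (mM _ hLf (Hq_ltoo hH)) (mM' _ hLf (Hq_ltoo hH)) /=; ring.
have := LQ_bound q1 k (Hq_sub (hK _ _ ep0 dH) (hK' _ _ ep0 dH)).
move=> /le_trans; apply; rewrite -mulrDl mulrA /ep mulrC divfK// gt_eqF//.
Qed.

(** Integrability of the products is included because [fourier] is additive only on integrable
    functions, which sums and differences of multipliers rely on. *)
Definition multop r (a : d.-tuple R -> R) M :=
  is_multiplication r q a M /\ forall g c, Lb mu q g c -> mu.-integrable setT (EFin \o (a \* g)).

Lemma multop_cst r (c : R) : multop r (fun=> c) (scaleD c).
Proof.
split; last by move=> g c' /(Lb_integrable q1)/(integrableZ_real c).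
split; first split.
- move=> a f g _ _; apply/funext => k; rewrite /scaleD /=; ring.
- apply: (@le_lt_trans _ _ (`|c| * 2)%:E); last by rewrite ltry.
  by apply: bound_opnorm => f; exact: Hq_scale.
- move=> g gL _; rewrite -fourierZ//.
  have [c' hc'] := Lfun_ex_Lb gL; exact: Lb_integrable q1 hc'.
Qed.

Lemma multop_sub r a a' M M' : multop r a M -> multop r a' M' ->
  multop r (fun x => a x - a' x) (fun f => M f \- M' f).
Proof.
move=> [[bM mM] iM] [[bM' mM'] iM']; split; last first.
  move=> g c hg; have := integrableB_real (iM g c hg) (iM' g c hg).
  by congr (_.-integrable _ _); apply/funext => x /=; rewrite mulrBl.
have [K K0 hK] := bounded_linear_bound bM; have [K' K'0 hK'] := bounded_linear_bound bM'.
split; first split.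
- move=> c f g hf hg; rewrite bM.1// bM'.1//; apply/funext => k; rewrite /scaleD /=; ring.
- apply: (@le_lt_trans _ _ (K * 2 + K' * 2)%:E); last by rewrite ltry.
  by apply: bound_opnorm => f hf; apply: Hq_sub; [exact: hK|exact: hK'].
- move=> g gL hg; rewrite mM// mM'//; have [c hc] := Lfun_ex_Lb gL.
  rewrite -(fourierB (iM g c hc) (iM' g c hc)); congr fourier.
  by apply/funext => x /=; rewrite mulrBl.
Qed.

Lemma multop_add r a a' M M' : multop r a M -> multop r a' M' ->
  multop r (fun x => a x + a' x) (fun f => M f \+ M' f).
Proof.
move=> h h'; have := multop_sub h (multop_sub (multop_cst r 0) h').
have -> : (fun x => a x - (0 - a' x)) = (fun x => a x + a' x) by apply/funext => x; ring.
have -> // : (fun f => M f \- (scaleD 0 f \- M' f)) = (fun f => M f \+ M' f).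
by apply/funext => f; apply/funext => k; rewrite /scaleD /=; ring.
Qed.

End BesselSpaces.

(** * Multiplication by a sum of trigonometric polynomials *)

Section SeriesMultiplier.
Context (R : realType) (d : nat).
Local Notation mu := (torus R d).
Variables (q r th : R).
Hypothesis q2 : 2 <= q.
Hypothesis th_d : d%:R / q <= th.
Hypothesis th_r : `|r| <= th.
Let q1 : 1 <= q. Proof. by rewrite (le_trans _ q2)// ler1n. Qed.
Let q0 : 0 < q. Proof. exact: lt_le_trans q1. Qed.
Implicit Types (w : nat -> d.-tuple R -> R) (kk : nat -> nat) (b : nat -> R).

Definition convw N (a : d.-tuple R -> R) (c : distr R d) : distr R d :=
  fun n => \sum_(k <- box d N) fourier a k * c (n - k).

(* The junk value 0 occurs only outside H^{r,q}. *)
Definition Wop w kk (f : distr R d) : distr R d := fun n =>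
  xget 0 [set z | ccvg (fun m => \sum_(i < m) convw (2 ^ kk i) (w i) f n) z].

Lemma convw_rank N a r1 r2 : finite_rank (fun c : distr R d => Jc r1 (convw N a (Jc r2 c))).
Proof.
move=> k; exists [seq k - l | l <- box d N], (fun m => (jf r1 k)%:C%C * (fourier a (k - m) * (jf r2 m)%:C%C)) => c.
rewrite big_map /Jc /convw mulr_sumr; apply: eq_bigr => l _.
have -> : k - (k - l) = l by rewrite opprB addrC subrK.
by rewrite !mulrA.
Qed.

Lemma convw_bound : exists2 C : R, 0 < C & forall (kk : nat) (a : d.-tuple R -> R) (b : R) c A,
  trig (2 ^ kk) a -> Lb mu q a b -> 0 < A -> Hq q r c A ->
  Hq q r (convw (2 ^ kk) a c) (C * (kk.+1%:R ^+ 2 * 2 `^ (kk%:R * th) * b) * A).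
Proof.
have [C C0 hC] := product_estimate q2 th_d th_r.
exists (C * 2); first by rewrite mulr_gt0.
move=> kk a b c A ha hb A0 hc.
have b0 := Lb_ge0 hb.
pose K := C * kk.+1%:R ^+ 2 * 2 `^ (kk%:R * th) * b.
have K0 : 0 <= K by rewrite /K !mulr_ge0 ?p2_ge0// ltW.
have ext := LQ_ext q1 (convw_rank (2 ^ kk) a r (- r)) K0.
have := ext _ (Jc r c) A A hc A0; rewrite JcNK => /(_ _)/LQ_le; apply.
  by rewrite /K (_ : C * 2 * _ * A = C * kk.+1%:R ^+ 2 * 2 `^ (kk%:R * th) * b * (A + A))//; ring.
move=> N P B PN PB; pose g := Jop (- r) N P.
have gN : trig N g := Jop_trig (- r) PN.
have gB : Lb mu q (Jop r N g) B.
  have -> : Jop r N g = P; last by [].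
  apply: (@trig_eq _ _ N N) => //; first exact: Jop_trig.
  by rewrite Jop_Jc// Jop_Jc// JcK.
have := hC kk N (2 ^ kk + N)%N a b g B ha hb gN gB (leqnn _) => h.
exists (Jop r (2 ^ kk + N) (fun x => a x * g x)); first by move: h; congr (Lb _ _ _ _); rewrite /K; ring.
rewrite Jop_Jc; last exact: trigM.
congr (Jc r _); apply/funext => n.
by rewrite (fourierM n ha (trig_integrable gN)) Jop_Jc.
Qed.

Lemma Wop_spec w kk f n z : ccvg (fun m => \sum_(i < m) convw (2 ^ kk i) (w i) f n) z -> Wop w kk f n = z.
Proof.
by move=> h; apply: (@xget_unique _ _ [set z | ccvg _ z]) => // y hy; exact: ccvg_uniq hy h.
Qed.

(** By [mser] the bounds of [convw_bound] are summable. The limit in L^q of the potentials supplies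
    limits of all coefficients, so [xget] does not return its default on H^{r,q}. *)
Lemma Wop_bound : exists2 C : R, 0 < C & forall w kk b B f A, mser q th w kk b B -> 0 < A -> Hq q r f A ->
  (forall n, ccvg (fun m => \sum_(i < m) convw (2 ^ kk i) (w i) f n) (Wop w kk f n)) /\
  Hq q r (Wop w kk f) (C * B * A).
Proof.
have [C C0 hC] := convw_bound; exists C => // w kk b B f A [h1 h2] A0 hf.
have hi i := hC (kk i) (w i) (b i) f A (h1 i).1 (h1 i).2 A0 hf.
have hs n : \sum_(i < n) C * ((kk i).+1%:R ^+ 2 * 2 `^ ((kk i)%:R * th) * b i) * A <= C * B * A.
  by rewrite -mulr_suml -mulr_sumr ler_wpM2r ?(ltW A0)// ler_wpM2l ?(ltW C0).
have [l hl cl] := LQ_series_ex q1 hi hs.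
have E n : ccvg (fun m => \sum_(i < m) convw (2 ^ kk i) (w i) f n) (Jc (- r) l n).
  have := ccvgM ((jf (- r) n)%:C%C) (cl n); congr (ccvg _ _); apply/funext => m.
  rewrite mulr_sumr; apply: eq_bigr => i _.
  by have /(congr1 (fun F => F n)) := JcNK r (convw (2 ^ kk i) (w i) f).
have W n : Wop w kk f n = Jc (- r) l n by exact: Wop_spec.
split; first by move=> n; rewrite W.
have -> : Wop w kk f = Jc (- r) l by apply/funext.
by rewrite /Hq JcK.
Qed.

Lemma mser_sup : exists2 C : R, 0 < C & forall w kk b B, mser q th w kk b B ->
  exists s, (forall i x, `|w i x| <= s i) /\ forall n, \sum_(i < n) s i <= C * B.
Proof.
have [C C0 hC] := @trig_sup R d q q1; exists C => // w kk b B [h1 h2].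
exists (fun i => C * ((kk i).+1%:R ^+ 2 * 2 `^ ((kk i)%:R * th) * b i)); split.
  move=> i x; apply: (le_trans (hC _ _ _ (h1 i).1 (h1 i).2 x)).
  have b0 := Lb_ge0 (h1 i).2; rewrite -[C * _ * _ * _]mulrA -[C * _ * _]mulrA ler_wpM2l ?(ltW C0)// mulrA ler_wpM2r//.
  apply: ler_pM; rewrite ?p2_ge0//; first by rewrite ler_eXnr// ler1n.
  by apply: p2_le; rewrite ler_wpM2l.
by move=> n; rewrite -mulr_sumr ler_wpM2l// ltW.
Qed.

(** The w_i are summable in the supremum norm, so for [g] in L^q the products w_i g form a
    convergent series in L^q with sum [a \* g] almost everywhere. Its coefficients are those that
    define [Wop]. *)
Lemma Wop_product w kk b B (a g : d.-tuple R -> R) c : mser q th w kk b B -> measurable_fun setT a ->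
  {ae mu, forall x, \sum_(i < n) w i x @[n --> \oo] --> a x} -> Lb mu q g c ->
  Wop w kk (fourier g) = fourier (a \* g) /\ mu.-integrable setT (EFin \o (a \* g)).
Proof.
move=> hw ma ha hg; have [C C0 hC] := mser_sup; have [s [s1 s2]] := hC _ _ _ _ hw.
have c0 := Lb_ge0 hg.
have hi i : Lb mu q (fun x => w i x * g x) (s i * c).
  by apply: Lb_mul_sup => //; have [] := trig_bmf (hw.1 i).1.
have hs n : \sum_(i < n) s i * c <= C * B * c by rewrite -mulr_suml ler_wpM2r.
have [G [GL aG cG]] := Lb_series q1 hi hs.
have aGe : {ae mu, forall x, (a \* g) x = G x}.
  apply: filterS2 ha aG => x ha hG; apply: (cvg_unique _ _ hG) => //.
  have -> : (fun n => \sum_(i < n) w i x * g x) = (fun n => (\sum_(i < n) w i x) * g x).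
    by apply/funext => n; rewrite mulr_suml.
  by apply: cvgM => //; exact: cvg_cst.
have mag : measurable_fun setT (a \* g) by apply: measurable_funM => //; exact: hg.1.
have Lag : Lb mu q (a \* g) (C * B * c) by exact: Lb_ae aGe GL.
have iag := Lb_integrable q1 Lag.
split => //; rewrite (fourier_eq_ae iag (Lb_integrable q1 GL) aGe).
apply/funext => n; apply: Wop_spec; have := cG n; congr (ccvg _ _); apply/funext => m.
apply: eq_bigr => i _; exact: (fourierM n (hw.1 i).1 (Lb_integrable q1 hg)).
Qed.

Lemma multop_Wop w kk b B (a : d.-tuple R -> R) : mser q th w kk b B -> measurable_fun setT a ->
  {ae mu, forall x, \sum_(i < n) w i x @[n --> \oo] --> a x} -> multop q r a (Wop w kk).
Proof.
move=> hw ma ha; have [C C0 hC] := Wop_bound; split; last first.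
  by move=> g c hg; have [] := Wop_product hw ma ha hg.
split; first split.
- move=> c f g /Hq_fin[A A0 hf] /Hq_fin[A' A'0 hg].
  have [cf _] := hC _ _ _ _ _ _ hw A0 hf; have [cg _] := hC _ _ _ _ _ _ hw A'0 hg.
  apply/funext => n; apply: Wop_spec; have := ccvgD (ccvgM (c%:C%C) (cf n)) (cg n).
  congr (ccvg _ _); apply/funext => m; rewrite mulr_sumr -big_split /=; apply: eq_bigr => i _.
  rewrite /convw mulr_sumr -big_split /=; apply: eq_bigr => k _.
  by rewrite /scaleD /= mulrDr mulrCA.
- apply: (@le_lt_trans _ _ (C * B * 2)%:E); last by rewrite ltry.
  by apply: bound_opnorm => // f hf; have [] := hC _ _ _ _ _ _ hw (ltr0Sn R 1) hf.
- by move=> g /Lfun_ex_Lb[c hc] _; have [] := Wop_product hw ma ha hc.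
Qed.

End SeriesMultiplier.

(** * The quasilinear operator *)

Section BesovBlocks.
Context (R : realType) (d : nat).
Local Notation mu := (torus R d).
Variables (q sg p : R) (chi : R -> R).
Hypothesis q2 : 2 <= q.
Hypothesis sg0 : 0 < sg.
Hypothesis p0 : 0 < p.
Hypothesis hchi : dyadic_cutoff chi.
Let q1 : 1 <= q. Proof. by rewrite (le_trans _ q2)// ler1n. Qed.
Implicit Types (u v : d.-tuple R -> R).

(** A single term of the sum is at most the whole norm. Infinite block norms are excluded by the
    assumed finite bound. *)
Lemma besov_term (f : distr R d) (l : nat) (A : R) : (besov_norm chi sg q p f < A%:E)%E ->
  (Lq_norm q (dyadic_block chi l f) < (2 `^ (- (l%:R * sg)) * A)%:E)%E.
Proof.
have N0 j : (0 <= Lq_norm q (dyadic_block chi j f))%E.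
  by apply: le_ereal_inf_tmp => _ [g _ <-]; exact: Lnorm_ge0.
pose t j := ((2 `^ (j%:R * sg))%R%:E * Lq_norm q (dyadic_block chi j f))%E.
have t0 j : (0 <= t j)%E by rewrite mule_ge0// lee_fin p2_ge0.
have tp0 j : (0 <= t j `^ p)%E by exact: poweR_ge0.
have h1 : (t l `^ p <= \sum_(0 <= j <oo) t j `^ p)%E.
  apply: le_trans (@nneseries_lim_ge R (fun j => t j `^ p)%E xpredT 0 l.+1 _); last by move=> j _ _.
  by rewrite big_nat_recr//= leeDr// sume_ge0.
have h2 : (t l <= besov_norm chi sg q p f)%E.
  have pn : p != 0 by rewrite gt_eqF.
  rewrite -[leLHS]poweRe1// -(mulfV pn) poweRrM.
  by apply: gt0_ler_poweR => //; rewrite ?invr_ge0 ?(ltW p0)// in_itv /= ?leey ?andbT// (le_trans _ h1).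
move=> /(le_lt_trans h2); rewrite /t powRN EFinM.
move: (Lq_norm _ _) (N0 l) => [x| |]//= _; last by rewrite mulry gtr0_sg ?p2_gt0// mul1e.
by rewrite -!EFinM !lte_fin ltr_pdivlMl ?p2_gt0.
Qed.

Lemma absfreqN (k : freq d) : absfreq R (- k) = absfreq R k.
Proof.
rewrite /absfreq; congr Num.sqrt; apply: eq_bigr => i _.
by rewrite [(- k) i]/(- k i) rmorphN sqrrN.
Qed.

Lemma absfreq_ge (k : freq d) i : `|k i|%:~R <= absfreq R k.
Proof.
rewrite intr_norm -sqrtr_sqr ler_wsqrtr//.
by rewrite (bigD1 i)//= lerDl sumr_ge0// => j _; exact: sqr_ge0.
Qed.

Lemma dyadic_supp l (k : freq d) : k \notin box d (2 ^ l.+1) -> dyadic chi l (absfreq R k) = 0.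
Proof.
move=> /notin_box[i ki]; have [_ _ _ c0] := hchi.
have h : 2 ^+ l.+1 <= absfreq R k.
  apply: le_trans (absfreq_ge k i); rewrite -natrX.
  by have -> : (2 ^ l.+1)%:R = (2 ^ l.+1)%N%:Z%:~R :> R by []; rewrite ler_int ltW.
case: l h {ki} => [|l] h /=; first by rewrite c0.
have h2 : 2 ^+ l.+1 * 2 <= absfreq R k by rewrite -exprSr.
rewrite !c0 ?subrr// ler_pdivlMr ?exprn_gt0 ?(le_trans _ h2)// mulrC ?ler_wpM2r//.
by rewrite ler_weXn2l// ler1n.
Qed.

Definition lpb u l : d.-tuple R -> R := reS (2 ^ l.+1) (dyadic_block chi l (fourier u)).

Section Integrable.
Variable u : d.-tuple R -> R.
Hypothesis iu : mu.-integrable setT (EFin \o u).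

Lemma dyadic_herm l : hermitian (dyadic_block chi l (fourier u)).
Proof.
apply: hermitianM; last exact: hermitian_fourier.
by apply: hermitian_even => k; rewrite absfreqN.
Qed.

Lemma fourier_lpb l : fourier (lpb u l) = dyadic_block chi l (fourier u).
Proof.
apply/funext => k; rewrite fourier_reS; last exact: dyadic_herm.
by case: ifPn => // /dyadic_supp h; rewrite /dyadic_block h mul0r.
Qed.

Lemma lpb_trig l : trig (2 ^ l.+1) (lpb u l).
Proof. by apply: trig_reS; exact: dyadic_herm. Qed.

(** The L^q function that realizes a block in the Besov norm and the polynomial [lpb u l] have equal
    coefficients, hence agree almost everywhere. *)
Lemma lpb_dyad A : (besov_norm chi sg q p (fourier u) < A%:E)%E -> dyad q sg (lpb u) A.
Proof.
move=> hA l; split; first exact: lpb_trig.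
have [g hg gf] := norm_LQ (besov_term l hA).
have lt := lpb_trig l.
apply: Lb_ae (hg); [exact: lt_le_trans q1|by have [] := trig_bmf lt|].
apply: fourier_inj; [exact: trig_integrable lt|exact: Lb_integrable q1 hg|].
by rewrite gf fourier_lpb.
Qed.

Lemma sum_dyadic J (t : R) : \sum_(l < J.+1) dyadic chi l t = chi (t / 2 ^+ J).
Proof.
elim: J => [|J ih]; first by rewrite big_ord1 expr0 divr1.
by rewrite big_ord_recr /= ih addrC subrK.
Qed.

(** The pieces are summable in L^q, so the series converges almost everywhere to some [G]. For each
    frequency the cutoffs eventually equal 1, so [G] and [u] have the same coefficients. *)
Lemma lpb_cvg A : dyad q sg (lpb u) A -> {ae mu, forall x, psum (lpb u) J x @[J --> \oo] --> u x}.
Proof.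
move=> hd; have A0 : 0 <= A := dyad_ge0 hd.
have [D D0 hD] := p2_series sg0.
have hs n : \sum_(i < n) 2 `^ (- (i%:R * sg)) * A <= D * A by rewrite -mulr_suml ler_wpM2r.
have [G [GL aG cG]] := Lb_series q1 (fun l => (hd l).2) hs.
have iG := Lb_integrable q1 GL.
have uG : fourier u = fourier G.
  apply/funext => k; apply: ccvg_uniq (cG k) => e e0.
  have [N hN] : exists N : nat, absfreq R k <= 2 ^+ N.
    exists (Num.truncn (absfreq R k)).+1; apply: (le_trans (ltW (truncnS_gt _))).
    by rewrite -natrX ler_nat ltnW// ltn_expl.
  exists N.+1 => -[//|n]; rewrite ltnS => Nn.
  have -> : \sum_(i < n.+1) fourier (lpb u i) k = fourier u k.
    under eq_bigr do rewrite fourier_lpb /dyadic_block.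
    rewrite -mulr_suml -rmorph_sum sum_dyadic; have [_ _ c1 _] := hchi.
    rewrite c1 ?mul1r// ler_pdivrMr ?exprn_gt0// mul1r (le_trans hN)//.
    by rewrite ler_weXn2l// ler1n.
  by rewrite subrr cmod0 ltW.
have := fourier_inj iu iG uG; apply: filterS2 aG => x hx ux; rewrite ux; exact: hx.
Qed.

End Integrable.

Lemma lpb_sub u v : mu.-integrable setT (EFin \o u) -> mu.-integrable setT (EFin \o v) ->
  (fun l x => lpb u l x - lpb v l x) = lpb (u \- v).
Proof.
move=> iu iv; apply/funext => l; have iuv := integrableB_real iu iv.
apply: (@trig_eq _ _ (2 ^ l.+1) (2 ^ l.+1)); [by apply: trigB; exact: lpb_trig|exact: lpb_trig|].
rewrite (fourierB (trig_integrable (lpb_trig iu l)) (trig_integrable (lpb_trig iv l))).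
rewrite !fourier_lpb// fourierB//; apply/funext => k; rewrite /dyadic_block /=; ring.
Qed.

End BesovBlocks.

(** * The gradient of the Laplacian and the divergence on Bessel potential spaces *)

Section DerivativeBounds.
Context (R : realType) (d : nat).
Variable q : R.
Hypothesis q2 : 2 <= q.
Let q1 : 1 <= q. Proof. by rewrite (le_trans _ q2)// ler1n. Qed.
Let q0 : 0 < q. Proof. exact: lt_le_trans q1. Qed.

Lemma diagonal_rank (w : freq d -> R[i]) : finite_rank (fun c : distr R d => fun k => w k * c k).
Proof. by move=> k; exists [:: k], w => c; rewrite big_seq1. Qed.

Lemma rz_bound i : exists2 C : R, 0 < C & forall (c : distr R d) A, 0 < A -> LQ q c A ->
  LQ q (fun k => rz R i k * c k) (C * A).
Proof.
have b0 := bconst_ge0 q2; exists (2 * bconst q + 1); first by rewrite ltr_wpDl// mulr_ge0.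
move=> c A A0 hc; have := LQ_ext q1 (diagonal_rank (rz R i)) b0 _ hc A0.
move=> /(_ _)/LQ_le; apply; first by rewrite -mulr2n -[(A *+ 2)]mulr_natl mulrA [X in X * A]mulrC ler_wpM2r ?(ltW A0)// lerDl.
move=> N P B PN PB; exists (riesz i N P); first exact: riesz_bound.
by apply/funext => k; rewrite riesz_fourier.
Qed.

(** The negative order makes the dyadic bounds 2^(-2 m) summable. *)
Lemma Jm2_bound : exists2 C : R, 0 < C & forall (c : distr R d) A, 0 < A -> LQ q c A ->
  LQ q (Jc (-2) c) (C * A).
Proof.
have [C C0 hC] := blk_Lb (-2) (@block_be R d).
have [D D0 hD] := p2_series (ltr0Sn R 1).
exists (C * D * 2); first by rewrite !mulr_gt0.
move=> c A A0 hc; have CD0 : 0 <= C * D by rewrite mulr_ge0// ltW.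
have := LQ_ext q1 (diagonal_rank (fun k => (jf (-2) k)%:C%C)) CD0 _ hc A0.
move=> /(_ _)/LQ_le; apply; first by rewrite -[X in _ <= X]mulrA mulr_natl mulr2n.
move=> N P B PN PB; exists (Jop (-2) N P); last by apply/funext => k; rewrite Jop_fourier.
have B0 := Lb_ge0 PB.
have Nn : (N <= 2 ^ N)%N by rewrite ltnW// ltn_expl.
have -> : Jop (-2) N P = fun x => \sum_(m < N.+1) blk (@be R d) (-2) m P x.
  by apply/funext => x; exact: be_decomp.
apply: Lb_le (@Lb_sum _ _ _ _ q _ (index_enum 'I_N.+1) (fun m x => blk (@be R d) (-2) m P x) _ q1 (fun m => hC m q P B q1 (trig_bmf PN) PB)).
have -> : \sum_(m < N.+1) C * 2 `^ (m%:R * -2) * B = C * B * \sum_(m < N.+1) 2 `^ (- (m%:R * 2)).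
  by rewrite mulr_sumr; apply: eq_bigr => m _; rewrite mulrN mulrAC.
by rewrite [X in _ <= X]mulrAC ler_wpM2l// mulr_ge0// ltW.
Qed.

Lemma partialE i (f : distr R d) r : Jc (r - 1) (partial i f) = fun k => rz R i k * Jc r f k.
Proof.
apply/funext => k; rewrite /Jc /partial /rz /jf jpD rmorphM /=; ring.
Qed.

(** Since Delta = 1 - (1 - Delta), the third order operator is (1 - Delta)^(3/2) followed by a Riesz
    transform and by (1 - Delta)^(-1) - 1, both bounded on L^q. *)
Lemma grad_laplacianE i (f : distr R d) s :
  Jc (s - 1) (grad (laplacian f) i) = fun k => rz R i k * (Jc (-2) (Jc (s + 2) f) k - Jc (s + 2) f k).
Proof.
rewrite /grad partialE; apply/funext => k; congr (_ * _); rewrite JcD.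
have L : laplacian f k = (1 - jb (fr R k))%:C%C * f k.
  rewrite /laplacian /partial /jb; under eq_bigr do rewrite mulrA.
  rewrite -mulr_suml; congr (_ * _).
  have -> : 1 - (1 + \sum_(j < d) (2 * pi * fr R k j) ^+ 2) = \sum_(j < d) - (2 * pi * fr R k j) ^+ 2.
    by rewrite sumrN; ring.
  rewrite rmorph_sum /=; apply: eq_bigr => j _; rewrite /fr.
  by apply/eqP; rewrite eq_complex /=; apply/andP; split; apply/eqP; ring.
rewrite /Jc L /jf (_ : s + 2 = s + (1 + 1)); last by ring.
rewrite (_ : -2 + (s + (1 + 1)) = s); last by ring.
have -> : jp (s + (1 + 1)) (fr R k) = jp s (fr R k) * jb (fr R k) by rewrite !jpD -jp1_sqr expr2.
by rewrite !rmorphM rmorphB rmorph1 /=; ring.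
Qed.

Lemma grad_laplacian_bound s : exists2 C : R, 0 < C & forall i (f : distr R d) A, 0 < A -> Hq q (s + 2) f A ->
  Hq q (s - 1) (grad (laplacian f) i) (C * A).
Proof.
have [C C0 hC] := Jm2_bound.
have [K hK] := choice (fun i => let: ex_intro2 x a b := rz_bound i in ex_intro (fun C => _ /\ _) x (conj a b)).
exists ((\sum_i K i + 1) * (C + 1)).
  by rewrite mulr_gt0// ltr_wpDl// ?sumr_ge0// => [i _|]; [have [/ltW] := hK i|exact: ltW].
move=> i f A A0 hf; have [K0 hKi] := hK i.
have h1 : LQ q (fun k => Jc (-2) (Jc (s + 2) f) k - Jc (s + 2) f k) (C * A + A).
  have := Hq_sub q2 (r := 0) (c := Jc (-2) (Jc (s + 2) f)) (c' := Jc (s + 2) f).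
  by rewrite /Hq !Jc0 => h; apply: h => //; exact: hC.
have A1 : 0 < C * A + A by rewrite addr_gt0// mulr_gt0.
rewrite /Hq grad_laplacianE; apply: LQ_le (hKi _ _ A1 h1).
rewrite (_ : (\sum_j K j + 1) * (C + 1) * A = (\sum_j K j + 1) * (C * A + A)); last by ring.
rewrite ler_wpM2r ?(ltW A1)//.
rewrite (bigD1 i)//= -addrA lerDl addr_ge0// sumr_ge0// => j _.
by have [/ltW] := hK j.
Qed.

Lemma divergence_bound s : exists2 C : R, 0 < C & forall (F : 'I_d -> distr R d) A, 0 < A ->
  (forall i, Hq q (s - 1) (F i) A) -> Hq q (s - 2) (divergence F) (C * A).
Proof.
have [K hK] := choice (fun i => let: ex_intro2 x a b := rz_bound i in ex_intro (fun C => _ /\ _) x (conj a b)).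
have K0 : 0 <= \sum_i K i by rewrite sumr_ge0// => i _; have [/ltW] := hK i.
exists (\sum_i K i + 1); first by rewrite ltr_wpDl.
move=> F A A0 hF.
have e : s - 2 = s - 1 - 1 by ring.
have h i : LQ q (Jc (s - 2) (partial i (F i))) (K i * A).
  by rewrite e partialE; have [_] := hK i; apply => //; exact: hF.
rewrite /Hq /divergence Jc_sum; apply: (@LQ_le _ _ _ _ (\sum_i K i * A)).
  by rewrite -mulr_suml ler_wpM2r ?(ltW A0)// lerDl.
exact: LQ_sum.
Qed.

End DerivativeBounds.

(** * Assembly of the operator bounds *)

Section Assembly.
Context (R : realType) (d : nat).
Local Notation mu := (torus R d).
Variables (chi : R -> R) (s q p sg : R) (F : R -> R) (A : R).
Hypothesis q2 : 2 <= q.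
Hypothesis p0 : 0 < p.
Hypothesis hchi : dyadic_cutoff chi.
Hypothesis sg_d : d%:R / q < sg.
Hypothesis sg_s : `|s - 1| < sg.
Hypothesis sF : forall n, cn n setT F.
Hypothesis A0 : 0 < A.
Let q1 : 1 <= q. Proof. by rewrite (le_trans _ q2)// ler1n. Qed.
Let q0 : 0 < q. Proof. exact: lt_le_trans q1. Qed.
Let sg0 : 0 < sg. Proof. exact: le_lt_trans sg_s. Qed.
Implicit Types (u v : d.-tuple R -> R).

Let th := Num.max (d%:R / q) `|s - 1|.
Let th_d : d%:R / q <= th. Proof. by rewrite le_max lexx. Qed.
Let th_r : `|s - 1| <= th. Proof. by rewrite le_max lexx orbT. Qed.
Let th_sg : th < sg. Proof. by rewrite gt_max sg_d. Qed.

Local Notation bn u := (besov_norm chi sg q p (fourier u%R)).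

Lemma continuous_smooth : continuous F.
Proof. by move=> y; apply: differentiable_continuous; apply/derivable1_diffP; exact: (sF 1).1. Qed.

Lemma measurable_comp_smooth u : mu.-integrable setT (EFin \o u) -> measurable_fun setT (F \o u).
Proof.
move=> iu; apply: measurableT_comp; first exact: continuous_measurable_fun continuous_smooth.
by have /measurable_EFinP := measurable_int _ iu.
Qed.

Lemma difference_multiplier : exists2 C : R, 0 < C & forall u v D,
  mu.-integrable setT (EFin \o u) -> mu.-integrable setT (EFin \o v) ->
  (bn u < A%:E)%E -> (bn v < A%:E)%E -> (bn (u \- v) < D%:E)%E ->
  exists M, multop q (s - 1) (fun x => F (u x) - F (v x)) M /\
    forall f B, 0 < B -> Hq q (s - 1) f B -> Hq q (s - 1) (M f) (C * D * B).
Proof.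
have [C C0 hC] := composition_series q2 th_d th_sg sF (ltW A0).
have [K K0 hK] := Wop_bound q2 th_d th_r.
exists (K * C); first exact: mulr_gt0.
move=> u v D iu iv uA vA uvD.
have du := lpb_dyad q2 p0 hchi iu uA; have dv := lpb_dyad q2 p0 hchi iv vA.
have iuv := integrableB_real iu iv.
have duv := lpb_dyad q2 p0 hchi iuv uvD.
rewrite -(lpb_sub hchi iu iv) in duv.
have [w [kk [b [hw lw]]]] := hC _ _ _ du dv duv.
have cu := lpb_cvg q2 sg0 hchi iu du; have cv := lpb_cvg q2 sg0 hchi iv dv.
exists (Wop w kk); split.
  apply: (multop_Wop q2 th_d th_r hw).
    by apply: measurable_funB; exact: measurable_comp_smooth.
  by apply: filterS2 cu cv => x; exact: lw.
by move=> f B B0 hf; have [_] := hK _ _ _ _ _ _ hw B0 hf; rewrite !mulrA.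
Qed.

Lemma besov0 : bn ((fun=> 0) : d.-tuple R -> R) = 0%E.
Proof.
have f0 : fourier (fun=> 0 : R) = (fun=> 0) :> distr R d.
  apply/funext => k; rewrite (fourier_syn (N := 0) (c := fun=> 0)) ?if_same// => x.
  by rewrite /syn big1// => i _; rewrite mul0r.
have n0 l : Lq_norm q (dyadic_block chi l (fourier (fun=> 0 : R) : distr R d)) = 0%E.
  apply/eqP; rewrite eq_le; apply/andP; split.
    apply: LQ_norm; rewrite f0; have := LQ0 d q2 (lexx (0 : R)); congr (LQ _ _ _).
    by apply/funext => k; rewrite /dyadic_block mulr0.
  by apply: le_ereal_inf_tmp => _ [g _ <-]; exact: Lnorm_ge0.
rewrite /besov_norm eseries0 => [|l _ _]; first by rewrite poweR0r// gt_eqF// invr_gt0.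
by rewrite n0 mule0 poweR0r// gt_eqF.
Qed.

Definition opA u (f : distr R d) : distr R d :=
  divergence (fun i => multiplication (s - 1) q (F \o u) (grad (laplacian f) i)).

(** The comparison with v = 0 handles F(u) - F(0), and the constant F(0) acts by scaling. This also
    proves that a multiplication operator exists, so [multiplication] is not its default value. *)
Lemma multiplication_smooth : exists2 C : R, 0 < C & forall u D, mu.-integrable setT (EFin \o u) ->
  (bn u < A%:E)%E -> (bn u < D%:E)%E ->
  multop q (s - 1) (F \o u) (multiplication (s - 1) q (F \o u)) /\
  forall f B, 0 < B -> Hq q (s - 1) f B ->
    Hq q (s - 1) (multiplication (s - 1) q (F \o u) f) (C * (D + 1) * B).
Proof.
have [C C0 hC] := difference_multiplier; exists (C + `|F 0|); first by rewrite ltr_wpDr.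
move=> u D iu uA uD.
have i0 : mu.-integrable setT (EFin \o (fun=> 0 : R)) by apply: bmf_integrable; exact: bmf_cst.
have u0 : u \- (fun=> 0) = u by apply/funext => x /=; rewrite subr0.
have D0 : 0 < D by rewrite -lte_fin; apply: le_lt_trans uD; exact: poweR_ge0.
have zA : (bn ((fun=> 0%R) : d.-tuple R -> R) < A%:E)%E by rewrite besov0 lte_fin.
have uD' : (bn (u \- (fun=> 0)) < D%:E)%E by rewrite u0.
have [M [hM bM]] := hC u (fun=> 0) D iu i0 uA zA uD'.
have hm := multop_add q2 hM (multop_cst d q2 (s - 1) (F 0)).
have aE : (fun x => F (u x) - F 0 + F 0) = F \o u by apply/funext => x; rewrite subrK.
rewrite aE in hm.
have mm : is_multiplication (s - 1) q (F \o u) (multiplication (s - 1) q (F \o u)).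
  exact: (@xgetPex _ (fun _ _ => 0) [set M | is_multiplication (s - 1) q (F \o u) M] (ex_intro _ _ hm.1)).
split; first by split => //; exact: hm.2.
move=> f B B0 hf; rewrite (multiplication_unique q2 mm hm.1 (Hq_ltoo hf)).
apply: LQ_le (Hq_add q2 (bM f B B0 hf) (Hq_scale q2 (F 0) hf)).
have F0 := normr_ge0 (F 0); rewrite -mulrDl ler_wpM2r ?(ltW B0)//; nra.
Qed.

Lemma linear_grad_laplacian (c : R) (f g : distr R d) i :
  grad (laplacian (scaleD c f \+ g)) i = scaleD c (grad (laplacian f) i) \+ grad (laplacian g) i.
Proof.
apply/funext => k; rewrite /grad /partial /laplacian /scaleD /partial /= mulrCA -mulrDr; congr (_ * _).
rewrite mulr_sumr -big_split /=; apply: eq_bigr => j _; ring.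
Qed.

Lemma linear_divergence (c : R) (G H : 'I_d -> distr R d) :
  divergence (fun i => scaleD c (G i) \+ H i) = scaleD c (divergence G) \+ divergence H.
Proof.
apply/funext => k; rewrite /divergence /partial /scaleD /= mulr_sumr -big_split /=.
apply: eq_bigr => j _; ring.
Qed.

Theorem opA_bounds : exists C L : R, [/\ 0 < C, 0 < L,
  forall u, mu.-integrable setT (EFin \o u) -> (bn u < A%:E)%E ->
    [/\ is_multiplier (s - 1) q (F \o u),
      bounded_linear (bessel_norm (s + 2) q) (bessel_norm (s - 2) q) (opA u) &
      (opnorm (bessel_norm (s + 2) q) (bessel_norm (s - 2) q) (opA u) <= C%:E * (1 + bn u))%E] &
  forall u v, mu.-integrable setT (EFin \o u) -> mu.-integrable setT (EFin \o v) ->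
    (bn u < A%:E)%E -> (bn v < A%:E)%E ->
    (opnorm (bessel_norm (s + 2) q) (bessel_norm (s - 2) q) (fun f => (opA u f \- opA v f)%R)
     <= L%:E * bn (u \- v))%E].
Proof.
have [Cm Cm0 hCm] := multiplication_smooth; have [Cd Cd0 hCd] := difference_multiplier.
have [Cg Cg0 hCg] := grad_laplacian_bound d q2 s; have [Cv Cv0 hCv] := divergence_bound d q2 s.
have bn0 u : (0 <= bn u)%E by exact: poweR_ge0.
(* One factor 2 in each constant comes from [bound_opnorm]. The other one in 4 comes from x + 2 <= 2
   (1 + x), where x is the norm of [u] and D = x + 1. *)
exists (4 * Cv * Cm * Cg), (2 * Cv * Cd * Cg); split; rewrite ?mulr_gt0//.
- move=> u iu uA; have [x uE] : exists x, bn u = x%:E.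
    by move: (bn0 u) uA; case: (bn u) => [x||] // _ _; exists x.
  have x0 : 0 <= x by rewrite -lee_fin -uE.
  have uD : (bn u < (x + 1)%:E)%E by rewrite uE lte_fin ltrDl.
  have [hm bm] := hCm u (x + 1) iu uA uD.
  have op : (opnorm (bessel_norm (s + 2) q) (bessel_norm (s - 2) q) (opA u) <= (4 * Cv * Cm * Cg)%:E * (1 + bn u))%E.
    rewrite uE -EFinD -EFinM; apply: bound_opnorm => f hf.
    have g2 : 0 < Cg * 2 by rewrite mulr_gt0.
    have B0 : 0 < Cm * (x + 1 + 1) * (Cg * 2) by rewrite mulr_gt0// mulr_gt0//; lra.
    apply: LQ_le (hCv _ _ B0 (fun i => bm _ _ g2 (hCg i f 2 (ltr0Sn R 1) hf))).
    rewrite (_ : 4 * Cv * Cm * Cg * (1 + x) = Cv * (Cm * (2 * (1 + x)) * (Cg * 2))); last by ring.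
    rewrite ler_wpM2l ?(ltW Cv0)// ler_wpM2r ?(ltW g2)// ler_wpM2l ?(ltW Cm0)//; lra.
  split => //; first by exists (multiplication (s - 1) q (F \o u)); exact: hm.1.
  split; last by apply: (le_lt_trans op); rewrite uE -EFinD -EFinM ltry.
  move=> c f g /Hq_fin[Bf Bf0 hf] /Hq_fin[Bg Bg0 hg].
  rewrite /opA -linear_divergence; congr divergence; apply/funext => i.
  rewrite linear_grad_laplacian hm.1.1.1//.
    exact: Hq_ltoo (hCg i f Bf Bf0 hf).
  exact: Hq_ltoo (hCg i g Bg Bg0 hg).
- move=> u v iu iv uA vA.
  have key D : (bn (u \- v) < D%:E)%E ->
    (opnorm (bessel_norm (s + 2) q) (bessel_norm (s - 2) q) (fun f => (opA u f \- opA v f)%R) <= (2 * Cv * Cd * Cg * D)%:E)%E.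
    move=> hD; have D0 : 0 < D by rewrite -lte_fin; exact: le_lt_trans hD.
    have [M [hM bM]] := hCd u v D iu iv uA vA hD.
    have [hu _] := hCm u A iu uA uA; have [hv _] := hCm v A iv vA vA.
    have huv := multop_sub q2 hu hv.
    apply: bound_opnorm => f hf.
    have g2 : 0 < Cg * 2 by rewrite mulr_gt0.
    have hG i := hCg i f 2 (ltr0Sn R 1) hf.
    (* The difference of the two selected operators and [M] both multiply by F(u) - F(v), so they
       agree on H^{s-1,q}, which contains the components of grad Delta f. *)
    have -> : opA u f \- opA v f = divergence (fun i => M (grad (laplacian f) i)).
      have -> : (fun i => M (grad (laplacian f) i)) = (fun i => scaleD (-1) (multiplication (s - 1) q (F \o v) (grad (laplacian f) i)) \+ multiplication (s - 1) q (F \o u) (grad (laplacian f) i)).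
        apply/funext => i; rewrite -(multiplication_unique q2 huv.1 hM.1 (Hq_ltoo (hG i))).
        by rewrite scaleDN1; apply/funext => k /=; rewrite addrC.
      rewrite linear_divergence scaleDN1; apply/funext => k /=; exact: addrC.
    have B0 : 0 < Cd * D * (Cg * 2) by rewrite !mulr_gt0.
    apply: LQ_le (hCv _ _ B0 (fun i => bM _ _ g2 (hG i))).
    by rewrite (_ : 2 * Cv * Cd * Cg * D = Cv * (Cd * D * (Cg * 2)))//; ring.
  have L0 : 0 < 2 * Cv * Cd * Cg by rewrite !mulr_gt0.
  move: (bn0 (u \- v)) key; case: (bn (u \- v)) => [x||] // x0 key; last first.
    by rewrite mulry gtr0_sg// mul1e leey.
  (* [key] asks for a bound strictly above the norm; the excess e / L becomes [e] after
     multiplication by the constant. *)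
  apply/lee_addgt0Pr => e e0; rewrite -EFinM -EFinD.
  have h : (x%:E < (x + e / (2 * Cv * Cd * Cg))%:E)%E by rewrite lte_fin ltrDl divr_gt0.
  apply: (le_trans (key _ h)); rewrite lee_fin mulrDr lerD2l mulrC divfK// gt_eqF//.
Qed.

End Assembly.

Theorem lemma2p1 (R : realType) (d : nat) (hd : (1 <= d)%N)
  (chi : R -> R) (hchi : dyadic_cutoff chi)
  (eta : R -> R) (eta_smooth : smooth_on setT eta)
  (eta_incr : {homo eta : x y / x <= y})
  (eta1 : forall r : R, 2 <= r -> eta r = 1)
  (eta0 : forall r : R, r <= 1 -> eta r = 0)
  (m : R -> R) (m_smooth : smooth_on [set r | 0 < r] m)
  (m_pos : forall r : R, 0 < r -> 0 < m r)
  (p kappa s q : R) (hadm : admissible d p kappa s q)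
  (j n : nat) :
  exists C L : R, 0 < C /\ 0 < L /\
    (forall u : d.-tuple R -> R,
       in_XTr chi p kappa s q u ->
       (XTr_norm chi p kappa s q u <= n%:R%:E)%E ->
       [/\ is_multiplier (s - 1) q (regularized m eta j \o u),
           bounded_linear (X1_norm s q) (X0_norm s q)
             (operatorA s q m eta j u) &
           (opnorm (X1_norm s q) (X0_norm s q) (operatorA s q m eta j u)
            <= C%:E * (1 + XTr_norm chi p kappa s q u))%E]) /\
    (forall u v : d.-tuple R -> R,
       in_XTr chi p kappa s q u -> in_XTr chi p kappa s q v ->
       (XTr_norm chi p kappa s q u <= n%:R%:E)%E ->
       (XTr_norm chi p kappa s q v <= n%:R%:E)%E ->
       (opnorm (X1_norm s q) (X0_norm s q)
          (fun f => (operatorA s q m eta j u f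
                      \- operatorA s q m eta j v f)%R)
        <= L%:E * XTr_norm chi p kappa s q (u \- v)%R)%E).
Proof.
case: hadm => [[s12 p2 q2 k0] [hp hd' hs']].
set sg := trace_exponent p kappa s in hd' hs'.
have p0 : 0 < p by exact: lt_le_trans p2.
(* Both alternatives of condition (a) give (1 + kappa) / p <= 1/2. This covers s - 1 < sg, and the
   condition 1 - s < sg covers the other sign of s - 1. *)
have sgs : s <= sg.
  rewrite /sg /trace_exponent; have [[p2' kp]|[_ -> ->]] := hp; last by rewrite addr0 mul1r; lra.
  have : (1 + kappa) / p <= 1 / 2 by rewrite ler_pdivrMr//; lra.
  lra.
have sg_s : `|s - 1| < sg by rewrite ltr_norml; lra.
have sg_d : d%:R / q < sg by rewrite -subr_gt0.
(* The bounds in [opA_bounds] are strict, so the radius is n + 1. *)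
have A0 : 0 < n%:R + 1 :> R by rewrite ltr_wpDl.
have sF k : cn k setT (regularized m eta j) by exact: regularized_cn.
have [C [L [C0 L0 h1 h2]]] := opA_bounds q2 p0 hchi sg_d sg_s sF A0.
have lt (x : \bar R) : (x <= n%:R%:E)%E -> (x < (n%:R + 1)%:E)%E.
  by move=> /le_lt_trans; apply; rewrite lte_fin ltrDl.
exists C, L; split => //; split => //; split.
  by move=> u [iu _] /lt un; exact: h1.
move=> u v [iu _] [iv _] un vn; have h := h2 u v iu iv (lt _ un) (lt _ vn).
rewrite /X1_norm /X0_norm /XTr_norm -/sg.
exact h.
Qed.
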